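(* Let $P_{2k}$ be a real-valued polynomial in $z_1,\bar z_1$ such that (i) there is an integer $k>1$ with $P_{2k}(rz)=r^{2k}P_{2k}(z)$ for all $r\in\mathbb R$, $z\in\mathbb C$, and (ii) $\frac{\partial^2 P_{2k}}{\partial z_1\partial\bar z_1}(z_1)>0$ for every $z_1\neq 0$. Let $\Omega=\{(z_1,z_2)\in\mathbb C^2 : \mathrm{Re}\, z_2+P_{2k}(z_1)<0\}$ (a Kohn-Nirenberg domain). Then the Bergman metric and the Carath\'eodory metric of $\Omega$ are both positive and complete.
   Context: For a domain $W\subset\mathbb C^n$, let $A^2(W)$ be the Hilbert space of square-integrable holomorphic functions on $W$ with complete orthonormal system $\{\varphi_j\}$, and $K_W(z,w)=\sum_j\varphi_j(z)\overline{\varphi_j(w)}$ its Bergman kernel. When $K_W(z,z)>0$, the Bergman metric is $\beta^W_z=\sum_{j,k}\frac{\partial^2\log K_W(z,z)}{\partial z_j\partial\bar z_k}dz_j\otimes d\bar z_k$. The Carath\'eodory pseudo-metric is $F^C_W(p,v)=\sup\{|df_p(v)| : f:W\to\Delta \text{ holomorphic}, f(p)=0\}$, $\Delta$ the unit disc, and the (integrated) Carath\'eodory distance $\rho^C_W(p,q)$ is the infimum of $\int_0^1F^C_W(\gamma(t),\gamma'(t))dt$ over piecewise $C^1$ curves $\gamma$ from $p$ to $q$ in $W$. A metric is positive if every nonzero tangent vector has positive length; it is complete if $W$ with the induced integrated distance (for the Bergman metric, the Riemannian distance of its real part) is Cauchy-complete. *)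

(* Defs.v *)
(* MathComp + MathComp-Analysis + real_closed's complex numbers R[i]. *)
From HB Require Import structures.
From mathcomp Require Import all_boot all_order all_algebra.
From mathcomp Require Import all_classical all_reals all_analysis.
From mathcomp Require Export complex.
Export Order.TTheory GRing.Theory Num.Theory.
Set Implicit Arguments. Unset Strict Implicit. Unset Printing Implicit Defensive.
Local Open Scope ring_scope.
Local Open Scope classical_set_scope.

(** Convention: C is [R[i]] and C^2 is identified with R^4 as the product
    type ((R*R)*(R*R)); the point ((x1,y1),(x2,y2)) is (z1,z2) with
    z_j = x_j + i y_j.  Tangent vectors at a point are elements of the same
    type (v = ((a1,b1),(a2,b2)) is the vector (a1+ib1, a2+ib2)). *)
Notation C2 R := ((R * R) * (R * R))%type.
(* same type, with R viewed as a normed module over itself (R^o := R) *)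
Notation C2o R := ((R^o * R^o) * (R^o * R^o))%type.

Definition cplx (R : realType) (x : R * R) : R[i] := Complex x.1 x.2.

(** modulus and squared modulus of a complex number *)
Definition sqmod (R : realType) (z : R[i]) : R := complex.Re z ^+ 2 + complex.Im z ^+ 2.
Definition cabs (R : realType) (z : R[i]) : R := Num.sqrt (sqmod z).

(** real coordinate directions of C^2 *)
Definition ex1 (R : realType) : C2 R := ((1, 0), (0, 0)).
Definition ey1 (R : realType) : C2 R := ((0, 1), (0, 0)).
Definition ex2 (R : realType) : C2 R := ((0, 0), (1, 0)).
Definition ey2 (R : realType) : C2 R := ((0, 0), (0, 1)).
Definition xdir (R : realType) (j : 'I_2) : C2 R := if val j == 0%N then ex1 R else ex2 R.
Definition ydir (R : realType) (j : 'I_2) : C2 R := if val j == 0%N then ey1 R else ey2 R.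
(** j-th complex coordinate of a (tangent) vector of C^2 *)
Definition ccoord (R : realType) (v : C2 R) (j : 'I_2) : R[i] :=
  if val j == 0%N then cplx v.1 else cplx v.2.

(** second real directional derivative  D_a D_b h *)
Definition D2 (R : realType) (V : normedModType R) (a b : V) (h : V -> R) (p : V) : R :=
  'D_a (fun q => 'D_b h q) p.

(** d^2 h / (dz_j dzbar_k) at p, for real h, where z_j = x_j + i y_j has real
    directions xj, yj and z_k has real directions xk, yk:
    d/dz_j = (d/dx_j - i d/dy_j)/2,  d/dzbar_k = (d/dx_k + i d/dy_k)/2. *)
Definition ddbar (R : realType) (V : normedModType R) (xj yj xk yk : V)
    (h : V -> R) (p : V) : R[i] :=
  Complex ((D2 xj xk h p + D2 yj yk h p) / 4%:R)
          ((D2 xj yk h p - D2 yj xk h p) / 4%:R).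

(** Holomorphy on W: f = u + i v is (real, Frechet) differentiable at every
    point of W and satisfies the Cauchy-Riemann equations in each variable,
    i.e. its real differential is C-linear. *)
Definition holomorphic_on (R : realType) (W : set (C2 R)) (f : C2 R -> R[i]) : Prop :=
  forall p, W p ->
    let u := fun q => complex.Re (f q) in
    let v := fun q => complex.Im (f q) in
    [/\ differentiable (u : C2o R -> R^o) (p : C2o R),
        differentiable (v : C2o R -> R^o) (p : C2o R),
        'D_(ex1 R) u p = 'D_(ey1 R) v p /\ 'D_(ey1 R) u p = - 'D_(ex1 R) v p &
        'D_(ex2 R) u p = 'D_(ey2 R) v p /\ 'D_(ey2 R) u p = - 'D_(ex2 R) v p].

(** complex differential df_p(v) *)
Definition dC (R : realType) (f : C2 R -> R[i]) (p v : C2 R) : R[i] :=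
  Complex ('D_v (fun q => complex.Re (f q)) p) ('D_v (fun q => complex.Im (f q)) p).

(** Lebesgue measure on C^2 = R^4 *)
Definition leb2 (R : realType) := product_measure1 (@lebesgue_measure R) (@lebesgue_measure R).
Definition leb4 (R : realType) := product_measure1 (@leb2 R) (@leb2 R).

(** A^2(W) *)
Definition A2 (R : realType) (W : set (C2 R)) (f : C2 R -> R[i]) : Prop :=
  holomorphic_on W f /\ (\int[@leb4 R]_(p in W) (sqmod (f p))%:E < +oo)%E.

(** L^2(W) inner product <f, g> = int_W f conj(g) *)
Definition inner (R : realType) (W : set (C2 R)) (f g : C2 R -> R[i]) : R[i] :=
  Complex (fine (\int[@leb4 R]_(p in W) (complex.Re (f p * (g p)^*))%:E)%E)
          (fine (\int[@leb4 R]_(p in W) (complex.Im (f p * (g p)^*))%:E)%E).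

(** {phi_j} is a complete orthonormal system of A^2(W) *)
Definition complete_orthonormal (R : realType) (W : set (C2 R))
    (phi : nat -> C2 R -> R[i]) : Prop :=
  [/\ forall j, A2 W (phi j),
      forall i j, inner W (phi i) (phi j) = (i == j)%:R &
      forall f, A2 W f -> (forall j, inner W f (phi j) = 0) -> forall p, W p -> f p = 0].

(** K_W(z,z) = sum_j phi_j(z) conj(phi_j(z)) (a real number) *)
Definition bergman_diag (R : realType) (phi : nat -> C2 R -> R[i]) (z : C2 R) : R :=
  \big[+%R/0%R]_(j <oo) complex.Re (phi j z * (phi j z)^*).

(** beta_z(v,v) = sum_{j,k} d^2 log K(z,z)/dz_j dzbar_k v_j conj(v_k) *)
Definition bergman_form (R : realType) (phi : nat -> C2 R -> R[i]) (z v : C2 R) : R[i] :=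
  \sum_(j < 2) \sum_(k < 2)
    ddbar (xdir R j) (ydir R j) (xdir R k) (ydir R k)
          (fun q => ln (bergman_diag phi q)) z * ccoord v j * (ccoord v k)^*.

(** length of a tangent vector for the Bergman metric: sqrt(Re beta(v,v)) *)
Definition bergman_length (R : realType) (phi : nat -> C2 R -> R[i]) (z v : C2 R) : \bar R :=
  (Num.sqrt (complex.Re (bergman_form phi z v)))%:E.

(** Caratheodory pseudo-metric *)
Definition caratheodory (R : realType) (W : set (C2 R)) (p v : C2 R) : \bar R :=
  ereal_sup [set (cabs (dC f p v))%:E | f in
     [set f : C2 R -> R[i] | [/\ holomorphic_on W f,
                                 forall q, W q -> cabs (f q) < 1 & f p = 0]]].

(** piecewise C^1 curves and integrated distances of a Finsler function F *)
Definition C1_curve (R : realType) (g : R -> C2 R) : Prop :=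
  (forall t, derivable g t 1) /\ continuous (g^`() : R^o -> C2o R).

(** gam : [0,1] -> W is piecewise C^1 from p to q, with breakpoints
    0 = s 0 < ... < s n = 1 and gam = g i (a C^1 map) on [s i, s (i+1)] *)
Definition pw_C1_path (R : realType) (W : set (C2 R)) (p q : C2 R) (gam : R -> C2 R)
    (n : nat) (s : nat -> R) (g : nat -> R -> C2 R) : Prop :=
  [/\ s 0%N = 0, s n = 1,
      forall i, (i < n)%N -> s i < s i.+1 /\ C1_curve (g i) /\
                (forall t, s i <= t <= s i.+1 -> gam t = g i t),
      gam 0 = p /\ gam 1 = q &
      forall t, 0 <= t <= 1 -> W (gam t)].

Definition curve_length (R : realType) (F : C2 R -> C2 R -> \bar R)
    (n : nat) (s : nat -> R) (g : nat -> R -> C2 R) : \bar R :=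
  (\sum_(i < n) \int[@lebesgue_measure R]_(t in `[s i, s i.+1])
                   F (g i t) ((g i)^`() t))%E.

Definition int_dist (R : realType) (W : set (C2 R)) (F : C2 R -> C2 R -> \bar R)
    (p q : C2 R) : \bar R :=
  ereal_inf [set l | exists gam n s g,
                       pw_C1_path W p q gam n s g /\ l = curve_length F n s g].

(** a (pseudo-)metric F on W is positive *)
Definition positive_metric (R : realType) (W : set (C2 R)) (F : C2 R -> C2 R -> \bar R) :=
  forall p v, W p -> v != 0 -> (0 < F p v)%E.

(** W with the distance d is Cauchy-complete *)
Definition complete_dist (R : realType) (W : set (C2 R)) (d : C2 R -> C2 R -> \bar R) :=
  forall u : nat -> C2 R, (forall m, W (u m)) ->
    (forall e : R, 0 < e -> exists N, forall m n, (N <= m)%N -> (N <= n)%N ->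
        (d (u m) (u n) < e%:E)%E) ->
    exists2 p, W p & (forall e : R, 0 < e -> exists N, forall n, (N <= n)%N ->
        (d (u n) p < e%:E)%E).

(** P(z) = sum_{a,b<N} c_{ab} z^a zbar^b *)
Definition zzpoly (R : realType) (N : nat) (c : nat -> nat -> R[i]) (z : R[i]) : R[i] :=
  \sum_(a < N) \sum_(b < N) c a b * z ^+ a * (z^*) ^+ b.

(** P as a real function of x1 + i y1 *)
Definition KN_P (R : realType) (N : nat) (c : nat -> nat -> R[i]) (x : R * R) : R :=
  complex.Re (zzpoly N c (cplx x)).

(** real directions of C = R^2 (for functions of z1 = x + i y) *)
Definition ex (R : realType) : R^o * R^o := (1, 0).
Definition ey (R : realType) : R^o * R^o := (0, 1).

(** Kohn-Nirenberg domain  { Re z2 + P(z1) < 0 } *)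
Definition KN_domain (R : realType) (N : nat) (c : nat -> nat -> R[i]) : set (C2 R) :=
  [set p | p.2.1 + KN_P N c p.1 < 0].

(* Main.v *)
(** Functions which decay fast enough are the whole point.  For every p in the
    domain and every T > 0 there is an entire f of two variables with
    |f| <= K exp(T r) and |f(p)| >= m exp(T r(p)), where r = Re z_2 + P(z_1) and
    m, K > 0 do not depend on p and T, and such that |f|^2 is dominated by a
    product of factors 1 / (1 + x^2).  It is a product of exp(T z_2), a slowly
    growing entire factor in z_2, and an entire function peaking at z_1(p) for the
    weight exp(T P).  By homogeneity that function only has to be found for
    |z_1(p)| <= 1 and large T; it is the limit of the iterates of a smoothing
    operator that preserves holomorphic functions and halves dbar in the weighted
    sup norm.

    As f is square integrable and f, z_1 f, z_2 f are bounded, both metrics are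
    positive and the Bergman metric dominates the Caratheodory metric.  If (u_n)
    is Cauchy for the integrated distance of either metric, then comparing the f
    of u_n for T = 1/|r(u_n)| at the points u_m keeps r(u_n) away from 0, and the
    Cauchy sequences f(u_n), (z_j f)(u_n) for a fixed f force u_n to converge in
    C^2, hence in the domain; both metrics are locally bounded there. *)
Require Import Defs.
From HB Require Import structures.
From mathcomp Require Import all_boot all_order all_algebra.
From mathcomp Require Import all_classical all_reals all_analysis.
From mathcomp Require Import measurable_realfun complex ring lra zify.
Import Order.TTheory GRing.Theory Num.Theory.
Import numFieldNormedType.Exports.
Set Implicit Arguments. Unset Strict Implicit. Unset Printing Implicit Defensive.
Local Open Scope ring_scope.
Local Open Scope classical_set_scope.

(** The obstacle is degeneracy: the Levi form of [P] vanishes at [z_1 = 0], so the weight [exp(T P)]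
    allows no Gaussian estimate there. [P] is therefore replaced by
    [P - eps (|z|^(2k) - k |z|^2 + k - 1)]. The subtracted term is the gap between [x^k] and its
    tangent at [x = 1], where [x = |z|^2]. It is nonnegative and vanishes on [|z| = 1]. Its part in
    [|z|^2] makes the new weight strictly subharmonic, its part in [|z|^(2k)] gives decay in [z_1],
    and a point rescaled to the unit circle loses nothing.

    The smoothing operator comes from polarization. If [p(z, w)] is the polarized weight,
    [exp(2 t (p(z, z+h) - p(z+h, z+h)))] carries values from [z+h] to [z] and beats the weight by a
    Gaussian in [h]. Averaging over an annulus in [h] that avoids 0 then shrinks dbar, without any
    [L^2] theory.

    The one-variable theory rests on translation invariance of the integral: Stokes, Pompeiu,
    Goursat and Cauchy estimates are obtained with piecewise polynomial cut-offs. *)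

Section Modulus.
Variable R : realType.
Implicit Types (z w : R[i]) (x y : R).

(** The library norm of [R[i]] takes its values in [R[i]]; through this identity and the injectivity
    of the embedding of [R], its laws descend to the real-valued [cabs]. *)
Lemma cabsE z : (cabs z)%:C%C = `|z|. Proof. by rewrite normc_def. Qed.

Lemma cabs_ge0 z : 0 <= cabs z. Proof. exact: sqrtr_ge0. Qed.
Hint Resolve cabs_ge0 : core.

Lemma cabs0 : cabs (0 : R[i]) = 0.
Proof. by apply: complexI; rewrite cabsE normr0. Qed.

Lemma cabs1 : cabs (1 : R[i]) = 1.
Proof. by apply: complexI; rewrite cabsE normr1. Qed.

Lemma cabsM z w : cabs (z * w) = cabs z * cabs w.
Proof. by apply: complexI; rewrite rmorphM /= !cabsE normrM. Qed.

Lemma cabsN z : cabs (- z) = cabs z.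
Proof. by apply: complexI; rewrite !cabsE normrN. Qed.

Lemma cabsB z w : cabs (z - w) = cabs (w - z).
Proof. by rewrite -cabsN opprB. Qed.

Lemma cabsX z n : cabs (z ^+ n) = cabs z ^+ n.
Proof. by elim: n => [|n IH]; rewrite ?expr0 ?cabs1 // !exprS cabsM IH. Qed.

Lemma cabsV z : cabs z^-1 = (cabs z)^-1.
Proof. by apply: complexI; rewrite fmorphV /= !cabsE normfV. Qed.

Lemma cabsD z w : cabs (z + w) <= cabs z + cabs w.
Proof. by rewrite -lecR rmorphD /= !cabsE ler_normD. Qed.

Lemma cabsBD z w : cabs (z - w) <= cabs z + cabs w.
Proof. by rewrite (le_trans (cabsD _ _)) // cabsN. Qed.

Lemma cabs_tri v z w : cabs (z - w) <= cabs (z - v) + cabs (v - w).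
Proof. by apply: le_trans (cabsD _ _); rewrite addrA subrK. Qed.

Lemma cabs_subr z w : cabs z - cabs w <= cabs (z - w).
Proof. by rewrite lerBlDr -{1}(subrK w z) cabsD. Qed.

Lemma cabs_eq0 z : (cabs z == 0) = (z == 0).
Proof. by rewrite -(inj_eq (@complexI R)) cabsE rmorph0 normr_eq0. Qed.

Lemma cabs_gt0 z : (0 < cabs z) = (z != 0).
Proof. by rewrite lt0r cabs_eq0 cabs_ge0 andbT. Qed.

Lemma sqr_cabs z : cabs z ^+ 2 = sqmod z.
Proof. by rewrite sqr_sqrtr // addr_ge0 ?sqr_ge0. Qed.

Lemma cabs_conj z : cabs (z^*) = cabs z.
Proof. by rewrite /cabs; congr Num.sqrt; case: z => a b; rewrite /sqmod /= sqrrN. Qed.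

Lemma cabs_real x : cabs (Complex x 0) = `|x|.
Proof. by rewrite /cabs /sqmod /= expr0n addr0 sqrtr_sqr. Qed.

Lemma Re_cabs z : `|complex.Re z| <= cabs z.
Proof. by rewrite -sqrtr_sqr ler_sqrt ?sqr_cabs ?addr_ge0 ?sqr_ge0 // lerDl sqr_ge0. Qed.

Lemma Im_cabs z : `|complex.Im z| <= cabs z.
Proof. by rewrite -sqrtr_sqr ler_sqrt ?sqr_cabs ?addr_ge0 ?sqr_ge0 // lerDr sqr_ge0. Qed.

Lemma Re_le_cabs z : complex.Re z <= cabs z.
Proof. exact: le_trans (ler_norm _) (Re_cabs z). Qed.

Lemma cabs_ReIm z : cabs z <= `|complex.Re z| + `|complex.Im z|.
Proof.
have {1}-> : z = Complex (complex.Re z) 0 + 'i%C * Complex (complex.Im z) 0.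
  by case: z => a b; rewrite /=; simpc.
apply: le_trans (cabsD _ _) _; rewrite cabsM !cabs_real.
have -> : cabs ('i%C : R[i]) = 1.
  by rewrite /cabs /sqmod /= expr0n add0r expr1n sqrtr1.
by rewrite mul1r.
Qed.

Lemma reD z w : complex.Re (z + w) = complex.Re z + complex.Re w. Proof. by case: z; case: w. Qed.
Lemma imD z w : complex.Im (z + w) = complex.Im z + complex.Im w. Proof. by case: z; case: w. Qed.
Lemma reN z : complex.Re (- z) = - complex.Re z. Proof. by case: z. Qed.
Lemma imN z : complex.Im (- z) = - complex.Im z. Proof. by case: z. Qed.
Lemma reM z w : complex.Re (z * w) = complex.Re z * complex.Re w - complex.Im z * complex.Im w.
Proof. by case: z; case: w. Qed.
Lemma imM z w : complex.Im (z * w) = complex.Re z * complex.Im w + complex.Im z * complex.Re w.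
Proof. by case: z; case: w. Qed.
Lemma reJ z : complex.Re (z^*) = complex.Re z. Proof. by case: z. Qed.
Lemma imJ z : complex.Im (z^*) = - complex.Im z. Proof. by case: z. Qed.

Lemma complexP z w : complex.Re z = complex.Re w -> complex.Im z = complex.Im w -> z = w.
Proof. by case: z => a b; case: w => c d /= -> ->. Qed.

Lemma mulJ z : z * z^* = Complex (cabs z ^+ 2) 0.
Proof. by apply: complexP; rewrite sqr_cabs ?reM ?imM ?reJ ?imJ /sqmod /=; ring. Qed.

Lemma cabs_sum I (r : seq I) (P : pred I) (F : I -> R[i]) :
  cabs (\sum_(i <- r | P i) F i) <= \sum_(i <- r | P i) cabs (F i).
Proof.
apply: (big_ind2 (fun a b => cabs a <= b)) => //; first by rewrite cabs0.
by move=> a b c d ab cd; apply: le_trans (cabsD _ _) _; apply: lerD.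
Qed.

Lemma re_sum I (r : seq I) (P : pred I) (F : I -> R[i]) :
  complex.Re (\sum_(i <- r | P i) F i) = \sum_(i <- r | P i) complex.Re (F i).
Proof. by apply: (big_morph (fun z : R[i] => complex.Re z) reD). Qed.

Lemma cplxK z : cplx (complex.Re z, complex.Im z) = z.
Proof. by case: z. Qed.

End Modulus.
#[global] Hint Resolve cabs_ge0 : core.

Notation mu2 R := (product_measure1 (@lebesgue_measure R) (@lebesgue_measure R)).

(** * Translation invariance of Lebesgue measure on the line and on the plane *)

Section Translation.
Variable R : realType.

Lemma measurable_shift1 (a : R) : measurable_fun setT (fun x : measurableTypeR R => (x + a : measurableTypeR R)).
Proof. by apply: measurable_funD => //; exact: measurable_cst. Qed.

(** The pushforward by a translation gives every half-open interval its length, and this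
    characterizes Lebesgue measure. In the plane, rectangles play the same role. *)
Lemma lebesgue_shift (a : R) (A : set (measurableTypeR R)) : measurable A ->
  @lebesgue_measure R ((fun x => x + a) @^-1` A) = @lebesgue_measure R A.
Proof.
move=> mA; apply/esym.
have mf : measurable_fun setT (fun x : measurableTypeR R => (x + a : measurableTypeR R)) := measurable_shift1 a.
pose F : {mfun measurableTypeR R >-> measurableTypeR R} := HB.pack (fun x : measurableTypeR R => (x + a : measurableTypeR R)) (isMeasurableFun.Build _ _ _ _ _ mf).
apply: (@lebesgue_measure_unique R (pushforward lebesgue_measure F)) => //= _ [[u v]] _ <-.
rewrite /pushforward [X in _ = lebesgue_measure X](_ : _ = [set` Interval (BRight (u - a)) (BRight (v - a))]); last first.
  have E (x : R) : (x \in Interval (BRight (u - a)) (BRight (v - a))) = (u < x + a <= v).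
    by rewrite in_itv /= ltrBlDr lerBrDr.
  apply/seteqP; split => x H.
    have H' : u < (x : R) + a <= v by move: H; rewrite /= in_itv.
    by move: (E x); rewrite H' => E'; exact: E'.
  have : (x : R) \in Interval (BRight (u - a)) (BRight (v - a)) := H.
  by rewrite E => H'; rewrite /preimage /= in_itv.
rewrite /=; rewrite !lebesgue_measure_itv /= !lte_fin ltrD2r -!EFinB; case: ifP => // _; congr EFin; ring.
Qed.

Definition shift2 (a : R * R) (x : measurableTypeR R * measurableTypeR R) : measurableTypeR R * measurableTypeR R :=
  (x.1 + a.1, x.2 + a.2).

Lemma measurable_shift2 a : measurable_fun setT (shift2 a).
Proof.
apply/measurable_fun_pairP; split.
  exact: measurableT_comp (measurable_shift1 a.1) measurable_fst.
exact: measurableT_comp (measurable_shift1 a.2) measurable_snd.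
Qed.

Lemma leb2_shift a (A : set (measurableTypeR R * measurableTypeR R)) : measurable A ->
  mu2 R (shift2 a @^-1` A) = mu2 R A.
Proof.
move=> mA; apply/esym.
pose F : {mfun (measurableTypeR R * measurableTypeR R)%type >-> (measurableTypeR R * measurableTypeR R)%type} :=
  HB.pack (shift2 a) (isMeasurableFun.Build _ _ _ _ _ (measurable_shift2 a)).
apply: (@product_measure_unique _ _ _ _ _ lebesgue_measure lebesgue_measure (pushforward (mu2 R) F)) => // B C mB mC.
transitivity (mu2 R (((fun x => x + a.1) @^-1` B) `*` ((fun x => x + a.2) @^-1` C))); first by [].
rewrite product_measure1E //; last 2 first.
- by rewrite -[X in measurable X]setTI; exact: measurable_shift1.
- by rewrite -[X in measurable X]setTI; exact: measurable_shift1.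
by congr (_ * _)%E; exact: lebesgue_shift.
Qed.

Lemma ge0_integral_shift2 a (f : measurableTypeR R * measurableTypeR R -> \bar R) :
  measurable_fun setT f -> (forall x, 0 <= f x)%E ->
  (\int[mu2 R]_x f (shift2 a x) = \int[mu2 R]_x f x)%E.
Proof.
move=> mf f0.
pose F : {mfun (measurableTypeR R * measurableTypeR R)%type >-> (measurableTypeR R * measurableTypeR R)%type} :=
  HB.pack (shift2 a) (isMeasurableFun.Build _ _ _ _ _ (measurable_shift2 a)).
transitivity (\int[pushforward (mu2 R) F]_x f x)%E; last first.
  by apply: eq_measure_integral => A mA _; exact: leb2_shift.
by rewrite (ge0_integral_pushforward (measurable_shift2 a)).
Qed.
End Translation.

(** * Measurability of open sets and of continuous functions in products *)

Section CountableBasis.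
Variable R : realType.

(** Products carry the product sigma-algebra and not a Borel one; a countable basis of measurable
    sets is what shows that open sets belong to it. [near p e] is any system of neighbourhoods, so
    no topology on [T] is needed. *)
Definition countable_basis d (T : measurableType d) (near : T -> R -> set T) :=
  exists B : nat -> set T, (forall n, measurable (B n)) /\
    forall p e, 0 < e -> exists n, B n p /\ B n `<=` near p e.

Lemma basis_open d (T : measurableType d) (near : T -> R -> set T) (A : set T) :
  countable_basis near -> (forall p, A p -> exists e, 0 < e /\ near p e `<=` A) ->
  measurable A.
Proof.
move=> [B [mB hB]] hA.
have -> : A = \bigcup_(n in [set n | B n `<=` A]) B n.
  apply/seteqP; split => p.
    move=> /[dup] Ap /hA[e [e0 eA]]; have [n [Bp Bn]] := hB p e e0.
    by exists n => //; exact: subset_trans eA.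
  by move=> [n nA] /nA.
exact: bigcup_measurable.
Qed.

Lemma basis_fun d (T : measurableType d) (near : T -> R -> set T) (v : T -> R) :
  countable_basis near ->
  (forall p e, 0 < e -> exists2 r, 0 < r & forall q, near p r q -> `|v q - v p| < e) ->
  measurable_fun setT v.
Proof.
move=> hB hv mD; apply: (measurability _ (RGenOInfty.measurableE R)) => //.
move=> /= _ [_ [a ->] <-]; rewrite setTI; apply: (basis_open hB) => p /=.
rewrite in_itv /= andbT => ap.
have [r r0 hr] := hv p (v p - a) ltac:(lra).
exists r; split => // q /hr /=; rewrite in_itv /= andbT ltr_norml => /andP[]; lra.
Qed.

Lemma basis_prod d1 (T1 : measurableType d1) (near1 : T1 -> R -> set T1)
    d2 (T2 : measurableType d2) (near2 : T2 -> R -> set T2) :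
  countable_basis near1 -> countable_basis near2 ->
  countable_basis (fun p e => near1 p.1 e `*` near2 p.2 e).
Proof.
move=> [B1 [m1 h1]] [B2 [m2 h2]].
exists (fun n => if unpickle n is Some (a, b) then B1 a `*` B2 b else set0); split.
  by move=> n; case: unpickle => [[a b]|] //; apply: measurableX.
move=> [p q] e e0; have [a [ap ha]] := h1 p e e0; have [b [bp hb]] := h2 q e e0.
exists (pickle (a, b)); rewrite pickleK; split => // -[x y] [/= Hx Hy].
by split; [exact: ha | exact: hb].
Qed.

Lemma basis_real : countable_basis (fun (p : measurableTypeR R) e => [set q : R | `|q - p| < e]).
Proof.
exists (fun n => if unpickle n is Some (q, m) then
   [set` Interval (BRight (ratr q - m.+1%:R^-1)) (BLeft (ratr q + m.+1%:R^-1 : R))] else set0); split.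
  by move=> n; case: unpickle => [[q m]|] //; apply: measurable_itv.
move=> p0 e e0; pose p : R := p0; rewrite -[p0]/p.
have [m hm] : exists m : nat, m.+1%:R^-1 < e / 2.
  by have [m _ /(_ _ (leqnn m)) /= H] := near_infty_natSinv_lt (PosNum (divr_gt0 e0 (ltr0Sn R 1))); exists m.
have [t [tE t0 te]] : exists t : R, [/\ t = m.+1%:R^-1, 0 < t & t < e / 2].
  by exists m.+1%:R^-1; split => //; rewrite invr_gt0 ltr0n.
(* With a rational [q] within [t] of [p], the interval of radius [t] about [q] contains [p], and its
   points are within [2 t < e] of [p]. *)
have ab : p - t < p + t by lra.
have [q] := rat_in_itvoo ab.
rewrite in_itv /= => /andP[q1 q2].
exists (pickle (q, m)); rewrite pickleK -tE; split.
  by rewrite /= in_itv /=; apply/andP; split; lra.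
by move=> x; rewrite /= in_itv /= => /andP[x1 x2]; rewrite ltr_norml; apply/andP; split; lra.
Qed.

End CountableBasis.

(** * Continuous functions on the plane and their integrals *)

Section Continuity.
Variable R : realType.
Implicit Types (u v : R[i] -> R[i]) (z w h : R[i]).

Definition cont_at u z := forall e, 0 < e ->
  exists2 d, 0 < d & forall w, cabs (w - z) < d -> cabs (u w - u z) < e.
Definition cont u := forall z, cont_at u z.

(** Compactness of a closed square, with the parameter [M] going to infinity as the second filter of
    the covering property. Local bounds, moduli of continuity (with [M] the inverse of the radius)
    and minima (with [M] the inverse of the lower bound) all become uniform through it. *)
Lemma plane_covering (P : R -> R[i] -> Prop) :
  (forall z, exists d M0, 0 < d /\ forall w M, cabs (w - z) < d -> M0 <= M -> P M w) ->
  forall r, exists M0, forall M z, M0 <= M -> cabs z <= r -> P M z.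
Proof.
move=> hP r.
have cK : compact (`[- r, r] `*` `[- r, r] : set (R^o * R^o)).
  by apply: compact_setX; exact: segment_compact.
move/compact_near_coveringP : cK => /(_ R (pinfty_nbhs R) (fun M x => P M (cplx x))).
case=> [|M0 [_ HM]].
  move=> [a b] _; have [d [M0 [d0 hd]]] := hP (Complex a b).
  exists (ball (a, b) (d / 2), [set M | M0 < M]) => /=.
    by split; [apply: (@nbhsx_ballx _ (R^o * R^o)%type); lra | exists M0; split => //; exact: num_real].
  move=> [[x y] M] [/= [/= xa yb] MM]; apply: hd; last exact: ltW.
  apply: le_lt_trans (cabs_ReIm _) _ => /=.
  rewrite -ball_normE /= in xa; rewrite -ball_normE /= in yb.
  by rewrite distrC in xa; rewrite distrC in yb; lra.
exists (M0 + 1) => M z MM zr; rewrite -(cplxK z); apply: (HM M); first lra.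
have := Re_cabs z; have := Im_cabs z; rewrite !ler_norml => /andP[i1 i2] /andP[r1 r2].
by split; rewrite /= in_itv /=; apply/andP; split; lra.
Qed.

Lemma cont_bounded u : cont u -> forall r, exists2 M, 0 <= M & forall z, cabs z <= r -> cabs (u z) <= M.
Proof.
move=> cu r; have [|M0 HM] := @plane_covering (fun M z => cabs (u z) <= M) _ r.
  move=> z; have [d d0 hd] := cu z 1 ltr01.
  exists d, (cabs (u z) + 1); split => // w M /hd dw MM.
  have := cabs_subr (u w) (u z); lra.
by exists `|M0| => [|z zr]; [exact: normr_ge0 | apply: HM => //; exact: ler_norm].
Qed.

Lemma cont_at_id z : cont_at id z. Proof. by move=> e e0; exists e. Qed.
Lemma cont_at_cst c z : cont_at (fun=> c) z.
Proof. by move=> e e0; exists 1 => // w _; rewrite subrr cabs0. Qed.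

Lemma cont_at_D u v z : cont_at u z -> cont_at v z -> cont_at (fun z => u z + v z) z.
Proof.
move=> cu cv e e0; have [a a0 ha] := cu (e / 2) ltac:(lra).
have [b b0 hb] := cv (e / 2) ltac:(lra).
exists (Num.min a b); first by rewrite lt_min a0.
move=> w; rewrite lt_min => /andP[/ha h1 /hb h2].
have -> : u w + v w - (u z + v z) = (u w - u z) + (v w - v z) by ring.
by have := cabsD (u w - u z) (v w - v z); lra.
Qed.

Lemma cont_at_M u v z : cont_at u z -> cont_at v z -> cont_at (fun z => u z * v z) z.
Proof.
move=> cu cv e e0.
have n0 : 0 < cabs (u z) + cabs (v z) + 1 by have := cabs_ge0 (u z); have := cabs_ge0 (v z); lra.
pose e' := Num.min 1 (e / (cabs (u z) + cabs (v z) + 1)).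
have e'0 : 0 < e' by rewrite lt_min ltr01 divr_gt0.
have e'1 : e' <= 1 by rewrite ge_min lexx.
have e'e : e' * (cabs (u z) + cabs (v z) + 1) <= e by rewrite -ler_pdivlMr // ge_min lexx orbT.
have [a a0 ha] := cu e' e'0; have [b b0 hb] := cv e' e'0.
exists (Num.min a b); first by rewrite lt_min a0.
move=> w; rewrite lt_min => /andP[/ha h1 /hb h2].
have -> : u w * v w - u z * v z = (u w - u z) * (v w - v z) + (u w - u z) * v z + u z * (v w - v z) by ring.
apply: le_lt_trans (cabsD _ _) _; rewrite cabsM.
apply: le_lt_trans (lerD (cabsD _ _) (lexx _)) _; rewrite !cabsM.
set x := cabs (u w - u z) in h1 *; set y := cabs (v w - v z) in h2 *.
have x0 : 0 <= x by exact: cabs_ge0.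
have y0 : 0 <= y by exact: cabs_ge0.
have := cabs_ge0 (u z); have := cabs_ge0 (v z); nra.
Qed.

Lemma cont_at_conj u z : cont_at u z -> cont_at (fun z => (u z)^*) z.
Proof. by move=> cu e /cu[d d0 hd]; exists d => // w /hd; rewrite -rmorphB cabs_conj. Qed.

Lemma contD u v : cont u -> cont v -> cont (fun z => u z + v z).
Proof. by move=> cu cv z; apply: cont_at_D. Qed.
Lemma contM u v : cont u -> cont v -> cont (fun z => u z * v z).
Proof. by move=> cu cv z; apply: cont_at_M. Qed.
Lemma cont_cst c : cont (fun=> c). Proof. by move=> z; apply: cont_at_cst. Qed.
Lemma contZ c v : cont v -> cont (fun z => c * v z).
Proof. by apply: contM; apply: cont_cst. Qed.
Lemma cont_conj u : cont u -> cont (fun z => (u z)^*).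
Proof. by move=> cu z; apply: cont_at_conj. Qed.
Lemma cont_comp u v : cont u -> cont v -> cont (fun z => u (v z)).
Proof. by move=> cu cv z e /(cu (v z))[d d0 hd]; have [r r0 hr] := cv z d d0; exists r => // w /hr /hd. Qed.
Lemma cont_shift u a : cont u -> cont (fun z => u (a + z)).
Proof. by move=> cu z e /(cu (a + z))[d d0 hd]; exists d => // w hw; apply: hd; rewrite opprD addrACA subrr add0r. Qed.
Lemma cont_abs u : cont u -> cont (fun z => Complex (cabs (u z)) 0).
Proof.
move=> cu z e /(cu z)[d d0 hd]; exists d => // w /hd.
have -> : Complex (cabs (u w)) 0 - Complex (cabs (u z)) 0 = Complex (cabs (u w) - cabs (u z)) 0 by simpc.
rewrite cabs_real; apply: le_lt_trans; rewrite ler_norml.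
by have := cabs_subr (u w) (u z); have := cabs_subr (u z) (u w); rewrite (cabsB (u z)); lra.
Qed.

(** The overlap [r' <= |z| < r] lets a function controlled on a disc only be multiplied by a cut-off
    and then treated as a continuous function on the whole plane. *)
Lemma cont_cut u v r r' : r' < r -> (forall z, cabs z < r -> cont_at u z) -> cont v ->
  (forall z, r' <= cabs z -> v z = 0) -> cont (fun z => u z * v z).
Proof.
move=> rr cu cv v0 z; have [zr|rz] := ltP (cabs z) r; first by apply: cont_at_M => //; exact: cu.
move=> e e0; exists (r - r'); first lra.
move=> w hw; rewrite !v0 ?mulr0 ?subrr ?cabs0 //; first lra.
have := cabs_subr z w; rewrite cabsB in hw; lra.
Qed.

Definition compact_supp u := exists r, forall z, r <= cabs z -> u z = 0.
Definition tame u := cont u /\ compact_supp u.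

Definition integral_re (f : R[i] -> R) : R := fine (\int[mu2 R]_p (f (cplx p))%:E)%E.
(** The integral over the plane, taken separately on real and imaginary parts. The default value of
    [fine] never shows on [tame] functions, which are integrable. *)
Definition J u : R[i] := Complex (integral_re (fun z => complex.Re (u z))) (integral_re (fun z => complex.Im (u z))).

Definition near2 (p : measurableTypeR R * measurableTypeR R) (e : R) :=
  [set q : measurableTypeR R | `|q - p.1| < e] `*` [set q : measurableTypeR R | `|q - p.2| < e].

Lemma basis2 : countable_basis near2.
Proof. exact: basis_prod (basis_real R) (basis_real R). Qed.

Lemma cont_measurable u : cont u ->
  measurable_fun setT (fun p : measurableTypeR R * measurableTypeR R => complex.Re (u (cplx p))) /\
  measurable_fun setT (fun p : measurableTypeR R * measurableTypeR R => complex.Im (u (cplx p))).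
Proof.
move=> cu; split; apply: (basis_fun basis2) => -[a b] e e0;
  have [d d0 hd] := cu (Complex a b) e e0; exists (d / 2); try lra;
  move=> [x y] [/= xa yb].
  rewrite -reN -reD; apply: le_lt_trans (Re_cabs _) _; apply: hd.
  by apply: le_lt_trans (cabs_ReIm _) _ => /=; lra.
rewrite -imN -imD; apply: le_lt_trans (Im_cabs _) _; apply: hd.
by apply: le_lt_trans (cabs_ReIm _) _ => /=; lra.
Qed.

Definition box (r : R) : set (measurableTypeR R * measurableTypeR R) := `[- r, r] `*` `[- r, r].

Lemma measurable_box r : measurable (box r).
Proof. by apply: measurableX; exact: measurable_itv. Qed.

Lemma box_measure r : 0 <= r -> mu2 R (box r) = ((2 * r) ^+ 2)%:E.
Proof.
move=> r0; rewrite /box product_measure1E; try exact: measurable_itv.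
rewrite /= !lebesgue_measure_itv /= lte_fin.
case: ifPn => [_|]; first by rewrite -EFinD -EFinM; congr EFin; ring.
rewrite -leNgt => r1; have -> : r = 0 by lra.
by rewrite mul0e; congr EFin; ring.
Qed.

Lemma box_integrable r (f : R[i] -> R) M : 0 <= r ->
  measurable_fun setT (fun p : measurableTypeR R * measurableTypeR R => f (cplx p)) ->
  (forall z, `|f z| <= M) -> (forall z, r < cabs z -> f z = 0) ->
  (mu2 R).-integrable setT (fun p => (f (cplx p))%:E) /\ `|integral_re f| <= M * (2 * r) ^+ 2.
Proof.
move=> r0 mf fM f0.
have M0 : 0 <= M := le_trans (normr_ge0 _) (fM 0).
have mE : measurable_fun setT (fun p : measurableTypeR R * measurableTypeR R => (f (cplx p))%:E).
  exact/measurable_EFinP.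
have fE p : (`|(f (cplx p))%:E| <= `|(M * \1_(box r) p)%:E|)%E.
  rewrite indicE; case: (boolP (p \in box r)) => [_|].
    by rewrite mulr1 !abse_EFin lee_fin (ger0_norm M0) fM.
  move=> np; rewrite f0 ?abse_EFin ?lee_fin ?normr0 ?normr_ge0 // ltNge; apply: contra np => pr; rewrite inE.
  have := Re_cabs (cplx p); have := Im_cabs (cplx p); rewrite !ler_norml => /andP[i1 i2] /andP[r1 r2].
  by split; rewrite /= in_itv /=; apply/andP; split; move: i1 i2 r1 r2 => /=; lra.
have mbox : measurable_fun setT (fun p => (M * \1_(box r) p)%:E).
  apply/measurable_EFinP; apply: measurable_funM; first exact: measurable_cst.
  by apply: measurable_indic; exact: measurable_box.
have Vbox : (\int[mu2 R]_p `|(M * \1_(box r) p)%:E| = (M * (2 * r) ^+ 2)%:E)%E.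
  rewrite (eq_integral (fun p => M%:E * (\1_(box r) p)%:E)%E); last first.
    by move=> p _; rewrite abse_EFin ger0_norm ?EFinM // mulr_ge0.
  rewrite ge0_integralZl ?lee_fin //; last first.
    by apply/measurable_EFinP; apply: measurable_indic; exact: measurable_box.
  rewrite integral_indic // ?setIT; last exact: measurable_box.
  by rewrite EFinM; congr (_ * _)%E; exact: box_measure.
have Ibox : (mu2 R).-integrable setT (fun p => (M * \1_(box r) p)%:E).
  by apply/integrableP; split => //; rewrite Vbox ltry.
have If : (mu2 R).-integrable setT (fun p => (f (cplx p))%:E).
  by apply: le_integrable Ibox => // p _; exact: fE.
split => //.
rewrite /integral_re -lee_fin EFin_normr_Rintegral // -Vbox.
apply: le_trans (le_abse_integral _ _ _) _ => //.
by apply: ge0_le_integral => //; try exact: measurableT_comp; move=> p _; exact: fE.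
Qed.
End Continuity.

(** * The integral as a positive linear functional invariant under translation *)

Section Functional.
Variable R : realType.
Implicit Types (u v : R[i] -> R[i]) (z w h : R[i]).
Local Notation RC x := (Complex x 0).

Lemma tame_cont u : tame u -> cont u. Proof. by case. Qed.

Lemma tameD u v : tame u -> tame v -> tame (fun z => u z + v z).
Proof.
move=> [cu [r hr]] [cv [s hs]]; split; first exact: contD.
exists (Num.max r s) => z; rewrite ge_max => /andP[zr zs].
by rewrite hr // hs // addr0.
Qed.

Lemma tameM u v : cont u -> tame v -> tame (fun z => u z * v z).
Proof. by move=> cu [cv [r hr]]; split; [exact: contM | exists r => z zr; rewrite hr // mulr0]. Qed.

Lemma tameMr u v : tame u -> cont v -> tame (fun z => u z * v z).
Proof. by move=> [cu [r hr]] cv; split; [exact: contM | exists r => z zr; rewrite hr // mul0r]. Qed.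

Lemma tameZ c u : tame u -> tame (fun z => c * u z).
Proof. by apply: tameM; exact: cont_cst. Qed.

Lemma tame0 : tame (fun=> 0 : R[i]).
Proof. by split; [exact: cont_cst | exists 0]. Qed.

Lemma tame_sum I (s : seq I) (F : I -> R[i] -> R[i]) :
  (forall i, tame (F i)) -> tame (fun z => \sum_(i <- s) F i z).
Proof.
move=> tF; elim: s => [|i s IH].
  by rewrite (_ : (fun z => _) = (fun=> 0)); [exact: tame0 | apply/funext => z; rewrite big_nil].
rewrite (_ : (fun z => _) = (fun z => F i z + \sum_(i <- s) F i z)).
  exact: tameD.
by apply/funext => z; rewrite big_cons.
Qed.

Lemma tameN u : tame u -> tame (fun z => - u z).
Proof. by move=> tu; under eq_fun do rewrite -mulN1r; exact: tameZ. Qed.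

Lemma tameB u v : tame u -> tame v -> tame (fun z => u z - v z).
Proof. by move=> tu tv; apply: tameD => //; exact: tameN. Qed.

Lemma tame_abs u : tame u -> tame (fun z => RC (cabs (u z))).
Proof. by move=> [cu [r hr]]; split; [exact: cont_abs | exists r => z zr; rewrite hr // cabs0]. Qed.

Lemma tame_shift a u : tame u -> tame (fun z => u (a + z)).
Proof.
move=> [cu [r hr]]; split; first exact: cont_shift.
exists (r + cabs a) => z zr; apply: hr.
have := cabs_subr z (- a); rewrite cabsN opprK (addrC z); lra.
Qed.

Lemma tame_bounded u : tame u -> exists M r, [/\ 0 <= M, 0 <= r, forall z, cabs (u z) <= M & forall z, r < cabs z -> u z = 0].
Proof.
move=> [cu [r hr]]; have [M M0 hM] := cont_bounded cu r.
exists M, `|r|; split => // z; last first.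
  by move=> rz; apply: hr; apply: le_trans (ltW rz); exact: ler_norm.
by have [/hM //|/ltW/hr ->] := leP (cabs z) r; rewrite cabs0.
Qed.

Lemma tame_integrable u : tame u ->
  (mu2 R).-integrable setT (fun p => (complex.Re (u (cplx p)))%:E) /\
  (mu2 R).-integrable setT (fun p => (complex.Im (u (cplx p)))%:E).
Proof.
move=> tu; have [M [r [M0 r0 hM hr]]] := tame_bounded tu.
have [mR mI] := cont_measurable (tame_cont tu).
have [||I1 _] := box_integrable (f := fun z => complex.Re (u z)) r0 mR (M := M).
- by move=> z; apply: le_trans (Re_cabs _) _.
- by move=> z /hr ->.
have [||I2 _] := box_integrable (f := fun z => complex.Im (u z)) r0 mI (M := M).
- by move=> z; apply: le_trans (Im_cabs _) _.
- by move=> z /hr ->.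
by [].
Qed.

Lemma integral_reD (f g : R[i] -> R) :
  (mu2 R).-integrable setT (fun p => (f (cplx p))%:E) ->
  (mu2 R).-integrable setT (fun p => (g (cplx p))%:E) ->
  integral_re (fun z => f z + g z) = integral_re f + integral_re g.
Proof. by move=> If Ig; exact: (@RintegralD _ _ _ (mu2 R) setT (f \o @cplx R) (g \o @cplx R)). Qed.

Lemma integral_reZ (c : R) (f : R[i] -> R) :
  (mu2 R).-integrable setT (fun p => (f (cplx p))%:E) ->
  integral_re (fun z => c * f z) = c * integral_re f.
Proof. by move=> If; exact: (@RintegralZl _ _ _ (mu2 R) setT (f \o @cplx R) c). Qed.

Lemma JD u v : tame u -> tame v -> J (fun z => u z + v z) = J u + J v.
Proof.
move=> /tame_integrable[a b] /tame_integrable[c d]; rewrite /J.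
have E1 : (fun z => complex.Re (u z + v z)) = (fun z => complex.Re (u z) + complex.Re (v z)).
  by apply/funext => z; rewrite reD.
have E2 : (fun z => complex.Im (u z + v z)) = (fun z => complex.Im (u z) + complex.Im (v z)).
  by apply/funext => z; rewrite imD.
by rewrite E1 E2 !integral_reD.
Qed.

Lemma integrableZ_re (c : R) (f : R[i] -> R) :
  (mu2 R).-integrable setT (fun p => (f (cplx p))%:E) ->
  (mu2 R).-integrable setT (fun p => (c * f (cplx p))%:E).
Proof.
move=> If; rewrite (_ : (fun p => _) = (fun p => c%:E * (f (cplx p))%:E))%E; first exact: integrableZl.
by apply/funext => p; rewrite EFinM.
Qed.

Lemma JZ c u : tame u -> J (fun z => c * u z) = c * J u.
Proof.
move=> /tame_integrable[a b]; rewrite /J.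
have E1 : (fun z => complex.Re (c * u z)) = (fun z => complex.Re c * complex.Re (u z) + (- complex.Im c) * complex.Im (u z)).
  by apply/funext => z; rewrite reM mulNr.
have Za x := @integrableZ_re x (fun z => complex.Re (u z)) a.
have Zb x := @integrableZ_re x (fun z => complex.Im (u z)) b.
have D1 x y : integral_re (fun z => x * complex.Re (u z) + y * complex.Im (u z)) =
    x * integral_re (fun z => complex.Re (u z)) + y * integral_re (fun z => complex.Im (u z)).
  rewrite (@integral_reD (fun z => x * complex.Re (u z)) (fun z => y * complex.Im (u z)) (Za x) (Zb y)).
  by rewrite !integral_reZ.
have E3 : (fun z => complex.Im (c * u z)) = (fun z => complex.Im c * complex.Re (u z) + complex.Re c * complex.Im (u z)).
  by apply/funext => z; rewrite imM addrC.
rewrite E1 E3 !D1.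
by apply: complexP; rewrite ?reM ?imM /=; ring.
Qed.

Lemma JN u : tame u -> J (fun z => - u z) = - J u.
Proof. by move=> tu; under eq_fun do rewrite -mulN1r; rewrite JZ // mulN1r. Qed.

Lemma JB u v : tame u -> tame v -> J (fun z => u z - v z) = J u - J v.
Proof. by move=> tu tv; rewrite JD ?JN //; exact: tameN. Qed.

Lemma J0 : J (fun=> 0 : R[i]) = 0.
Proof. by have := JZ 0 tame0; rewrite !mul0r. Qed.

Lemma J_sum I (s : seq I) (F : I -> R[i] -> R[i]) : (forall i, tame (F i)) ->
  J (fun z => \sum_(i <- s) F i z) = \sum_(i <- s) J (F i).
Proof.
move=> tF; elim: s => [|i s IH].
  by rewrite big_nil; under eq_fun do rewrite big_nil; exact: J0.
rewrite big_cons -IH -JD //; last exact: tame_sum.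
by under eq_fun do rewrite big_cons.
Qed.

Lemma integral_re_shift a (f : R[i] -> R) :
  measurable_fun setT (fun p : measurableTypeR R * measurableTypeR R => f (cplx p)) ->
  integral_re (fun z => f (a + z)) = integral_re f.
Proof.
move=> mf; rewrite /integral_re; congr fine.
pose g (p : measurableTypeR R * measurableTypeR R) := (f (cplx p))%:E.
have mg : measurable_fun setT g by exact/measurable_EFinP.
have E p : (f (a + cplx p))%:E = g (shift2 (complex.Re a, complex.Im a) p).
  by rewrite /g; congr (EFin (f _)); case: a => x y; rewrite /cplx /shift2 /=; simpc; rewrite (addrC x) (addrC y).
under eq_integral do rewrite E.
set s := (complex.Re a, complex.Im a).
(* Invariance was proved for nonnegative functions; it is applied to the positive and the negative
   part. *)
have P := @ge0_integral_shift2 R s (g ^\+)%E (measurable_funepos mg) (funepos_ge0 g).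
have N := @ge0_integral_shift2 R s (g ^\-)%E (measurable_funeneg mg) (funeneg_ge0 g).
rewrite integralE [RHS]integralE -P -N; congr (_ - _)%E; apply: eq_integral => x _.
  by have := congr1 (fun f => f x) (funepos_comp g (shift2 s)).
by have := congr1 (fun f => f x) (funeneg_comp g (shift2 s)).
Qed.

Lemma J_shift a u : tame u -> J (fun z => u (a + z)) = J u.
Proof.
move=> /tame_cont/cont_measurable[mR mI]; rewrite /J.
congr Complex; first exact: (@integral_re_shift a (fun z => complex.Re (u z)) mR).
exact: (@integral_re_shift a (fun z => complex.Im (u z)) mI).
Qed.

Lemma J_center a u : tame u -> J (fun z => u (z - a)) = J u.
Proof. by move=> tu; rewrite -(J_shift (- a) tu); under eq_fun do rewrite addrC. Qed.

(** The support lies in a square of area [4 r^2], and the real and imaginary parts each contribute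
    [M] times that area, hence the factor 8. *)
Lemma J_bound u M r : tame u -> 0 <= r -> (forall z, cabs (u z) <= M) ->
  (forall z, r < cabs z -> u z = 0) -> cabs (J u) <= 8 * M * r ^+ 2.
Proof.
move=> tu r0 hM hr; have [mR mI] := cont_measurable (tame_cont tu).
have [||_ I1] := box_integrable (f := fun z => complex.Re (u z)) r0 mR (M := M).
- by move=> z; apply: le_trans (Re_cabs _) _.
- by move=> z /hr ->.
have [||_ I2] := box_integrable (f := fun z => complex.Im (u z)) r0 mI (M := M).
- by move=> z; apply: le_trans (Im_cabs _) _.
- by move=> z /hr ->.
apply: le_trans (cabs_ReIm _) _ => /=; apply: le_trans (lerD I1 I2) _.
by rewrite le_eqVlt; apply/orP; left; apply/eqP; ring.
Qed.

Lemma J_le u v : tame u -> tame v -> (forall z, complex.Re (u z) <= complex.Re (v z)) ->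
  complex.Re (J u) <= complex.Re (J v).
Proof.
move=> /tame_integrable[Iu _] /tame_integrable[Iv _] uv /=.
by apply: (@le_Rintegral _ _ _ (mu2 R) setT) => //.
Qed.

Lemma J_norm u : tame u -> cabs (J u) <= complex.Re (J (fun z => RC (cabs (u z)))).
Proof.
move=> tu; have [j0|j0] := eqVneq (J u) 0.
  rewrite j0 cabs0; have := J_le tame0 (tame_abs tu); rewrite J0; apply => z /=; exact: cabs_ge0.
have a0 : 0 < cabs (J u) by rewrite cabs_gt0.
(* Multiplication by this unimodular number turns [J u] into its modulus, so that monotonicity of
   the real part of [J] applies. *)
pose c := (J u)^* * RC (cabs (J u))^-1.
have -> : cabs (J u) = complex.Re (J (fun z => c * u z)).
  rewrite JZ // /c mulrAC (mulrC _ (J u)) mulJ; simpc => /=.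
  by rewrite expr2 mulfK // gt_eqF.
apply: J_le; [exact: tameZ | exact: tame_abs | move=> z /=].
apply: le_trans (Re_le_cabs _) _; rewrite cabsM {1}/c cabsM cabs_conj cabs_real ger0_norm ?invr_ge0 ?cabs_ge0 //.
by rewrite divff ?mul1r // gt_eqF.
Qed.

Lemma J_kernel_bound (k : R[i] -> R) u M : tame (fun z => RC (k z)) -> cont u ->
  (forall z, 0 <= k z) -> (forall z, k z != 0 -> cabs (u z) <= M) ->
  cabs (J (fun z => RC (k z) * u z)) <= M * complex.Re (J (fun z => RC (k z))).
Proof.
move=> tk cu k0 hM; apply: le_trans (J_norm _) _; first exact: tameMr.
have -> : M * complex.Re (J (fun z => RC (k z))) = complex.Re (J (fun z => RC M * RC (k z))).
  by rewrite JZ // reM /= mul0r subr0.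
apply: J_le; [apply: tame_abs; exact: tameMr | exact: tameZ | move=> z /=].
rewrite cabsM cabs_real ger0_norm // mul0r subr0.
have [->|kz] := eqVneq (k z) 0; first by rewrite mul0r mulr0.
by rewrite mulrC ler_wpM2r // hM.
Qed.

Lemma J_gt0 (k : R[i] -> R) z0 : tame (fun z => RC (k z)) -> (forall z, 0 <= k z) -> 0 < k z0 ->
  0 < complex.Re (J (fun z => RC (k z))).
Proof.
move=> tk k0 kz0.
have -> : J (fun z => RC (k z)) = J (fun z => RC (k (z0 + z))) by rewrite (J_shift z0 tk).
(* [e] is half the value at [z0]. By continuity the kernel stays above [e] on a small square about
   [z0], and the integral is at least [e] times its area. *)
have [e e0 ke] : exists2 e, 0 < e & k z0 = e + e by exists (k z0 / 2); lra.
have [d d0 hd] := tame_cont tk z0 e0.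
have [_ Vbox] : True /\ (\int[mu2 R]_p (e * \1_(box (d / 4)) p)%:E = (e * (2 * (d / 4)) ^+ 2)%:E)%E.
  split => //; under eq_integral do rewrite EFinM.
  rewrite ge0_integralZl ?lee_fin //; [|by apply/measurable_EFinP; apply: measurable_indic; exact: measurable_box| lra].
  rewrite integral_indic // ?setIT; last exact: measurable_box.
  by rewrite EFinM; congr (_ * _)%E; apply: box_measure; lra.
have [I1 _] := tame_integrable (tame_shift z0 tk).
apply: (@lt_le_trans _ _ (e * (2 * (d / 4)) ^+ 2)).
  by rewrite mulr_gt0 ?exprn_gt0; lra.
rewrite /= -lee_fin /integral_re fineK; last exact: integrable_fin_num.
rewrite -Vbox; apply: ge0_le_integral => //.
- by move=> p _; rewrite lee_fin mulr_ge0 //; lra.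
- apply/measurable_EFinP; apply: measurable_funM; first exact: measurable_cst.
  by apply: measurable_indic; exact: measurable_box.
- by case/integrableP : I1.
move=> [x y] _; rewrite lee_fin indicE /=; case: (boolP (_ \in box _)) => [|_]; last by rewrite mulr0.
rewrite inE => -[/=]; rewrite !in_itv /= => xd yd; rewrite mulr1.
have := hd (z0 + cplx (x, y)); rewrite addrC addKr => /(_ _)/wrap[].
  apply: le_lt_trans (cabs_ReIm _) _ => /=.
  have h1 : `|x| <= d / 4 by rewrite ler_norml.
  have h2 : `|y| <= d / 4 by rewrite ler_norml.
  lra.
simpc; rewrite cabs_real ltr_norml => /andP[]; lra.
Qed.
End Functional.

(** * A calculus of uniform first-order expansions, with Stokes and differentiation under the
    integral *)

Section D11.
Variable R : realType.
Implicit Types (u v al be : R[i] -> R[i]) (z w h : R[i]).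
Local Notation RC x := (Complex x 0).

(* [K] is, locally uniformly in [z] and the parameter [w], of the form
   K(z + h) = K(z) + A h + B conj(h) + O(|h|^2); thus A = dK/dz, B = dK/dzbar. *)
Definition D11p (K A B : R[i] -> R[i] -> R[i]) := forall r, exists2 C, 0 <= C &
  forall z w, cabs z <= r -> cabs w <= r ->
    [/\ cabs (K z w) <= C, cabs (A z w) <= C, cabs (B z w) <= C &
     forall h, cabs h <= 1 ->
       cabs (K (z + h) w - K z w - A z w * h - B z w * h^*) <= C * cabs h ^+ 2].

Definition D11 u al be := D11p (fun z _ => u z) (fun z _ => al z) (fun z _ => be z).

Lemma D11E u al be : D11 u al be -> forall r, exists2 C, 0 <= C &
  forall z, cabs z <= r -> [/\ cabs (u z) <= C, cabs (al z) <= C, cabs (be z) <= C &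
     forall h, cabs h <= 1 -> cabs (u (z + h) - u z - al z * h - be z * h^*) <= C * cabs h ^+ 2].
Proof.
move=> D r; have [C C0 hC] := D `|r|; exists C => // z zr.
have r0 : r <= `|r| by exact: ler_norm.
by apply: (hC z 0); rewrite ?cabs0 ?normr_ge0 //; exact: le_trans zr r0.
Qed.

Lemma D11I u al be : (forall r, exists2 C, 0 <= C &
  forall z, cabs z <= r -> [/\ cabs (u z) <= C, cabs (al z) <= C, cabs (be z) <= C &
     forall h, cabs h <= 1 -> cabs (u (z + h) - u z - al z * h - be z * h^*) <= C * cabs h ^+ 2]) -> D11 u al be.
Proof. by move=> D r; have [C C0 hC] := D r; exists C => // z w /hC. Qed.

Lemma D11p_of u al be : D11 u al be -> D11p (fun z _ => u z) (fun z _ => al z) (fun z _ => be z).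
Proof. by []. Qed.

(** Evaluating an [R]-linear map at [w] and at [i w] separates its [C]-linear part from its
    antilinear part. *)
Lemma lin_bound a b w K : cabs (a * w + b * w^*) <= K -> cabs (a * ('i%C * w) + b * ('i%C * w)^*) <= K ->
  cabs a * cabs w <= K /\ cabs b * cabs w <= K.
Proof.
move=> h1 h2; have i2 : ('i%C : R[i]) * 'i%C = -1 by rewrite -expr2 sqr_i.
have ci : ('i%C : R[i])^* = - 'i%C by apply: complexP; rewrite ?reN ?imN /= ?oppr0.
have ai : cabs ('i%C : R[i]) = 1 by rewrite /cabs /sqmod /= expr0n add0r expr1n sqrtr1.
rewrite rmorphM /= ci in h2.
have e1 : a * w *+ 2 = (a * w + b * w^*) - 'i%C * (a * ('i%C * w) + b * (- 'i%C * w^*)).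
  have -> : 'i%C * (a * ('i%C * w) + b * (- 'i%C * w^*)) = ('i%C * 'i%C) * (a * w - b * w^*) by ring.
  by rewrite i2; ring.
have e2 : b * w^* *+ 2 = (a * w + b * w^*) + 'i%C * (a * ('i%C * w) + b * (- 'i%C * w^*)).
  have -> : 'i%C * (a * ('i%C * w) + b * (- 'i%C * w^*)) = ('i%C * 'i%C) * (a * w - b * w^*) by ring.
  by rewrite i2; ring.
have two x : cabs (x *+ 2) = 2 * cabs x.
  have -> : x *+ 2 = RC 2 * x by apply: complexP; rewrite ?reM ?imM mulr2n ?reD ?imD /=; ring.
  by rewrite cabsM cabs_real ger0_norm.
have b1 := cabsBD (a * w + b * w^*) ('i%C * (a * ('i%C * w) + b * (- 'i%C * w^*))).
have b2 := cabsD (a * w + b * w^*) ('i%C * (a * ('i%C * w) + b * (- 'i%C * w^*))).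
rewrite -e1 two (cabsM a) (cabsM 'i%C) ai mul1r in b1; rewrite -e2 two (cabsM b) cabs_conj (cabsM 'i%C) ai mul1r in b2.
by split; lra.
Qed.

Lemma lin_zero a b C : (forall h, cabs h <= 1 -> cabs (a * h + b * h^*) <= C * cabs h ^+ 2) -> a = 0 /\ b = 0.
Proof.
move=> H; have ai : cabs ('i%C : R[i]) = 1 by rewrite /cabs /sqmod /= expr0n add0r expr1n sqrtr1.
have K t : 0 < t -> t <= 1 -> cabs a <= C * t /\ cabs b <= C * t.
  move=> t0 t1; have ct : cabs (RC t) = t by rewrite cabs_real gtr0_norm.
  have [||h1 h2] := @lin_bound a b (RC t) (C * t ^+ 2).
  - by rewrite -[X in C * X ^+ 2]ct; apply: H; rewrite ct.
  - by have := H ('i%C * RC t); rewrite cabsM ai ct mul1r; apply.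
  by rewrite ct expr2 mulrA !ler_pM2r // in h1 h2.
have Z x : 0 <= x -> (forall t, 0 < t -> t <= 1 -> x <= C * t) -> x = 0.
  move=> x0 hx; apply/eqP; rewrite eq_le x0 andbT leNgt; apply/negP => xp.
  have c0 : 0 < `|C| + 1 by have := normr_ge0 C; lra.
  pose t := Num.min 1 (x / 2 / (`|C| + 1)).
  have t0 : 0 < t by rewrite lt_min ltr01 !divr_gt0.
  have ht := hx t t0 ltac:(by rewrite ge_min lexx).
  have : t * (`|C| + 1) <= x / 2 by rewrite -ler_pdivlMr // ge_min lexx orbT.
  have := ler_wpM2r (ltW t0) (ler_norm C); lra.
by split; apply/eqP; rewrite -cabs_eq0; apply/eqP; apply: Z => // t t0 t1; have [] := K t t0 t1.
Qed.

Lemma lin_est a b h C x : cabs a <= C -> cabs b <= C -> cabs h <= 1 -> cabs x <= C * cabs h ^+ 2 ->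
  cabs (x + (a * h + b * h^*)) <= 3 * C * cabs h.
Proof.
move=> aC bC h1 xC; have h0 := cabs_ge0 h; have C0 : 0 <= C := le_trans (cabs_ge0 _) aC.
have := cabsD x (a * h + b * h^*); have := cabsD (a * h) (b * h^*).
rewrite !cabsM cabs_conj; have p1 := ler_wpM2r h0 aC; have p2 := ler_wpM2r h0 bC.
have p3 : cabs h ^+ 2 <= cabs h by rewrite expr2 ler_piMl.
have := ler_wpM2l C0 p3; lra.
Qed.

(** Regularity of the coefficients comes for free from the uniform quadratic remainder. Expanding at
    [z] and at [z + h] and comparing both at [z + h + k], with [|k| = |h|], bounds the change of the
    linear part applied to [k] by a multiple of [|h|^2]; [lin_bound] then bounds the change of each
    coefficient. *)
Lemma D11_lip u al be : D11 u al be -> forall r, exists2 C, 0 <= C & forall z h, cabs z <= r -> cabs h <= 2^-1 ->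
  [/\ cabs (u (z + h) - u z) <= C * cabs h, cabs (al (z + h) - al z) <= C * cabs h & cabs (be (z + h) - be z) <= C * cabs h].
Proof.
move=> /D11E D r; have [C C0 hC] := D (r + 1); exists (6 * C); first lra.
move=> z h zr h2; have [zr1 h1] : cabs z <= r + 1 /\ cabs h <= 1 by split; lra.
have zh1 : cabs (z + h) <= r + 1 by have := cabsD z h; lra.
have [uz az bz Ez] := hC z zr1; have [uh ah bh Eh] := hC (z + h) zh1.
have hh := cabs_ge0 h.
pose a := al (z + h) - al z; pose b := be (z + h) - be z.
have key k : cabs k = cabs h -> cabs (a * k + b * k^*) <= 6 * C * cabs h * cabs h.
  move=> kh; have k1 : cabs k <= 1 by rewrite kh.
  have hk1 : cabs (h + k) <= 1 by have := cabsD h k; lra.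
  have E1 := Ez h h1; have E2 := Eh k k1; have E3 := Ez (h + k) hk1.
  have -> : a * k + b * k^* = (u (z + (h + k)) - u z - al z * (h + k) - be z * (h + k)^*)
      - (u (z + h) - u z - al z * h - be z * h^*) - (u (z + h + k) - u (z + h) - al (z + h) * k - be (z + h) * k^*).
    by rewrite /a /b rmorphD /= addrA; ring.
  have t1 := cabsBD (u (z + (h + k)) - u z - al z * (h + k) - be z * (h + k)^* - (u (z + h) - u z - al z * h - be z * h^*))
       (u (z + h + k) - u (z + h) - al (z + h) * k - be (z + h) * k^*).
  have t2 := cabsBD (u (z + (h + k)) - u z - al z * (h + k) - be z * (h + k)^*) (u (z + h) - u z - al z * h - be z * h^*).
  have hk2 := cabsD h k; rewrite kh in hk2 E2.
  have q : cabs (h + k) ^+ 2 <= 4 * cabs h ^+ 2.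
    by have := ler_pM (cabs_ge0 _) (cabs_ge0 _) hk2 hk2; lra.
  by have := ler_wpM2l C0 q; lra.
have [||l1 l2] := @lin_bound a b h (6 * C * cabs h * cabs h); first exact: key.
  by apply: key; rewrite cabsM /cabs /sqmod /= expr0n add0r expr1n sqrtr1 mul1r.
split.
- have -> : u (z + h) - u z = (u (z + h) - u z - al z * h - be z * h^*) + (al z * h + be z * h^*) by ring.
  have := lin_est az bz h1 (Ez h h1); have := mulr_ge0 C0 hh; lra.
- have [->|h0] := eqVneq h 0; first by rewrite addr0 subrr cabs0 mulr0.
  by rewrite -(ler_pM2r (x := cabs h)) // cabs_gt0.
- have [->|h0] := eqVneq h 0; first by rewrite addr0 subrr cabs0 mulr0.
  by rewrite -(ler_pM2r (x := cabs h)) // cabs_gt0.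
Qed.

Lemma lip_cont u : (forall r, exists2 C, 0 <= C & forall z h, cabs z <= r -> cabs h <= 2^-1 ->
  cabs (u (z + h) - u z) <= C * cabs h) -> cont u.
Proof.
move=> H z e e0; have [C C0 hC] := H (cabs z).
have c0 : 0 < C + 1 by lra.
exists (Num.min 2^-1 (e / (C + 1))); first by rewrite lt_min divr_gt0 // andbT; lra.
move=> w; rewrite lt_min => /andP[w1]; rewrite ltr_pdivlMr // => w2.
have := hC z (w - z) (lexx _) (ltW w1); rewrite (addrC z) subrK.
have := cabs_ge0 (w - z); lra.
Qed.

Lemma D11_cont u al be : D11 u al be -> [/\ cont u, cont al & cont be].
Proof.
by move=> /D11_lip D; split; apply: lip_cont => r; have [C C0 hC] := D r; exists C => // z h zr hr; have [] := hC z h zr hr.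
Qed.

Lemma D11pM K A B K' A' B' : D11p K A B -> D11p K' A' B' ->
  D11p (fun z w => K z w * K' z w) (fun z w => A z w * K' z w + K z w * A' z w)
    (fun z w => B z w * K' z w + K z w * B' z w).
Proof.
move=> D D' r; have [C C0 hC] := D r; have [C' C0' hC'] := D' r.
exists (11 * (C * C')); first by rewrite !mulr_ge0.
move=> z w zr wr; have [k a b E] := hC z w zr wr; have [k' a' b' E'] := hC' z w zr wr.
have pp x y (M M' : R) : cabs x <= M -> cabs y <= M' -> cabs (x * y) <= M * M'.
  by move=> xm ym; rewrite cabsM ler_pM ?cabs_ge0.
have CC := mulr_ge0 C0 C0'.
split; first by have := pp _ _ _ _ k k'; lra.
- by have := cabsD (A z w * K' z w) (K z w * A' z w); have := pp _ _ _ _ a k'; have := pp _ _ _ _ k a'; lra.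
- by have := cabsD (B z w * K' z w) (K z w * B' z w); have := pp _ _ _ _ b k'; have := pp _ _ _ _ k b'; lra.
move=> h h1; have h0 := cabs_ge0 h.
have L X Y c c1 c2 (x : R[i]) : 0 <= c -> cabs c1 <= c -> cabs c2 <= c -> cabs x <= c * cabs h ^+ 2 ->
   Y - X - c1 * h - c2 * h^* = x -> cabs (Y - X) <= 3 * c * cabs h.
  move=> c0 hc1 hc2 hx e; have -> : Y - X = x + (c1 * h + c2 * h^*) by rewrite -e; ring.
  exact: lin_est.
have l1 := L _ _ _ _ _ _ C0 a b (E h h1) erefl.
have l2 := L _ _ _ _ _ _ C0' a' b' (E' h h1) erefl.
have -> : K (z + h) w * K' (z + h) w - K z w * K' z w - (A z w * K' z w + K z w * A' z w) * h - (B z w * K' z w + K z w * B' z w) * h^*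
  = (K (z + h) w - K z w) * (K' (z + h) w - K' z w) + (K (z + h) w - K z w - A z w * h - B z w * h^*) * K' z w
    + K z w * (K' (z + h) w - K' z w - A' z w * h - B' z w * h^*) by ring.
apply: le_trans (cabsD _ _) _; apply: le_trans (lerD (cabsD _ _) (lexx _)) _.
have t1 := pp _ _ _ _ l1 l2; have t2 := pp _ _ _ _ (E h h1) k'; have t3 := pp _ _ _ _ k (E' h h1).
apply: le_trans (lerD (lerD t1 t2) t3) _.
by rewrite le_eqVlt; apply/orP; left; apply/eqP; ring.
Qed.

Lemma D11pD K A B K' A' B' : D11p K A B -> D11p K' A' B' ->
  D11p (fun z w => K z w + K' z w) (fun z w => A z w + A' z w) (fun z w => B z w + B' z w).
Proof.
move=> D D' r; have [C C0 hC] := D r; have [C' C0' hC'] := D' r.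
exists (C + C'); first by rewrite addr_ge0.
move=> z w zr wr; have [k a b E] := hC z w zr wr; have [k' a' b' E'] := hC' z w zr wr.
split; try by apply: le_trans (cabsD _ _) _; exact: lerD.
move=> h h1.
have -> : K (z + h) w + K' (z + h) w - (K z w + K' z w) - (A z w + A' z w) * h - (B z w + B' z w) * h^* =
  (K (z + h) w - K z w - A z w * h - B z w * h^*) + (K' (z + h) w - K' z w - A' z w * h - B' z w * h^*) by ring.
by apply: le_trans (cabsD _ _) _; rewrite mulrDl; exact: lerD (E h h1) (E' h h1).
Qed.

Lemma D11p_par (f : R[i] -> R[i]) : cont f -> D11p (fun _ w => f w) (fun _ _ => 0) (fun _ _ => 0).
Proof.
move=> cf r; have [C C0 hC] := cont_bounded cf r; exists C => // z w zr wr; rewrite !cabs0; split => //; first exact: hC.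
by move=> h _; rewrite subrr !mul0r !subr0 cabs0 mulr_ge0 // sqr_ge0.
Qed.

Lemma D11_eq u al be u' al' be' : D11 u al be -> u =1 u' -> al =1 al' -> be =1 be' -> D11 u' al' be'.
Proof. by move=> D /funext <- /funext <- /funext <-. Qed.

Lemma D11M u al be v al' be' : D11 u al be -> D11 v al' be' ->
  D11 (fun z => u z * v z) (fun z => al z * v z + u z * al' z) (fun z => be z * v z + u z * be' z).
Proof. exact: D11pM. Qed.
Lemma D11D u al be v al' be' : D11 u al be -> D11 v al' be' ->
  D11 (fun z => u z + v z) (fun z => al z + al' z) (fun z => be z + be' z).
Proof. exact: D11pD. Qed.
Lemma D11_cst c : D11 (fun=> c) (fun=> 0) (fun=> 0).
Proof. exact: (D11p_par (cont_cst c)). Qed.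
Lemma D11Z c u al be : D11 u al be -> D11 (fun z => c * u z) (fun z => c * al z) (fun z => c * be z).
Proof. by move=> D; apply: D11_eq (D11M (D11_cst c) D) _ _ _ => z //; rewrite mul0r add0r. Qed.
Lemma D11_conj u al be : D11 u al be -> D11 (fun z => (u z)^*) (fun z => (be z)^*) (fun z => (al z)^*).
Proof.
move=> /D11E D; apply: D11I => r; have [C C0 hC] := D r; exists C => // z /hC[a b c E].
rewrite !cabs_conj; split => // h h1.
have -> : (u (z + h))^* - (u z)^* - (be z)^* * h - (al z)^* * h^* = (u (z + h) - u z - al z * h - be z * h^*)^*.
  by rewrite !rmorphB !rmorphM /= conjCK; ring.
by rewrite cabs_conj; exact: E.
Qed.
Lemma D11_id : D11 id (fun=> 1) (fun=> 0).
Proof.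
apply: D11I => r; exists (`|r| + 1) => [|z zr]; first by have := normr_ge0 r; lra.
have := ler_norm r; have := normr_ge0 r; rewrite cabs0 cabs1; split; rewrite /=; try lra.
move=> h _; have -> : z + h - z - 1 * h - 0 * h^* = 0 by ring.
by rewrite cabs0 mulr_ge0 ?sqr_ge0 //; have := normr_ge0 r; lra.
Qed.
Lemma D11_shift a u al be : D11 u al be -> D11 (fun z => u (a + z)) (fun z => al (a + z)) (fun z => be (a + z)).
Proof.
move=> /D11E D; apply: D11I => r; have [C C0 hC] := D (cabs a + r); exists C => // z zr.
have [|p1 p2 p3 E] := hC (a + z); first by have := cabsD a z; lra.
by split => // h /E; rewrite addrA.
Qed.

(** The one-dimensional analogue, a local $C^{1,1}$ condition. It admits quadratic splines, so that
    every cut-off below can be piecewise polynomial instead of smooth. *)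
Definition RC11 (f f' : R -> R) := forall r, exists2 C, 0 <= C & forall x y, `|x| <= r -> `|y| <= r ->
  [/\ `|f x| <= C, `|f' x| <= C & `|f (x + y) - f x - f' x * y| <= C * y ^+ 2].

Lemma D11_real (f f' : R -> R) (g : R[i] -> R) al be : RC11 f f' -> D11 (fun z => RC (g z)) al be ->
  D11 (fun z => RC (f (g z))) (fun z => RC (f' (g z)) * al z) (fun z => RC (f' (g z)) * be z).
Proof.
move=> F /D11E D; apply: D11I => r; have [C C0 hC] := D r; have [M M0 hM] := F (3 * C + 1).
exists (M * (9 * C ^+ 2 + C) + M); first by rewrite addr_ge0 // mulr_ge0 // addr_ge0 // mulr_ge0 // sqr_ge0.
move=> z /hC[gz a b E]; rewrite cabs_real in gz.
have [||fg f'g _] := hM (g z) 0; [lra | rewrite normr0; lra|].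
have fa x : cabs x <= C -> cabs (RC (f' (g z)) * x) <= M * (9 * C ^+ 2 + C) + M.
  move=> xC; rewrite cabsM cabs_real; have := ler_pM (normr_ge0 _) (cabs_ge0 _) f'g xC.
  have := mulr_ge0 M0 (sqr_ge0 C); lra.
split; try exact: fa; first by rewrite cabs_real; have := mulr_ge0 M0 (addr_ge0 (mulr_ge0 (ler0n R 9) (sqr_ge0 C)) C0); lra.
move=> h h1; set d := g (z + h) - g z.
have h0 := cabs_ge0 h; have Eh := E h h1.
have RCB x y : RC x - RC y = RC (x - y) :> R[i] by simpc.
have dl : `|d| <= 3 * C * cabs h.
  rewrite -cabs_real -RCB.
  have -> : RC (g (z + h)) - RC (g z) = (RC (g (z + h)) - RC (g z) - al z * h - be z * h^*) + (al z * h + be z * h^*) by ring.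
  exact: lin_est.
have [||_ _ Ef] := hM (g z) d; [lra | by have := ler_wpM2l (mulr_ge0 (ler0n R 3) C0) h1; lra |].
rewrite /d (addrC (g z)) subrK -/d in Ef.
have -> : RC (f (g (z + h))) - RC (f (g z)) - RC (f' (g z)) * al z * h - RC (f' (g z)) * be z * h^*
  = RC (f (g (z + h)) - f (g z) - f' (g z) * d) + RC (f' (g z)) * (RC (g (z + h)) - RC (g z) - al z * h - be z * h^*).
  have -> : RC (f (g (z + h)) - f (g z) - f' (g z) * d) = RC (f (g (z + h))) - RC (f (g z)) - RC (f' (g z)) * (RC (g (z + h)) - RC (g z)) :> R[i].
    by apply: complexP; rewrite ?(reD, imD, reN, imN, reM, imM) /d /=; ring.
  ring.
apply: le_trans (cabsD _ _) _; rewrite cabsM !cabs_real.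
have t1 : M * d ^+ 2 <= M * (9 * C ^+ 2 * cabs h ^+ 2).
  apply: ler_wpM2l => //; rewrite -real_normK ?num_real //.
  by have := ler_pM (normr_ge0 d) (normr_ge0 d) dl dl; nra.
have t2 := ler_pM (normr_ge0 _) (cabs_ge0 _) f'g Eh.
have := mulr_ge0 M0 (sqr_ge0 (cabs h)); lra.
Qed.

Lemma D11_Re : D11 (fun z => RC (complex.Re z)) (fun=> RC 2^-1) (fun=> RC 2^-1).
Proof.
apply: D11_eq (D11Z (RC 2^-1) (D11D D11_id (D11_conj D11_id))) _ _ _ => z /=.
- by apply: complexP; rewrite ?(reM, imM, reD, imD, reJ, imJ) /=; [field | ring].
- by apply: complexP; rewrite ?(reM, imM, reD, imD, reJ, imJ) /=; ring.
- by apply: complexP; rewrite ?(reM, imM, reD, imD, reJ, imJ) /=; ring.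
Qed.

Lemma D11_Im : D11 (fun z => RC (complex.Im z)) (fun=> Complex 0 (- 2^-1)) (fun=> Complex 0 2^-1).
Proof.
apply: D11_eq (D11Z (Complex 0 (- 2^-1)) (D11D D11_id (D11Z (-1) (D11_conj D11_id)))) _ _ _ => z /=.
- by apply: complexP; rewrite ?(reM, imM, reD, imD, reN, imN, reJ, imJ) /=; field.
- by apply: complexP; rewrite ?(reM, imM, reD, imD, reN, imN, reJ, imJ) /=; ring.
- by apply: complexP; rewrite ?(reM, imM, reD, imD, reN, imN, reJ, imJ) /=; ring.
Qed.

Lemma D11_sqabs : D11 (fun z => RC (cabs z ^+ 2)) (fun z => z^*) (fun z => z).
Proof.
apply: D11_eq (D11M D11_id (D11_conj D11_id)) _ _ _ => z /=; first by rewrite mulJ.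
- by rewrite rmorph0 mulr0 addr0 mul1r.
- by rewrite rmorph1 mulr1 mul0r add0r.
Qed.

(* Translation invariance of the integral is all that is used: the average of u(. + h) - u vanishes. *)
Lemma stokes u al be : compact_supp u -> D11 u al be -> [/\ tame al, tame be, J al = 0 & J be = 0].
Proof.
move=> [r hr] D; have [cu ca cb] := D11_cont D.
have tu : tame u by split => //; exists r.
have vanish z : r + 1 <= cabs z -> al z = 0 /\ be z = 0.
  move=> zr; have [C C0 /(_ z (lexx _))[_ _ _ E]] := D11E D (cabs z).
  apply: (@lin_zero _ _ C) => h h1; have := E h h1.
  rewrite !hr; [|lra|by have := cabs_subr z (- h); rewrite opprK cabsN; lra].
  by rewrite -cabsN; congr (cabs _ <= _); ring.
have ta : tame al by split => //; exists (r + 1) => z /vanish[].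
have tb : tame be by split => //; exists (r + 1) => z /vanish[].
have [C C0 hC] := D11E D (`|r| + 2).
suff [] : J al = 0 /\ J be = 0 by split.
apply: (@lin_zero _ _ (8 * C * (`|r| + 2) ^+ 2)) => h h1.
have th := tame_shift h tu.
have cm c v : tame v -> tame (fun z => v z * c) by move=> tv; apply: tameMr => //; exact: cont_cst.
have jm c v : tame v -> J (fun z => v z * c) = J v * c.
  by move=> tv; rewrite mulrC -JZ //; congr J; apply/funext => z; rewrite mulrC.
have t1 : tame (fun z => u (h + z) - u z) := tameB th tu.
have t2 : tame (fun z => u (h + z) - u z - al z * h) := tameB t1 (cm h al ta).
have t3 : tame (fun z => be z * h^*) := cm h^* be tb.
have -> : J al * h + J be * h^* = - J (fun z => u (h + z) - u z - al z * h - be z * h^*).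
  by rewrite (JB t2 t3) (JB t1 (cm h al ta)) (JB th tu) (J_shift h tu) (jm h al ta) (jm _ be tb); ring.
rewrite cabsN.
have -> : 8 * C * (`|r| + 2) ^+ 2 * cabs h ^+ 2 = 8 * (C * cabs h ^+ 2) * (`|r| + 2) ^+ 2 by ring.
have r0 := normr_ge0 r; have rr := ler_norm r; have h0 := cabs_ge0 h.
have out z : `|r| + 2 < cabs z -> u (h + z) - u z - al z * h - be z * h^* = 0.
  move=> zr; have [-> ->] := vanish z ltac:(lra); rewrite !hr; [by ring|lra|].
  by have := cabs_subr z (- h); rewrite opprK cabsN (addrC z); lra.
apply: J_bound.
- exact: tameB t2 t3.
- lra.
- move=> z; have [zr|/out ->] := leP (cabs z) (`|r| + 2); last by rewrite cabs0 mulr_ge0 // sqr_ge0.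
  by have [_ _ _ /(_ h h1)] := hC z zr; rewrite (addrC z).
- exact: out.
Qed.

(** The expansion of [K] is uniform over the support of [g], hence integrates term by term.
    Continuity in the second variable is a separate hypothesis because [D11p] asserts no regularity
    there. *)
Lemma D11p_integral K A B g : D11p K A B -> tame g ->
  (forall z, [/\ cont (K z), cont (A z) & cont (B z)]) ->
  D11 (fun z => J (fun w => K z w * g w)) (fun z => J (fun w => A z w * g w)) (fun z => J (fun w => B z w * g w)).
Proof.
move=> D tg cK; apply: D11I => r.
have [M [s [M0 s0 hM hs]]] := tame_bounded tg.
have [C C0 hC] := D (Num.max r s); exists (8 * (C * M) * s ^+ 2).
  by rewrite !mulr_ge0 // sqr_ge0.
move=> z zr; have [ck ca cb] := cK z.
have zr' : cabs z <= Num.max r s by rewrite le_max zr.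
have B' (X : R[i] -> R[i]) c : cont X -> 0 <= c -> (forall w, cabs w <= s -> cabs (X w) <= C * c) ->
    cabs (J (fun w => X w * g w)) <= 8 * (C * M) * s ^+ 2 * c.
  move=> cX c0 hX; have -> : 8 * (C * M) * s ^+ 2 * c = 8 * (C * c * M) * s ^+ 2 by ring.
  apply: J_bound => //; first exact: tameM.
    move=> w; have [ws|/hs ->] := leP (cabs w) s; last by rewrite mulr0 cabs0 !mulr_ge0.
    by rewrite cabsM ler_pM ?cabs_ge0 ?hX ?hM.
  by move=> w /hs ->; rewrite mulr0.
have Cw w : cabs w <= s -> cabs w <= Num.max r s by move=> ws; rewrite le_max ws orbT.
split; try (rewrite -[leRHS]mulr1; apply: B' => // w /Cw ws; rewrite mulr1; by have [] := hC z w zr' ws).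
move=> h h1; have [ck' _ _] := cK (z + h).
have cZ c (X : R[i] -> R[i]) : cont X -> cont (fun w => X w * c) by move=> cX; apply: contM => //; exact: cont_cst.
have cN (X Y : R[i] -> R[i]) : cont X -> cont Y -> cont (fun w => X w - Y w).
  move=> cX cY; apply: contD => //; under eq_fun do rewrite -mulN1r; exact: contZ.
have E : J (fun w => K (z + h) w * g w) - J (fun w => K z w * g w) - J (fun w => A z w * g w) * h - J (fun w => B z w * g w) * h^* =
  J (fun w => (K (z + h) w - K z w - A z w * h - B z w * h^*) * g w).
  have t1 := tameM ck' tg; have t2 := tameM ck tg; have t3 := tameM ca tg; have t4 := tameM cb tg.
  have -> : (fun w => (K (z + h) w - K z w - A z w * h - B z w * h^*) * g w) =
      (fun w => K (z + h) w * g w - K z w * g w - h * (A z w * g w) - h^* * (B z w * g w)).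
    by apply/funext => w; ring.
  rewrite (JB (tameB (tameB t1 t2) (tameZ h t3)) (tameZ h^* t4)) (JB (tameB t1 t2) (tameZ h t3)) (JB t1 t2).
  by rewrite (JZ h t3) (JZ h^* t4) (mulrC h) (mulrC h^*).
rewrite E; apply: B'; [|exact: sqr_ge0|].
  exact: (cN _ _ (cN _ _ (cN _ _ ck' ck) (cZ h _ ca)) (cZ h^* _ cb)).
by move=> w /Cw ws; have [_ _ _ /(_ h h1)] := hC z w zr' ws.
Qed.
End D11.

(** * Quadratic and cubic splines and their refinement *)

Section Splines.
Variable R : realType.
Implicit Types (f g : R -> R) (x y : R).

Definition ppart x : R := if 0 <= x then x else 0.

Lemma ppart_ge0 x : 0 <= ppart x. Proof. by rewrite /ppart; case: ifP. Qed.
Lemma ppart_abs x : ppart x <= `|x|.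
Proof. by rewrite /ppart; case: ifP => [/ger0_norm -> //|_]; exact: normr_ge0. Qed.

Lemma RC11_pp2 : RC11 (fun x => ppart x ^+ 2) (fun x => 2 * ppart x).
Proof.
move=> r; exists (1 + 2 * `|r| + `|r| ^+ 2) => [|x y xr yr].
  by rewrite !addr_ge0 ?mulr_ge0 ?sqr_ge0.
have r0 : 0 <= r := le_trans (normr_ge0 _) xr; rewrite (ger0_norm r0).
have p0 := ppart_ge0 x; have p1 := le_trans (ppart_abs x) xr.
have pp : ppart x ^+ 2 <= r ^+ 2 by rewrite ler_sqr.
have rr := sqr_ge0 r; have y2 := sqr_ge0 y; have ppp := sqr_ge0 (ppart x).
split; [rewrite ger0_norm //; lra | rewrite ger0_norm; lra |].
apply: (@le_trans _ _ (1 * y ^+ 2)); last by apply: ler_wpM2r => //; lra.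
rewrite mul1r ler_norml /ppart; have xy := sqr_ge0 (x + y).
case: ifPn => [h1|]; case: ifPn => [h2|]; rewrite -?ltNge; try (move=> h3); try (move=> h4); apply/andP; split; nra.
Qed.

Lemma RC11_pp3 : RC11 (fun x => ppart x ^+ 3) (fun x => 3 * ppart x ^+ 2).
Proof.
move=> r; exists (`|r| ^+ 3 + 3 * `|r| ^+ 2 + 4 * `|r|) => [|x y xr yr].
  by rewrite !addr_ge0 ?mulr_ge0 ?sqr_ge0 ?exprn_ge0.
have r0 : 0 <= r := le_trans (normr_ge0 _) xr; rewrite (ger0_norm r0).
have p0 := ppart_ge0 x; have p1 := le_trans (ppart_abs x) xr.
have pp : ppart x ^+ 2 <= r ^+ 2 by rewrite ler_sqr.
have ppp : ppart x ^+ 3 <= r ^+ 3 by rewrite lerXn2r ?nnegrE.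
have rr := sqr_ge0 r; have y2 := sqr_ge0 y; have pp0 := sqr_ge0 (ppart x).
have ppp0 : 0 <= ppart x ^+ 3 by rewrite exprn_ge0.
have r3 : 0 <= r ^+ 3 by rewrite exprn_ge0.
split; [rewrite ger0_norm //; lra | rewrite ger0_norm; lra |].
apply: (@le_trans _ _ (4 * r * y ^+ 2)); last by apply: ler_wpM2r => //; lra.
move: xr yr; rewrite !ler_norml => /andP[x1 x2] /andP[y1 y3].
have ry : 0 <= r * y ^+ 2 by rewrite mulr_ge0.
rewrite /ppart; case: ifPn => [h1|]; case: ifPn => [h2|]; rewrite -?ltNge.
- have -> : (x + y) ^+ 3 - x ^+ 3 - 3 * x ^+ 2 * y = (3 * x + y) * y ^+ 2 by ring.
  have a : 3 * x + y <= 4 * r by lra.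
  have b : - (4 * r) <= 3 * x + y by lra.
  by rewrite -mulNr !ler_wpM2r.
- move=> h3; rewrite expr0n expr0n /= mulr0 mul0r !subr0.
  have a : (x + y) ^+ 2 <= y ^+ 2 by rewrite ler_sqr ?nnegrE; lra.
  have b : (x + y) ^+ 3 <= r * y ^+ 2 by rewrite exprS ler_pM ?sqr_ge0 //; lra.
  have c : 0 <= (x + y) ^+ 3 by rewrite exprn_ge0.
  by apply/andP; split; lra.
- move=> h3; rewrite expr0n /= sub0r.
  have a : x ^+ 2 <= y ^+ 2 by rewrite -(sqrrN y) ler_sqr ?nnegrE; lra.
  have b : x * x ^+ 2 <= r * y ^+ 2 by rewrite ler_pM ?sqr_ge0.
  have c : x ^+ 2 * (- y) <= r * y ^+ 2.
    have -> : r * y ^+ 2 = y ^+ 2 * r by ring.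
    by rewrite ler_pM ?sqr_ge0 //; lra.
  have d : 0 <= x ^+ 2 * (- y) by rewrite mulr_ge0 ?sqr_ge0 //; lra.
  have e : 0 <= x * x ^+ 2 by rewrite mulr_ge0 ?sqr_ge0.
  by apply/andP; split; lra.
- by move=> _ _; rewrite !expr0n /= mulr0 mul0r !subr0; apply/andP; split; lra.
Qed.

Lemma RC11D f (f' : R -> R) g (g' : R -> R) : RC11 f f' -> RC11 g g' -> RC11 (fun x => f x + g x) (fun x => f' x + g' x).
Proof.
move=> F G r; have [C C0 hC] := F r; have [D D0 hD] := G r; exists (C + D) => [|x y xr yr]; first lra.
have [a b c] := hC x y xr yr; have [a' b' c'] := hD x y xr yr.
split; try (by apply: le_trans (ler_normD _ _) _; exact: lerD).
have -> : f (x + y) + g (x + y) - (f x + g x) - (f' x + g' x) * y = (f (x + y) - f x - f' x * y) + (g (x + y) - g x - g' x * y) by ring.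
by rewrite mulrDl; apply: le_trans (ler_normD _ _) _; exact: lerD.
Qed.

Lemma RC11_affine c a b f (f' : R -> R) : RC11 f f' -> RC11 (fun x => c * f (a * x + b)) (fun x => c * a * f' (a * x + b)).
Proof.
move=> F r; have [C C0 hC] := F (`|a| * `|r| + `|b|).
exists (`|c| * C * (1 + `|a| + `|a| ^+ 2)) => [|x y xr yr].
  by rewrite !mulr_ge0 // !addr_ge0 // sqr_ge0.
have r0 : 0 <= r := le_trans (normr_ge0 _) xr; rewrite (ger0_norm r0) in hC.
have [||fx f'x E] := hC (a * x + b) (a * y).
- by apply: le_trans (ler_normD _ _) _; rewrite normrM lerD // ler_wpM2l.
- by rewrite normrM; have := ler_wpM2l (normr_ge0 a) yr; have := normr_ge0 b; lra.
have cC : 0 <= `|c| * C by rewrite mulr_ge0.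
have a0 := normr_ge0 a; have aa := sqr_ge0 `|a|.
split.
- rewrite normrM; apply: (@le_trans _ _ (`|c| * C * 1)); first by rewrite mulr1 ler_wpM2l.
  by apply: ler_wpM2l => //; lra.
- rewrite !normrM; apply: (@le_trans _ _ (`|c| * C * `|a|)); first by rewrite mulrAC ler_wpM2r // ler_wpM2l.
  by apply: ler_wpM2l => //; lra.
have -> : c * f (a * (x + y) + b) - c * f (a * x + b) - c * a * f' (a * x + b) * y =
   c * (f (a * x + b + a * y) - f (a * x + b) - f' (a * x + b) * (a * y)).
  by rewrite (_ : a * (x + y) + b = a * x + b + a * y); ring.
rewrite normrM; apply: le_trans (ler_wpM2l (normr_ge0 c) E) _.
have -> : `|c| * (C * (a * y) ^+ 2) = `|c| * C * `|a| ^+ 2 * y ^+ 2 by rewrite real_normK ?num_real //; ring.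
by apply: ler_wpM2r; [exact: sqr_ge0 | apply: ler_wpM2l => //; lra].
Qed.

Lemma RC11_eq f (f' : R -> R) g (g' : R -> R) : RC11 f f' -> f =1 g -> f' =1 g' -> RC11 g g'.
Proof. by move=> F /funext <- /funext <-. Qed.

(** The third difference of [x_+^2], which is twice the uniform quadratic B-spline with knots 0, 1,
    2, 3; [dbspline] is its derivative. [cspline], the third difference of [x_+^3], is three times
    its primitive and climbs from 0 to the plateau 6. *)
Definition bspline x := ppart x ^+ 2 - 3 * ppart (x - 1) ^+ 2 + 3 * ppart (x - 2) ^+ 2 - ppart (x - 3) ^+ 2.
Definition dbspline x := 2 * (ppart x - 3 * ppart (x - 1) + 3 * ppart (x - 2) - ppart (x - 3)).
Definition cspline x := ppart x ^+ 3 - 3 * ppart (x - 1) ^+ 3 + 3 * ppart (x - 2) ^+ 3 - ppart (x - 3) ^+ 3.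

Lemma RC11_bspline : RC11 bspline dbspline.
Proof.
have A c b := RC11_affine c 1 b RC11_pp2.
apply: RC11_eq (RC11D (RC11D (RC11D (A 1 0) (A (-3) (-1))) (A 3 (-2))) (A (-1) (-3))) _ _ => x.
  by rewrite /bspline !(mul1r, addr0); ring.
by rewrite /dbspline !(mul1r, addr0); ring.
Qed.

Lemma RC11_cspline : RC11 cspline (fun x => 3 * bspline x).
Proof.
have A c b := RC11_affine c 1 b RC11_pp3.
apply: RC11_eq (RC11D (RC11D (RC11D (A 1 0) (A (-3) (-1))) (A 3 (-2))) (A (-1) (-3))) _ _ => x.
  by rewrite /cspline !(mul1r, addr0); ring.
by rewrite /bspline !(mul1r, addr0); ring.
Qed.

Lemma ppart_lt x : x < 0 -> ppart x = 0. Proof. by rewrite /ppart ltNge => /negbTE ->. Qed.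
Lemma ppart_ge x : 0 <= x -> ppart x = x. Proof. by rewrite /ppart => ->. Qed.
Lemma ppart_le x : x <= 0 -> ppart x = 0.
Proof. by rewrite le_eqVlt => /orP[/eqP ->|/ppart_lt //]; rewrite /ppart lexx. Qed.

Lemma bspline_le0 x : x <= 0 -> bspline x = 0.
Proof. by move=> x0; rewrite /bspline !ppart_le; try lra; ring. Qed.
Lemma bspline_ge3 x : 3 <= x -> bspline x = 0.
Proof. by move=> x0; rewrite /bspline !ppart_ge; try lra; ring. Qed.
Lemma dbspline_le0 x : x <= 0 -> dbspline x = 0.
Proof. by move=> x0; rewrite /dbspline !ppart_le; try lra; ring. Qed.
Lemma dbspline_ge3 x : 3 <= x -> dbspline x = 0.
Proof. by move=> x0; rewrite /dbspline !ppart_ge; try lra; ring. Qed.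
Lemma cspline_le0 x : x <= 0 -> cspline x = 0.
Proof. by move=> x0; rewrite /cspline !ppart_le; try lra; ring. Qed.
Lemma cspline_ge3 x : 3 <= x -> cspline x = 6.
Proof. by move=> x0; rewrite /cspline !ppart_ge; try lra; ring. Qed.

Lemma bspline_gt0 x : 0 < x -> x < 3 -> 0 < bspline x.
Proof.
move=> x0 x3; rewrite /bspline (ppart_ge (ltW x0)) (@ppart_lt (x - 3)) ?subr_lt0 //.
have [h1|h1] := ltP x 1.
  by rewrite !ppart_lt ?subr_lt0 //; [rewrite expr0n /= !mulr0 subr0 addr0 subr0 exprn_gt0 | lra].
rewrite (@ppart_ge (x - 1)) ?subr_ge0 //.
have [h2|h2] := ltP x 2; first by rewrite ppart_lt ?subr_lt0 //; nra.
rewrite ppart_ge ?subr_ge0 //.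
have -> : x ^+ 2 - 3 * (x - 1) ^+ 2 + 3 * (x - 2) ^+ 2 - 0 ^+ 2 = (3 - x) ^+ 2 by ring.
by rewrite exprn_gt0 // subr_gt0.
Qed.

Lemma bspline_ge0 x : 0 <= bspline x.
Proof.
have [/bspline_le0 -> //|x0] := leP x 0; have [/bspline_ge3 -> //|x3] := leP 3 x.
exact/ltW/bspline_gt0.
Qed.

Lemma ppart_scale x a : 0 <= a -> ppart (a * x) = a * ppart x.
Proof.
move=> a0; have [x0|x0] := leP 0 x; first by rewrite !ppart_ge // mulr_ge0.
by rewrite (ppart_lt x0) mulr0 ppart_le // mulr_ge0_le0 // ltW.
Qed.

Definition mask (i : nat) : R := nth 0 [:: 1; 3; 3; 1] i.

(* The mask (1+s)^3 satisfies (1+s)^3 (1-s)^3 = (1-s^2)^3. *)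
Lemma bspline_refine x : bspline x = 4^-1 * \sum_(i < 4) mask i * bspline (2 * x - i%:R).
Proof.
rewrite !big_ord_recr big_ord0 /= /bump /= /mask /= add0r.
have H a b : b = 2 * a -> ppart (x - a) = 2^-1 * ppart (2 * x - b).
  move=> ->; have -> : 2 * x - 2 * a = 2 * (x - a) by ring.
  by rewrite ppart_scale // mulKf.
have H0 : ppart x = 2^-1 * ppart (2 * x) by rewrite ppart_scale // mulKf.
have E11 : 2 * x - 1 - 1 = 2 * x - 2 by ring.
have E12 : 2 * x - 1 - 2 = 2 * x - 3 by ring.
have E13 : 2 * x - 1 - 3 = 2 * x - 4 by ring.
have E21 : 2 * x - 2 - 1 = 2 * x - 3 by ring.
have E22 : 2 * x - 2 - 2 = 2 * x - 4 by ring.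
have E23 : 2 * x - 2 - 3 = 2 * x - 5 by ring.
have E31 : 2 * x - 3 - 1 = 2 * x - 4 by ring.
have E32 : 2 * x - 3 - 2 = 2 * x - 5 by ring.
have E33 : 2 * x - 3 - 3 = 2 * x - 6 by ring.
have [K1 K2 K3] : [/\ ppart (x - 1) = 2^-1 * ppart (2 * x - 2), ppart (x - 2) = 2^-1 * ppart (2 * x - 4) &
  ppart (x - 3) = 2^-1 * ppart (2 * x - 6)] by split; apply: H; ring.
rewrite /bspline H0 K1 K2 K3 subr0 E11 E12 E13 E21 E22 E23 E31 E32 E33.
by field.
Qed.
End Splines.

(** * Inverses, square roots, the radial cut-off and its annular kernel *)

Section Pompeiu.
Variable R : realType.
Implicit Types (u al be : R[i] -> R[i]) (z w h : R[i]).
Local Notation RC x := (Complex x 0).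

Lemma D11V u al be c : 0 < c -> (forall z, c <= cabs (u z)) -> D11 u al be ->
  D11 (fun z => (u z)^-1) (fun z => - al z / u z ^+ 2) (fun z => - be z / u z ^+ 2).
Proof.
move=> c0 uc /D11E D; apply: D11I => r; have [C C0 hC] := D r.
have u0 z : 0 < cabs (u z) by apply: lt_le_trans (uc z).
have un z : u z != 0 by rewrite -cabs_gt0.
have iu z : cabs (u z)^-1 <= c^-1 by rewrite cabsV lef_pV2 ?posrE.
have ic : 0 < c^-1 by rewrite invr_gt0.
exists (c^-1 + C * c^-1 ^+ 2 + 9 * C ^+ 2 * c^-1 ^+ 3) => [|z zr].
  by rewrite !addr_ge0 ?mulr_ge0 ?exprn_ge0 // ltW.
have [uz az bz E] := hC z zr.
have n1 : 0 <= C * c^-1 ^+ 2 by rewrite mulr_ge0 ?exprn_ge0 // ltW.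
have n2 : 0 <= 9 * C ^+ 2 * c^-1 ^+ 3 by rewrite !mulr_ge0 ?exprn_ge0 // ltW.
have i2 : cabs (u z ^+ 2)^-1 <= c^-1 ^+ 2 by rewrite -exprVn cabsX lerXn2r ?nnegrE ?cabs_ge0 // ltW.
have q x : cabs x <= C -> cabs (- x / u z ^+ 2) <= c^-1 + C * c^-1 ^+ 2 + 9 * C ^+ 2 * c^-1 ^+ 3.
  move=> xC; rewrite mulNr cabsN cabsM.
  have := ler_pM (cabs_ge0 _) (cabs_ge0 _) xC i2; lra.
split; [by have := iu z; lra | exact: q | exact: q |] => h h1.
set b := u (z + h); set a := u z; have an := un z; have bn := un (z + h); rewrite -/a -/b in an bn.
have -> : b^-1 - a^-1 - - al z / a ^+ 2 * h - - be z / a ^+ 2 * h^* =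
  (b - a) ^+ 2 * (a^-1 ^+ 2 * b^-1) - (b - a - al z * h - be z * h^*) * a^-1 ^+ 2 by field; rewrite an bn.
apply: le_trans (cabsBD _ _) _.
rewrite (cabsM ((b - a) ^+ 2)) (cabsM (a^-1 ^+ 2)) (cabsM (b - a - al z * h - be z * h^*)) !cabsX.
have L : cabs (b - a) <= 3 * C * cabs h.
  have -> : b - a = (b - a - al z * h - be z * h^*) + (al z * h + be z * h^*) by ring.
  by apply: lin_est => //; exact: E.
have L2 : cabs (b - a) ^+ 2 <= 9 * C ^+ 2 * cabs h ^+ 2.
  by have := ler_pM (cabs_ge0 _) (cabs_ge0 _) L L; lra.
have ia : cabs a^-1 ^+ 2 <= c^-1 ^+ 2 by rewrite lerXn2r ?nnegrE ?cabs_ge0 ?iu // ltW.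
have t0 : cabs a^-1 ^+ 2 * cabs b^-1 <= c^-1 ^+ 3.
  by rewrite (exprSr c^-1) ler_pM ?exprn_ge0 ?cabs_ge0 ?iu.
have t1 : cabs (b - a) ^+ 2 * (cabs a^-1 ^+ 2 * cabs b^-1) <= 9 * C ^+ 2 * cabs h ^+ 2 * c^-1 ^+ 3.
  by apply: ler_pM; rewrite ?mulr_ge0 ?exprn_ge0 ?cabs_ge0.
have t2 : cabs (b - a - al z * h - be z * h^*) * cabs a^-1 ^+ 2 <= C * cabs h ^+ 2 * c^-1 ^+ 2.
  by apply: ler_pM; rewrite ?exprn_ge0 ?cabs_ge0 //; exact: E.
have := mulr_ge0 (ltW ic) (sqr_ge0 (cabs h)); lra.
Qed.

Lemma D11_sqrt (f : R[i] -> R) al be c : 0 < c -> (forall z, c <= f z) -> D11 (fun z => RC (f z)) al be ->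
  D11 (fun z => RC (Num.sqrt (f z))) (fun z => al z * RC (2 * Num.sqrt (f z))^-1) (fun z => be z * RC (2 * Num.sqrt (f z))^-1).
Proof.
move=> c0 fc /D11E D; apply: D11I => r; have [C C0 hC] := D r.
have f0 z : 0 < f z by apply: lt_le_trans (fc z).
pose s := Num.sqrt c; have s0 : 0 < s by rewrite sqrtr_gt0.
have sf z : s <= Num.sqrt (f z) by rewrite ler_sqrt // ltW.
exists (C * s^-1 + C + 1 + 9 * C ^+ 2 * s^-1 ^+ 3) => [|z zr].
  by rewrite !addr_ge0 ?mulr_ge0 ?exprn_ge0 ?invr_ge0 // ltW.
have [fz az bz E] := hC z zr.
have n1 : 0 <= C * s^-1 by rewrite mulr_ge0 ?invr_ge0 // ltW.
have n2 : 0 <= 9 * C ^+ 2 * s^-1 ^+ 3 by rewrite !mulr_ge0 ?exprn_ge0 ?invr_ge0 // ltW.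
have i2 y : 0 < y -> s <= y -> (2 * y)^-1 <= s^-1.
  by move=> y0 sy; rewrite lef_pV2 ?posrE ?mulr_gt0 //; lra.
set a := Num.sqrt (f z); have a0 : 0 < a by apply: lt_le_trans (sf z).
have aa : a ^+ 2 = f z by rewrite sqr_sqrtr // ltW.
have q x : cabs x <= C -> cabs (x * RC (2 * a)^-1) <= C * s^-1.
  move=> xC; rewrite cabsM cabs_real ger0_norm; last by rewrite invr_ge0; lra.
  by apply: ler_pM; rewrite ?cabs_ge0 ?invr_ge0 ?i2 ?sf //; lra.
split; [|by have := q _ az; lra|by have := q _ bz; lra|].
  rewrite cabs_real ger0_norm ?sqrtr_ge0 //; rewrite cabs_real gtr0_norm // -aa in fz.
  by have := sqr_ge0 (a - 1); nra.
move=> h h1; set b := Num.sqrt (f (z + h)); have b0 : 0 < b by apply: lt_le_trans (sf _).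
have bb : b ^+ 2 = f (z + h) by rewrite sqr_sqrtr // ltW.
have ab : 0 < a + b by lra.
have Eh := E h h1; rewrite -aa -bb in Eh.
(* For the two roots, [b - a] is [(b^2 - a^2) / (2 a)] minus an explicit term quadratic in
   [b^2 - a^2], whose denominator is bounded below since both roots are at least [s]. *)
have -> : RC b - RC a - al z * RC (2 * a)^-1 * h - be z * RC (2 * a)^-1 * h^* =
  (RC (b ^+ 2) - RC (a ^+ 2) - al z * h - be z * h^*) * RC (2 * a)^-1 - RC ((b ^+ 2 - a ^+ 2) ^+ 2 / (2 * a * (a + b) ^+ 2)).
  have e1 : RC b - RC a = (RC (b ^+ 2) - RC (a ^+ 2)) * RC (2 * a)^-1 - RC ((b ^+ 2 - a ^+ 2) ^+ 2 / (2 * a * (a + b) ^+ 2)).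
    apply: complexP; rewrite ?(reD, imD, reN, imN, reM, imM) /=; last by ring.
    by field; rewrite !gt_eqF.
  by rewrite e1; ring.
have L : `|b ^+ 2 - a ^+ 2| <= 3 * C * cabs h.
  rewrite -cabs_real (_ : RC (b ^+ 2 - a ^+ 2) = (RC (b ^+ 2) - RC (a ^+ 2) - al z * h - be z * h^*) + (al z * h + be z * h^*)).
    exact: lin_est.
  by rewrite [RHS](_ : _ = RC (b ^+ 2) - RC (a ^+ 2)); [simpc | ring].
have L2 : (b ^+ 2 - a ^+ 2) ^+ 2 <= 9 * C ^+ 2 * cabs h ^+ 2.
  by rewrite -real_normK ?num_real //; have := ler_pM (normr_ge0 _) (normr_ge0 _) L L; lra.
apply: le_trans (cabsBD _ _) _; rewrite cabsM !cabs_real.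
have d0 : 0 < 2 * a * (a + b) ^+ 2 by rewrite !mulr_gt0.
rewrite (ger0_norm (_ : 0 <= (2 * a)^-1)); last by rewrite invr_ge0; lra.
rewrite (ger0_norm (_ : 0 <= _ / _)); last by rewrite divr_ge0 ?sqr_ge0 // ltW.
have t1 := ler_pM (cabs_ge0 _) (_ : 0 <= (2 * a)^-1) Eh (i2 a a0 (sf z)).
have {}t1 := t1 ltac:(by rewrite invr_ge0; lra).
have t2 : (b ^+ 2 - a ^+ 2) ^+ 2 / (2 * a * (a + b) ^+ 2) <= 9 * C ^+ 2 * cabs h ^+ 2 * s^-1 ^+ 3.
  apply: ler_pM; rewrite ?sqr_ge0 ?invr_ge0 ?(ltW d0) // exprVn lef_pV2 ?posrE ?exprn_gt0 //.
  have sa := sf z; have sb := sf (z + h); rewrite -/a -/b in sa sb.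
  have ab0 : 0 < a + b by rewrite addr_gt0.
  have sab : s <= a + b by apply: le_trans sa _; rewrite lerDl ltW.
  have H : s ^+ 2 <= (a + b) ^+ 2 by apply: lerXn2r; rewrite ?nnegrE ?(ltW ab0) ?(ltW s0).
  rewrite exprS; apply: ler_pM; rewrite ?sqr_ge0 ?(ltW s0) //.
  by apply: le_trans sa _; rewrite ler_peMl ?ler1n // ltW.
have h2 := sqr_ge0 (cabs h); have := mulr_ge0 C0 h2; lra.
Qed.

(** The affine map sends [[1/2, 1]] onto the knot interval [[0, 3]] in reverse, and [1/6] normalizes
    the plateau of [cspline]: [zeta] falls from 1 to 0 there, and [mzeta] is minus its
    derivative. *)
Definition zeta (x : R) := 6^-1 * cspline ((-6) * x + 6).
Definition mzeta (x : R) := 3 * bspline ((-6) * x + 6).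

Lemma RC11_zeta : RC11 zeta (fun x => - mzeta x).
Proof. by apply: RC11_eq (RC11_affine (6^-1 : R) (-6) 6 (@RC11_cspline R)) _ _ => x //; rewrite /mzeta; field. Qed.
Lemma RC11_mzeta : RC11 mzeta (fun x => 3 * (-6) * dbspline ((-6) * x + 6)).
Proof. exact: (RC11_affine (3 : R) (-6) 6 (@RC11_bspline R)). Qed.
Lemma mzeta_ge0 x : 0 <= mzeta x. Proof. by rewrite /mzeta mulr_ge0 // bspline_ge0. Qed.
Lemma mzeta_out x : 1 <= x -> mzeta x = 0.
Proof. by move=> x1; rewrite /mzeta bspline_le0 ?mulr0 //; lra. Qed.
Lemma mzeta_in x : x <= 2^-1 -> mzeta x = 0.
Proof. by move=> x1; rewrite /mzeta bspline_ge3 ?mulr0 //; lra. Qed.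
Lemma zeta_out x : 1 <= x -> zeta x = 0.
Proof. by move=> x1; rewrite /zeta cspline_le0 ?mulr0 //; lra. Qed.
Lemma zeta_in x : x <= 2^-1 -> zeta x = 1.
Proof. by move=> x1; rewrite /zeta cspline_ge3 ?mulVf //; lra. Qed.

Lemma cspline_bound (x : R) : 0 <= cspline x /\ cspline x <= 6.
Proof.
have [x0|x0] := leP x 0; first by rewrite cspline_le0 //; lra.
have [x3|x3] := leP 3 x; first by rewrite cspline_ge3 //; lra.
rewrite /cspline (ppart_ge (ltW x0)) (@ppart_lt _ (x - 3)) ?subr_lt0 //.
have [h1|h1] := ltP x 1.
  rewrite !ppart_lt ?subr_lt0 //; try lra.
  by have := exprn_ge0 3 (ltW x0); have := exprn_ile1 3 (ltW x0) (ltW h1); split; lra.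
rewrite (@ppart_ge _ (x - 1)) ?subr_ge0 //.
have [h2|h2] := ltP x 2.
  rewrite ppart_lt ?subr_lt0 //; set y := x - 1.
  have y0 : 0 <= y by rewrite /y; lra.
  have y1 : y <= 1 by rewrite /y; lra.
  have -> : x = 1 + y by rewrite /y; ring.
  have p2 := sqr_ge0 y; have p3 := mulr_ge0 y0 p2; have p4 := ler_piMl p2 y1.
  have p5 : 0 <= (1 - y) ^+ 2 * (1 + 2 * y) by rewrite mulr_ge0 ?sqr_ge0 //; lra.
  by split; lra.
rewrite ppart_ge ?subr_ge0 //.
have -> : x ^+ 3 - 3 * (x - 1) ^+ 3 + 3 * (x - 2) ^+ 3 - 0 ^+ 3 = 6 - (3 - x) ^+ 3 by ring.
have a : 0 <= 3 - x by lra.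
have b : 3 - x <= 1 by lra.
by have := exprn_ge0 3 a; have := exprn_ile1 3 a b; split; lra.
Qed.

Lemma zeta_bound x : 0 <= zeta x /\ zeta x <= 1.
Proof. by rewrite /zeta; have [] := cspline_bound ((-6) * x + 6); split; lra. Qed.

Variable d : R.
Hypothesis d0 : 0 < d.

(** [zl] is a radial cut-off, equal to 1 where [|h|^2 <= d^2 / 2] and to 0 where [|h| >= d]. Its
    dbar-derivative is [- mk h * h], so the averaging kernel [mk] lives on the annulus in between.
    That it avoids [h = 0] is what later allows a gain in the weight. The summand 0 matches the
    shape produced by [RC11_affine]. *)
Definition zl h := zeta (d ^- 2 * cabs h ^+ 2 + 0).
Definition mk h := d ^- 2 * mzeta (d ^- 2 * cabs h ^+ 2 + 0).
Definition dmk h := d ^- 2 * d ^- 2 * (3 * (-6) * dbspline ((-6) * (d ^- 2 * cabs h ^+ 2 + 0) + 6)).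

Let dd0 : 0 < d ^- 2. Proof. by rewrite invr_gt0 exprn_gt0. Qed.

Lemma D11_zl : D11 (fun h => RC (zl h)) (fun h => RC (- mk h) * h^*) (fun h => RC (- mk h) * h).
Proof.
apply: D11_eq (D11_real (RC11_eq (RC11_affine 1 (d ^- 2) 0 RC11_zeta) (fun _ => mul1r _) (fun _ => erefl)) (@D11_sqabs R)) _ _ _ => h //=;
  by congr (RC _ * _); rewrite /mk; ring.
Qed.

Lemma D11_mk : D11 (fun h => RC (mk h)) (fun h => RC (dmk h) * h^*) (fun h => RC (dmk h) * h).
Proof. exact: D11_real (RC11_affine (d ^- 2) (d ^- 2) 0 RC11_mzeta) (@D11_sqabs R). Qed.

Lemma scaled_ge h : d <= cabs h -> 1 <= d ^- 2 * cabs h ^+ 2 + 0.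
Proof. by move=> dh; rewrite addr0 mulrC ler_pdivlMr ?exprn_gt0 // mul1r lerXn2r ?nnegrE ?cabs_ge0 // ltW. Qed.

Lemma zl_out h : d <= cabs h -> zl h = 0. Proof. by move=> /scaled_ge; exact: zeta_out. Qed.
Lemma mk_out h : d <= cabs h -> mk h = 0. Proof. by move=> /scaled_ge/mzeta_out; rewrite /mk => ->; rewrite mulr0. Qed.
Lemma mk_ge0 h : 0 <= mk h. Proof. by rewrite mulr_ge0 ?mzeta_ge0 // ltW. Qed.
Lemma mk_supp h : mk h != 0 -> d ^+ 2 / 2 <= cabs h ^+ 2 /\ cabs h <= d.
Proof.
move=> m0; split; last by rewrite leNgt; apply: contraNN m0 => /ltW/mk_out ->.
rewrite leNgt; apply: contraNN m0 => lt; rewrite /mk mzeta_in ?mulr0 //.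
by rewrite addr0 mulrC ler_pdivrMr ?exprn_gt0 //; lra.
Qed.
Lemma zl0 : zl 0 = 1. Proof. by rewrite /zl cabs0 expr0n mulr0 addr0 zeta_in // invr_ge0. Qed.
Lemma zl_ge0 h : 0 <= zl h. Proof. by case: (zeta_bound (d ^- 2 * cabs h ^+ 2 + 0)). Qed.
Lemma zl_le1 h : zl h <= 1. Proof. by case: (zeta_bound (d ^- 2 * cabs h ^+ 2 + 0)). Qed.

Lemma tame_zl : tame (fun h => RC (zl h)).
Proof. by split; [case: (D11_cont D11_zl) | exists d => h /zl_out ->]. Qed.
Lemma tame_mk : tame (fun h => RC (mk h)).
Proof. by split; [case: (D11_cont D11_mk) | exists d => h /mk_out ->]. Qed.

Definition mass : R := complex.Re (J (fun h => RC (mk h))).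

Lemma J_mk : J (fun h => RC (mk h)) = RC mass.
Proof.
apply: complexP => //=; rewrite /integral_re.
have -> : (fun p : measurableTypeR R * measurableTypeR R => (0 : R)%:E) = (fun=> 0%E) by [].
by rewrite integral0.
Qed.

Lemma mass_gt0 : 0 < mass.
Proof.
(* At this radius the argument of the spline is [-6 * 3/4 + 6 = 3/2], the middle of its support. *)
apply: (J_gt0 (z0 := RC (Num.sqrt (3 / 4) * d))) tame_mk mk_ge0 _.
rewrite /mk mulr_gt0 // /mzeta mulr_gt0 // cabs_real ger0_norm ?mulr_ge0 ?sqrtr_ge0 ?(ltW d0) //.
rewrite exprMn sqr_sqrtr // ?divr_ge0 // addr0.
have -> : d ^- 2 * (3 / 4 * d ^+ 2) = 3 / 4 by field; rewrite gt_eqF.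
by apply: bspline_gt0; lra.
Qed.
End Pompeiu.

(** * The Cauchy-Pompeiu formula through a regularized kernel *)

Section PompeiuFormula.
Variable R : realType.
Implicit Types (u v al be : R[i] -> R[i]) (z w h : R[i]).
Local Notation RC x := (Complex x 0).
Variable d : R.
Hypothesis d0 : 0 < d.
Local Notation mk := (mk d).
Local Notation zl := (zl d).
Local Notation mass := (mass d).

Lemma RCM (x y : R) : RC (x * y) = RC x * RC y :> R[i].
Proof. by apply: complexP; rewrite ?reM ?imM /=; ring. Qed.
Lemma RCD (x y : R) : RC (x + y) = RC x + RC y :> R[i].
Proof. by apply: complexP; rewrite ?reD ?imD /=; ring. Qed.
Lemma RCN (x : R) : RC (- x) = - RC x :> R[i].
Proof. by apply: complexP; rewrite ?reN ?imN /=; ring. Qed.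
Lemma RCV (x : R) : RC x^-1 = (RC x)^-1 :> R[i].
Proof. exact: (fmorphV (real_complex R)). Qed.
Lemma RCX (x : R) n : RC (x ^+ n) = RC x ^+ n :> R[i].
Proof. exact: (rmorphXn (real_complex R)). Qed.
Lemma RC1 : RC 1 = 1 :> R[i]. Proof. by []. Qed.
Lemma RC2 : RC 2 = 2 :> R[i]. Proof. exact: (rmorph_nat (real_complex R) 2). Qed.
Lemma tame_RCM (a b : R[i] -> R) : cont (fun h => RC (a h)) -> tame (fun h => RC (b h)) -> tame (fun h => RC (a h * b h)).
Proof. by move=> ca tb; under eq_fun do rewrite RCM; exact: tameM. Qed.
Lemma cont_RCM (a b : R[i] -> R) : cont (fun h => RC (a h)) -> cont (fun h => RC (b h)) -> cont (fun h => RC (a h * b h)).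
Proof. by move=> ca cb; under eq_fun do rewrite RCM; exact: contM. Qed.
Lemma RC_re (x : R) z : complex.Re (RC x * z) = x * complex.Re z.
Proof. by rewrite reM mul0r subr0. Qed.

Section Shift.
Variable s : R.
Hypothesis s0 : 0 < s.
(** The singular kernel [1 / h] is replaced by [h^* / (|h|^2 + s)], to which the calculus of
    expansions applies. The parameter [s] is made small only in [pompeiu_split], so the bounds below
    must be uniform in it. *)
Let q h : R := cabs h ^+ 2 + s.
Let q0 h : 0 < q h. Proof. by have := s0; have := sqr_ge0 (cabs h); rewrite /q /=; lra. Qed.
Let Dq : D11 (fun h => RC (q h)) (fun h => h^*) (fun h => h).
Proof.
apply: D11_eq (D11D (@D11_sqabs R) (D11_cst (RC s))) _ _ _ => h; rewrite /q ?addr0 //.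
by rewrite RCD.
Qed.
Let inv h : R := (q h)^-1.
Let Dinv : D11 (fun h => RC (inv h)) (fun h => RC (- inv h ^+ 2) * h^*) (fun h => RC (- inv h ^+ 2) * h).
Proof.
have qs h : s <= cabs (RC (q h)) by rewrite cabs_real gtr0_norm // /q /= lerDr sqr_ge0.
have qn h : RC (q h) != 0 by rewrite -cabs_gt0; apply: lt_le_trans (qs h).
by apply: D11_eq (D11V s0 qs Dq) _ _ _ => h /=; rewrite /inv ?RCN ?RCM ?RCV //; field; exact: qn.
Qed.
Let isq h : R := (Num.sqrt (q h))^-1.
Let Disq : D11 (fun h => RC (isq h)) (fun h => RC (- (isq h ^+ 3) / 2) * h^*) (fun h => RC (- (isq h ^+ 3) / 2) * h).
Proof.
have qs h : s <= q h by rewrite /q /= lerDr sqr_ge0.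
have ss : 0 < Num.sqrt s by rewrite sqrtr_gt0.
have sq h : Num.sqrt s <= cabs (RC (Num.sqrt (q h))) by rewrite cabs_real ger0_norm ?sqrtr_ge0 // ler_sqrt // ltW.
have qn h : Num.sqrt (q h) != 0 by rewrite gt_eqF // sqrtr_gt0.
apply: D11_eq (D11V ss sq (D11_sqrt s0 qs Dq)) _ _ _ => h /=; rewrite /isq; first by rewrite -RCV.
all: move: (Num.sqrt (q h)) (qn h) => y yn; have yc : RC y != 0 :> R[i] by rewrite -cabs_gt0 cabs_real normr_gt0.
all: by rewrite !(RCX, RCN, RCV, RCM) RC2; field.
Qed.

(** Integrability of [1 / |h|] uniformly in [s], without polar coordinates: Stokes is applied to
    [h^* isq zl], whose dbar-derivative is at least [isq zl / 2 - d mk]. *)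
Lemma fundamental_bound : complex.Re (J (fun h => RC (isq h * zl h))) <= 2 * d * mass.
Proof.
have [cs _ _] := D11_cont Disq.
have D := D11M (D11M (D11_conj (@D11_id R)) Disq) (D11_zl d).
have sW : compact_supp (fun z => z^* * RC (isq z) * RC (zl z)).
  by exists d => h /(zl_out d0) ->; rewrite mulr0.
have [_ tb _ jb] := stokes sW D.
have ti : tame (fun h => RC (isq h * zl h)) by exact: tame_RCM (tame_zl d0).
have tm := tame_mk d0.
have tt : tame (fun h => RC (2^-1) * RC (isq h * zl h) - RC d * RC (mk h)).
  by apply: tameB; exact: tameZ.
have := J_le tt tb; rewrite jb (JB (tameZ _ ti) (tameZ _ tm)) (JZ _ ti) (JZ _ tm) reD reN !RC_re.
rewrite -[complex.Re (J (fun h => RC (mk h)))]/mass.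
suff H : forall h, complex.Re (RC (2^-1) * RC (isq h * zl h) - RC d * RC (mk h)) <=
   complex.Re ((1^* * RC (isq h) + h^* * (RC (- isq h ^+ 3 / 2) * h)) * RC (zl h) + h^* * RC (isq h) * (RC (- mk h) * h)).
  by move=> /(_ H); rewrite [complex.Re 0]/=; lra.
move=> h.
have qq : Num.sqrt (q h) ^+ 2 = q h by rewrite sqr_sqrtr // ltW.
have sq0 : 0 < Num.sqrt (q h) by rewrite sqrtr_gt0.
have i0 : 0 < isq h by rewrite invr_gt0.
have hs : cabs h <= Num.sqrt (q h) by rewrite -ler_sqr ?nnegrE ?cabs_ge0 ?(ltW sq0) // qq /q /= lerDl (ltW s0).
have -> : (1^* * RC (isq h) + h^* * (RC (- isq h ^+ 3 / 2) * h)) * RC (zl h) + h^* * RC (isq h) * (RC (- mk h) * h) =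
  RC ((isq h - cabs h ^+ 2 * isq h ^+ 3 / 2) * zl h - cabs h ^+ 2 * isq h * mk h).
  have hh : h * h^* = RC (cabs h) ^+ 2 by rewrite mulJ RCX.
  move: (isq h) (zl h) (mk h) => i1 z1 m1.
  by rewrite rmorph1 !(RCX, RCD, RCN, RCV, RCM) -hh; ring.
rewrite -!RCM -RCN -RCD /=.
have e1 : cabs h * isq h <= 1 by rewrite ler_pdivrMr // mul1r.
have e10 : 0 <= cabs h * isq h by rewrite mulr_ge0 ?cabs_ge0 // ltW.
have e2 : cabs h ^+ 2 * isq h ^+ 3 <= isq h.
  have -> : cabs h ^+ 2 * isq h ^+ 3 = (cabs h * isq h) ^+ 2 * isq h by ring.
  by apply: ler_piMl; [exact: ltW | rewrite expr_le1].
have e3 : cabs h ^+ 2 * isq h * mk h <= d * mk h.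
  have [->|mn] := eqVneq (mk h) 0; first by rewrite !mulr0.
  have [_ hd] := mk_supp d0 mn; apply: ler_wpM2r; first exact: mk_ge0.
  have -> : cabs h ^+ 2 * isq h = cabs h * (cabs h * isq h) by ring.
  by apply: le_trans hd; apply: ler_piMr; rewrite ?cabs_ge0.
have := ler_wpM2r (zl_ge0 d h) e2; lra.
Qed.

(** [s inv^2] is the dbar-derivative of [h^* inv], an approximation to a multiple of the Dirac mass
    at 0. Stokes for [h^* inv zl] leaves only the derivative of the cut-off, which is
    [|h|^2 inv mk <= mk] in size. *)
Lemma kernel_mass : complex.Re (J (fun h => RC (s * inv h ^+ 2 * zl h))) <= mass.
Proof.
have [ci _ _] := D11_cont Dinv.
have D := D11M (D11M (D11_conj (@D11_id R)) Dinv) (D11_zl d).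
have sW : compact_supp (fun z => z^* * RC (inv z) * RC (zl z)).
  by exists d => h /(zl_out d0) ->; rewrite mulr0.
have [_ tb _ jb] := stokes sW D.
have tm := tame_mk d0.
have ti : tame (fun h => RC (s * inv h ^+ 2 * zl h)).
  apply: tame_RCM (tame_zl d0); apply: cont_RCM; first exact: cont_cst.
  by under eq_fun do rewrite RCX expr2; exact: contM.
have := J_le (tameB ti tm) tb; rewrite jb (JB ti tm) reD reN.
rewrite -[complex.Re (J (fun h => RC (mk h)))]/mass.
suff H : forall h, complex.Re (RC (s * inv h ^+ 2 * zl h) - RC (mk h)) <=
   complex.Re ((1^* * RC (inv h) + h^* * (RC (- inv h ^+ 2) * h)) * RC (zl h) + h^* * RC (inv h) * (RC (- mk h) * h)).
  by move=> /(_ H); rewrite [complex.Re 0]/=; lra.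
move=> h; have qn : q h != 0 by rewrite gt_eqF.
have i0 : 0 < inv h by rewrite invr_gt0.
have -> : (1^* * RC (inv h) + h^* * (RC (- inv h ^+ 2) * h)) * RC (zl h) + h^* * RC (inv h) * (RC (- mk h) * h) =
  RC ((inv h - cabs h ^+ 2 * inv h ^+ 2) * zl h - cabs h ^+ 2 * inv h * mk h).
  have hh : h * h^* = RC (cabs h) ^+ 2 by rewrite mulJ RCX.
  move: (inv h) (zl h) (mk h) => i1 z1 m1.
  by rewrite rmorph1 !(RCX, RCD, RCN, RCV, RCM) -hh; ring.
rewrite -RCN -RCD /=.
have -> : inv h - cabs h ^+ 2 * inv h ^+ 2 = s * inv h ^+ 2 by rewrite /inv /q /=; field; exact: qn.
have : cabs h ^+ 2 * inv h <= 1 by rewrite ler_pdivrMr // mul1r /q /= lerDl ltW.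
move=> /(ler_wpM2r (mk_ge0 d0 h)); lra.
Qed.

(** Stokes for [h^* inv zl v] turns the integrand into [g] below. Its first term is the approximate
    Dirac mass against [v]: within [del] of 0 the function [v] is at most [e], and farther out
    [inv <= del^-2]. The second lives on the annulus, where [inv <= 2 / d^2]. The terms with [b1]
    and [b2] are of size [isq] and [sqrt s * isq], which [fundamental_bound] controls. *)
Lemma pompeiu_s v al be b1 b2 m B e M del : D11 v al be -> (forall h, be h = b1 h - h * b2 h) ->
  cont b1 -> cont b2 -> 0 < del ->
  (forall h, cabs h <= d -> cabs (b1 h) <= m) -> (forall h, cabs h <= d -> cabs (b2 h) <= B) -> (forall h, cabs h <= d -> cabs (v h) <= M) ->
  (forall h, cabs h < del -> cabs (v h) <= e) -> 0 <= e ->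
  cabs (J (fun h => RC (mk h) * v h + RC (zl h) * b2 h)) <= e * mass + s * (M / del ^+ 4 * complex.Re (J (fun h => RC (zl h)))
     + 2 * M / d ^+ 2 * mass) + 2 * d * mass * (m + Num.sqrt s * B).
Proof.
move=> Dv beE c1 c2 del0 bm b2B vM ve e0.
have B0 : 0 <= B by apply: le_trans (b2B 0 _); rewrite ?cabs_ge0 ?cabs0 ?ltW.
have M0 : 0 <= M by apply: le_trans (vM 0 _); rewrite ?cabs_ge0 ?cabs0 ?ltW.
have m0 : 0 <= m by apply: le_trans (bm 0 _); rewrite ?cabs_ge0 ?cabs0 ?ltW.
have [ci _ _] := D11_cont Dinv; have [cs _ _] := D11_cont Disq; have [cv _ cb] := D11_cont Dv.
have tm := tame_mk d0; have tz := tame_zl d0.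
have D := D11M (D11M (D11M (D11_conj (@D11_id R)) Dinv) (D11_zl d)) Dv.
have sW : compact_supp (fun z => z^* * RC (inv z) * RC (zl z) * v z).
  by exists d => h /(zl_out d0) ->; rewrite mulr0 mul0r.
have [_ tb _ jb] := stokes sW D.
have i0 h : 0 < inv h by rewrite invr_gt0.
have is0 h : 0 < isq h by rewrite invr_gt0 sqrtr_gt0.
pose g h := RC (s * inv h ^+ 2 * zl h) * v h + RC (s * inv h * mk h) * v h + (h^* * RC (inv h * zl h) * b1 h + RC (s * inv h * zl h) * b2 h).
have E : (fun h => RC (mk h) * v h + RC (zl h) * b2 h) = (fun h => g h -
   (((1^* * RC (inv h) + h^* * (RC (- inv h ^+ 2) * h)) * RC (zl h) + h^* * RC (inv h) * (RC (- mk h) * h)) * v h +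
      h^* * RC (inv h) * RC (zl h) * be h)).
  apply/funext => h; have qn : q h != 0 by rewrite gt_eqF.
  have -> : (1^* * RC (inv h) + h^* * (RC (- inv h ^+ 2) * h)) * RC (zl h) + h^* * RC (inv h) * (RC (- mk h) * h) =
    RC ((inv h - cabs h ^+ 2 * inv h ^+ 2) * zl h - cabs h ^+ 2 * inv h * mk h).
    have hh : h * h^* = RC (cabs h) ^+ 2 by rewrite mulJ RCX.
    move: (inv h) (zl h) (mk h) => i1 z1 m1.
    by rewrite rmorph1 !(RCX, RCD, RCN, RCV, RCM) -hh; ring.
  have -> : inv h - cabs h ^+ 2 * inv h ^+ 2 = s * inv h ^+ 2 by rewrite /inv /q /=; field; exact: qn.
  have -> : cabs h ^+ 2 * inv h = 1 - s * inv h by rewrite /inv /q /=; field; exact: qn.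
  have sE : 1 = RC s * RC (inv h) + h * h^* * RC (inv h).
    by rewrite mulJ -!RCM -RCD -RC1; congr Complex; rewrite /inv /q /=; field; exact: qn.
  have -> : RC (zl h) * b2 h = RC (zl h) * ((RC s * RC (inv h) + h * h^* * RC (inv h)) * b2 h) by rewrite -sE mul1r.
  rewrite beE /g; move: (inv h) (zl h) (mk h) => i1 z1 m1.
  by rewrite !(RCX, RCD, RCN, RCM) RC1; ring.
have tiz : tame (fun h => RC (s * inv h ^+ 2 * zl h)).
  apply: tame_RCM tz; apply: cont_RCM; first exact: cont_cst.
  by under eq_fun do rewrite RCX expr2; exact: contM.
have tim : tame (fun h => RC (s * inv h * mk h)).
  by apply: tame_RCM tm; apply: cont_RCM => //; exact: cont_cst.
have tisz : tame (fun h => RC (isq h * zl h)) by exact: tame_RCM.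
have tinz : tame (fun h => RC (inv h * zl h)) by exact: tame_RCM.
have tg : tame g.
  rewrite /g; apply: tameD; last first.
    apply: tameD; first by apply: (tameMr _ c1); apply: (tameM _ tinz); apply: cont_conj; exact: cont_at_id.
    by apply: (tameMr _ c2); apply: tame_RCM tz; apply: cont_RCM => //; exact: cont_cst.
  by apply: tameD; apply: (tameMr _ cv).
rewrite E (JB tg tb) jb subr0; apply: le_trans (J_norm tg) _.
(* A pointwise majorant of [|g|] whose integral is known from [kernel_mass] and
   [fundamental_bound]. *)
pose G h := RC e * RC (s * inv h ^+ 2 * zl h) + RC (s * (M / del ^+ 4)) * RC (zl h) +
   RC (s * (2 * M / d ^+ 2)) * RC (mk h) + RC (m + Num.sqrt s * B) * RC (isq h * zl h).
have tG : tame G by do 3 (apply: tameD; last exact: tameZ); exact: tameZ.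
have JG : complex.Re (J G) <= e * mass + s * (M / del ^+ 4 * complex.Re (J (fun h => RC (zl h)))
     + 2 * M / d ^+ 2 * mass) + 2 * d * mass * (m + Num.sqrt s * B).
  have T1 := tameZ (RC e) tiz; have T2 := tameZ (RC (s * (M / del ^+ 4))) tz.
  have T3 := tameZ (RC (s * (2 * M / d ^+ 2))) tm; have T4 := tameZ (RC (m + Num.sqrt s * B)) tisz.
  have mB : 0 <= m + Num.sqrt s * B by rewrite addr_ge0 // mulr_ge0 // sqrtr_ge0.
  rewrite /G (JD (tameD (tameD T1 T2) T3) T4) (JD (tameD T1 T2) T3) (JD T1 T2).
  rewrite (JZ _ tiz) (JZ _ tz) (JZ _ tm) (JZ _ tisz) !reD !RC_re.
  rewrite -[complex.Re (J (fun h => RC (mk h)))]/mass.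
  have := ler_wpM2l e0 kernel_mass; have := ler_wpM2l mB fundamental_bound; lra.
apply: le_trans (J_le (tame_abs tg) tG _) JG => h; rewrite [leLHS]/=.
have -> : complex.Re (G h) = e * (s * inv h ^+ 2 * zl h) + s * (M / del ^+ 4) * zl h + s * (2 * M / d ^+ 2) * mk h + (m + Num.sqrt s * B) * (isq h * zl h).
  by rewrite /G !reD !RC_re.
have k0 : 0 <= s * inv h ^+ 2 * zl h.
  by apply: mulr_ge0; [apply: mulr_ge0; [exact: ltW | exact: sqr_ge0] | exact: zl_ge0].
have k1 : 0 <= s * inv h * mk h.
  by apply: mulr_ge0; [apply: mulr_ge0; exact: ltW | exact: mk_ge0].
have [hd|hd] := leP (cabs h) d; last first.
  by rewrite /g !(zl_out d0 (ltW hd)) !(mk_out d0 (ltW hd)) !mulr0 !mul0r !addr0 ?mulr0 ?mul0r ?addr0 cabs0.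
apply: le_trans (cabsD _ _) _; apply: lerD; last first.
  apply: le_trans (cabsD _ _) _; rewrite [leRHS]mulrDl; apply: lerD; last first.
    have sq0 : 0 < Num.sqrt s by rewrite sqrtr_gt0.
    have t : s * inv h <= Num.sqrt s * isq h.
      have iE : inv h = isq h ^+ 2 by rewrite /isq /inv exprVn sqr_sqrtr // ltW.
      have sE : s = Num.sqrt s ^+ 2 by rewrite sqr_sqrtr // ltW.
      rewrite iE {1}sE -exprMn expr2; apply: ler_piMr; first by apply: mulr_ge0; apply: ltW.
      rewrite /isq ler_pdivrMr ?sqrtr_gt0 // mul1r; apply: ler_wsqrtr; rewrite /q /=.
      by have := sqr_ge0 (cabs h); lra.
    have z0 := zl_ge0 d h; have si : 0 <= s * inv h by apply: mulr_ge0; apply: ltW.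
    rewrite cabsM cabs_real ger0_norm; last exact: mulr_ge0.
    have -> : Num.sqrt s * B * (isq h * zl h) = Num.sqrt s * isq h * zl h * B by ring.
    apply: ler_pM; [exact: mulr_ge0 | exact: cabs_ge0 | | exact: b2B].
    exact: ler_wpM2r.
  rewrite !cabsM cabs_conj cabs_real ger0_norm; last by rewrite mulr_ge0 ?zl_ge0 // ltW.
  have qq : Num.sqrt (q h) ^+ 2 = q h by rewrite sqr_sqrtr // ltW.
  have sq0 : 0 < Num.sqrt (q h) by rewrite sqrtr_gt0.
  have hs : cabs h <= Num.sqrt (q h) by rewrite -ler_sqr ?nnegrE ?cabs_ge0 ?(ltW sq0) // qq /q /= lerDl (ltW s0).
  have t : cabs h * inv h <= isq h.
    rewrite (_ : inv h = Num.sqrt (q h) ^- 2); last by rewrite /inv qq.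
    rewrite /isq; apply: (@le_trans _ _ (Num.sqrt (q h) * Num.sqrt (q h) ^- 2)).
      by apply: ler_wpM2r => //; rewrite invr_ge0 sqr_ge0.
    have qn0 : Num.sqrt (q h) != 0 by rewrite (gt_eqF sq0).
    rewrite le_eqVlt; apply/orP; left; apply/eqP; move: (Num.sqrt (q h)) qn0 => y yn; by field.
  have t2 := ler_wpM2r (zl_ge0 d h) t.
  have t3 : 0 <= cabs h * inv h * zl h by apply: mulr_ge0; [apply: mulr_ge0; [exact: cabs_ge0 | exact: ltW] | exact: zl_ge0].
  by rewrite mulrA mulrC; exact: ler_pM (cabs_ge0 _) t3 (bm h hd) t2.
apply: le_trans (cabsD _ _) _; apply: lerD; last first.
  rewrite cabsM cabs_real ger0_norm //.
  have [->|mn] := eqVneq (mk h) 0; first by rewrite !mulr0 mul0r.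
  have [hq _] := mk_supp d0 mn.
  have -> : s * (2 * M / d ^+ 2) * mk h = s * (2 / d ^+ 2) * mk h * M by ring.
  have hd' := vM h hd; apply: (ler_pM k1 (cabs_ge0 _) _ hd').
  apply: ler_wpM2r; first exact: mk_ge0.
  rewrite ler_pM2l // /inv -[2 / d ^+ 2]invrK lef_pV2 ?posrE ?invr_gt0 ?divr_gt0 ?exprn_gt0 //.
  by rewrite invf_div /q /=; have := s0; lra.
rewrite cabsM cabs_real ger0_norm //.
have [hl|hl] := ltP (cabs h) del.
  have := ler_wpM2l k0 (ve h hl); have : 0 <= s * (M / del ^+ 4) * zl h.
    apply: mulr_ge0; last exact: zl_ge0.
    by apply: mulr_ge0; [exact: ltW | apply: divr_ge0 => //; apply: exprn_ge0; exact: ltW].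
  lra.
have t : s * inv h ^+ 2 * zl h * cabs (v h) <= s * (M / del ^+ 4) * zl h.
  have -> : s * (M / del ^+ 4) * zl h = s * (del ^- 2) ^+ 2 * zl h * M by field; rewrite gt_eqF.
  apply: (ler_pM k0 (cabs_ge0 _) _ (vM h hd)); apply: ler_wpM2r; first exact: zl_ge0.
  rewrite ler_pM2l // lerXn2r ?nnegrE ?invr_ge0 ?sqr_ge0 ?(ltW (i0 h)) ?(ltW (q0 h)) //.
  rewrite /inv lef_pV2 ?posrE ?exprn_gt0 // /q /=.
  have := s0; have : del ^+ 2 <= cabs h ^+ 2 by rewrite lerXn2r ?nnegrE ?cabs_ge0 // ltW.
  lra.
have := mulr_ge0 e0 k0; lra.
Qed.
End Shift.

(** Only [b1] enters the error. The part [- h b2] of the dbar-derivative is divisible by [h], so it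
    cancels the pole of the kernel and can be moved, as [zl b2], into the average on the left. This
    is what makes the correction term of [dbar_step] possible. *)
Lemma pompeiu_split u al be b1 b2 m : D11 u al be -> (forall h, be h = b1 h - h * b2 h) -> cont b1 -> cont b2 ->
  (forall h, cabs h <= d -> cabs (b1 h) <= m) ->
  cabs (J (fun h => RC (mk h) * u h + RC (zl h) * b2 h) - RC mass * u 0) <= 2 * d * mass * m.
Proof.
move=> Du beE c1 c2 bm.
(* Subtracting the value at 0 makes the function small near 0, as the approximate Dirac mass
   requires. *)
have Dv : D11 (fun h => u h - u 0) al be.
  by apply: D11_eq (D11D Du (D11_cst (- u 0))) _ _ _ => h; rewrite ?addr0.
have [cv _ _] := D11_cont Dv; have [cu _ _] := D11_cont Du.
have -> : J (fun h => RC (mk h) * u h + RC (zl h) * b2 h) - RC mass * u 0 =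
    J (fun h => RC (mk h) * (u h - u 0) + RC (zl h) * b2 h).
  have tm := tame_mk d0; have tz := tameMr (tame_zl d0) c2.
  rewrite -(J_mk d) mulrC -(JZ _ tm) -(JB (tameD (tameMr tm cu) tz) (tameZ _ tm)).
  by congr J; apply/funext => h; rewrite mulrBr (mulrC (u 0)) addrAC.
have [M M0 vM] := cont_bounded cv d; have [B B0 b2B] := cont_bounded c2 d.
have ms := mass_gt0 d0.
apply/ler_addgt0Pr => e e0.
pose e1 := e / (3 * (mass + 1)).
have e10 : 0 < e1 by rewrite divr_gt0 //; lra.
have [del del0 hdel] := cv 0 e1 e10.
pose A := M / del ^+ 4 * complex.Re (J (fun h => RC (zl h))) + 2 * M / d ^+ 2 * mass.
pose A' := 2 * d * mass * B; pose X := `|A| + `|A'| + 1.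
have [nA nA'] : 0 <= `|A| /\ 0 <= `|A'| by rewrite !normr_ge0.
have X0 : 0 < X by rewrite /X; lra.
(* [s] will be [r^2], so that both [s] and [sqrt s] are at most [r]; [X] collects the coefficients
   of all terms that vanish with [s]. *)
pose r : R := Num.min 1 (e / (3 * X)).
have r0 : 0 < r by rewrite lt_min ltr01 divr_gt0 //; lra.
have [r1 re] : r <= 1 /\ r <= e / (3 * X) by rewrite /r !ge_min !lexx orbT.
have s0 : 0 < r ^+ 2 by rewrite exprn_gt0.
have := pompeiu_s s0 Dv beE c1 c2 del0 bm b2B vM (e := e1) _ (ltW e10).
move=> H; apply: le_trans (H _) _.
  by move=> h hh; have := hdel h; rewrite subr0 subrr subr0 => /(_ hh)/ltW.
rewrite -/A sqrtr_sqr gtr0_norm // [2 * d * mass * (m + _)]mulrDr.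
have a1 : e1 * mass <= e / 3.
  have -> : e1 * mass = e / 3 * (mass / (mass + 1)) by rewrite /e1; field; rewrite gt_eqF; lra.
  by apply: ler_piMr; [lra | rewrite ler_pdivrMr; lra].
have rX : r * X <= e / 3.
  by apply: le_trans (ler_wpM2r (ltW X0) re) _; rewrite le_eqVlt; apply/orP; left; apply/eqP; field; rewrite gt_eqF.
have a2 : r ^+ 2 * A <= r * `|A|.
  apply: (@le_trans _ _ (r ^+ 2 * `|A|)); first by apply: ler_wpM2l; [exact: ltW | exact: ler_norm].
  by apply: ler_wpM2r => //; rewrite expr2; apply: ler_piMr => //; exact: ltW.
have a3 : 2 * d * mass * (r * B) <= r * `|A'|.
  by rewrite (_ : 2 * d * mass * (r * B) = r * A'); [apply: ler_wpM2l; [exact: ltW | exact: ler_norm] | rewrite /A'; ring].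
have rE : r * X = r * `|A| + r * `|A'| + r by rewrite /X; ring.
move: rX; rewrite rE; lra.
Qed.

(** The case [b2 = 0]; with [m = 0] it is the mean value property for the kernel [mk]. *)
Lemma pompeiu u al be m : D11 u al be -> (forall h, cabs h <= d -> cabs (be h) <= m) ->
  cabs (J (fun h => RC (mk h) * u h) - RC mass * u 0) <= 2 * d * mass * m.
Proof.
move=> Du bm; have [_ _ cb] := D11_cont Du.
have := pompeiu_split Du (b1 := be) (b2 := fun=> 0) _ cb (cont_cst 0) bm.
have -> : (fun h => RC (mk h) * u h + RC (zl h) * 0) = (fun h => RC (mk h) * u h) by apply/funext => h; rewrite mulr0 addr0.
by apply=> h; rewrite mulr0 subr0.
Qed.
End PompeiuFormula.

(** * Goursat's lemma with splines in place of contours *)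

Section Goursat.
Variable R : realType.
Implicit Types (f u v : R[i] -> R[i]) (z w h : R[i]) (t : R).
Local Notation RC x := (Complex x 0).

(** Complex differentiability at a single point, with no control on how the derivative varies. This
    is all that [holomorphic_on] provides, and why a Goursat argument is needed before any integral
    formula. *)
Definition cderiv f z a := forall e, 0 < e -> exists2 d, 0 < d &
  forall h, cabs h < d -> cabs (f (z + h) - f z - a * h) <= e * cabs h.

Lemma cderiv_cont f z a : cderiv f z a -> cont_at f z.
Proof.
move=> D e e0; have [d d0 hd] := D 1 ltr01.
have c0 : 0 < 1 + cabs a by have := cabs_ge0 a; lra.
exists (Num.min d (e / (1 + cabs a))); first by rewrite lt_min d0 divr_gt0.
move=> w; rewrite lt_min => /andP[wd]; rewrite ltr_pdivlMr // => we.
have := hd (w - z) wd; rewrite (addrC z) subrK => H.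
have -> : f w - f z = (f w - f z - a * (w - z)) + a * (w - z) by ring.
apply: le_lt_trans (cabsD _ _) _; rewrite cabsM; lra.
Qed.

Lemma dbspline_refine (x : R) : dbspline x = 2^-1 * \sum_(i < 4) mask R i * dbspline (2 * x - i%:R).
Proof.
rewrite !big_ord_recr big_ord0 /= /mask /= add0r.
have H a b : b = 2 * a -> ppart (x - a) = 2^-1 * ppart (2 * x - b).
  move=> ->; have -> : 2 * x - 2 * a = 2 * (x - a) by ring.
  by rewrite ppart_scale // mulKf.
have H0 : ppart x = 2^-1 * ppart (2 * x) by rewrite ppart_scale // mulKf.
have E11 : 2 * x - 1 - 1 = 2 * x - 2 by ring.
have E12 : 2 * x - 1 - 2 = 2 * x - 3 by ring.
have E13 : 2 * x - 1 - 3 = 2 * x - 4 by ring.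
have E21 : 2 * x - 2 - 1 = 2 * x - 3 by ring.
have E22 : 2 * x - 2 - 2 = 2 * x - 4 by ring.
have E23 : 2 * x - 2 - 3 = 2 * x - 5 by ring.
have E31 : 2 * x - 3 - 1 = 2 * x - 4 by ring.
have E32 : 2 * x - 3 - 2 = 2 * x - 5 by ring.
have E33 : 2 * x - 3 - 3 = 2 * x - 6 by ring.
have [K1 K2 K3] : [/\ ppart (x - 1) = 2^-1 * ppart (2 * x - 2), ppart (x - 2) = 2^-1 * ppart (2 * x - 4) &
  ppart (x - 3) = 2^-1 * ppart (2 * x - 6)] by split; apply: H; ring.
by rewrite /dbspline H0 K1 K2 K3 subr0 E11 E12 E13 E21 E22 E23 E31 E32 E33; field.
Qed.

Lemma spline_bound : exists2 C, 0 <= C & forall x : R, bspline x <= C /\ `|dbspline x| <= C.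
Proof.
have [C C0 hC] := @RC11_bspline R 3; exists C => // x.
have [x0|x0] := leP x 0; first by rewrite bspline_le0 // dbspline_le0 // normr0.
have [x3|x3] := leP 3 x; first by rewrite bspline_ge3 // dbspline_ge3 // normr0.
have [||a b _] := hC x 0; [by rewrite ler_norml; apply/andP; split; lra | by rewrite normr0 |].
by split => //; exact: le_trans (ler_norm _) a.
Qed.

(** A tensor spline on the square of side [3 / t] with lower left corner [z0]; [dbump] and [dbump']
    are its dbar- and d-derivative. The integral of [f * dbump] replaces the contour integral of [f]
    around the square. *)
Definition bump t z0 z := RC (bspline (t * complex.Re (z - z0) + 0)) * RC (bspline (t * complex.Im (z - z0) + 0)).
Definition dbump t z0 z :=
  RC (t / 2) * (RC (dbspline (t * complex.Re (z - z0) + 0)) * RC (bspline (t * complex.Im (z - z0) + 0))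
   + 'i%C * (RC (bspline (t * complex.Re (z - z0) + 0)) * RC (dbspline (t * complex.Im (z - z0) + 0)))).
Definition dbump' t z0 z :=
  RC (t / 2) * (RC (dbspline (t * complex.Re (z - z0) + 0)) * RC (bspline (t * complex.Im (z - z0) + 0))
   - 'i%C * (RC (bspline (t * complex.Re (z - z0) + 0)) * RC (dbspline (t * complex.Im (z - z0) + 0)))).

Lemma D11_bump t z0 : D11 (bump t z0) (dbump' t z0) (dbump t z0).
Proof.
have Ar := RC11_affine (1 : R) t 0 (@RC11_bspline R).
have Dr := D11_real Ar (D11_shift (- z0) (@D11_Re R)).
have Di := D11_real Ar (D11_shift (- z0) (@D11_Im R)).
have i2 : Complex 0 2^-1 = RC 2^-1 * 'i%C :> R[i] by apply: complexP; rewrite ?reM ?imM /=; ring.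
have i2' : Complex 0 (- 2^-1) = - (RC 2^-1 * 'i%C) :> R[i] by apply: complexP; rewrite ?reN ?imN ?reM ?imM /=; ring.
apply: D11_eq (D11M Dr Di) _ _ _ => z; rewrite /bump /dbump /dbump' (addrC (- z0)) ?mul1r // ?i2 ?i2'.
all: move: (dbspline _) (bspline _) (dbspline _) (bspline _) => a b a' b'; rewrite !RCM; ring.
Qed.

Definition square t z0 z := [/\ 0 <= complex.Re (z - z0), t * complex.Re (z - z0) <= 3,
  0 <= complex.Im (z - z0) & t * complex.Im (z - z0) <= 3].

Lemma dbump_out t z0 z : 0 < t -> ~ square t z0 z -> bump t z0 z = 0 /\ dbump t z0 z = 0.
Proof.
move=> t0 H; rewrite /bump /dbump !addr0.
have K x : (x < 0 \/ 3 < t * x) -> bspline (t * x) = 0 /\ dbspline (t * x) = 0.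
  case=> h; last by rewrite bspline_ge3 ?dbspline_ge3 ?ltW.
  by rewrite bspline_le0 ?dbspline_le0 //; apply: mulr_ge0_le0; exact: ltW.
have [h|h] : (complex.Re (z - z0) < 0 \/ 3 < t * complex.Re (z - z0)) \/ (complex.Im (z - z0) < 0 \/ 3 < t * complex.Im (z - z0)).
- have [a|a] := ltP (complex.Re (z - z0)) 0; first by left; left.
  have [b|b] := ltP 3 (t * complex.Re (z - z0)); first by left; right.
  have [c|c] := ltP (complex.Im (z - z0)) 0; first by right; left.
  have [d|d] := ltP 3 (t * complex.Im (z - z0)); first by right; right.
  by case: H.
all: have RC0 : RC 0 = 0 :> R[i] by [].
all: by have [-> ->] := K _ h; rewrite RC0; split; ring.
Qed.

Lemma square_dist t z0 z w : 0 < t -> square t z0 z -> square t z0 w -> cabs (z - w) <= 6 / t.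
Proof.
move=> t0 [a b c d] [a' b' c' d']; rewrite ler_pdivlMr //.
have : cabs (z - w) <= `|complex.Re (z - z0) - complex.Re (w - z0)| + `|complex.Im (z - z0) - complex.Im (w - z0)|.
  have -> : complex.Re (z - z0) - complex.Re (w - z0) = complex.Re (z - w) by rewrite !(reD, reN); ring.
  have -> : complex.Im (z - z0) - complex.Im (w - z0) = complex.Im (z - w) by rewrite !(imD, imN); ring.
  exact: cabs_ReIm.
move: a b c d a' b' c' d'; move: (complex.Re _) (complex.Im _) (complex.Re _) (complex.Im _) => x y x' y'.
move=> a b c d a' b' c' d' H.
have tx : t * `|x - x'| <= 3 by rewrite -(ger0_norm (ltW t0)) -normrM ler_norml; apply/andP; split; nra.
have ty : t * `|y - y'| <= 3 by rewrite -(ger0_norm (ltW t0)) -normrM ler_norml; apply/andP; split; nra.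
rewrite (distrC x') (distrC y') in H.
by have := ler_wpM2l (ltW t0) H; lra.
Qed.

Lemma dbump_bound : exists2 C, 0 <= C & forall t z0 z, 0 < t -> cabs (dbump t z0 z) <= t * C.
Proof.
have [C C0 hC] := spline_bound; exists (C * C) => [|t z0 z t0]; first exact: mulr_ge0.
rewrite /dbump cabsM cabs_real ger0_norm; last by apply: divr_ge0; [exact: ltW | lra].
have ai : cabs ('i%C : R[i]) = 1 by rewrite /cabs /sqmod /= expr0n add0r expr1n sqrtr1.
have P x y : cabs (RC (dbspline x) * RC (bspline y)) <= C * C.
  rewrite cabsM !cabs_real (ger0_norm (bspline_ge0 y)); apply: ler_pM; rewrite ?bspline_ge0 //.
  by case: (hC x). by case: (hC y).
have := cabsD (RC (dbspline (t * complex.Re (z - z0) + 0)) * RC (bspline (t * complex.Im (z - z0) + 0)))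
  ('i%C * (RC (bspline (t * complex.Re (z - z0) + 0)) * RC (dbspline (t * complex.Im (z - z0) + 0)))).
rewrite (cabsM 'i%C) ai mul1r (mulrC (RC (bspline _))) => H.
have := P (t * complex.Re (z - z0) + 0) (t * complex.Im (z - z0) + 0).
have := P (t * complex.Im (z - z0) + 0) (t * complex.Re (z - z0) + 0) => h1 h2.
have := ler_wpM2l (ltW t0) (le_trans H (lerD h2 h1)); lra.
Qed.

Lemma tame_dbump t z0 : 0 < t -> tame (dbump t z0) /\ tame (bump t z0).
Proof.
move=> t0; have D := D11_bump t z0; have [cb _ _] := D11_cont D.
have s : compact_supp (bump t z0).
  exists (cabs z0 + 6 / t + 1) => z hz; apply: (proj1 (dbump_out t0 _)) => sq.
  have s0 : square t z0 z0 by rewrite /square subrr /= !mulr0; split.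
  by have := square_dist t0 sq s0; have := cabs_subr z z0; lra.
by have [_ td _ _] := stokes s D.
Qed.

Definition child t z0 (i j : nat) := z0 + Complex (i%:R / (2 * t)) (j%:R / (2 * t)).

(** The subdivision step: the refinement equations of the spline and of its derivative yield sixteen
    overlapping copies at half scale. The factor [1/16] is [1/4 * 1/2] from these equations times
    the [1/2] lost to the prefactor [2 t / 2]. *)
Lemma dbump_refine t z0 z : 0 < t ->
  dbump t z0 z = \sum_(p : 'I_4 * 'I_4) RC (mask R p.1 * mask R p.2 / 16) * dbump (2 * t) (child t z0 p.1 p.2) z.
Proof.
move=> t0; have tn : t != 0 by rewrite gt_eqF.
rewrite /dbump; set x := complex.Re (z - z0); set y := complex.Im (z - z0).
have Ex i j : (2 * t) * complex.Re (z - child t z0 i j) + 0 = 2 * (t * x + 0) - i%:R.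
  by rewrite /child /x !(reD, reN) /=; field.
have Ey i j : (2 * t) * complex.Im (z - child t z0 i j) + 0 = 2 * (t * y + 0) - j%:R.
  by rewrite /child /y !(imD, imN) /=; field.
have RCS (F : 'I_4 -> R) : RC (\sum_(i < 4) F i) = \sum_(i < 4) RC (F i) :> R[i].
  exact: (rmorph_sum (real_complex R)).
rewrite (bspline_refine (t * x + 0)) (bspline_refine (t * y + 0)) (dbspline_refine (t * x + 0)) (dbspline_refine (t * y + 0)).
have prodS (a b : R) (F G : 'I_4 -> R) : RC (a * \sum_i F i) * RC (b * \sum_j G j) = \sum_(p : 'I_4 * 'I_4) RC (a * b * (F p.1 * G p.2)).
  rewrite -RCM -(rmorph_sum (real_complex R)) /=; congr (RC _).
  rewrite -[RHS]mulr_sumr -(pair_bigA _ (fun i j => F i * G j)) /= -mulrACA big_distrl /=.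
  by congr (_ * _); apply: eq_bigr => i _; rewrite mulr_sumr.
rewrite !prodS mulr_sumr -big_split mulr_sumr /=; apply: eq_bigr => -[i j] _ /=.
rewrite Ex Ey; move: (dbspline _) (bspline _) (dbspline _) (bspline _) => a b a' b'.
have h2 : (2 : R) != 0 by [].
by apply: complexP; rewrite ?(reM, imM, reD, imD) /=; field.
Qed.

Lemma child_square t z0 i j z : 0 < t -> (i < 4)%N -> (j < 4)%N -> square (2 * t) (child t z0 i j) z -> square t z0 z.
Proof.
move=> t0 i4 j4; rewrite /square /child opprD addrA; set x := z - z0.
rewrite !(reD, imD, reN, imN) /= => -[a b c d].
have q n : (n < 4)%N -> 0 <= n%:R / (2 * t) /\ t * (n%:R / (2 * t)) <= 3 / 2.
  move=> n4; have n3 : n%:R <= 3 :> R by rewrite ler_nat.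
  have -> : t * (n%:R / (2 * t)) = n%:R / 2 by field; rewrite gt_eqF.
  split; last lra.
  by apply: divr_ge0 => //; lra.
have [i0 i1] := q i i4; have [j0 j1] := q j j4.
by split; nra.
Qed.

Section Disc.
Variables (f : R[i] -> R[i]) (rho rho' : R).
Hypothesis rr : rho' < rho.
Hypothesis fD : forall z, cabs z < rho -> exists a, cderiv f z a.

Let inside t z0 := forall z, square t z0 z -> cabs z <= rho'.

Let fcont z : cabs z < rho -> cont_at f z.
Proof. by move=> /fD[a]; exact: cderiv_cont. Qed.

Let tame_f v : tame v -> (forall z, rho' < cabs z -> v z = 0) -> tame (fun z => f z * v z).
Proof.
move=> [cv [r hr]] v0; split; last by exists r => z /hr ->; rewrite mulr0.
apply: (@cont_cut _ _ _ rho ((rho + rho') / 2)) => //; first by have := rr; lra.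
by move=> z hz; apply: v0; have := rr; lra.
Qed.

Let mu t z0 := J (fun z => f z * dbump t z0 z).

Let tame_mu t z0 : 0 < t -> inside t z0 -> tame (fun z => f z * dbump t z0 z).
Proof.
move=> t0 ins; apply: tame_f; first by case: (tame_dbump z0 t0).
move=> z hz; apply: (proj2 (dbump_out t0 _)) => /ins; lra.
Qed.

Let inside_child t z0 i j : 0 < t -> (i < 4)%N -> (j < 4)%N -> inside t z0 -> inside (2 * t) (child t z0 i j).
Proof. by move=> t0 i4 j4 ins z /(child_square t0 i4 j4)/ins. Qed.

(** The sixteen weights sum to [8 * 8 / 16 = 4]. If every child had less than a quarter of [mu],
    their weighted sum would be too small. *)
Let mu_child t z0 : 0 < t -> inside t z0 -> exists ij : nat * nat, [/\ (ij.1 < 4)%N, (ij.2 < 4)%N &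
  cabs (mu t z0) <= 4 * cabs (mu (2 * t) (child t z0 ij.1 ij.2))].
Proof.
move=> t0 ins; apply/not_existsP => H.
have t20 : 0 < 2 * t by lra.
have tm (p : 'I_4 * 'I_4) := tame_mu t20 (inside_child t0 (ltn_ord p.1) (ltn_ord p.2) ins).
have E : mu t z0 = \sum_(p : 'I_4 * 'I_4) RC (mask R p.1 * mask R p.2 / 16) * mu (2 * t) (child t z0 p.1 p.2).
  rewrite /mu (_ : (fun z => f z * dbump t z0 z) = (fun z => \sum_(p : 'I_4 * 'I_4)
     RC (mask R p.1 * mask R p.2 / 16) * (f z * dbump (2 * t) (child t z0 p.1 p.2) z))).
    rewrite J_sum; last by move=> p; exact: tameZ.
    by apply: eq_bigr => p _; rewrite JZ.
  apply/funext => z; rewrite dbump_refine // mulr_sumr; apply: eq_bigr => p _; ring.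
have m0 (i : 'I_4) : 0 < mask R i by case: i => -[|[|[|[|]]]].
have key : cabs (mu t z0) <= \sum_(p : 'I_4 * 'I_4) (mask R p.1 * mask R p.2 / 16) * cabs (mu (2 * t) (child t z0 p.1 p.2)).
  rewrite {1}E; apply: le_trans (cabs_sum _ _ _) _; apply: ler_sum => p _.
  rewrite cabsM cabs_real ger0_norm //; apply: divr_ge0 => //; apply: mulr_ge0; exact: ltW.
have Sm : \sum_(p : 'I_4 * 'I_4) (mask R p.1 * mask R p.2 / 16) = 4.
  rewrite -(pair_bigA _ (fun i j : 'I_4 => mask R i * mask R j / 16)) /= !big_ord_recr !big_ord0 /= /mask /=; lra.
have : \sum_(p : 'I_4 * 'I_4) (mask R p.1 * mask R p.2 / 16) * cabs (mu (2 * t) (child t z0 p.1 p.2))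
   < \sum_(p : 'I_4 * 'I_4) (mask R p.1 * mask R p.2 / 16) * (cabs (mu t z0) / 4).
  apply: ltr_sum => [|p _]; first by apply/hasP; exists (ord0, ord0); rewrite ?mem_index_enum.
  rewrite ltr_pM2l ?divr_gt0 ?mulr_gt0 // ltNge; apply/negP => le.
  by apply: (H (p.1 : nat, p.2 : nat)); split; rewrite /= ?ltn_ord // mulrC -ler_pdivrMr.
by rewrite -mulr_suml Sm; lra.
Qed.

(** Nested squares shrink to a point where [f] is linearized. At scale [T = 2^n t] the remainder is
    at most [e * 6 / T], [dbump] is of size [T] and the area is of order [T^-2]; the product
    compensates the factor [4^n] accumulated from [mu_child], and [e] is arbitrary. *)
Lemma goursat t z0 : 0 < t -> inside t z0 -> mu t z0 = 0.
Proof.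
move=> t0 ins; pose st := (R * R[i])%type.
pose good (s : st) := 0 < s.1 /\ inside s.1 s.2.
have [next hn] : {nx : st -> st & forall s, good s -> exists ij : nat * nat, [/\ (ij.1 < 4)%N, (ij.2 < 4)%N,
    nx s = (2 * s.1, child s.1 s.2 ij.1 ij.2) & cabs (mu s.1 s.2) <= 4 * cabs (mu (nx s).1 (nx s).2)]}.
  apply: (choice (P := fun s y => good s -> exists ij : nat * nat, [/\ (ij.1 < 4)%N, (ij.2 < 4)%N,
    y = (2 * s.1, child s.1 s.2 ij.1 ij.2) & cabs (mu s.1 s.2) <= 4 * cabs (mu y.1 y.2)])) => s.
  have [g|ng] := pselect (good s); last by exists s.
  have [ij [i4 j4 hij]] := mu_child g.1 g.2.
  by exists (2 * s.1, child s.1 s.2 ij.1 ij.2) => _; exists ij.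
pose S n := iter n next (t, z0).
have gS n : [/\ good (S n), (S n).1 = 2 ^+ n * t & cabs (mu t z0) <= 4 ^+ n * cabs (mu (S n).1 (S n).2)].
  elim: n => [|n [g e l]]; first by rewrite /S /= !expr0 !mul1r.
  have [ij [i4 j4 E hij]] := hn _ g; rewrite /S iterS -/(S n); split.
  - have gt : 0 < 2 * (S n).1 by rewrite mulr_gt0 // g.1.
    rewrite E; split; first exact: gt.
    by apply: inside_child => //; [exact: g.1 | exact: g.2].
  - by rewrite E /= e exprS mulrA.
  - apply: le_trans l _; rewrite exprSr -mulrA; apply: ler_wpM2l; first by rewrite exprn_ge0.
    exact: hij.
have nest n z : square (S n.+1).1 (S n.+1).2 z -> square (S n).1 (S n).2 z.
  have [g _ _] := gS n; have [ij [i4 j4 E _]] := hn _ g; rewrite /S iterS -/(S n) E /=.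
  exact: child_square g.1 i4 j4.
have nest' m n z : square (S (n + m)%N).1 (S (n + m)%N).2 z -> square (S n).1 (S n).2 z.
  elim: m => [|m IH]; first by rewrite addn0.
  by rewrite addnS => /nest.
have corner n : square (S n).1 (S n).2 (S n).2.
  by rewrite /square subrr /= !mulr0; split.
have sq m n : square (S n).1 (S n).2 (S (maxn n m)).2.
  have := corner (maxn n m); rewrite -{1 2}(subnKC (leq_maxl n m)); exact: nest'.
have gt n : 0 < (S n).1 by have [[]] := gS n.
have bound (g : R[i] -> R) n m : (forall z, square (S n).1 (S n).2 z -> g (S n).2 <= g z /\ g z <= g (S n).2 + 3 / (S n).1) ->
   (forall z, square (S m).1 (S m).2 z -> g (S m).2 <= g z /\ g z <= g (S m).2 + 3 / (S m).1) ->
   g (S m).2 <= g (S n).2 + 3 / (S n).1.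
  by move=> hn1 hm1; have [_ a] := hn1 _ (sq m n); have [b _] := hm1 _ (sq n m); rewrite maxnC in b; lra.
(* A point common to all squares: in each coordinate, the supremum of the lower left corners. *)
have wit (g : R[i] -> R) : (forall n z, square (S n).1 (S n).2 z -> g (S n).2 <= g z /\ g z <= g (S n).2 + 3 / (S n).1) ->
   exists x, forall n, g (S n).2 <= x /\ x <= g (S n).2 + 3 / (S n).1.
  move=> hg; pose A := [set g (S n).2 | n in [set: nat]].
  have bnd n m := bound g n m (hg n) (hg m).
  have hs : has_sup A.
    by split; [exists (g (S 0).2), 0%N | exists (g (S 0).2 + 3 / (S 0).1) => _ [m _ <-]; exact: bnd].
  exists (sup A) => n; split; first by apply: (sup_upper_bound hs); exists n.
  by apply: ge_sup => [|_ [m _ <-]]; [case: hs | exact: bnd].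
have [x hx] : exists x, forall n, complex.Re (S n).2 <= x /\ x <= complex.Re (S n).2 + 3 / (S n).1.
  apply: wit => n z [a b _ _]; rewrite reD reN in a b.
  by rewrite -lerBlDl ler_pdivlMr // mulrC; split; lra.
have [y hy] : exists y, forall n, complex.Im (S n).2 <= y /\ y <= complex.Im (S n).2 + 3 / (S n).1.
  apply: wit => n z [_ _ a b]; rewrite imD imN in a b.
  by rewrite -lerBlDl ler_pdivlMr // mulrC; split; lra.
pose z1 := Complex x y.
have sq1 n : square (S n).1 (S n).2 z1.
  have [a b] := hx n; have [c d] := hy n; rewrite /square !(reD, imD, reN, imN) /=.
  rewrite -lerBlDl ler_pdivlMr // mulrC in b; rewrite -lerBlDl ler_pdivlMr // mulrC in d.
  by split; lra.
have [a Da] : exists a, cderiv f z1 a by apply: fD; have := ins _ (sq1 0%N); have := rr; lra.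
have [C C0 hC] := dbump_bound.
have bd e : 0 < e -> cabs (mu t z0) <= e * (8 * 6 ^+ 3 * C / t ^+ 2).
  move=> e0; have [dd dd0 hd] := Da e e0.
  have [n hn6] : exists n, 6 / (S n).1 < dd.
    have h0 : 0 < 6 / t by rewrite divr_gt0.
    have [n hn2] : exists n, 6 / t / dd < 2 ^+ n.
      exists (Num.bound (6 / t / dd)); apply: lt_le_trans (archi_boundP _) _.
        by apply: divr_ge0; exact: ltW.
      by rewrite -natrX ler_nat ltnW // ltn_expl.
    exists n; have [_ -> _] := gS n.
    have -> : 6 / (2 ^+ n * t) = 6 / t / 2 ^+ n by field; rewrite !gt_eqF ?exprn_gt0.
    by rewrite ltr_pdivrMr ?exprn_gt0 // (mulrC dd) -ltr_pdivrMr.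
  have [[T0 insn] Te hmu] := gS n; apply: le_trans hmu _.
  set T := (S n).1 in T0 insn Te hn6 *; set zn := (S n).2 in insn *.
  have [td tb] := tame_dbump zn T0.
  (* By Stokes an affine function has integral 0 against [dbump], so [f] may be replaced by its
     first-order remainder at [z1]. *)
  have D := D11M (D11D (D11_cst (f z1 - a * z1)) (D11Z a (@D11_id R))) (D11_bump T zn).
  have [_ _ _ j0] := stokes (tameM (contD (cont_cst _) (contZ a (@cont_at_id R))) tb).2 D.
  have E : mu T zn = J (fun z => (f z - f z1 - a * (z - z1)) * dbump T zn z).
    have -> : (fun z => (f z - f z1 - a * (z - z1)) * dbump T zn z) = (fun z => f z * dbump T zn z -
       ((0 + a * 0) * bump T zn z + (f z1 - a * z1 + a * z) * dbump T zn z)).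
      by apply/funext => z; ring.
    rewrite JB //; [by rewrite j0 subr0 | exact: tame_mu |].
    by have [] := stokes (tameM (contD (cont_cst _) (contZ a (@cont_at_id R))) tb).2 D.
  have tE : tame (fun z => (f z - f z1 - a * (z - z1)) * dbump T zn z).
    have -> : (fun z => (f z - f z1 - a * (z - z1)) * dbump T zn z) = (fun z => f z * dbump T zn z -
       ((f z1 - a * z1 + a * z) * dbump T zn z)) by apply/funext => z; ring.
    apply: tameB; first exact: tame_mu.
    by apply: tameM => //; apply: contD; [exact: cont_cst | apply: contZ; exact: cont_at_id].
  rewrite E -(J_shift zn tE).
  have -> : e * (8 * 6 ^+ 3 * C / t ^+ 2) = 4 ^+ n * (8 * (e * (6 / T) * (T * C)) * (6 / T) ^+ 2).
    rewrite Te (_ : 4 ^+ n = (2 ^+ n) ^+ 2); last by rewrite exprAC; congr (_ ^+ n); ring.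
    by field; rewrite !gt_eqF ?exprn_gt0.
  have T60 : 0 < 6 / T by rewrite divr_gt0.
  apply: ler_wpM2l; first by rewrite exprn_ge0.
  apply: (@J_bound _ _ (e * (6 / T) * (T * C)) (6 / T) (tame_shift zn tE) (ltW T60)).
    move=> z; have [s|s] := pselect (square T zn (zn + z)); last first.
      rewrite (proj2 (dbump_out T0 s)) mulr0 cabs0.
      by apply: mulr_ge0; apply: mulr_ge0 => //; exact: ltW.
    have dz := square_dist T0 s (sq1 n).
    have := hd (zn + z - z1) (le_lt_trans dz hn6); rewrite (addrC z1) subrK => H.
    rewrite cabsM; apply: ler_pM; rewrite ?cabs_ge0 ?hC //.
    by apply: le_trans H _; apply: ler_wpM2l => //; exact: ltW.
  move=> z hz; have [s|s] := pselect (square T zn (zn + z)); last by rewrite (proj2 (dbump_out T0 s)) mulr0.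
  by exfalso; have := square_dist T0 s (corner n); rewrite -/zn (addrC zn) addrK; lra.
apply/eqP; rewrite -cabs_eq0 eq_le cabs_ge0 andbT; apply/ler_addgt0Pr => e e0; rewrite add0r.
pose K := 8 * 6 ^+ 3 * C / t ^+ 2.
have K0 : 0 <= K by apply: divr_ge0; [rewrite !mulr_ge0 // exprn_ge0 | rewrite exprn_ge0 // ltW].
have := bd (e / (K + 1)) ltac:(by rewrite divr_gt0; lra); rewrite -/K => H; apply: le_trans H _.
by rewrite mulrAC ler_pdivrMr; [nra | lra].
Qed.
End Disc.
End Goursat.

(** * Mean value property and Cauchy estimates in one variable *)

Section MeanValue.
Variable R : realType.
Implicit Types (f u v : R[i] -> R[i]) (z w h : R[i]) (t : R).
Local Notation RC x := (Complex x 0).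

Lemma cont_uniform (g : R[i] -> R[i]) : cont g -> forall r e, 0 < e ->
  exists2 d, 0 < d & forall z w, cabs z <= r -> cabs (w - z) <= d -> cabs (g w - g z) <= e.
Proof.
move=> cg r e e0.
have [|M0 HM] := @plane_covering R (fun M z => 0 < M -> forall w, cabs (w - z) <= M^-1 -> cabs (g w - g z) <= e) _ r.
  move=> z; have [d d0 hd] := cg z (e / 2) ltac:(lra).
  exists (d / 2), (4 / d); split; first lra.
  move=> w M wz dM M0 w' ww'.
  have iM : M^-1 <= d / 4.
    by rewrite -[d / 4]invrK invf_div lef_pV2 ?posrE ?divr_gt0.
  have := cabs_tri (g z) (g w') (g w); rewrite (cabsB (g z)).
  have := hd w ltac:(lra); have := hd w' ltac:(by have := cabs_tri w w' z; lra); lra.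
have m0 : 0 < `|M0| + 1 by have := normr_ge0 M0; lra.
exists (`|M0| + 1)^-1 => [|z w zr zw]; first by rewrite invr_gt0.
by apply: (HM (`|M0| + 1)) => //; have := ler_norm M0; lra.
Qed.

Lemma D11p_conv k al be : D11 k al be -> D11p (fun z w => k (w - z)) (fun z w => - al (w - z)) (fun z w => - be (w - z)).
Proof.
move=> /D11E D r; have [C C0 hC] := D (r + r); exists C => // z w zr wr.
have [|p1 p2 p3 E] := hC (w - z); first by have := cabsBD w z; lra.
rewrite !cabsN; split => // h h1; have := E (- h); rewrite cabsN => /(_ h1).
by rewrite rmorphN /= !mulrN !mulNr opprD addrA.
Qed.

Definition breal t z := bspline (t * complex.Re (z - 0) + 0) * bspline (t * complex.Im (z - 0) + 0) : R.

Lemma bumpE t z : bump t 0 z = RC (breal t z). Proof. by rewrite /bump RCM. Qed.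

(** Regularization: the convolution [F t] of [f] (cut off far away) with a spline has an expansion,
    and its dbar-derivative on the disc of radius [d] is an integral that [goursat] shows to be 0.
    [pompeiu] applies to [F t], and [F t] divided by the mass [mt] of the spline is uniformly close
    to [f] for large [t]. *)
Theorem mean_value f rho d : 0 < d -> d < rho -> (forall z, cabs z < rho -> exists a, cderiv f z a) ->
  tame (fun h => RC (mk d h) * f h) /\ J (fun h => RC (mk d h) * f h) = RC (mass d) * f 0.
Proof.
move=> d0 dr fD.
have fc z : cabs z < rho -> cont_at f z by move=> /fD[a]; exact: cderiv_cont.
have tmf : tame (fun h => RC (mk d h) * f h).
  have [cm [r hr]] := tame_mk d0; split; last by exists r => z /hr ->; rewrite mul0r.
  under eq_fun do rewrite mulrC; apply: (@cont_cut _ _ _ rho d) => // z /(mk_out d0) -> //.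
split => //.
(* The cut-off [chi] is 1 up to [r1] and 0 from [r2] on; the margin [r1 - d] leaves room for the
   support of the spline. *)
pose r1 := (2 * d + rho) / 3; pose r2 := (d + 2 * rho) / 3.
have [dr1 r12 r2r] : [/\ d < r1, r1 < r2 & r2 < rho] by rewrite /r1 /r2; split; lra.
have r10 : 0 < r1 by lra.
have q0 : 0 < r2 ^+ 2 - r1 ^+ 2 by rewrite subr_gt0 ltr_pXn2r ?nnegrE //; lra.
pose a := (2 * (r2 ^+ 2 - r1 ^+ 2))^-1; pose b := 2^-1 - a * r1 ^+ 2.
have a0 : 0 < a by rewrite invr_gt0; lra.
pose chi z := 1 * zeta (a * cabs z ^+ 2 + b) : R.
have Dchi := D11_real (RC11_affine (1 : R) a b (@RC11_zeta R)) (@D11_sqabs R).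
have [cchi _ _] := D11_cont Dchi.
have chi1 z : cabs z <= r1 -> chi z = 1.
  move=> zr; rewrite /chi mul1r zeta_in // /b.
  have : cabs z ^+ 2 <= r1 ^+ 2 by rewrite lerXn2r ?nnegrE ?cabs_ge0 // ltW.
  by move=> /(ler_wpM2l (ltW a0)); lra.
have chi0 z : r2 <= cabs z -> chi z = 0.
  move=> zr; rewrite /chi mul1r zeta_out // /b.
  have : r2 ^+ 2 <= cabs z ^+ 2 by rewrite lerXn2r ?nnegrE ?cabs_ge0 //; lra.
  move=> /(ler_wpM2l (ltW a0)).
  have : a * (2 * (r2 ^+ 2 - r1 ^+ 2)) = 1 by rewrite mulVf // gt_eqF //; lra.
  lra.
pose g z := f z * RC (chi z).
have cg : cont g by apply: (@cont_cut _ _ _ rho r2) => // z /chi0 ->.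
have tg : tame g by split => //; exists r2 => z /chi0 h; rewrite /g h mulr0.
have gf z : cabs z <= r1 -> g z = f z by move=> /chi1 h; rewrite /g h mulr1.
have D t := D11p_integral (D11p_conv (D11_bump t 0)) tg.
have cconv k (z : R[i]) : cont k -> cont (fun w => k (w - z)).
  by move=> ck; under eq_fun do rewrite addrC; exact: cont_shift.
pose F t z := J (fun w => bump t 0 (w - z) * g w).
have DF t : D11 (F t) (fun z => J (fun w => - dbump' t 0 (w - z) * g w)) (fun z => J (fun w => - dbump t 0 (w - z) * g w)).
  apply: D => z; have [c1 c2 c3] := D11_cont (D11_bump t 0).
  have cN k : cont k -> cont (fun w => - k w) by move=> ck; under eq_fun do rewrite -mulN1r; exact: contZ.
  by split; [exact: cconv | apply: cN; exact: cconv | apply: cN; exact: cconv].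
have bF t : 0 < t -> 6 / t <= r1 - d -> forall z, cabs z <= d -> J (fun w => - dbump t 0 (w - z) * g w) = 0.
  move=> t0 ht z zd.
  have ins w : square t z w -> cabs w <= r1.
    move=> sq; have s0 : square t z z by rewrite /square subrr /= !mulr0; split.
    by have := square_dist t0 sq s0; have := cabs_subr w z; lra.
  have := goursat (lt_trans r12 r2r) fD t0 ins.
  have -> : (fun z0 => f z0 * dbump t z z0) = (fun w => - (- dbump t 0 (w - z) * g w)).
    apply/funext => w; have E : dbump t 0 (w - z) = dbump t z w by rewrite /dbump subr0.
    rewrite E; have [sq|nsq] := pselect (square t z w); first by rewrite gf; [ring | exact: ins].
    by rewrite (proj2 (dbump_out t0 nsq)); ring.
  move=> H; apply/eqP; rewrite -oppr_eq0 -JN ?H //.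
  have [td _] := tame_dbump z t0.
  apply: tameMr cg; apply: tameN.
  by rewrite (_ : (fun w => dbump t 0 (w - z)) = dbump t z) //; apply/funext => w; rewrite /dbump subr0.
have -> : (fun h => RC (mk d h) * f h) = (fun h => RC (mk d h) * g h).
  apply/funext => h; have [->|mn] := eqVneq (mk d h) 0; first by rewrite !mul0r.
  by have [_ hd] := mk_supp d0 mn; rewrite gf //; lra.
rewrite -(gf 0); last by rewrite cabs0 ltW.
have ms := mass_gt0 d0; have tm := tame_mk d0.
apply/eqP; rewrite -subr_eq0 -cabs_eq0 eq_le cabs_ge0 andbT; apply/ler_addgt0Pr => e e0; rewrite add0r.
pose e1 := e / (2 * mass d); have e10 : 0 < e1 by rewrite divr_gt0 // mulr_gt0.
have [del del0 hdel] := cont_uniform cg d e10.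
pose m := Num.min del (r1 - d); have m0 : 0 < m by rewrite lt_min del0 subr_gt0.
pose t := 6 / m; have t0 : 0 < t by rewrite divr_gt0.
have tE : 6 / t = m by rewrite /t; field; rewrite gt_eqF.
have [tdl tr] : 6 / t <= del /\ 6 / t <= r1 - d by rewrite tE /m !ge_min !lexx orbT.
have [tdb tb] := tame_dbump 0 t0.
have tbr : tame (fun w => RC (breal t w))
  by rewrite -(_ : bump t 0 = (fun w => RC (breal t w))); [exact: tb | apply/funext => w; exact: bumpE].
have br0 w : 0 <= breal t w by rewrite mulr_ge0 ?bspline_ge0.
pose mt := complex.Re (J (fun w => RC (breal t w))).
have mt0 : 0 < mt.
  apply: (J_gt0 (z0 := Complex t^-1 t^-1) tbr br0).
  by rewrite /breal subr0 /= addr0 divff ?gt_eqF // mulr_gt0 // bspline_gt0 //; lra.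
have Jt : J (fun w => RC (breal t w)) = RC mt.
  apply: complexP => //=; rewrite /integral_re.
  have -> : (fun p : measurableTypeR R * measurableTypeR R => (0 : R)%:E) = (fun=> 0%E) by [].
  by rewrite integral0.
have near z : cabs z <= d -> cabs (F t z - RC mt * g z) <= e1 * mt.
  move=> zd.
  have tc : tame (fun w => RC (breal t (w - z))).
    split; first exact: (cconv (fun w => RC (breal t w)) z tbr.1).
    have [_ [r hr]] := tbr; exists (r + cabs z) => w hw; apply: hr; have := cabs_subr w z; lra.
  have Jc : J (fun w => RC (breal t (w - z))) = RC mt by rewrite -Jt (J_center z tbr).
  have -> : F t z - RC mt * g z = J (fun w => RC (breal t (w - z)) * (g w - g z)).
    rewrite -Jc mulrC -(JZ _ tc) /F -JB; [|by under eq_fun do rewrite bumpE; exact: tameMr|exact: tameZ].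
    by congr J; apply/funext => w; rewrite bumpE; ring.
  rewrite -[mt]/(complex.Re (RC mt)) -Jc; apply: J_kernel_bound => //.
    by apply: contD => //; exact: cont_cst.
  move=> w bn; apply: hdel => //; apply: le_trans tdl.
  have [sq|nsq] := pselect (square t 0 (w - z)).
    have s0 : square t 0 0 by rewrite /square subrr /= !mulr0; split.
    by have := square_dist t0 sq s0; rewrite subr0.
  by case/eqP: bn; have [+ _] := dbump_out t0 nsq; rewrite bumpE => -[].
have [cF _ _] := D11_cont (DF t).
have P := pompeiu d0 (DF t) (m := 0) (fun h hd => eq_ind_r (fun x => cabs x <= 0) (eq_ind_r (fun x => x <= 0) (lexx 0) (cabs0 R)) (bF t t0 tr h hd)).
have {}P : J (fun h => RC (mk d h) * F t h) = RC (mass d) * F t 0.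
  by apply/eqP; rewrite -subr_eq0 -cabs_eq0 eq_le cabs_ge0 andbT; rewrite mulr0 in P.
have E : RC mt * (J (fun h => RC (mk d h) * g h) - RC (mass d) * g 0) =
  - J (fun h => RC (mk d h) * (F t h - RC mt * g h)) + RC (mass d) * (F t 0 - RC mt * g 0).
  have tt := tameMr tm cg; have tF := tameMr tm cF.
  rewrite (_ : (fun h => RC (mk d h) * (F t h - RC mt * g h)) = (fun h => RC (mk d h) * F t h - RC mt * (RC (mk d h) * g h))).
    by rewrite (JB tF (tameZ (RC mt) tt)) (JZ _ tt) P; ring.
  by apply/funext => h; ring.
have Q : mt * cabs (J (fun h => RC (mk d h) * g h) - RC (mass d) * g 0) <= mt * e.
  rewrite -{1}(gtr0_norm mt0) -cabs_real -cabsM E; apply: le_trans (cabsD _ _) _; rewrite cabsN cabsM cabs_real (gtr0_norm ms).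
  have n0 := near 0; rewrite cabs0 in n0; have {}n0 := n0 (ltW d0).
  have cc : cont (fun h => F t h - RC mt * g h).
    by apply: contD => //; under eq_fun do rewrite -mulN1r; apply: contZ; exact: contZ.
  have nk := J_kernel_bound (M := e1 * mt) tm cc (mk_ge0 d0) (fun h mn => near h (mk_supp d0 mn).2).
  rewrite -[complex.Re (J (fun h => RC (mk d h)))]/(mass d) in nk.
  have ee : e1 * mass d * 2 = e by rewrite /e1; field; rewrite gt_eqF.
  have := ler_wpM2l (ltW ms) n0; rewrite -ee; lra.
by rewrite ler_pM2l in Q.
Qed.

(** The inequality [2 Re ((f 0)^* f h) - |f 0|^2 <= |f h|^2] is integrated against [mk]; by the mean
    value property its left side gives [mass |f 0|^2]. *)
Lemma mean_value_sq f rho d : 0 < d -> d < rho -> (forall z, cabs z < rho -> exists a, cderiv f z a) ->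
  tame (fun h => RC (mk d h * cabs (f h) ^+ 2)) /\
  mass d * cabs (f 0) ^+ 2 <= complex.Re (J (fun h => RC (mk d h * cabs (f h) ^+ 2))).
Proof.
move=> d0 dr fD; have [tmf mv] := mean_value d0 dr fD; have tm := tame_mk d0.
have tt : tame (fun h => RC (mk d h * cabs (f h) ^+ 2)).
  have [cm [r hr]] := tm; split; last by exists r => z /hr [->]; rewrite mul0r.
  have -> : (fun h => RC (mk d h * cabs (f h) ^+ 2)) = (fun h => (f h * (f h)^*) * RC (mk d h)).
    by apply/funext => h; rewrite RCM mulJ mulrC.
  apply: (@cont_cut _ _ _ rho d) => // z; last by move=> /(mk_out d0) ->.
  by move=> /fD[a /cderiv_cont c]; apply: cont_at_M => //; exact: cont_at_conj.
split => //.
have t1 := tameZ (RC 2 * (f 0)^*) tmf; have t2 := tameZ (RC (cabs (f 0) ^+ 2)) tm.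
have := J_le (tameB t1 t2) tt; rewrite (JB t1 t2) (JZ _ tmf) (JZ _ tm) mv J_mk.
have -> : RC 2 * (f 0)^* * (RC (mass d) * f 0) - RC (cabs (f 0) ^+ 2) * RC (mass d) = RC (mass d * cabs (f 0) ^+ 2).
  by rewrite RCM -mulJ RC2; ring.
apply=> h; rewrite [leRHS]/= reD reN [complex.Re (RC _ * _)]RC_re [complex.Re (RC (mk d h))]/=.
have -> : RC 2 * (f 0)^* * (RC (mk d h) * f h) = RC (2 * mk d h) * ((f 0)^* * f h) by rewrite (RCM 2); ring.
rewrite RC_re.
have : 2 * complex.Re ((f 0)^* * f h) - cabs (f 0) ^+ 2 <= cabs (f h) ^+ 2.
  rewrite !sqr_cabs /sqmod reM reJ imJ.
  have := sqr_ge0 (complex.Re (f 0) - complex.Re (f h)); have := sqr_ge0 (complex.Im (f 0) - complex.Im (f h)); lra.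
by move=> /(ler_wpM2l (mk_ge0 d0 h)); lra.
Qed.

Lemma lin_zero_o a b : (forall e, 0 < e -> exists2 d, 0 < d & forall h, cabs h < d -> cabs (a * h + b * h^*) <= e * cabs h) ->
  a = 0 /\ b = 0 :> R[i].
Proof.
move=> H; suff K e : 0 < e -> cabs a <= e /\ cabs b <= e.
  by split; apply/eqP; rewrite -cabs_eq0 eq_le cabs_ge0 andbT; apply/ler_addgt0Pr => e e0; rewrite add0r; have [] := K e e0.
move=> e0; have [d d0 hd] := H e e0.
have ct : cabs (RC (d / 2)) = d / 2 by rewrite cabs_real ger0_norm //; lra.
have ci : cabs ('i%C * RC (d / 2)) = d / 2.
  by rewrite cabsM ct /cabs /sqmod /= expr0n add0r expr1n sqrtr1 mul1r.
have [||] := @lin_bound _ a b (RC (d / 2)) (e * (d / 2)).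
- by rewrite -{3}ct; apply: hd; rewrite ct; lra.
- by rewrite -{3}ci; apply: hd; rewrite ci; lra.
by rewrite ct !ler_pM2r //; lra.
Qed.

(** For [|c| <= 1] the mean value property writes [f c] as the integral of [f] against the translate
    by [c] of one fixed kernel. The expansion of that kernel carries over to [f], with a constant
    that depends on the kernel alone. The translates stay in [|w| <= 2], inside the disc of radius
    3. *)
Lemma cauchy_estimate : exists2 C, 0 <= C & forall f m a, (forall z, cabs z < 3 -> exists a, cderiv f z a) ->
  (forall z, cabs z < 3 -> cabs (f z) <= m) -> cderiv f 0 a ->
  cabs a <= C * m /\ forall h, cabs h <= 1 -> cabs (f h - f 0 - a * h) <= C * m * cabs h ^+ 2.
Proof.
have d0 : 0 < 1 :> R by [].
have ms := mass_gt0 d0; have Dm := D11_mk (1 : R); have [cm ca cb] := D11_cont Dm.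
have [K K0 hK] := D11E Dm 2.
exists ((mass 1)^-1 * (32 * K)) => [|f m a fD fm Da].
  by apply: mulr_ge0; [rewrite invr_ge0 ltW | rewrite mulr_ge0].
have m0 : 0 <= m by apply: le_trans (fm 0 _); rewrite ?cabs_ge0 ?cabs0.
pose al h := RC (dmk 1 h) * h^* : R[i]; pose be h := RC (dmk 1 h) * h : R[i].
have [_ _ tal tbe] : [/\ True, True, tame al & tame be].
  have sm : compact_supp (fun h => RC (mk (1 : R) h)) by exists 1 => h /(mk_out d0) ->.
  by have [] := stokes sm Dm; split.
have out h : 1 < cabs h -> al h = 0 /\ be h = 0.
  move=> h1; have [dn0|dn] := eqVneq (dmk 1 h) 0; first by rewrite /al /be dn0; split; exact: mul0r.
  case/eqP: dn; rewrite /dmk dbspline_le0 ?mulr0 //.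
  have := scaled_ge d0 (ltW h1); rewrite addr0; lra.
have tf u r : r < 3 -> tame u -> (forall w, r <= cabs w -> u w = 0) -> tame (fun w => f w * u w).
  move=> r3 [cu su] hu; split; last by have [s hs] := su; exists s => w /hs ->; rewrite mulr0.
  by apply: (cont_cut r3) => // z /fD[b]; exact: cderiv_cont.
have l23 : 2 < 3 :> R by lra.
have ta : tame (fun w => f w * al w) by apply: (tf _ _ l23) => // w hw; have [] := out w ltac:(lra).
have tb : tame (fun w => f w * be w) by apply: (tf _ _ l23) => // w hw; have [] := out w ltac:(lra).
have tk c : cabs c <= 1 -> tame (fun w => f w * RC (mk 1 (w - c))).
  move=> c1; apply: (tf _ _ l23) => //; last by move=> w hw; rewrite mk_out //; have := cabs_subr w c; lra.
  have := tame_shift (- c) (tame_mk d0); by under [X in tame X]eq_fun do rewrite addrC.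
have rep c : cabs c <= 1 -> RC (mass 1) * f c = J (fun w => f w * RC (mk 1 (w - c))).
  move=> c1; have [|t1 E] := @mean_value (fun h => f (c + h)) 2 1 d0 (ltr1n _ 2).
    move=> z z2; have [|b hb] := fD (c + z); first by have := cabsD c z; lra.
    by exists b => e /hb[d d'0 hd]; exists d => // h /hd; rewrite addrA.
  rewrite addr0 in E; rewrite -E -(J_center c t1); congr J.
  by apply/funext => w; rewrite (addrC c) subrK mulrC.
pose A := - (RC (mass 1))^-1 * J (fun w => f w * al w); pose B := - (RC (mass 1))^-1 * J (fun w => f w * be w).
have mn : RC (mass 1) != 0 :> R[i] by rewrite -cabs_gt0 cabs_real gtr0_norm.
have im : cabs ((RC (mass (1 : R)))^-1) = (mass 1)^-1.
  by rewrite cabsV cabs_real gtr0_norm.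
have T h : cabs h <= 1 -> cabs (f h - f 0 - A * h - B * h^*) <= (mass 1)^-1 * (32 * K) * m * cabs h ^+ 2.
  move=> h1; have h0 : cabs (0 : R[i]) <= 1 by rewrite cabs0.
  have E : f h - f 0 - A * h - B * h^* = (RC (mass 1))^-1 *
     J (fun w => f w * RC (mk 1 (w - h)) - f w * RC (mk 1 (w - 0)) + h * (f w * al w) + h^* * (f w * be w)).
    have t1 := tk h h1; have t2 := tk 0 h0.
    rewrite (JD (tameD (tameB t1 t2) (tameZ h ta)) (tameZ h^* tb)) (JD (tameB t1 t2) (tameZ h ta)) (JB t1 t2) (JZ h ta) (JZ h^* tb).
    by rewrite -!rep // /A /B; field.
  rewrite E cabsM im -!mulrA; apply: ler_wpM2l; first by rewrite invr_ge0 ltW.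
  have -> : 32 * (K * (m * cabs h ^+ 2)) = 8 * (m * (K * cabs h ^+ 2)) * 2 ^+ 2 by ring.
  have EE : (fun w => f w * RC (mk 1 (w - h)) - f w * RC (mk 1 (w - 0)) + h * (f w * al w) + h^* * (f w * be w)) =
    (fun w => f w * (RC (mk 1 (w + - h)) - RC (mk 1 w) - al w * (- h) - be w * (- h)^*)).
    by apply/funext => w; rewrite subr0 rmorphN /=; ring.
  have vanish w : 2 < cabs w -> f w * (RC (mk 1 (w + - h)) - RC (mk 1 w) - al w * (- h) - be w * (- h)^*) = 0.
    move=> w2; have [-> ->] := out w ltac:(lra); rewrite !mk_out //; [by ring | lra |].
    by have := cabs_subr w h; lra.
  have tE : tame (fun w => f w * RC (mk 1 (w - h)) - f w * RC (mk 1 (w - 0)) + h * (f w * al w) + h^* * (f w * be w)).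
    by do 2 (apply: tameD; last exact: tameZ); apply: tameB; exact: tk.
  rewrite EE in tE *; have c0 := sqr_ge0 (cabs h).
  apply: (@J_bound _ _ _ 2 tE _ _ vanish) => // w.
  have [w2|w2] := leP (cabs w) 2; last first.
    by rewrite vanish // cabs0; apply: mulr_ge0 => //; exact: mulr_ge0.
  have [_ _ _ H] := hK w w2; rewrite cabsM; apply: ler_pM; rewrite ?cabs_ge0 //; first by apply: fm; lra.
  by have := H (- h); rewrite cabsN; apply.
(* [A] and [B] come from differentiating the kernel. Uniqueness of first-order expansions identifies
   [A] with the given derivative and shows that the dbar-coefficient [B] is 0. *)
have U : A - a = 0 /\ B = 0.
  apply: lin_zero_o => e e0; have [d d'0 hd] := Da (e / 2) ltac:(lra).
  set Q := (mass 1)^-1 * (32 * K) * m in T.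
  have Q0 : 0 <= Q by rewrite /Q; apply: mulr_ge0 => //; apply: mulr_ge0; [rewrite invr_ge0 ltW | rewrite mulr_ge0].
  exists (Num.min d (Num.min 1 (e / (2 * (Q + 1))))).
    by rewrite !lt_min d'0 ltr01 divr_gt0 //; lra.
  move=> h; rewrite !lt_min => /andP[hdd /andP[h1]]; rewrite ltr_pdivlMr; last lra.
  move=> he; have H1 := T h (ltW h1); have := hd h hdd; rewrite add0r => H2.
  have -> : (A - a) * h + B * h^* = (f h - f 0 - a * h) - (f h - f 0 - A * h - B * h^*) by ring.
  apply: le_trans (cabsBD _ _) _; have := cabs_ge0 h => h0.
  have : Q * cabs h ^+ 2 <= e / 2 * cabs h.
    by rewrite expr2 mulrA; apply: ler_wpM2r => //; nra.
  lra.
have [Aa B0] := U; have {}Aa : a = A by apply/eqP; rewrite eq_sym -subr_eq0 Aa.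
split; last by move=> h /T; rewrite B0 mul0r subr0 Aa.
rewrite Aa /A mulNr cabsN cabsM im -mulrA; apply: ler_wpM2l; first by rewrite invr_ge0 ltW.
have b1 : cabs (J (fun w => f w * al w)) <= 8 * (m * K) * 2 ^+ 2.
  apply: J_bound => // w; last by move=> w2; have [-> _] := out w ltac:(lra); rewrite mulr0.
  have [w2|w2] := leP (cabs w) 2; last by have [-> _] := out w ltac:(lra); rewrite mulr0 cabs0 mulr_ge0.
  by have [_ H _ _] := hK w w2; rewrite cabsM; apply: ler_pM; rewrite ?cabs_ge0 //; apply: fm; lra.
by apply: le_trans b1 _; rewrite le_eqVlt; apply/orP; left; apply/eqP; ring.
Qed.
End MeanValue.

(** * Holomorphy in two variables in epsilon form *)

Section Bridge.
Variable R : realType.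
Implicit Types (p q h v : C2 R) (f : C2 R -> R[i]) (L : R[i]).
Local Notation RC x := (Complex x 0).

Definition z1 p : R[i] := cplx p.1.
Definition z2 p : R[i] := cplx p.2.
(** Unlike the sup norm on [R^4], this norm is homogeneous under complex scalars ([pn_csc]), which
    suits restriction to complex lines; [norm_pn] and [pn_norm] compare the two. *)
Definition pn p : R := cabs (z1 p) + cabs (z2 p).

Lemma z1D p q : z1 (p + q) = z1 p + z1 q. Proof. by []. Qed.
Lemma z2D p q : z2 (p + q) = z2 p + z2 q. Proof. by []. Qed.
Lemma z1N p : z1 (- p) = - z1 p. Proof. by []. Qed.
Lemma z2N p : z2 (- p) = - z2 p. Proof. by []. Qed.
Lemma z1Z (t : R) p : z1 (t *: p) = RC t * z1 p.
Proof. by apply: complexP; rewrite ?reM ?imM /=; rewrite ?mul0r ?subr0 ?addr0. Qed.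
Lemma z2Z (t : R) p : z2 (t *: p) = RC t * z2 p.
Proof. by apply: complexP; rewrite ?reM ?imM /=; rewrite ?mul0r ?subr0 ?addr0. Qed.
Lemma pn_ge0 p : 0 <= pn p. Proof. by rewrite addr_ge0 ?cabs_ge0. Qed.
Lemma pnZ t p : pn (t *: p) = `|t| * pn p.
Proof. by rewrite /pn z1Z z2Z !cabsM !cabs_real mulrDr. Qed.
Lemma pnD p q : pn (p + q) <= pn p + pn q.
Proof. by rewrite /pn z1D z2D; have := cabsD (z1 p) (z1 q); have := cabsD (z2 p) (z2 q); lra. Qed.
Lemma pnN p : pn (- p) = pn p. Proof. by rewrite /pn z1N z2N !cabsN. Qed.
Lemma pn0 : pn 0 = 0. Proof. by rewrite /pn [z1 0](_ : _ = 0) // [z2 0](_ : _ = 0) // cabs0 addr0. Qed.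
Lemma pn_gt0 p : (0 < pn p) = (p != 0).
Proof.
apply/idP/idP => [|p0]; first by apply: contraTN => /eqP ->; rewrite pn0 ltxx.
rewrite lt_neqAle pn_ge0 andbT eq_sym; apply: contraNN p0.
rewrite /pn paddr_eq0 ?cabs_ge0 // !cabs_eq0 => /andP[/eqP a /eqP b].
by case: p a b => [[a b] [c d]] [/= -> ->] [-> ->].
Qed.

(** Complex Frechet differentiability with partial derivatives [L1] and [L2]. [holo_CD] and
    [CD_holo] pass between it and the real derivatives with their Cauchy-Riemann equations. *)
Definition CD f p L1 L2 := forall e, 0 < e -> exists2 d, 0 < d &
  forall h, pn h < d -> cabs (f (p + h) - f p - (L1 * z1 h + L2 * z2 h)) <= e * pn h.

Lemma deriv_eps (u : C2 R -> R) p v (l : R) :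
  (forall e, 0 < e -> exists2 d, 0 < d & forall t, t != 0 -> `|t| < d -> `|t^-1 * (u (p + t *: v) - u p) - l| <= e) ->
  'D_v u p = l.
Proof.
move=> H; rewrite /derive; apply: cvg_lim => //.
apply/cvgrPdist_le => e e0; have [d d0 hd] := H e e0.
near=> t; rewrite distrC /= (addrC (t *: v)); apply: hd.
  by near: t; exact: nbhs_dnbhs_neq.
near: t; apply: dnbhs0_lt => //.
Unshelve. all: by end_near. Qed.

Lemma re_lin (t : R) (x y w : R[i]) : complex.Re (RC t * (x - y) - w) = t * (complex.Re x - complex.Re y) - complex.Re w.
Proof. by rewrite reD reN RC_re reD reN. Qed.
Lemma im_lin (t : R) (x y w : R[i]) : complex.Im (RC t * (x - y) - w) = t * (complex.Im x - complex.Im y) - complex.Im w.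
Proof. by rewrite imD imN imM /= mul0r addr0 imD imN. Qed.

Lemma CD_dC f p L1 L2 v : CD f p L1 L2 -> dC f p v = L1 * z1 v + L2 * z2 v.
Proof.
move=> D; have K e : 0 < e -> exists2 d, 0 < d & forall t, t != 0 -> `|t| < d ->
    cabs (RC t^-1 * (f (p + t *: v) - f p) - (L1 * z1 v + L2 * z2 v)) <= e.
  move=> e0; have c0 : 0 < pn v + 1 by have := pn_ge0 v; lra.
  have [d d0 hd] := D (e / (pn v + 1)) ltac:(by rewrite divr_gt0).
  exists (d / (pn v + 1)); first by rewrite divr_gt0.
  move=> t t0; rewrite ltr_pdivlMr // => td.
  have := hd (t *: v); rewrite pnZ z1Z z2Z => /(_ _)/wrap[].
    by have := normr_ge0 t; have := pn_ge0 v; nra.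
  have tn : RC t != 0 by rewrite -cabs_gt0 cabs_real normr_gt0.
  have -> : RC t^-1 * (f (p + t *: v) - f p) - (L1 * z1 v + L2 * z2 v) =
     RC t^-1 * (f (p + t *: v) - f p - (L1 * (RC t * z1 v) + L2 * (RC t * z2 v))) by rewrite RCV; field.
  rewrite cabsM cabs_real normfV (mulrC `|t|^-1) ler_pdivrMr ?normr_gt0 // => H; apply: le_trans H _.
  have -> : e / (pn v + 1) * (`|t| * pn v) = (e * `|t|) * (pn v / (pn v + 1)) by field; rewrite gt_eqF.
  by apply: ler_piMr; [rewrite mulr_ge0 // ltW | rewrite ler_pdivrMr // mul1r; lra].
set Z := L1 * z1 v + L2 * z2 v in K *.
apply: complexP; apply: deriv_eps => e /K[d d0 hd]; exists d => // t t0 /(hd t t0); apply: le_trans.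
  by rewrite -re_lin; exact: Re_cabs.
by rewrite -im_lin; exact: Im_cabs.
Qed.

Lemma CD_dC1 f p L1 L2 : CD f p L1 L2 -> L1 = dC f p (ex1 R) /\ L2 = dC f p (ex2 R).
Proof.
move=> D; rewrite !(CD_dC _ D).
have [a b c d] : [/\ z1 (ex1 R) = 1, z2 (ex1 R) = 0, z1 (ex2 R) = 0 & z2 (ex2 R) = 1] by [].
by rewrite a b c d !(mulr1, mulr0, addr0, add0r).
Qed.

Lemma norm_pn (h : C2o R) : `|h| <= pn h.
Proof.
case: h => [[a b] [c d]]; rewrite !prod_normE /= !ge_max.
have h1 := Re_cabs (Complex a b); have h2 := Im_cabs (Complex a b).
have h3 := Re_cabs (Complex c d); have h4 := Im_cabs (Complex c d).
have p1 := cabs_ge0 (Complex a b); have p2 := cabs_ge0 (Complex c d).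
rewrite /pn /z1 /z2 /cplx /=; move: h1 h2 h3 h4 => /= h1 h2 h3 h4.
by apply/andP; split; apply/andP; split; lra.
Qed.

Lemma pn_norm (h : C2o R) : pn h <= 4 * `|h|.
Proof.
case: h => [[a b] [c d]]; rewrite !prod_normE /=.
have := cabs_ReIm (Complex a b); have := cabs_ReIm (Complex c d); rewrite /pn /z1 /z2 /cplx /=.
have m x y : x <= Num.max x y /\ y <= Num.max x y :> R by rewrite !le_max !lexx orbT.
have [e1 e2] := m `|a| `|b|; have [e3 e4] := m `|c| `|d|.
have [e5 e6] := m (Num.max `|a| `|b|) (Num.max `|c| `|d|); lra.
Qed.

Section Diff.
Variables (u : C2 R -> R) (p : C2 R).

Lemma diff_eps : differentiable (u : C2o R -> R^o) (p : C2o R) -> forall e, 0 < e -> exists2 d, 0 < d &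
  forall h : C2 R, pn h < d -> `|u (p + h) - u p - ('D_(ex1 R) u p * h.1.1 + 'D_(ey1 R) u p * h.1.2 +
     'D_(ex2 R) u p * h.2.1 + 'D_(ey2 R) u p * h.2.2)| <= e * pn h.
Proof.
move=> du e e0; have /eqaddoP /(_ e e0) := diff_locally du.
move=> /nbhs_ballP[d /= d0 hd]; exists d => // h hpd.
have hb : ball (0 : C2o R) d (h : C2o R).
  by rewrite -ball_normE /= sub0r normrN; apply: le_lt_trans (norm_pn h) hpd.
have := hd _ hb; rewrite /= /cst => H.
have D w : 'D_w u p = 'd (u : C2o R -> R^o) (p : C2o R) w by exact: (deriveE (f := (u : C2o R -> R^o)) w du).
rewrite !D; apply: le_trans (ler_wpM2l (ltW e0) (norm_pn h)).
apply: le_trans H; rewrite le_eqVlt; apply/orP; left; apply/eqP; congr `|_|.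
have E : (h : C2o R) = h.1.1 *: (ex1 R : C2o R) + h.1.2 *: (ey1 R : C2o R) + h.2.1 *: (ex2 R : C2o R) + h.2.2 *: (ey2 R : C2o R).
  case: h {hpd hb} => [[a b] [c d']]; rewrite /ex1 /ey1 /ex2 /ey2 /=.
  have -> : a *: ((1, 0), (0, 0)) + b *: ((0, 1), (0, 0)) + c *: ((0, 0), (1, 0)) + d' *: ((0, 0), (0, 1)) =
    ((a * 1 + b * 0 + c * 0 + d' * 0, a * 0 + b * 1 + c * 0 + d' * 0),
     (a * 0 + b * 0 + c * 1 + d' * 0, a * 0 + b * 0 + c * 0 + d' * 1)) :> C2o R by [].
  by rewrite !(mulr0, mulr1, addr0, add0r).
pose D' (w : C2o R) : R := 'd (u : C2o R -> R^o) (p : C2o R) w.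
have DE : D' h = D' (ex1 R) * h.1.1 + D' (ey1 R) * h.1.2 + D' (ex2 R) * h.2.1 + D' (ey2 R) * h.2.2.
  transitivity (D' (h.1.1 *: (ex1 R : C2o R) + h.1.2 *: (ey1 R : C2o R) + h.2.1 *: (ex2 R : C2o R) + h.2.2 *: (ey2 R : C2o R))).
    by rewrite -E.
  by rewrite /D' !linearD !linearZ; congr (_ + _ + _ + _); exact: mulrC.
transitivity (u (h + p) - (u p + D' h)); last by [].
transitivity (u (p + h) - u p - D' h); first by rewrite DE.
by rewrite [h + p]addrC opprD addrA.
Qed.

Lemma eps_diff (a b c d : R) : (forall e, 0 < e -> exists2 de, 0 < de &
  forall h : C2 R, pn h < de -> `|u (p + h) - u p - (a * h.1.1 + b * h.1.2 + c * h.2.1 + d * h.2.2)| <= e * pn h) ->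
  differentiable (u : C2o R -> R^o) (p : C2o R).
Proof.
move=> H; pose df (h : C2o R) : R^o := a * h.1.1 + b * h.1.2 + c * h.2.1 + d * h.2.2.
have lin : linear df.
  move=> k x y.
  change (a * (k * x.1.1 + y.1.1) + b * (k * x.1.2 + y.1.2) + c * (k * x.2.1 + y.2.1) + d * (k * x.2.2 + y.2.2) =
    k * (a * x.1.1 + b * x.1.2 + c * x.2.1 + d * x.2.2) + (a * y.1.1 + b * y.1.2 + c * y.2.1 + d * y.2.2)).
  by move: x.1.1 x.1.2 x.2.1 x.2.2 y.1.1 y.1.2 y.2.1 y.2.2 => x1 x2 x3 x4 y1 y2 y3 y4; rewrite !mulrDr !mulrA !(mulrC k) !addrA; ring.
pose df' : {linear C2o R -> R^o} := HB.pack df (GRing.isLinear.Build _ _ _ _ _ lin).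
have cdf : continuous df'.
  apply/linear_bounded_continuous; rewrite /= /bounded_near.
  exists (`|a| + `|b| + `|c| + `|d|); split; first exact: num_real.
  move=> M hM; near=> x => /=.
  have x1 : `|x| <= 1.
    near: x; apply/nbhs_ballP; exists 1 => //= y; rewrite -ball_normE /= sub0r normrN; exact: ltW.
  apply: ltW; apply: le_lt_trans hM.
  have K (r s : R) : `|s| <= 1 -> `|r * s| <= `|r| by move=> s1; rewrite normrM; apply: ler_piMr.
  have : [/\ `|x.1.1| <= 1, `|x.1.2| <= 1, `|x.2.1| <= 1 & `|x.2.2| <= 1].
    by move: x1; rewrite !prod_normE /= !ge_max => /andP[/andP[? ?] /andP[? ?]]; split.
  move=> [/(K a) k1 /(K b) k2 /(K c) k3 /(K d) k4]; rewrite /df.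
  apply: le_trans (ler_normD _ _) (lerD _ k4); apply: le_trans (ler_normD _ _) (lerD _ k3).
  by apply: le_trans (ler_normD _ _) (lerD k1 k2).
have E : (u : C2o R -> R^o) \o shift (p : C2o R) = cst (u p) + (df' : C2o R -> R^o) +o_ (0 : C2o R) id.
  apply/eqaddoP => e e0; have [de de0 hd] := H (e / 4) ltac:(lra).
  apply/nbhs_ballP; exists (de / 4) => /=; first by rewrite divr_gt0.
  move=> h; rewrite -ball_normE /= sub0r normrN => hh.
  have hp := pn_norm h; have := hd h ltac:(lra).
  have -> : (u \o shift p - (cst (u p) + df)) h = u (p + h) - u p - (a * h.1.1 + b * h.1.2 + c * h.2.1 + d * h.2.2).
    transitivity (u (h + p) - (u p + (a * h.1.1 + b * h.1.2 + c * h.2.1 + d * h.2.2))); first by [].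
    by rewrite [h + p]addrC opprD addrA.
  move=> H1; apply: le_trans H1 _; have := ler_wpM2l (ltW e0) hp; rewrite /=; lra.
apply/diff_locallyP; rewrite (diff_unique cdf E); split => //.
Unshelve. all: by end_near. Qed.
End Diff.

Lemma cauchy_riemann_combine (X Y : R[i]) (a b c d x : R) h :
  `|complex.Re X - complex.Re Y - (a * h.1.1 + - b * h.1.2 + c * h.2.1 + - d * h.2.2)| <= x ->
  `|complex.Im X - complex.Im Y - (b * h.1.1 + a * h.1.2 + d * h.2.1 + c * h.2.2)| <= x ->
  cabs (X - Y - (Complex a b * z1 h + Complex c d * z2 h)) <= x + x.
Proof.
move=> H1 H2; apply: le_trans (cabs_ReIm _) _; apply: lerD.
  move: H1; rewrite !(reD, reN, reM) /=; congr (is_true (`|_| <= _)); ring.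
move: H2; rewrite !(imD, imN, imM) /=; congr (is_true (`|_| <= _)); ring.
Qed.

Lemma holo_CD W f p : holomorphic_on W f -> W p -> CD f p (dC f p (ex1 R)) (dC f p (ex2 R)).
Proof.
move=> H Wp e e0; have e20 : 0 < e / 2 by lra.
have [du dv [c1 c2] [c3 c4]] := H p Wp.
have [d1 d10 h1] := @diff_eps (fun q => complex.Re (f q)) p du _ e20.
have [d2 d20 h2] := @diff_eps (fun q => complex.Im (f q)) p dv _ e20.
exists (Num.min d1 d2) => [|h]; first by rewrite lt_min d10.
rewrite lt_min => /andP[/h1 H1 /h2 H2].
rewrite c2 c4 in H1; rewrite -c1 -c3 in H2.
have -> : e * pn h = e / 2 * pn h + e / 2 * pn h by rewrite -mulrDl -splitr.
exact: cauchy_riemann_combine H1 H2.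
Qed.

Lemma CD_holo W f : (forall p, W p -> exists L1 L2, CD f p L1 L2) -> holomorphic_on W f.
Proof.
move=> H p /H[L1 [L2 D]] /=.
have E v := CD_dC v D.
have part (a b c d : R) (g : R[i] -> R) : (forall z, `|g z| <= cabs z) -> (forall x y, g (x - y) = g x - g y) ->
   (forall h, g (L1 * z1 h + L2 * z2 h) = a * h.1.1 + b * h.1.2 + c * h.2.1 + d * h.2.2) ->
   differentiable ((fun q => g (f q)) : C2o R -> R^o) (p : C2o R).
  move=> gc gB gE; apply: (@eps_diff _ _ a b c d) => e /D[de de0 hd]; exists de => // h /hd; apply: le_trans.
  by rewrite -gE -!gB.
split.
- apply: (part (complex.Re L1) (- complex.Im L1) (complex.Re L2) (- complex.Im L2)) => [||h]; first exact: Re_cabs.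
    by move=> x y; rewrite reD reN.
  by rewrite reD !reM /=; ring.
- apply: (part (complex.Im L1) (complex.Re L1) (complex.Im L2) (complex.Re L2)) => [||h]; first exact: Im_cabs.
    by move=> x y; rewrite imD imN.
  by rewrite imD !imM /=; ring.
- have := E (ex1 R); have := E (ey1 R); rewrite /dC.
  have [-> -> -> ->] : [/\ z1 (ex1 R) = 1, z2 (ex1 R) = 0, z1 (ey1 R) = 'i%C & z2 (ey1 R) = 0] by [].
  rewrite !mulr0 !addr0 mulr1 => e1 e2.
  have := congr1 (@complex.Re R) e1; have := congr1 (@complex.Im R) e1.
  have := congr1 (@complex.Re R) e2; have := congr1 (@complex.Im R) e2.
  by rewrite reM imM /= => -> -> -> ->; split; ring.
- have := E (ex2 R); have := E (ey2 R); rewrite /dC.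
  have [-> -> -> ->] : [/\ z1 (ex2 R) = 0, z2 (ex2 R) = 1, z1 (ey2 R) = 0 & z2 (ey2 R) = 'i%C] by [].
  rewrite !mulr0 !add0r mulr1 => e1 e2.
  have := congr1 (@complex.Re R) e1; have := congr1 (@complex.Im R) e1.
  have := congr1 (@complex.Re R) e2; have := congr1 (@complex.Im R) e2.
  by rewrite reM imM /= => -> -> -> ->; split; ring.
Qed.
End Bridge.

(** * Cauchy estimates, limits and derivatives of holomorphic functions of two variables *)

Section Holomorphic2.
Variable R : realType.
Implicit Types (p q h v : C2 R) (f g : C2 R -> R[i]) (W : set (C2 R)).
Local Notation RC x := (Complex x 0).

Definition CDon W f := forall p, W p -> exists L1 L2, CD f p L1 L2.
Definition pball p r : set (C2 R) := [set q | pn (q - p) < r].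
Definition opn W := forall p, W p -> exists2 r, 0 < r & pball p r `<=` W.

Lemma holo_CDon W f : holomorphic_on W f <-> CDon W f.
Proof.
split=> [H p Wp|]; last exact: CD_holo.
by exists (dC f p (ex1 R)), (dC f p (ex2 R)); exact: (holo_CD H Wp).
Qed.

Lemma pball_sub p r q s : pn (q - p) + s <= r -> pball q s `<=` pball p r.
Proof. by move=> H w hw; rewrite /pball /= in hw *; have := pnD (w - q) (q - p); rewrite addrA subrK; lra. Qed.

Lemma pball_center p r : 0 < r -> pball p r p.
Proof. by move=> r0; rewrite /pball /= subrr pn0. Qed.

Lemma CD_cst c p : CD (fun=> c) p 0 0.
Proof. by move=> e e0; exists 1 => // h _; rewrite !mul0r addr0 subrr subr0 cabs0 mulr_ge0 ?pn_ge0 ?ltW. Qed.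
Lemma CD_z1 p : CD (@z1 R) p 1 0.
Proof. by move=> e e0; exists 1 => // h _; rewrite z1D (_ : _ - _ = 0); [rewrite cabs0 mulr_ge0 ?pn_ge0 ?ltW | ring]. Qed.
Lemma CD_z2 p : CD (@z2 R) p 0 1.
Proof. by move=> e e0; exists 1 => // h _; rewrite z2D (_ : _ - _ = 0); [rewrite cabs0 mulr_ge0 ?pn_ge0 ?ltW | ring]. Qed.

Lemma CD_lip f p L1 L2 : CD f p L1 L2 -> exists2 d, 0 < d &
  forall h, pn h < d -> cabs (f (p + h) - f p) <= (1 + cabs L1 + cabs L2) * pn h.
Proof.
move=> D; have [d d0 hd] := D 1 ltr01; exists d => // h /hd H.
have -> : f (p + h) - f p = (f (p + h) - f p - (L1 * z1 h + L2 * z2 h)) + (L1 * z1 h + L2 * z2 h) by rewrite subrK.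
apply: le_trans (cabsD _ _) _; have := cabsD (L1 * z1 h) (L2 * z2 h); rewrite !cabsM.
move: H; rewrite /pn; have := cabs_ge0 L1; have := cabs_ge0 L2; have := cabs_ge0 (z1 h); have := cabs_ge0 (z2 h).
move: (cabs (z1 h)) (cabs (z2 h)) (cabs L1) (cabs L2) => a b c d' b0 a0 d'0 c0.
have := mulr_ge0 c0 b0; have := mulr_ge0 d'0 a0; lra.
Qed.

Lemma CD_comp (G : R[i] -> R[i]) a f p L1 L2 : cderiv G (f p) a -> CD f p L1 L2 ->
  CD (fun q => G (f q)) p (a * L1) (a * L2).
Proof.
move=> DG D e e0; have [d d0 hd] := CD_lip D.
set K := 1 + cabs L1 + cabs L2 in hd.
have K0 : 0 < K by rewrite /K; have := cabs_ge0 L1; have := cabs_ge0 L2; lra.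
have a0 : 0 < cabs a + 1 by have := cabs_ge0 a; lra.
have [d1 d10 h1] := DG (e / (2 * K)) ltac:(by rewrite divr_gt0 // mulr_gt0).
have [d2 d20 h2] := D (e / (2 * (cabs a + 1))) ltac:(by rewrite divr_gt0 // mulr_gt0).
exists (Num.min d (Num.min (d1 / K) d2)) => [|h]; first by rewrite !lt_min d0 divr_gt0.
rewrite !lt_min => /andP[/hd hk /andP[]]; rewrite ltr_pdivlMr // => h1' /h2 H2.
have := h1 (f (p + h) - f p) ltac:(lra); rewrite (addrC (f p)) subrK => H1.
have -> : G (f (p + h)) - G (f p) - (a * L1 * z1 h + a * L2 * z2 h) =
  (G (f (p + h)) - G (f p) - a * (f (p + h) - f p)) + a * (f (p + h) - f p - (L1 * z1 h + L2 * z2 h)) by ring.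
apply: le_trans (cabsD _ _) _; rewrite cabsM.
have t1 : e / (2 * K) * cabs (f (p + h) - f p) <= e / 2 * pn h.
  have -> : e / 2 * pn h = e / (2 * K) * (K * pn h) by field; rewrite gt_eqF.
  by apply: ler_wpM2l => //; apply: divr_ge0; [exact: ltW | rewrite mulr_ge0 // ltW].
have t2 : cabs a * cabs (f (p + h) - f p - (L1 * z1 h + L2 * z2 h)) <= e / 2 * pn h.
  apply: le_trans (ler_wpM2l (cabs_ge0 a) H2) _.
  have -> : cabs a * (e / (2 * (cabs a + 1)) * pn h) = e / 2 * pn h * (cabs a / (cabs a + 1)) by field; rewrite gt_eqF.
  by apply: ler_piMr; [rewrite mulr_ge0 ?pn_ge0 //; lra | rewrite ler_pdivrMr // mul1r; lra].
lra.
Qed.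

Lemma CD_add f g p L1 L2 M1 M2 : CD f p L1 L2 -> CD g p M1 M2 -> CD (fun q => f q + g q) p (L1 + M1) (L2 + M2).
Proof.
move=> Df Dg e e0; have e20 : 0 < e / 2 by lra.
have [d d0 hd] := Df _ e20; have [d' d'0 hd'] := Dg _ e20.
exists (Num.min d d') => [|h]; first by rewrite lt_min d0.
rewrite lt_min => /andP[/hd H1 /hd' H2].
have -> : f (p + h) + g (p + h) - (f p + g p) - ((L1 + M1) * z1 h + (L2 + M2) * z2 h) =
  (f (p + h) - f p - (L1 * z1 h + L2 * z2 h)) + (g (p + h) - g p - (M1 * z1 h + M2 * z2 h)) by ring.
apply: le_trans (cabsD _ _) _; lra.
Qed.

Lemma cderiv_sq (z : R[i]) : cderiv (fun w => w * w) z (z + z).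
Proof.
move=> e e0; exists e => // h he; have -> : (z + h) * (z + h) - z * z - (z + z) * h = h * h :> R[i] by ring.
by rewrite cabsM; apply: ler_wpM2r; [exact: cabs_ge0 | exact: ltW].
Qed.

Lemma cderiv_lin (c z : R[i]) : cderiv (fun w => c * w) z c.
Proof.
move=> e e0; exists 1 => // h _; have -> : c * (z + h) - c * z - c * h = 0 :> R[i] by ring.
by rewrite cabs0 mulr_ge0 ?cabs_ge0 // ltW.
Qed.

Lemma CD_eq f g p L1 L2 M1 M2 : CD f p L1 L2 -> f =1 g -> L1 = M1 -> L2 = M2 -> CD g p M1 M2.
Proof. by move=> D /funext <- <- <-. Qed.

Lemma CD_scale c f p L1 L2 : CD f p L1 L2 -> CD (fun q => c * f q) p (c * L1) (c * L2).
Proof. exact: (CD_comp (cderiv_lin c (f p))). Qed.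

(* Polarization reduces the product rule to the chain rule for squares. *)
Lemma CD_mul f g p L1 L2 M1 M2 : CD f p L1 L2 -> CD g p M1 M2 ->
  CD (fun q => f q * g q) p (L1 * g p + f p * M1) (L2 * g p + f p * M2).
Proof.
move=> Df Dg; have sq u N1 N2 (D : CD u p N1 N2) := CD_comp (cderiv_sq (u p)) D.
have A := sq _ _ _ (CD_add Df Dg); have B := sq _ _ _ (CD_add Df (CD_scale (-1) Dg)).
have n2 : (2 : R[i]) != 0 by rewrite pnatr_eq0.
by apply: CD_eq (CD_add (CD_scale (4^-1) A) (CD_scale (- 4^-1) B)) _ _ _ => [q| |] /=; field.
Qed.

Lemma CD_near f g p L1 L2 r : 0 < r -> (forall q, pball p r q -> f q = g q) -> CD f p L1 L2 -> CD g p L1 L2.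
Proof.
move=> r0 fg D e e0; have [d d0 hd] := D e e0; exists (Num.min d r) => [|h]; first by rewrite lt_min d0.
rewrite lt_min => /andP[/hd H hr]; rewrite -!fg //; first exact: pball_center.
by rewrite /pball /= addrAC subrr add0r.
Qed.

Definition csc (z : R[i]) v : C2 R := ((complex.Re (z * z1 v), complex.Im (z * z1 v)), (complex.Re (z * z2 v), complex.Im (z * z2 v))).
Lemma z1_csc z v : z1 (csc z v) = z * z1 v. Proof. exact: cplxK. Qed.
Lemma z2_csc z v : z2 (csc z v) = z * z2 v. Proof. exact: cplxK. Qed.
Lemma pn_csc z v : pn (csc z v) = cabs z * pn v.
Proof. by rewrite /pn z1_csc z2_csc !cabsM mulrDr. Qed.
Lemma C2P p q : z1 p = z1 q -> z2 p = z2 q -> p = q.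
Proof. by case: p q => [[a b] [c d]] [[a' b'] [c' d']] [/= -> ->] [-> ->]. Qed.
Lemma cscD z w v : csc (z + w) v = csc z v + csc w v.
Proof. by apply: C2P; rewrite ?z1D ?z2D ?z1_csc ?z2_csc mulrDl. Qed.
Lemma csc0 v : csc 0 v = 0.
Proof. by apply: C2P; rewrite ?z1_csc ?z2_csc mul0r. Qed.

Lemma CD_slice f p v z L1 L2 : CD f (p + csc z v) L1 L2 -> cderiv (fun z => f (p + csc z v)) z (L1 * z1 v + L2 * z2 v).
Proof.
move=> D e e0; have c0 : 0 < pn v + 1 by have := pn_ge0 v; lra.
have [d d0 hd] := D (e / (pn v + 1)) ltac:(by rewrite divr_gt0).
exists (d / (pn v + 1)) => [|h]; first by rewrite divr_gt0.
rewrite ltr_pdivlMr // => hh; have := hd (csc h v); rewrite pn_csc z1_csc z2_csc cscD addrA => /(_ _)/wrap[].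
  by have := cabs_ge0 h; have := pn_ge0 v; nra.
have -> : (L1 * z1 v + L2 * z2 v) * h = L1 * (h * z1 v) + L2 * (h * z2 v) by ring.
move=> H; apply: le_trans H _.
have -> : e / (pn v + 1) * (cabs h * pn v) = e * cabs h * (pn v / (pn v + 1)) by field; rewrite gt_eqF.
by apply: ler_piMr; [rewrite mulr_ge0 ?cabs_ge0 // ltW | rewrite ler_pdivrMr // mul1r; lra].
Qed.

(** Both bounds concern one direction [h] at a time, so they follow from the one-variable estimate
    on the complex line through [p] along [h]. The factor 9 is the square of the rescaling factor
    3. *)
Lemma cauchy_estimate2 : exists2 C, 0 <= C & forall f p r m L1 L2, 0 < r -> CDon (pball p r) f ->
  (forall q, pball p r q -> cabs (f q) <= m) -> CD f p L1 L2 -> forall h,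
  cabs (L1 * z1 h + L2 * z2 h) <= C * m / r * pn h /\
  (pn h <= r / 3 -> cabs (f (p + h) - f p - (L1 * z1 h + L2 * z2 h)) <= C * m / r ^+ 2 * pn h ^+ 2).
Proof.
have [C C0 hC] := cauchy_estimate R; exists (9 * C) => [|f p r m L1 L2 r0 fD fm D h]; first by rewrite mulr_ge0.
have m0 : 0 <= m by apply: le_trans (fm p (pball_center p r0)); exact: cabs_ge0.
have [->|h0] := eqVneq h 0.
  rewrite addr0 [z1 0](_ : _ = 0) // [z2 0](_ : _ = 0) // !mulr0 addr0 subrr subr0 cabs0 pn0.
  by rewrite !mulr0 expr0n /= mulr0.
have ph : 0 < pn h by rewrite pn_gt0.
(* [v] is [h] rescaled to length [r / 3]: the disc of radius 3 in the parameter stays in the ball of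
   radius [r]. *)
pose v := csc (RC (r / (3 * pn h))) h.
have s0 : 0 < r / (3 * pn h) by rewrite divr_gt0 // mulr_gt0.
have pv : pn v = r / 3 by rewrite pn_csc cabs_real gtr0_norm //; field; rewrite gt_eqF.
have inb z : cabs z < 3 -> pball p r (p + csc z v).
  by move=> z3; rewrite /pball /= addrAC subrr add0r pn_csc pv; nra.
have D0 : cderiv (fun z => f (p + csc z v)) 0 (L1 * z1 v + L2 * z2 v) by apply: CD_slice; rewrite csc0 addr0.
have [||H1 H2] := hC _ m _ _ _ D0.
- by move=> z /inb/fD[M1 [M2 /CD_slice]]; exists (M1 * z1 v + M2 * z2 v).
- by move=> z /inb/fm.
pose t := 3 * pn h / r; have t0 : 0 < t by rewrite divr_gt0 // mulr_gt0.
have hv : csc (RC t) v = h.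
  have e : RC t * RC (r / (3 * pn h)) = 1 :> R[i] by rewrite -RCM /t (_ : _ * _ = 1) //; field; rewrite !gt_eqF.
  by apply: C2P; rewrite ?z1_csc ?z2_csc mulrA e mul1r.
have Lh : L1 * z1 h + L2 * z2 h = (L1 * z1 v + L2 * z2 v) * RC t by rewrite -hv !z1_csc !z2_csc; ring.
have ct : cabs (RC t) = t by rewrite cabs_real gtr0_norm.
split.
  rewrite Lh cabsM ct; apply: le_trans (ler_wpM2r (ltW t0) H1) _.
  have -> : 9 * C * m / r * pn h = C * m * t * 3 by rewrite /t; field; rewrite gt_eqF.
  by have := mulr_ge0 (mulr_ge0 C0 m0) (ltW t0); lra.
move=> hr; have := H2 (RC t); rewrite ct hv csc0 addr0 -Lh => /(_ _)/wrap[].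
  by rewrite /t ler_pdivrMr //; lra.
by rewrite (_ : C * m * t ^+ 2 = 9 * C * m / r ^+ 2 * pn h ^+ 2) // /t; field; rewrite gt_eqF.
Qed.

Lemma inv_small (K e : R) : 0 <= K -> 0 < e -> exists N, forall n, (N <= n)%N -> K / n.+1%:R <= e.
Proof.
move=> K0 e0; exists (Num.bound (K / e)) => n Nn.
have := archi_boundP (divr_ge0 K0 (ltW e0)); rewrite ltr_pdivrMr // => H.
rewrite ler_pdivrMr ?ltr0n //; apply: le_trans (ltW H) _; rewrite mulrC; apply: ler_wpM2l; first exact: ltW.
by rewrite ler_nat; exact: leqW.
Qed.

Lemma real_cauchy (a : nat -> R) : (forall e, 0 < e -> exists N, forall n m, (N <= n)%N -> (N <= m)%N -> `|a n - a m| <= e) ->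
  exists l, forall e, 0 < e -> exists N, forall n, (N <= n)%N -> `|a n - l| <= e.
Proof.
move=> H; have cv : cvg (a @ \oo).
  apply/cauchy_cvgP/cauchy_ballP => e e0; have [N hN] := H (e / 2) ltac:(lra).
  exists ([set a n | n in [set n | (N <= n)%N]], [set a n | n in [set n | (N <= n)%N]]) => /=.
    by split; exists N => //= n Nn; exists n.
  move=> [x y] [/= [n Nn <-] [m Nm <-]]; rewrite -ball_normE /=; have := hN n m Nn Nm; lra.
exists (lim (a @ \oo)) => e e0.
have /cvgrPdist_le/(_ e e0)[N _ hN] : a @ \oo --> lim (a @ \oo) := cv.
by exists N => n /hN; rewrite distrC.
Qed.

Lemma complex_cauchy (a : nat -> R[i]) : (forall e, 0 < e -> exists N, forall n m, (N <= n)%N -> (N <= m)%N -> cabs (a n - a m) <= e) ->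
  exists l, forall e, 0 < e -> exists N, forall n, (N <= n)%N -> cabs (a n - l) <= e.
Proof.
move=> H; have [x hx] : exists x, forall e, 0 < e -> exists N, forall n, (N <= n)%N -> `|complex.Re (a n) - x| <= e.
  apply: real_cauchy => e /H[N hN]; exists N => n m Nn Nm; apply: le_trans (hN n m Nn Nm).
  by rewrite -reN -reD; exact: Re_cabs.
have [y hy] : exists x, forall e, 0 < e -> exists N, forall n, (N <= n)%N -> `|complex.Im (a n) - x| <= e.
  apply: real_cauchy => e /H[N hN]; exists N => n m Nn Nm; apply: le_trans (hN n m Nn Nm).
  by rewrite -imN -imD; exact: Im_cabs.
exists (Complex x y) => e e0; have e20 : 0 < e / 2 by lra.
have [N hN] := hx _ e20; have [M hM] := hy _ e20; exists (maxn N M) => n; rewrite geq_max => /andP[/hN h1 /hM h2].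
by apply: le_trans (cabs_ReIm _) _; rewrite reD reN imD imN /=; lra.
Qed.

(** Cauchy's estimate for the differences [F n - F m] makes the derivatives a Cauchy sequence. The
    quadratic remainder bound of [F n], uniform in [n], then passes to the limit and shows that the
    limit is differentiable. *)
Lemma weierstrass (F : nat -> C2 R -> R[i]) f p r M : 0 < r -> (forall n, CDon (pball p r) (F n)) ->
  (forall n q, pball p r q -> cabs (F n q) <= M) ->
  (forall e, 0 < e -> exists N, forall n, (N <= n)%N -> forall q, pball p r q -> cabs (F n q - f q) <= e) ->
  exists L1 L2, CD f p L1 L2 /\ forall v e, 0 < e -> exists N, forall n, (N <= n)%N -> cabs (dC (F n) p v - dC f p v) <= e.
Proof.
move=> r0 FD FM Fu; have [C C0 hC] := cauchy_estimate2.
have pp := pball_center p r0.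
have [L1 hL1] := choice (fun n => FD n p pp); have [L2 hL2] := choice hL1.
have Lc n m e : (forall q, pball p r q -> cabs (F n q - F m q) <= e) -> forall h,
    cabs ((L1 n * z1 h + L2 n * z2 h) - (L1 m * z1 h + L2 m * z2 h)) <= C * e / r * pn h.
  move=> he h; have D (q : C2 R) N1 N2 P1 P2 (A : CD (F n) q N1 N2) (B : CD (F m) q P1 P2) := CD_add A (CD_scale (-1) B).
  have [|| H _] := hC (fun q => F n q + -1 * F m q) p r e _ _ r0 _ _ (D _ _ _ _ _ (hL2 n) (hL2 m)) h.
  - by move=> q hq; have [N1 [N2 A]] := FD n q hq; have [P1 [P2 B]] := FD m q hq; eexists; eexists; exact: (D _ _ _ _ _ A B).
  - by move=> q hq; rewrite mulN1r; exact: he.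
  by apply: le_trans H; rewrite le_eqVlt; apply/orP; left; apply/eqP; congr cabs; ring.
have UC e : 0 < e -> exists N, forall n m, (N <= n)%N -> (N <= m)%N -> forall q, pball p r q -> cabs (F n q - F m q) <= e.
  move=> e0; have [N hN] := Fu (e / 2) ltac:(lra); exists N => n m Nn Nm q hq.
  have := cabs_tri (f q) (F n q) (F m q); have := hN n Nn q hq; have := hN m Nm q hq; rewrite (cabsB (f q)); lra.
have Lcc v e : 0 < e -> exists N, forall n m, (N <= n)%N -> (N <= m)%N ->
    cabs ((L1 n * z1 v + L2 n * z2 v) - (L1 m * z1 v + L2 m * z2 v)) <= e.
  move=> e0; have K0 : 0 <= C / r * pn v by rewrite mulr_ge0 ?pn_ge0 // divr_ge0 // ltW.
  have [N hN] := UC (e / (C / r * pn v + 1)) ltac:(by rewrite divr_gt0 //; lra).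
  exists N => n m Nn Nm; apply: le_trans (Lc n m _ (hN n m Nn Nm) v) _.
  set K := C / r * pn v in K0 *.
  have -> : C * (e / (K + 1)) / r * pn v = e * (K / (K + 1)) by rewrite /K; ring.
  by apply: ler_piMr; [exact: ltW | rewrite ler_pdivrMr; lra].
have [l1 hl1] : exists l, forall e, 0 < e -> exists N, forall n, (N <= n)%N -> cabs (L1 n - l) <= e.
  apply: complex_cauchy => e /(Lcc (ex1 R)); rewrite [z1 _](_ : _ = 1) // [z2 _](_ : _ = 0) //.
  by move=> [N hN]; exists N => n m Nn Nm; have := hN n m Nn Nm; rewrite !mulr1 !mulr0 !addr0.
have [l2 hl2] : exists l, forall e, 0 < e -> exists N, forall n, (N <= n)%N -> cabs (L2 n - l) <= e.
  apply: complex_cauchy => e /(Lcc (ex2 R)); rewrite [z1 _](_ : _ = 0) // [z2 _](_ : _ = 1) //.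
  by move=> [N hN]; exists N => n m Nn Nm; have := hN n m Nn Nm; rewrite !mulr1 !mulr0 !add0r.
have hl v e : 0 < e -> exists N, forall n, (N <= n)%N -> cabs (L1 n * z1 v + L2 n * z2 v - (l1 * z1 v + l2 * z2 v)) <= e.
  move=> e0; have c0 : 0 < pn v + 1 by have := pn_ge0 v; lra.
  have e10 : 0 < e / (pn v + 1) by rewrite divr_gt0.
  have [N hN] := hl1 _ e10; have [N' hN'] := hl2 _ e10; exists (maxn N N') => n; rewrite geq_max => /andP[/hN h1 /hN' h2].
  have -> : L1 n * z1 v + L2 n * z2 v - (l1 * z1 v + l2 * z2 v) = (L1 n - l1) * z1 v + (L2 n - l2) * z2 v by ring.
  apply: le_trans (cabsD _ _) _; rewrite !cabsM.
  have t1 := ler_wpM2r (cabs_ge0 (z1 v)) h1; have t2 := ler_wpM2r (cabs_ge0 (z2 v)) h2.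
  apply: le_trans (lerD t1 t2) _; rewrite -mulrDr -/(pn v) mulrAC ler_pdivrMr //.
  by apply: ler_wpM2l; [exact: ltW | lra].
have M0 : 0 <= M := le_trans (cabs_ge0 _) (FM 0%N p pp).
have D : CD f p l1 l2.
  move=> e e0; have K0 : 0 <= C * M / r ^+ 2 by rewrite !mulr_ge0 // invr_ge0 sqr_ge0.
  exists (Num.min (r / 3) (e / (C * M / r ^+ 2 + 1))) => [|h].
    by rewrite lt_min !divr_gt0 //; lra.
  rewrite lt_min => /andP[hr]; rewrite ltr_pdivlMr; last lra.
  move=> he; apply/ler_addgt0Pr => d d0; have d30 : 0 < d / 3 by lra.
  have [N1 h1] := Fu _ d30; have [N2 h2] := hl h _ d30.
  pose n := maxn N1 N2; have {}h1 := h1 n (leq_maxl _ _); have {}h2 := h2 n (leq_maxr _ _).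
  have inb : pball p r (p + h) by rewrite /pball /= addrAC subrr add0r; lra.
  have [_ H] := hC (F n) p r M _ _ r0 (FD n) (FM n) (hL2 n) h; have {}H := H (ltW hr).
  have -> : f (p + h) - f p - (l1 * z1 h + l2 * z2 h) = (F n (p + h) - F n p - (L1 n * z1 h + L2 n * z2 h)) +
    (L1 n * z1 h + L2 n * z2 h - (l1 * z1 h + l2 * z2 h)) + ((f (p + h) - F n (p + h)) + (F n p - f p)) by ring.
  apply: le_trans (cabsD _ _) _; apply: le_trans (lerD (cabsD _ _) (cabsD _ _)) _.
  rewrite (cabsB (f (p + h))); have a1 := h1 _ inb; have a2 := h1 _ pp.
  have : C * M / r ^+ 2 * pn h ^+ 2 <= e * pn h.
    by rewrite expr2 mulrA; apply: ler_wpM2r; [exact: pn_ge0 | have := pn_ge0 h; lra].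
  lra.
exists l1, l2; split => // v e e0; have [N hN] := hl v e e0; exists N => n /hN.
by rewrite (CD_dC v D) (CD_dC v (hL2 n)).
Qed.

Lemma CD_shift f p q L1 L2 : CD f (p + q) L1 L2 -> CD (fun w => f (w + q)) p L1 L2.
Proof. by move=> D e /D[d d0 hd]; exists d => // h /hd; rewrite (addrAC p). Qed.

(** The second-order Cauchy estimate makes the difference quotients of [f] along [v] converge
    locally uniformly to the derivative, and [weierstrass] applies to them. *)
Lemma dC_CDon W f v : opn W -> CDon W f -> CDon W (fun q => dC f q v).
Proof.
move=> oW fD p Wp; have [r r0 rW] := oW p Wp; have [C C0 hC] := cauchy_estimate2.
have [L1 [L2 D]] := fD p Wp; have [d d0 hd] := CD_lip D.
pose M := cabs (f p) + (1 + cabs L1 + cabs L2) * d.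
pose s := Num.min d r / 2; have [s0 sd sr] : [/\ 0 < s, s < d & s < r].
  rewrite /s; have m0 : 0 < Num.min d r by rewrite lt_min d0.
  have : Num.min d r <= d by rewrite ge_min lexx.
  have : Num.min d r <= r by rewrite ge_min lexx orbT.
  by split; lra.
have sW : pball p s `<=` W by move=> q hq; apply: rW; rewrite /pball /= in hq *; lra.
have fM q : pball p s q -> cabs (f q) <= M.
  rewrite /pball /= => hq; have := hd (q - p) ltac:(lra); rewrite (addrC p) subrK => H.
  have := cabs_subr (f q) (f p); rewrite /M.
  have : (1 + cabs L1 + cabs L2) * pn (q - p) <= (1 + cabs L1 + cabs L2) * d.
    by apply: ler_wpM2l; [rewrite !addr_ge0 ?cabs_ge0 | lra].
  lra.
have fb q : pball p (s / 2) q -> pball q (s / 2) `<=` pball p s.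
  by rewrite /pball /= => hq; apply: pball_sub; lra.
have s20 : 0 < s / 2 by lra.
have M0 : 0 <= M := le_trans (cabs_ge0 _) (fM p (pball_center p s0)).
have est q : pball p (s / 2) q -> forall h, cabs (dC f q h) <= C * M / (s / 2) * pn h /\
    (pn h <= s / 2 / 3 -> cabs (f (q + h) - f q - dC f q h) <= C * M / (s / 2) ^+ 2 * pn h ^+ 2).
  move=> hq h; have [N1 [N2 A]] := fD q (sW q (fb q hq q (pball_center q s20))).
  have [||H1 H2] := hC f q (s / 2) M _ _ s20 _ _ A h.
  - by move=> w /(fb q hq)/sW/fD.
  - by move=> w /(fb q hq)/fM.
  by rewrite (CD_dC h A).
pose t (n : nat) : R := (s / 12) / (pn v + 1) / n.+1%:R.
have c0 : 0 < pn v + 1 by have := pn_ge0 v; lra.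
have t0 n : 0 < t n.
  by apply: divr_gt0; [apply: divr_gt0 => //; apply: divr_gt0 | rewrite ltr0n].
have tv n : pn (t n *: v) <= s / 12 / n.+1%:R.
  rewrite pnZ gtr0_norm // /t.
  have -> : s / 12 / (pn v + 1) / n.+1%:R * pn v = s / 12 / n.+1%:R * (pn v / (pn v + 1)).
    by field; rewrite gt_eqF //= pnatr_eq0.
  apply: ler_piMr; last by rewrite ler_pdivrMr // mul1r; lra.
  by apply: divr_ge0 => //; apply: divr_ge0 => //; exact: ltW.
have tv1 n : pn (t n *: v) <= s / 12.
  apply: le_trans (tv n) _; apply: ler_piMr; first by apply: divr_ge0 => //; exact: ltW.
  by rewrite invf_le1 ?ltr0n // ler1n.
have dZ q n : pball p (s / 2) q -> dC f q (t n *: v) = RC (t n) * dC f q v.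
  move=> hq; have [N1 [N2 A]] := fD q (sW q (fb q hq q (pball_center q s20))).
  by rewrite !(CD_dC _ A) z1Z z2Z; ring.
pose F n q := RC (t n)^-1 * (f (q + t n *: v) + -1 * f q).
pose K := C * M / (s / 2) ^+ 2 * (pn v + 1) ^+ 2.
have K0 : 0 <= K.
  by apply: mulr_ge0; [apply: divr_ge0; [exact: mulr_ge0 | exact: sqr_ge0] | exact: sqr_ge0].
have Fe n q : pball p (s / 2) q -> cabs (F n q - dC f q v) <= K * t n.
  move=> hq; have [_ H] := est q hq (t n *: v); have {}H := H ltac:(by have := tv1 n; lra).
  rewrite dZ // in H; have tn : RC (t n) != 0 by rewrite -cabs_gt0 cabs_real gtr0_norm.
  have -> : F n q - dC f q v = RC (t n)^-1 * (f (q + t n *: v) - f q - RC (t n) * dC f q v).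
    by rewrite /F RCV; move: (dC f q v) (f (q + t n *: v)) (f q) => x y z; field.
  rewrite cabsM cabs_real gtr0_norm ?invr_gt0 // mulrC ler_pdivrMr //; apply: le_trans H _.
  rewrite pnZ gtr0_norm // /K -[leRHS]mulrA -[leRHS]mulrA; apply: ler_wpM2l.
    by apply: mulr_ge0; [exact: mulr_ge0 | rewrite invr_ge0 sqr_ge0].
  have -> : (t n * pn v) ^+ 2 = pn v ^+ 2 * (t n * t n) by ring.
  apply: ler_wpM2r; first by apply: mulr_ge0; exact: ltW.
  by rewrite lerXn2r ?nnegrE ?pn_ge0 //; lra.
have tn0 n : t n <= t 0%N.
  rewrite /t divr1; apply: ler_piMr; first by apply: divr_ge0; [apply: divr_ge0 => //; exact: ltW | exact: ltW].
  by rewrite invf_le1 ?ltr0n // ler1n.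
have sub3 q : pball p (s / 3) q -> pball p (s / 2) q by rewrite /pball /=; lra.
have [||||L1' [L2' [D' _]]] := @weierstrass F (fun q => dC f q v) p (s / 3) (C * M / (s / 2) * pn v + K * t 0%N).
- lra.
- move=> n q /sub3 hq; have [A1 [A2 A]] := fD q (sW q (fb q hq q (pball_center q s20))).
  have qt : pball p s (q + t n *: v).
    by rewrite /pball /= in hq *; have := pnD (q - p) (t n *: v); have := tv1 n; rewrite addrAC; lra.
  have [B1 [B2 B]] := fD _ (sW _ qt).
  by eexists; eexists; exact: (CD_scale _ (CD_add (CD_shift B) (CD_scale (-1) A))).
- move=> n q /sub3 hq; have H := Fe n q hq; have [E _] := est q hq v.
  have := cabs_subr (F n q) (dC f q v); have := ler_wpM2l K0 (tn0 n); lra.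
- move=> e e0; have [N hN] := inv_small (mulr_ge0 K0 (ltW (t0 0%N))) e0; exists N => n Nn q /sub3 hq.
  apply: le_trans (Fe n q hq) _; apply: le_trans (hN n Nn).
  by rewrite /t divr1 !mulrA.
by exists L1', L2'.
Qed.
End Holomorphic2.

(** * Sigma-finiteness of product measures *)

Section ProductSigmaFinite.
Context d1 d2 (T1 : measurableType d1) (T2 : measurableType d2) (R : realType).
Variables (m1 : {sigma_finite_measure set T1 -> \bar R}) (m2 : {sigma_finite_measure set T2 -> \bar R}).

Lemma product_sigma_finite : sigma_finite setT (product_measure1 m1 m2).
Proof.
have /sigma_finiteP[F [TF ndF Foo]] := sigma_finiteT m1.
have /sigma_finiteP[G [TG ndG Goo]] := sigma_finiteT m2.
exists (fun n => F n `*` G n) => [|k]; last first.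
  have [mF fF] := Foo k; have [mG fG] := Goo k; split; first exact: measurableX.
  by rewrite product_measure1E// lte_mul_pinfty// ge0_fin_numE.
apply/seteqP; split => // -[x y] _.
have [n _ Fnx] : (\bigcup_n F n) x by rewrite -TF.
have [k _ Gky] : (\bigcup_n G n) y by rewrite -TG.
exists (maxn n k) => //; split.
  by move: x Fnx; exact/subsetPset/ndF/leq_maxl.
by move: y Gky; exact/subsetPset/ndG/leq_maxr.
Qed.

(* Packed by hand: the canonical sigma-finite structure on product_measure1 is
   shadowed by the one for pairs of subprobabilities. *)
Definition product_sfm := (HB.pack (product_measure1 m1 m2)
  (Measure_isSigmaFinite.Build _ _ _ (product_measure1 m1 m2) product_sigma_finite)
  : {sigma_finite_measure set (T1 * T2)%type -> \bar R}).
End ProductSigmaFinite.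

Definition sf2 (R : realType) : {sigma_finite_measure set (measurableTypeR R * measurableTypeR R)%type -> \bar R} :=
  @product_sfm _ _ (measurableTypeR R) (measurableTypeR R) R (@lebesgue_measure R) (@lebesgue_measure R).

Notation mu4 R := (product_measure1 (sf2 R) (sf2 R)).

(** The packing changes only the attached structure, so the two measures are convertible; [mu4] is
    the form to which Tonelli applies. *)
Lemma leb4E (R : realType) : @leb4 R = mu4 R. Proof. by []. Qed.

(** * Point evaluations are bounded by the [L^2] norm *)

Section MeanValueL2.
Variable R : realType.
Implicit Types (p v : C2 R) (f g : C2 R -> R[i]) (W : set (C2 R)).
Local Notation RC x := (Complex x 0).
Local Notation T2 := (measurableTypeR R * measurableTypeR R)%type.
Local Notation T4 := (T2 * T2)%type.

Definition near4 (p : T4) (e : R) : set T4 := near2 p.1 e `*` near2 p.2 e.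

Lemma basis4 : countable_basis near4.
Proof. exact: basis_prod (basis2 R) (basis2 R). Qed.

Lemma near4_pn p q e : near4 p e q -> pn (q - p) < 4 * e.
Proof.
move: p q => [[a b] [c d]] [[a' b'] [c' d']] [[/= h1 h2] [/= h3 h4]]; rewrite /pn.
have := cabs_ReIm (z1 (((a', b'), (c', d')) - ((a, b), (c, d)))).
have := cabs_ReIm (z2 (((a', b'), (c', d')) - ((a, b), (c, d)))).
rewrite /=; move: h1 h2 h3 h4 => /=; lra.
Qed.

Lemma opn_measurable W : opn W -> measurable (W : set T4).
Proof.
move=> oW; apply: (basis_open basis4) => p Wp; have [r r0 rW] := oW p Wp.
exists (r / 4); split => [|q /near4_pn hq]; first by rewrite divr_gt0.
by apply: rW; rewrite /pball /=; lra.
Qed.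

Definition cont2 W (v : C2 R -> R) := forall p e, W p -> 0 < e -> exists2 d, 0 < d & forall q, pn (q - p) < d -> `|v q - v p| < e.

Lemma cont2_measurable W (v : C2 R -> R) : opn W -> cont2 W v -> measurable_fun (W : set T4) (v : T4 -> R).
Proof.
move=> oW cv mD; apply: (measurability _ (RGenOInfty.measurableE R)) => //.
move=> /= _ [_ [a ->] <-]; apply: (basis_open basis4) => p [Wp] /=.
rewrite in_itv /= andbT => ap; have [r r0 rW] := oW p Wp.
have [d d0 hd] := cv p (v p - a) Wp ltac:(by rewrite subr_gt0).
exists (Num.min r d / 4); split => [|q /near4_pn]; first by rewrite divr_gt0 // lt_min r0.
rewrite mulrC divfK ?pnatr_eq0 // lt_min => /andP[hr /hd]; rewrite ltr_norml => /andP[h1 _].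
by split; [exact: rW | rewrite /= in_itv /= andbT; lra].
Qed.

Lemma CD_cont f p L1 L2 : CD f p L1 L2 -> forall e, 0 < e -> exists2 d, 0 < d & forall q, pn (q - p) < d -> cabs (f q - f p) < e.
Proof.
move=> /CD_lip[d d0 hd] e e0; set K := 1 + cabs L1 + cabs L2 in hd.
have K0 : 0 < K by rewrite /K; have := cabs_ge0 L1; have := cabs_ge0 L2; lra.
exists (Num.min d (e / K)) => [|q]; first by rewrite lt_min d0 divr_gt0.
rewrite lt_min ltr_pdivlMr // => /andP[/hd]; rewrite (addrC p) subrK => H he.
by apply: le_lt_trans H _; rewrite mulrC.
Qed.

Lemma CDon_cont2 W f : CDon W f -> cont2 W (fun p => complex.Re (f p)) /\ cont2 W (fun p => complex.Im (f p)).
Proof.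
move=> fD; split=> p e Wp e0; have [L1 [L2 /CD_cont/(_ e e0)[d d0 hd]]] := fD p Wp; exists d => // q /hd; apply: le_lt_trans.
  by rewrite -reN -reD; exact: Re_cabs.
by rewrite -imN -imD; exact: Im_cabs.
Qed.

Lemma holo_measurable W f : opn W -> CDon W f ->
  measurable_fun (W : set T4) (fun p : T4 => complex.Re (f p)) /\ measurable_fun (W : set T4) (fun p : T4 => complex.Im (f p)).
Proof. by move=> oW /CDon_cont2[c1 c2]; split; exact: cont2_measurable. Qed.

Lemma sqmod_measurable W f : opn W -> CDon W f -> measurable_fun (W : set T4) (fun p : T4 => sqmod (f p)).
Proof.
move=> oW fD; have [m1 m2] := holo_measurable oW fD.
by apply: measurable_funD; exact: measurable_funX.
Qed.

Lemma J_EFin (g : R[i] -> R) : tame (fun h => RC (g h)) -> (forall h, 0 <= g h) ->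
  ((complex.Re (J (fun h => RC (g h))))%:E = \int[mu2 R]_p (g (cplx p))%:E)%E.
Proof.
move=> tg g0; have [I _] := tame_integrable tg.
by rewrite /= /integral_re fineK //; exact: integrable_fin_num.
Qed.

Definition pt (a b : R[i]) : C2 R := ((complex.Re a, complex.Im a), (complex.Re b, complex.Im b)).
Lemma z1_pt a b : z1 (pt a b) = a. Proof. exact: cplxK. Qed.
Lemma z2_pt a b : z2 (pt a b) = b. Proof. exact: cplxK. Qed.

(** The one-variable inequality is used in [z_1], then in [z_2], and Tonelli joins the two. The
    resulting product kernel is bounded by [M^2] and supported in [W], so the full integral over [W]
    dominates. *)
Lemma mean_value_L2 (r : R) : 0 < r -> exists2 C, 0 <= C & forall W f p, opn W -> pball p r `<=` W -> CDon W f ->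
  ((sqmod (f p))%:E <= C%:E * \int[mu4 R]_(q in (W : set T4)) (sqmod (f q))%:E)%E.
Proof.
(* A bidisc of radius [rho = r / 2] lies in the [pn]-ball of radius [r], and [d < rho] is the room
   that [mean_value_sq] asks for. *)
move=> r0; pose d : R := r / 3; pose rho : R := r / 2.
have [d0 dr] : 0 < d /\ d < rho by rewrite /d /rho; split; lra.
have Dm := D11_mk d; have [cm _ _] := D11_cont Dm; have tm := tame_mk d0.
have [M M0 hM] : exists2 M, 0 <= M & forall h : R[i], mk d h <= M.
  have [M [s [M0 _ hM _]]] := tame_bounded tm; exists M => // h; apply: le_trans (hM h).
  by rewrite cabs_real ler_norm.
have ms := mass_gt0 d0.
exists ((mass d)^-1 ^+ 2 * M ^+ 2); first by rewrite mulr_ge0 // sqr_ge0.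
move=> W f p oW pW fD.
have inW a b : cabs (a - z1 p) < rho -> cabs (b - z2 p) < rho -> W (pt a b).
  by move=> h1 h2; apply: pW; rewrite /pball /= /pn z1D z2D z1N z2N z1_pt z2_pt; move: h1 h2; rewrite /rho; lra.
have [a1 a2 a3 a4] : [/\ z1 (ex1 R) = 1, z2 (ex1 R) = 0, z1 (ex2 R) = 0 & z2 (ex2 R) = 1] by [].
have slice1 (h : R[i]) : pt (z1 p + h) (z2 p) = p + csc h (ex1 R).
  by apply: C2P; rewrite ?z1D ?z2D ?z1_pt ?z2_pt ?z1_csc ?z2_csc ?a1 ?a2 ?mulr1 ?mulr0 ?addr0.
have slice2 (a h : R[i]) : pt a (z2 p + h) = pt a (z2 p) + csc h (ex2 R).
  by apply: C2P; rewrite ?z1D ?z2D ?z1_pt ?z2_pt ?z1_csc ?z2_csc ?a3 ?a4 ?mulr1 ?mulr0 ?addr0.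
have rho0 : 0 < rho by lra.
have cp (q : R[i]) : cabs (q - q) < rho by rewrite subrr cabs0.
have D1 (z : R[i]) : cabs z < rho -> exists a, cderiv (fun h : R[i] => f (pt (z1 p + h) (z2 p))) z a.
  move=> zr; have [|L1 [L2 D]] := fD (pt (z1 p + z) (z2 p)).
    by apply: inW => //; rewrite addrAC subrr add0r.
  rewrite slice1 in D; exists (L1 * z1 (ex1 R) + L2 * z2 (ex1 R)).
  have -> : (fun h : R[i] => f (pt (z1 p + h) (z2 p))) = (fun h : R[i] => f (p + csc h (ex1 R))).
    by apply/funext => h; rewrite slice1.
  exact: CD_slice D.
have D2 (a z : R[i]) : cabs (a - z1 p) < rho -> cabs z < rho -> exists b, cderiv (fun h : R[i] => f (pt a (z2 p + h))) z b.
  move=> ar zr; have [|L1 [L2 D]] := fD (pt a (z2 p + z)).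
    by apply: inW => //; rewrite addrAC subrr add0r.
  rewrite slice2 in D; exists (L1 * z1 (ex2 R) + L2 * z2 (ex2 R)).
  have -> : (fun h : R[i] => f (pt a (z2 p + h))) = (fun h : R[i] => f (pt a (z2 p) + csc h (ex2 R))).
    by apply/funext => h; rewrite slice2.
  exact: CD_slice D.
pose g1 (w : R[i]) : R := mk d (w - z1 p) * cabs (f (pt w (z2 p))) ^+ 2.
pose g2 (a w : R[i]) : R := mk d (w - z2 p) * cabs (f (pt a w)) ^+ 2.
have mk0 := mk_ge0 d0.
have center (c : R[i]) (u : R[i] -> R) : tame (fun h => RC (u (c + h))) -> tame (fun w => RC (u w)) /\ J (fun h => RC (u (c + h))) = J (fun w => RC (u w)).
  move=> tu; have e : (fun z => RC (u (c + (- c + z)))) = (fun w => RC (u w)).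
    by apply/funext => w; rewrite addrA subrr add0r.
  by have t' := tame_shift (- c) tu; have j := J_shift (- c) tu; rewrite e in t' j.
have ptp : pt (z1 p + 0) (z2 p) = p by rewrite addr0; apply: C2P; rewrite ?z1_pt ?z2_pt.
have [t1 e1] : tame (fun w => RC (g1 w)) /\ mass d * sqmod (f p) <= complex.Re (J (fun w => RC (g1 w))).
  have [t e] := mean_value_sq d0 dr D1; rewrite ptp sqr_cabs in e.
  have E : (fun h => RC (mk d h * cabs (f (pt (z1 p + h) (z2 p))) ^+ 2)) = (fun h => RC (g1 (z1 p + h))).
    by apply/funext => h; rewrite /g1 addrAC subrr add0r.
  by rewrite E in t e; have [t' j] := center _ _ t; rewrite -j.
have S2 (a : R[i]) : cabs (a - z1 p) < rho -> tame (fun w => RC (g2 a w)) /\ mass d * cabs (f (pt a (z2 p))) ^+ 2 <= complex.Re (J (fun w => RC (g2 a w))).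
  move=> ar; have [t e] := mean_value_sq d0 dr (fun z => D2 a z ar); rewrite addr0 in e.
  have E : (fun h => RC (mk d h * cabs (f (pt a (z2 p + h))) ^+ 2)) = (fun h => RC (g2 a (z2 p + h))).
    by apply/funext => h; rewrite /g2 (addrAC (z2 p)) subrr add0r.
  by rewrite E in t e; have [t' j] := center _ _ t; rewrite -j.
pose G (q : T4) : R := mk d (z1 q - z1 p) * mk d (z2 q - z2 p) * sqmod (f q).
have sq0 q : 0 <= sqmod (f q) by rewrite -sqr_cabs sqr_ge0.
have G0 q : 0 <= G q by rewrite /G; apply: mulr_ge0 => //; exact: mulr_ge0.
have cmk (zz : C2 R -> R[i]) : (forall a b, zz (a - b) = zz a - zz b) -> (forall a, cabs (zz a) <= pn a) -> cont2 W (fun q => mk d (zz q - zz p)).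
  move=> zB zp q e _ /(cm (zz q - zz p))[de de0 hd]; exists de => // w hw.
  have := hd (zz w - zz p) ltac:(by rewrite opprB addrA subrK -zB; apply: le_lt_trans (zp _) hw).
  by rewrite -RCN -RCD cabs_real.
have mG : measurable_fun (W : set T4) G.
  apply: measurable_funM; last exact: sqmod_measurable.
  apply: measurable_funM; apply: (cont2_measurable oW).
    by apply: (cmk (@z1 R)) => // a; rewrite lerDl cabs_ge0.
  by apply: (cmk (@z2 R)) => // a; rewrite lerDr cabs_ge0.
have Gout q : ~ W q -> G q = 0.
  move=> nW; rewrite /G; have [h1|h1] := ltP (cabs (z1 q - z1 p)) rho; last by rewrite (mk_out d0) ?mul0r //; lra.
  have [h2|h2] := ltP (cabs (z2 q - z2 p)) rho; last by rewrite (mk_out d0 (h := z2 q - z2 p)) ?mulr0 ?mul0r //; lra.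
  by case: nW; have := inW _ _ h1 h2; rewrite (_ : pt _ _ = q) //; apply: C2P; rewrite ?z1_pt ?z2_pt.
have GE : (fun q : T4 => (G q)%:E) = ((fun q : T4 => (G q)%:E) \_ (W : set T4)).
  apply/funext => q; rewrite patchE; case: ifPn => //; rewrite notin_setE => /Gout ->; by [].
have mW := opn_measurable oW.
have mGT : measurable_fun setT (fun q : T4 => (G q)%:E).
  rewrite GE; apply/(measurable_restrictT _ mW).
  exact/measurable_EFinP.
have step1 : ((mass d ^+ 2 * sqmod (f p))%:E <= \int[mu4 R]_q (G q)%:E)%E.
  have GE0 q : (0 <= (G q)%:E)%E by rewrite lee_fin.
  have FT : (\int[mu4 R]_q (G q)%:E = \int[mu2 R]_x \int[mu2 R]_y (G (x, y))%:E)%E by exact: (@fubini_tonelli1 _ _ T2 T2 R (sf2 R) (sf2 R) (fun q : T4 => (G q)%:E) mGT GE0).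
  rewrite FT.
  have -> : ((mass d ^+ 2 * sqmod (f p))%:E = (mass d)%:E * (mass d * sqmod (f p))%:E)%E by rewrite -EFinM; congr EFin; ring.
  apply: (@le_trans _ _ ((mass d)%:E * (complex.Re (J (fun w => RC (g1 w))))%:E)%E).
    by apply: lee_wpmul2l; rewrite lee_fin // ltW.
  have g10 h : 0 <= g1 h by rewrite mulr_ge0 ?sqr_ge0.
  rewrite J_EFin // -ge0_integralZl //; last 3 first.
  - by have [/integrableP[]] := tame_integrable t1.
  - by move=> x _; rewrite lee_fin.
  - by rewrite lee_fin ltW.
  apply: ge0_le_integral => //.
  - by move=> x _; rewrite -EFinM lee_fin mulr_ge0 // ltW.
  - apply: emeasurable_funM => //.
    by have [/integrableP[]] := tame_integrable t1.
  - by exact: (@measurable_fun_fubini_tonelli_F _ _ T2 T2 R (sf2 R) (fun q : T4 => (G q)%:E) mGT GE0).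
  move=> x _; have [xr|xr] := ltP (cabs (cplx x - z1 p)) rho; last first.
    rewrite /g1 (mk_out d0) ?mul0r ?mule0; last lra.
    by apply: integral_ge0 => y _; rewrite lee_fin.
  have [t2 e2] := S2 _ xr.
  have g20 h : 0 <= g2 (cplx x) h by rewrite mulr_ge0 ?sqr_ge0.
  have -> : (\int[mu2 R]_y (G (x, y))%:E = (mk d (cplx x - z1 p))%:E * (complex.Re (J (fun w => RC (g2 (cplx x) w))))%:E)%E.
    rewrite J_EFin // -ge0_integralZl //; last 3 first.
    - by have [/integrableP[]] := tame_integrable t2.
    - by move=> y _; rewrite lee_fin.
    - by rewrite lee_fin.
    apply: eq_integral => y _; rewrite -EFinM; congr EFin; rewrite /G /g2 -sqr_cabs -mulrA.
    by rewrite (_ : pt (cplx x) (cplx y) = (x, y)) //; case: x {xr t2 e2 g20} => ? ?; case: y.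
  rewrite -!EFinM lee_fin /g1 mulrCA; apply: ler_wpM2l => //.
have step2 : (\int[mu4 R]_q (G q)%:E <= (M ^+ 2)%:E * \int[mu4 R]_(q in (W : set T4)) (sqmod (f q))%:E)%E.
  rewrite GE -integral_mkcond -ge0_integralZl //; last 3 first.
  - by apply/measurable_EFinP; exact: sqmod_measurable.
  - by move=> q _; rewrite lee_fin.
  - by rewrite lee_fin sqr_ge0.
  apply: ge0_le_integral => //.
  - by move=> q _; rewrite lee_fin.
  - exact/measurable_EFinP.
  - apply: emeasurable_funM => //; apply/measurable_EFinP; exact: sqmod_measurable.
  move=> q _; rewrite -EFinM lee_fin /G; apply: ler_wpM2r => //.
  by rewrite expr2; apply: ler_pM.
have := le_trans step1 step2 => H.
have -> : ((sqmod (f p))%:E = ((mass d)^-1 ^+ 2)%:E * (mass d ^+ 2 * sqmod (f p))%:E)%E.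
  by rewrite -EFinM mulrA -exprMn mulVf ?gt_eqF // expr1n mul1r.
rewrite [X in (_ <= X * _)%E]EFinM -muleA; apply: lee_wpmul2l; last exact: H.
by rewrite lee_fin sqr_ge0.
Qed.
End MeanValueL2.

(** * Square summable sequences and their real inner product *)

Section SquareSummable.
Variable R : realType.
Implicit Types (x y : nat -> R[i]) (a b : R).
Local Notation RC x := (Complex x 0).

Definition sq2 n x : R := \sum_(0 <= j < n) sqmod (x j).
(** Norm at most [a] in [l2], expressed by partial sums so that no convergence is presupposed. *)
Definition bnd a x := 0 <= a /\ forall n, sq2 n x <= a ^+ 2.
Definition prn n x y : R := \sum_(0 <= j < n) complex.Re (x j * (y j)^*).
(** The real part of the [l2] inner product. Imaginary parts appear, up to sign, as [pr] with one
    argument multiplied by [i], which keeps all computations with the Bergman kernel real. *)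
Definition pr x y : R := limn (fun n => prn n x y).

Lemma sqmod_ge0 (z : R[i]) : 0 <= sqmod z.
Proof. by rewrite -sqr_cabs sqr_ge0. Qed.

Lemma sqmodM (z w : R[i]) : sqmod (z * w) = sqmod z * sqmod w.
Proof. by rewrite -!sqr_cabs cabsM exprMn. Qed.

Lemma re_mulJ (z : R[i]) : complex.Re (z * z^*) = sqmod z.
Proof. by rewrite mulJ /= sqr_cabs. Qed.

Lemma re_mulJC (z w : R[i]) : complex.Re (z * w^*) = complex.Re (w * z^*).
Proof. by rewrite !reM !reJ !imJ; ring. Qed.

Lemma prnn n x : prn n x x = sq2 n x.
Proof. by apply: eq_bigr => j _; rewrite re_mulJ. Qed.

Lemma prnC n x y : prn n x y = prn n y x.
Proof. by apply: eq_bigr => j _; exact: re_mulJC. Qed.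

Lemma sq2_ge0 n x : 0 <= sq2 n x.
Proof. by apply: sumr_ge0 => j _; exact: sqmod_ge0. Qed.

Lemma sq2_mono n m x : (n <= m)%N -> sq2 n x <= sq2 m x.
Proof.
move=> nm; rewrite /sq2 (@big_cat_nat _ _ _ n 0%N m) //= lerDl.
by apply: sumr_ge0 => j _; exact: sqmod_ge0.
Qed.

Lemma sq2Z n (c : R[i]) x : sq2 n (fun j => c * x j) = sqmod c * sq2 n x.
Proof. by rewrite /sq2 mulr_sumr; apply: eq_bigr => j _; exact: sqmodM. Qed.

Lemma sq2J n x : sq2 n (fun j => (x j)^*) = sq2 n x.
Proof. by apply: eq_bigr => j _; rewrite -!sqr_cabs cabs_conj. Qed.

Lemma cauchy_schwarz_step (s r A B X Y : R) : 0 <= A -> 0 <= B -> 0 <= X -> 0 <= Y ->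
  s ^+ 2 <= A * B -> r ^+ 2 <= X * Y -> (s + r) ^+ 2 <= (A + X) * (B + Y).
Proof.
move=> A0 B0 X0 Y0 hs hr.
have AY : 0 <= A * Y by exact: mulr_ge0.
have BX : 0 <= B * X by exact: mulr_ge0.
have h : 2 * (s * r) <= A * Y + B * X.
  have [//|lt] := leP (2 * (s * r)) (A * Y + B * X).
  have : (A * Y + B * X) ^+ 2 < (2 * (s * r)) ^+ 2 by rewrite ltr_pXn2r ?nnegrE //; lra.
  have : (s * r) ^+ 2 <= (A * Y) * (B * X).
    have -> : A * Y * (B * X) = (A * B) * (X * Y) by ring.
    by rewrite exprMn; apply: ler_pM => //; exact: sqr_ge0.
  have := sqr_ge0 (A * Y - B * X).
  move: (s * r) (A * Y) (B * X) => p q u; rewrite !expr2; lra.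
have -> : (s + r) ^+ 2 = s ^+ 2 + 2 * (s * r) + r ^+ 2 by ring.
have -> : (A + X) * (B + Y) = A * B + (A * Y + B * X) + X * Y by ring.
lra.
Qed.

Lemma prn_cs n x y : prn n x y ^+ 2 <= sq2 n x * sq2 n y.
Proof.
elim: n => [|n IH]; first by rewrite /prn /sq2 !big_nil expr0n mulr0.
rewrite /prn /sq2 !big_nat_recr //=; apply: cauchy_schwarz_step; rewrite ?sq2_ge0 ?sqmod_ge0 //.
rewrite -sqr_cabs -(sqr_cabs (y n)) -exprMn -(cabs_conj (y n)) -cabsM -[leLHS]real_normK ?num_real //.
by rewrite lerXn2r ?nnegrE ?cabs_ge0 //; exact: Re_cabs.
Qed.

Lemma prn_bound n a b x y : bnd a x -> bnd b y -> `|prn n x y| <= a * b.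
Proof.
move=> [a0 hx] [b0 hy]; rewrite -(@ler_pXn2r _ 2) ?nnegrE ?normr_ge0 ?mulr_ge0 //.
rewrite real_normK ?num_real //; apply: le_trans (prn_cs n x y) _.
by rewrite exprMn ler_pM ?sq2_ge0.
Qed.

Lemma comb_cs n x y : sqmod (\sum_(0 <= j < n) x j * y j) <= sq2 n x * sq2 n y.
Proof.
set w := \sum_(_ <= _ < _) _.
have e : sqmod w = prn n (fun j => w^* * x j) (fun j => (y j)^*).
  rewrite -re_mulJ mulrC {2}/w mulr_sumr re_sum; apply: eq_bigr => j _.
  by rewrite mulrA; congr (complex.Re (_ * _)); case: (y j) => u v; congr Complex; rewrite opprK.
have [w0|w0] := eqVneq (sqmod w) 0; first by rewrite w0 mulr_ge0 ?sq2_ge0.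
have wp : 0 < sqmod w by rewrite lt_def w0 sqmod_ge0.
have := prn_cs n (fun j => w^* * x j) (fun j => (y j)^*).
rewrite -e sq2J sq2Z (_ : sqmod w^* = sqmod w); last by rewrite -!sqr_cabs cabs_conj.
by rewrite expr2 -mulrA ler_pM2l.
Qed.

(** The converse of Cauchy-Schwarz, tested on the normalized conjugate of [x]. It converts estimates
    for single functions [sum c_j F_j] into [l2] estimates for the sequence [F]. *)
Lemma dualize n a x : 0 <= a -> (forall c, sq2 n c <= 1 -> cabs (\sum_(0 <= j < n) c j * x j) <= a) ->
  sq2 n x <= a ^+ 2.
Proof.
move=> a0 H; have [->|S0] := eqVneq (sq2 n x) 0; first exact: sqr_ge0.
have Sp : 0 < sq2 n x by rewrite lt_def S0 sq2_ge0.
set s := Num.sqrt (sq2 n x); have s0 : 0 < s by rewrite sqrtr_gt0.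
have sE : s ^+ 2 = sq2 n x by rewrite sqr_sqrtr // ltW.
have := H (fun j => RC s^-1 * (x j)^*); rewrite sq2Z sq2J -sE.
have -> : sqmod (RC s^-1) = (s ^+ 2)^-1 by rewrite /sqmod /= expr0n addr0 exprVn.
rewrite mulVf ?expf_neq0 ?gt_eqF // => /(_ (lexx _)).
have -> : \sum_(0 <= j < n) RC s^-1 * (x j)^* * x j = RC s^-1 * RC (sq2 n x).
  rewrite -[X in _ * RC X]prnn; have -> : RC (prn n x x) = \sum_(0 <= j < n) RC (sqmod (x j)).
    rewrite prnn /sq2; elim: (index_iota 0 n) => [|j l IH]; rewrite ?big_nil // !big_cons -IH; apply: complexP; rewrite ?reD ?imD //=; ring.
  rewrite mulr_sumr; apply: eq_bigr => j _.
  by rewrite -mulrA (mulrC (x j)^*) mulJ sqr_cabs.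
have s1 := ltW s0; rewrite -sE cabsM !cabs_real !ger0_norm ?invr_ge0 ?sqr_ge0 //.
have -> : s^-1 * s ^+ 2 = s by rewrite expr2 mulrA mulVf ?gt_eqF // mul1r.
by move=> sa; rewrite lerXn2r ?nnegrE.
Qed.

Lemma bnd_le a b x : bnd a x -> a <= b -> bnd b x.
Proof. by move=> [a0 H] ab; split=> [|n]; [exact: le_trans ab|apply: le_trans (H n) _; rewrite lerXn2r ?nnegrE //; exact: le_trans ab]. Qed.

Lemma bndD a b x y : bnd a x -> bnd b y -> bnd (a + b) (fun j => x j + y j).
Proof.
move=> hx hy; have [a0 Hx] := hx; have [b0 Hy] := hy; split=> [|n]; first exact: addr_ge0.
have -> : sq2 n (fun j => x j + y j) = sq2 n x + 2 * prn n x y + sq2 n y.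
  rewrite /sq2 /prn mulr_sumr -!big_split /=; apply: eq_bigr => j _.
  by rewrite /sqmod reD imD reM reJ imJ; ring.
have := prn_bound n hx hy; rewrite ler_norml => /andP[_].
have := Hx n; have := Hy n; rewrite !expr2; nra.
Qed.

Lemma bndZ a x (c : R[i]) : bnd a x -> bnd (cabs c * a) (fun j => c * x j).
Proof.
move=> [a0 H]; split=> [|n]; first by rewrite mulr_ge0 ?cabs_ge0.
by rewrite sq2Z exprMn sqr_cabs ler_wpM2l ?sqmod_ge0.
Qed.

Lemma prn_cvg a b x y : bnd a x -> bnd b y -> prn n x y @[n --> \oo] --> pr x y.
Proof.
move=> [a0 hx] [b0 hy]; suff H : cvgn (fun n => prn n x y) by exact: H.
apply: (@normed_cvg _ R^o (fun j => complex.Re (x j * (y j)^*))).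
apply: nondecreasing_is_cvgn.
  by apply: nondecreasing_series => j _ _ /=.
exists (a ^+ 2 + b ^+ 2) => _ [n _ <-]; apply: le_trans (lerD (hx n) (hy n)).
rewrite /series /sq2 -big_split /=; apply: ler_sum => j _.
apply: le_trans (Re_cabs _) _; rewrite cabsM cabs_conj -!sqr_cabs.
have := cabs_ge0 (x j); have := cabs_ge0 (y j); have := sqr_ge0 (cabs (x j) - cabs (y j)).
by rewrite !expr2; nra.
Qed.

Lemma pr_bound a b x y : bnd a x -> bnd b y -> `|pr x y| <= a * b.
Proof.
move=> hx hy; have c := prn_cvg hx hy.
have cc : cvgn (fun n => prn n x y) by apply: cvgP c.
have B n : - (a * b) <= prn n x y <= a * b by rewrite -ler_norml; exact: prn_bound.
by rewrite ler_norml limr_ge ?limr_le //; apply: nearW => n; have /andP[] := B n.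
Qed.

Lemma prC x y : pr x y = pr y x.
Proof. by rewrite /pr (_ : (fun n => prn n x y) = (fun n => prn n y x)) //; apply/funext => n; exact: prnC. Qed.

Lemma prD a b d x x' y : bnd a x -> bnd b x' -> bnd d y -> pr (fun j => x j + x' j) y = pr x y + pr x' y.
Proof.
move=> hx hx' hy; apply/cvg_lim => //.
have -> : (fun n => prn n (fun j => x j + x' j) y) = (fun n => prn n x y + prn n x' y).
  by apply/funext => n; rewrite /prn -big_split /=; apply: eq_bigr => j _; rewrite mulrDl reD.
apply: cvgD; [exact: prn_cvg hx hy | exact: prn_cvg hx' hy].
Qed.

Lemma prZ a b (t : R) x y : bnd a x -> bnd b y -> pr (fun j => RC t * x j) y = t * pr x y.
Proof.
move=> hx hy; apply/cvg_lim => //.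
have -> : (fun n => prn n (fun j => RC t * x j) y) = (fun n => t * prn n x y).
  by apply/funext => n; rewrite /prn mulr_sumr /=; apply: eq_bigr => j _; rewrite -mulrA reM /= mul0r subr0.
by apply: cvgM; [exact: cvg_cst | exact: prn_cvg hx hy].
Qed.

Lemma prI x y : pr (fun j => Complex 0 1 * x j) (fun j => Complex 0 1 * y j) = pr x y.
Proof.
rewrite /pr (_ : (fun n => prn n _ _) = (fun n => prn n x y)) //.
apply/funext => n; apply: eq_bigr => j _.
by rewrite !reM !reJ !imJ !imM !reM /=; ring.
Qed.

Lemma pr_ge n a x : bnd a x -> sq2 n x <= pr x x.
Proof.
move=> hx; have c := prn_cvg hx hx.
apply: limr_ge; first exact: cvgP c.
by exists n => // m nm; rewrite /= prnn; exact: sq2_mono.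
Qed.

Lemma pr_le a x : bnd a x -> pr x x <= a ^+ 2.
Proof. by move=> hx; have := pr_bound hx hx; rewrite ler_norml -expr2 => /andP[]. Qed.

Lemma sq2_eps a x e : bnd a x -> 0 < e -> exists n, pr x x - e <= sq2 n x.
Proof.
move=> hx e0; have /cvgrPdist_le/(_ e e0)[n _ /(_ n (leqnn n))] := prn_cvg hx hx.
by rewrite /= prnn ler_norml => /andP[h1 h2]; exists n; lra.
Qed.

End SquareSummable.

(** * Sequences of holomorphic functions as holomorphic maps into [l2] *)

Section Families.
Variable R : realType.
Implicit Types (p q h v : C2 R) (W : set (C2 R)) (F G : nat -> C2 R -> R[i]).
Local Notation RC x := (Complex x 0).

(** A directional derivative together with its existence, which [derive] alone does not assert.
    [dd_is_derive] reduces it to one real variable, where chain and quotient rules are available. *)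
Definition dd (u : C2 R -> R) p v (l : R) := forall e, 0 < e -> exists2 d, 0 < d &
  forall t, t != 0 -> `|t| < d -> `|t^-1 * (u (p + t *: v) - u p) - l| <= e.

Lemma dd_derive u p v l : dd u p v l -> 'D_v u p = l.
Proof. exact: deriv_eps. Qed.

Lemma dd_is_derive u p v l : dd u p v l <-> is_derive (0 : R) (1 : R) (fun t : R => u (p + t *: v)) l.
Proof.
split=> [H|[H El] e e0].
  have C : (fun t : R => t^-1 *: (((fun t : R => u (p + t *: v)) \o shift (0 : R)) (t *: (1 : R)) - u (p + 0 *: v))) @ 0^' --> l.
    apply/cvgrPdist_le => e e0; have [d d0 hd] := H e e0.
    near=> t; rewrite distrC /= addr0 scale0r addr0 (_ : t *: (1 : R) = t); last exact: mulr1.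
    apply: hd; first by near: t; exact: nbhs_dnbhs_neq.
    by near: t; apply: dnbhs0_lt.
  by apply: DeriveDef; [exact: cvgP C | exact: cvg_lim C].
have {}H : (fun t : R => t^-1 *: (((fun t : R => u (p + t *: v)) \o shift (0 : R)) (t *: (1 : R)) - u (p + 0 *: v))) @ 0^' --> l.
  by rewrite -El; exact: H.
have /cvgrPdist_le/(_ e e0) := H.
rewrite near_withinE => /nbhs_ballP[d d0 hd]; exists d => // t t0 td.
have := hd t _ t0; rewrite distrC /= addr0 scale0r addr0 (_ : t *: (1 : R) = t); last exact: mulr1.
by apply; rewrite /ball /= sub0r normrN.
Unshelve. all: by end_near. Qed.

Lemma dd_near W u w p v l : opn W -> W p -> (forall q, W q -> u q = w q) -> dd w p v l -> dd u p v l.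
Proof.
move=> oW Wp uw D e e0; have [r r0 rW] := oW p Wp; have [d d0 hd] := D e e0.
have v0 : 0 < 1 + pn v by have := pn_ge0 v; lra.
exists (Num.min d (r / (1 + pn v))) => [|t t0]; first by rewrite lt_min d0 divr_gt0.
rewrite lt_min ltr_pdivlMr // => /andP[td tr].
rewrite uw ?uw //; first exact: hd.
apply: rW; rewrite /pball /= addrAC subrr add0r pnZ; apply: le_lt_trans tr.
by rewrite ler_wpM2l // lerDr.
Qed.

Lemma dd_quad u p v l (C r : R) : 0 < r -> 0 <= C -> (forall t, `|t| < r -> `|u (p + t *: v) - u p - t * l| <= C * t ^+ 2) -> dd u p v l.
Proof.
move=> r0 C0 H e e0; have C1 : 0 < 1 + C by lra.
exists (Num.min r (e / (1 + C))) => [|t t0]; first by rewrite lt_min r0 divr_gt0.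
rewrite lt_min ltr_pdivlMr // => /andP[/H h te].
have -> : t^-1 * (u (p + t *: v) - u p) - l = t^-1 * (u (p + t *: v) - u p - t * l).
  by rewrite [RHS]mulrBr mulKf.
rewrite normrM normfV ler_pdivrMl ?normr_gt0 //; apply: le_trans h _.
have := normr_ge0 t; rewrite -real_normK ?num_real // expr2; nra.
Qed.

(** A holomorphic map into [l2]: holomorphic components with locally uniformly bounded [l2] norm. *)
Definition fam W F := (forall j, CDon W (F j)) /\
  forall p, W p -> exists r A, [/\ 0 < r, pball p r `<=` W & forall q, pball p r q -> bnd A (F^~ q)].

Lemma CDon_dC W f p : CDon W f -> W p -> CD f p (dC f p (ex1 R)) (dC f p (ex2 R)).
Proof. by move=> fD /fD[L1 [L2 D]]; have [<- <-] := CD_dC1 D. Qed.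

Lemma CD_sum n (c : nat -> R[i]) F p (L M : nat -> R[i]) : (forall j, CD (F j) p (L j) (M j)) ->
  CD (fun q => \sum_(0 <= j < n) c j * F j q) p (\sum_(0 <= j < n) c j * L j) (\sum_(0 <= j < n) c j * M j).
Proof.
move=> D; elim: n => [|n IH].
  by rewrite !big_nil; apply: CD_eq (CD_cst 0 p) _ _ _ => // q; rewrite big_nil.
rewrite !big_nat_recr //=; apply: CD_eq (CD_add IH (CD_scale (c n) (D n))) _ _ _ => // q.
by rewrite big_nat_recr.
Qed.

(** Cauchy estimates with values in [l2]. The scalar estimate is applied to the finite combinations
    [sum c_j F_j] with [sum |c_j|^2 <= 1], bounded by Cauchy-Schwarz, and [dualize] recovers the
    sequence. *)
Lemma fam_est W F p : opn W -> fam W F -> W p -> exists r A, [/\ 0 < r, 0 <= A, pball p r `<=` W &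
  forall q, pball p r q -> [/\ bnd A (F^~ q), (forall v, bnd (A * pn v) (fun j => dC (F j) q v)) &
   forall h, pn h <= r -> bnd (A * pn h ^+ 2) (fun j => F j (q + h) - F j q - dC (F j) q h)]].
Proof.
move=> oW [FD Fb] Wp; have [r0 [A [r00 rW hA]]] := Fb p Wp.
have [C C0 hC] := cauchy_estimate2 R.
pose s : R := r0 / 2; have s0 : 0 < s by rewrite /s; lra.
have [A0 _] := hA p (pball_center p r00).
have i0 : 0 <= s^-1 by rewrite invr_ge0 ltW.
have B1 : 0 <= C * A / s by rewrite !mulr_ge0.
have B2 : 0 <= C * A / s ^+ 2 by rewrite -exprVn !mulr_ge0 // exprn_ge0.
exists (s / 3), (A + C * A / s + C * A / s ^+ 2); split => //; rewrite ?divr_gt0 //; first by rewrite !addr_ge0.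
  by apply: subset_trans rW; apply: pball_sub; rewrite subrr pn0 /s; lra.
move=> q qp; have qs : pball q s `<=` pball p r0.
  by apply: pball_sub; move: qp; rewrite /pball /= /s; lra.
have [L1 [L2 [Dq dE]]] : exists L1 L2 : nat -> R[i], (forall j, CD (F j) q (L1 j) (L2 j)) /\ forall j v, dC (F j) q v = L1 j * z1 v + L2 j * z2 v.
  have D j := CDon_dC (FD j) (rW _ (qs _ (pball_center q s0))).
  by exists (fun j => dC (F j) q (ex1 R)), (fun j => dC (F j) q (ex2 R)); split => // j v; exact: CD_dC (D j).
have key n (c : nat -> R[i]) (cn : sq2 n c <= 1) h :
    cabs (\sum_(0 <= j < n) c j * (L1 j * z1 h + L2 j * z2 h)) <= C * A / s * pn h /\
    (pn h <= s / 3 -> cabs (\sum_(0 <= j < n) c j * (F j (q + h) - F j q - (L1 j * z1 h + L2 j * z2 h))) <= C * A / s ^+ 2 * pn h ^+ 2).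
  have D := CD_sum n c Dq.
  have on : CDon (pball q s) (fun w => \sum_(0 <= j < n) c j * F j w).
    move=> w /qs/rW Ww; have Dw j := CDon_dC (FD j) Ww.
    by have := CD_sum n c Dw; move=> ?; eexists; eexists; eauto.
  have bd w : pball q s w -> cabs (\sum_(0 <= j < n) c j * F j w) <= A.
    move=> /qs/hA[_ Hw]; rewrite -(@ler_pXn2r _ 2) ?nnegrE ?cabs_ge0 // sqr_cabs.
    apply: le_trans (comb_cs n c (F^~ w)) _; rewrite -[leRHS]mul1r.
    by apply: ler_pM => //; exact: sq2_ge0.
  have := hC _ q s A _ _ s0 on bd D h.
  have E1 : \sum_(0 <= j < n) c j * (L1 j * z1 h + L2 j * z2 h) = (\sum_(0 <= j < n) c j * L1 j) * z1 h + (\sum_(0 <= j < n) c j * L2 j) * z2 h.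
    by rewrite !mulr_suml -big_split /=; apply: eq_bigr => j _; ring.
  have E2 : \sum_(0 <= j < n) c j * (F j (q + h) - F j q - (L1 j * z1 h + L2 j * z2 h)) =
      \sum_(0 <= j < n) c j * F j (q + h) - \sum_(0 <= j < n) c j * F j q - \sum_(0 <= j < n) c j * (L1 j * z1 h + L2 j * z2 h).
    by rewrite -!sumrB; apply: eq_bigr => j _; rewrite !mulrBr.
  by rewrite E2 E1.
have mono (x y : R) : 0 <= y -> x <= A + C * A / s + C * A / s ^+ 2 -> x * y <= (A + C * A / s + C * A / s ^+ 2) * y.
  by move=> y0 xy; exact: ler_wpM2r.
split.
- by apply: bnd_le (hA q _) _; [apply: qs; exact: pball_center | lra].
- move=> v; rewrite (_ : (fun j => dC (F j) q v) = (fun j => L1 j * z1 v + L2 j * z2 v)); last by apply/funext => j; exact: dE.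
  apply: (@bnd_le _ (C * A / s * pn v)); last by apply: mono; [exact: pn_ge0 | lra].
  have n0 : 0 <= C * A / s * pn v by rewrite mulr_ge0 ?pn_ge0.
  by split => // n; apply: dualize => // c cn; have [] := key n c cn v.
- move=> h hs; rewrite (_ : (fun j => F j (q + h) - F j q - dC (F j) q h) = (fun j => F j (q + h) - F j q - (L1 j * z1 h + L2 j * z2 h))); last first.
    by apply/funext => j; congr (_ - _); exact: dE.
  apply: (@bnd_le _ (C * A / s ^+ 2 * pn h ^+ 2)); last by apply: mono; [exact: sqr_ge0 | lra].
  have n0 : 0 <= C * A / s ^+ 2 * pn h ^+ 2 by rewrite mulr_ge0 ?sqr_ge0.
  by split => // n; apply: dualize => // c cn; have [_ ] := key n c cn h; exact.
Qed.

Lemma fam_d W F v : opn W -> fam W F -> fam W (fun j q => dC (F j) q v).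
Proof.
move=> oW fF; split=> [j|p Wp]; first by apply: dC_CDon oW _; have [] := fF.
have [r [A [r0 A0 rW H]]] := fam_est oW fF Wp.
by exists r, (A * pn v); split => // q /H[_ ].
Qed.

(** The product rule that justifies differentiating the Bergman series term by term. Both families
    have second-order expansions in [l2] by [fam_est]; after multiplying out, six products remain
    beyond first order, and [pr_bound] makes each [O(t^2)]. *)
Lemma pr_deriv W F G p v : opn W -> fam W F -> fam W G -> W p ->
  dd (fun q => pr (F^~ q) (G^~ q)) p v (pr (fun j => dC (F j) p v) (G^~ p) + pr (F^~ p) (fun j => dC (G j) p v)).
Proof.
move=> oW fF fG Wp.
have [r [A [r0 A0 rW H]]] := fam_est oW fF Wp; have [s [B [s0 B0 sW H']]] := fam_est oW fG Wp.
have [bF bdF bqF] := H p (pball_center p r0); have [bG bdG bqG] := H' p (pball_center p s0).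
have dCt f t : CDon W f -> dC f p (t *: v) = RC t * dC f p v.
  by move=> /(_ p Wp)[L1 [L2 D]]; rewrite !(CD_dC _ D) z1Z z2Z; ring.
have [FD _] := fF; have [GD _] := fG.
have [dF hdF] : exists dF : nat -> R[i], forall j, dC (F j) p v = dF j by exists (fun j => dC (F j) p v).
have [dG hdG] : exists dG : nat -> R[i], forall j, dC (G j) p v = dG j by exists (fun j => dC (G j) p v).
have eF : (fun j => dC (F j) p v) = dF by apply/funext => j; exact: hdF.
have eG : (fun j => dC (G j) p v) = dG by apply/funext => j; exact: hdG.
have {}bqF t : pn (t *: v) <= r -> bnd (A * pn (t *: v) ^+ 2) (fun j => F j (p + t *: v) - F j p - RC t * dF j).
  move=> /bqF; congr bnd; apply/funext => j; congr (_ - _); rewrite -?hdF -?hdG; exact: dCt.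
have {}bqG t : pn (t *: v) <= s -> bnd (B * pn (t *: v) ^+ 2) (fun j => G j (p + t *: v) - G j p - RC t * dG j).
  move=> /bqG; congr bnd; apply/funext => j; congr (_ - _); rewrite -?hdF -?hdG; exact: dCt.
have {}bdF : bnd (A * pn v) dF by rewrite -eF.
have {}bdG : bnd (B * pn v) dG by rewrite -eG.
rewrite eF eG {eF eG hdF hdG}.
set m := pn v; have m0 : 0 <= m := pn_ge0 v.
apply: (@dd_quad _ _ _ _ (A * m ^+ 2 * B + A * m * (B * m) + A * m ^+ 2 * (B * m ^+ 2) + A * (B * m ^+ 2) + (A * m) * (B * m ^+ 2) + (A * m ^+ 2) * (B * m)) (Num.min 1 (Num.min (r / (1 + m)) (s / (1 + m))))).
- have : 0 < 1 + m by lra.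
  by move=> h; rewrite !lt_min ltr01 !divr_gt0.
- by rewrite !addr_ge0 ?mulr_ge0 ?sqr_ge0.
move=> t; have m1 : 0 < 1 + m by lra.
rewrite !lt_min !ltr_pdivlMr // => /andP[t1 /andP[tr ts]].
have t0 := normr_ge0 t.
have pt : pn (t *: v) = `|t| * m by exact: pnZ.
have hr : pn (t *: v) <= r by rewrite pt; nra.
have hs : pn (t *: v) <= s by rewrite pt; nra.
pose x1 := fun j => RC t * dF j; pose x2 := fun j => F j (p + t *: v) - F j p - RC t * dF j.
pose y1 := fun j => RC t * dG j; pose y2 := fun j => G j (p + t *: v) - G j p - RC t * dG j.
have Fx : (F^~ (p + t *: v)) = (fun j => F j p + (x1 j + x2 j)).
  by apply/funext => j; rewrite /x1 /x2; ring.
have Gy : (G^~ (p + t *: v)) = (fun j => G j p + (y1 j + y2 j)).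
  by apply/funext => j; rewrite /y1 /y2; ring.
have bx1 : bnd (`|t| * (A * m)) x1 by rewrite -cabs_real; exact: bndZ (RC t) bdF.
have by1 : bnd (`|t| * (B * m)) y1 by rewrite -cabs_real; exact: bndZ (RC t) bdG.
have bx2 : bnd (A * (`|t| * m) ^+ 2) x2 by rewrite -pt; exact: bqF.
have by2 : bnd (B * (`|t| * m) ^+ 2) y2 by rewrite -pt; exact: bqG.
have bx := bndD bx1 bx2; have byy := bndD by1 by2.
rewrite Fx Gy (prD bF bx (bndD bG byy)) [pr (F^~ p) _]prC [pr (fun j => x1 j + x2 j) _]prC.
rewrite (prD bG byy bF) (prD bG byy bx) (prD by1 by2 bF) (prD by1 by2 bx).
rewrite ![pr _ (fun j => x1 j + x2 j)]prC (prD bx1 bx2 bG) (prD bx1 bx2 by1) (prD bx1 bx2 by2).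
rewrite (prZ t bdF bG) (prZ t bdG bF) [pr dG _]prC [pr (G^~ p) (F^~ p)]prC.
have e1 := pr_bound bx1 by1; have e2 := pr_bound bx1 by2; have e3 := pr_bound bx2 by1.
have e4 := pr_bound bx2 by2; have e5 := pr_bound bx2 bG; have e6 := pr_bound by2 bF.
set a1 := pr x1 y1 in e1 *; set a2 := pr x1 y2 in e2 *; set a3 := pr x2 y1 in e3 *; set a4 := pr x2 y2 in e4 *.
set a5 := pr x2 _ in e5 *; set a6 := pr y2 _ in e6 *.
set b0 := pr (F^~ p) (G^~ p); set b1 := pr dF _; set b2 := pr (F^~ p) _.
have -> : b0 + (t * b2 + a6) + (t * b1 + a5 + (a1 + a3 + (a2 + a4))) - b0 - t * (b1 + b2) = a1 + a2 + a3 + a4 + a5 + a6 by ring.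
have tt : t ^+ 2 = `|t| ^+ 2 by rewrite real_normK ?num_real.
have tri : `|a1 + a2 + a3 + a4 + a5 + a6| <= `|a1| + `|a2| + `|a3| + `|a4| + `|a5| + `|a6|.
  by do 4 (apply: le_trans (ler_normD _ _) _; rewrite lerD2r); exact: ler_normD.
apply: le_trans tri _; rewrite tt.
have c3 : `|t| ^+ 3 <= `|t| ^+ 2 by rewrite exprS; apply: ler_piMl; [exact: exprn_ge0 | exact: ltW].
have c4 : `|t| ^+ 4 <= `|t| ^+ 2.
  by apply: le_trans c3; rewrite exprS; apply: ler_piMl; [exact: exprn_ge0 | exact: ltW].
have f2 : `|a2| <= A * m * (B * m ^+ 2) * `|t| ^+ 2.
  apply: le_trans e2 _; have -> : `|t| * (A * m) * (B * (`|t| * m) ^+ 2) = A * m * (B * m ^+ 2) * `|t| ^+ 3 by ring.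
  by apply: ler_wpM2l c3; rewrite !mulr_ge0 ?sqr_ge0.
have f3 : `|a3| <= A * m ^+ 2 * (B * m) * `|t| ^+ 2.
  apply: le_trans e3 _; have -> : A * (`|t| * m) ^+ 2 * (`|t| * (B * m)) = A * m ^+ 2 * (B * m) * `|t| ^+ 3 by ring.
  by apply: ler_wpM2l c3; rewrite !mulr_ge0 ?sqr_ge0.
have f4 : `|a4| <= A * m ^+ 2 * (B * m ^+ 2) * `|t| ^+ 2.
  apply: le_trans e4 _; have -> : A * (`|t| * m) ^+ 2 * (B * (`|t| * m) ^+ 2) = A * m ^+ 2 * (B * m ^+ 2) * `|t| ^+ 4 by ring.
  by apply: ler_wpM2l c4; rewrite !mulr_ge0 ?sqr_ge0.
have -> : (A * m ^+ 2 * B + A * m * (B * m) + A * m ^+ 2 * (B * m ^+ 2) + A * (B * m ^+ 2) + (A * m) * (B * m ^+ 2) + (A * m ^+ 2) * (B * m)) * `|t| ^+ 2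
  = `|t| * (A * m) * (`|t| * (B * m)) + A * m * (B * m ^+ 2) * `|t| ^+ 2 + A * m ^+ 2 * (B * m) * `|t| ^+ 2 + A * m ^+ 2 * (B * m ^+ 2) * `|t| ^+ 2 + A * (`|t| * m) ^+ 2 * B + B * (`|t| * m) ^+ 2 * A by ring.
by rewrite !lerD.
Qed.
End Families.

(** * The Bergman form in terms of an orthonormal system *)

Section BergmanForm.
Variables (R : realType) (W : set (C2 R)) (phi : nat -> C2 R -> R[i]).
Hypotheses (oW : opn W) (fphi : fam W phi).
Implicit Types (p q a b v : C2 R).
Local Notation RC x := (Complex x 0).
Local Notation I1 := (Complex 0 1).
Local Notation K q := (pr (phi^~ q) (phi^~ q)).
Local Notation dphi v := (fun j q => dC (phi j) q v).
Hypothesis Kpos : forall q, W q -> 0 < K q.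

Lemma bergman_diagE : bergman_diag phi = (fun q => K q).
Proof.
apply/funext => q; rewrite /pr (_ : (fun n => prn n _ _) = (fun n => \sum_(j < n) complex.Re (phi j q * (phi j q)^*))) //.
by apply/funext => n; rewrite /prn big_mkord.
Qed.

Lemma CDon_bnd F p : fam W F -> W p -> exists A, bnd A (F^~ p).
Proof. by move=> [_ H] /H[r [A [r0 _ hA]]]; exists A; apply: hA; exact: pball_center. Qed.

Lemma dd_diag p b : W p -> dd (bergman_diag phi) p b (2 * pr (dphi b ^~ p) (phi^~ p)).
Proof.
move=> Wp; have := pr_deriv b oW fphi fphi Wp.
by rewrite [X in _ + X]prC bergman_diagE mulrDl mul1r.
Qed.

Lemma dd_ln (u : C2 R -> R) p b l : 0 < u p -> dd u p b l -> dd (fun q => ln (u q)) p b (l / u p).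
Proof.
move=> u0 /dd_is_derive D; apply/dd_is_derive.
have D2 : is_derive (u (p + (0 : R) *: b)) (1 : R) (@ln R) (u p)^-1.
  by rewrite scale0r addr0; exact: is_derive1_ln.
by rewrite mulrC; exact: (@is_derive1_comp R (@ln R) (fun t : R => u (p + t *: b))).
Qed.

Lemma dd_div (u w : C2 R -> R) p b l m : w p != 0 -> dd u p b l -> dd w p b m ->
  dd (fun q => u q / w q) p b (l / w p - u p * m / w p ^+ 2).
Proof.
move=> w0 /dd_is_derive Du /dd_is_derive Dw; apply/dd_is_derive.
have w0' : w (p + (0 : R) *: b) != 0 by rewrite scale0r addr0.
have Dv := is_deriveV w0' Dw.
apply: (@is_derive_eq _ _ _ _ _ _ _ _ (is_deriveM Du Dv)).
rewrite /= !scale0r !addr0 /GRing.scale /=; field; exact: w0.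
Qed.

Lemma D2_lnK p a b : W p -> D2 a b (fun q => ln (bergman_diag phi q)) p =
  2 * (pr (fun j => dC (fun q => dC (phi j) q b) p a) (phi^~ p) + pr (dphi b ^~ p) (dphi a ^~ p)) / K p
  - 2 * pr (dphi b ^~ p) (phi^~ p) * (2 * pr (dphi a ^~ p) (phi^~ p)) / K p ^+ 2.
Proof.
move=> Wp; rewrite /D2; apply: dd_derive.
have K0 : K p != 0 by rewrite gt_eqF // Kpos.
have d0 : bergman_diag phi p != 0 by rewrite bergman_diagE.
have -> : K p = bergman_diag phi p by rewrite bergman_diagE.
have E q : W q -> 'D_b (fun q => ln (bergman_diag phi q)) q = 2 * pr (dphi b ^~ q) (phi^~ q) / bergman_diag phi q.
  by move=> Wq; apply: dd_derive; apply: dd_ln (dd_diag b Wq); rewrite bergman_diagE; exact: Kpos.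
apply: (dd_near oW Wp E); apply: (dd_div d0 _ (dd_diag a Wp)).
have := pr_deriv a oW (fam_d b oW fphi) fphi Wp.
move=> /dd_is_derive D; apply/dd_is_derive.
Qed.


Lemma prNl A B (x y : nat -> R[i]) : bnd A x -> bnd B y -> pr (fun j => - x j) y = - pr x y.
Proof.
move=> hx hy; rewrite -mulN1r -(prZ (-1) hx hy); congr pr; apply/funext => j.
by apply: complexP; rewrite ?reN ?imN ?reM ?imM /=; ring.
Qed.

Lemma prIr A B (x y : nat -> R[i]) : bnd A x -> bnd B y -> pr x (fun j => I1 * y j) = - pr (fun j => I1 * x j) y.
Proof.
move=> hx hy; rewrite -(prI x) prC.
have -> : (fun j => I1 * (I1 * y j)) = (fun j => - y j).
  by apply/funext => j; apply: complexP; rewrite ?reN ?imN ?reM ?imM ?reM ?imM /=; ring.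
by rewrite (prNl hy (bndZ I1 hx)) prC.
Qed.

Lemma prII A (x : nat -> R[i]) : bnd A x -> pr (fun j => I1 * x j) x = 0.
Proof. by move=> hx; have := prIr hx hx; rewrite prC; lra. Qed.

Lemma dC_ey f p : CDon W f -> W p -> (dC f p (ey1 R) = I1 * dC f p (ex1 R)) /\ (dC f p (ey2 R) = I1 * dC f p (ex2 R)).
Proof.
move=> fD /fD[L1 [L2 D]]; rewrite !(CD_dC _ D).
have [a1 a2 a3 a4] : [/\ z1 (ex1 R) = 1, z2 (ex1 R) = 0, z1 (ex2 R) = 0 & z2 (ex2 R) = 1] by [].
have [b1 b2 b3 b4] : [/\ z1 (ey1 R) = I1, z2 (ey1 R) = 0, z1 (ey2 R) = 0 & z2 (ey2 R) = I1] by [].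
by rewrite a1 a2 a3 a4 b1 b2 b3 b4; split; ring.
Qed.

Lemma dC_ydir f p j : CDon W f -> W p -> dC f p (ydir R j) = I1 * dC f p (xdir R j).
Proof. by move=> fD Wp; have [h1 h2] := dC_ey fD Wp; rewrite /ydir /xdir; case: ifP. Qed.

Lemma dC_near f g p v : CDon W f -> W p -> (forall q, W q -> g q = f q) -> dC g p v = dC f p v.
Proof.
move=> fD Wp gf; have [r r0 rW] := oW Wp; have [L1 [L2 D]] := fD p Wp.
have E q : pball p r q -> f q = g q by move=> /rW/gf.
by rewrite (CD_dC v (CD_near r0 E D)) (CD_dC v D).
Qed.

Lemma dC_scale f p v c : CDon W f -> W p -> dC (fun q => c * f q) p v = c * dC f p v.
Proof. by move=> fD /fD[L1 [L2 D]]; rewrite (CD_dC v (CD_scale c D)) (CD_dC v D); ring. Qed.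

(** Derivatives of holomorphic functions along [ydir] are [i] times those along [xdir]. The second
    derivatives [s] of the [phi n] therefore cancel in the mixed derivative, and only products of
    first derivatives remain. *)
Lemma ddbar_lnK p j k (X : 'I_2 -> nat -> R[i]) : W p -> (forall i, (dphi (xdir R i) ^~ p) = X i) -> ddbar (xdir R j) (ydir R j) (xdir R k) (ydir R k) (fun q => ln (bergman_diag phi q)) p =
  Complex (pr (X k) (X j) / K p - (pr (X k) (phi^~ p) * pr (X j) (phi^~ p)
     + pr (fun n => I1 * X k n) (phi^~ p) * pr (fun n => I1 * X j n) (phi^~ p)) / K p ^+ 2)
    (pr (fun n => I1 * X k n) (X j) / K p - (pr (fun n => I1 * X k n) (phi^~ p) * pr (X j) (phi^~ p)
     - pr (X k) (phi^~ p) * pr (fun n => I1 * X j n) (phi^~ p)) / K p ^+ 2).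
Proof.
move=> Wp hx; have [FD _] := fphi.
have FDd i v := dC_CDon v oW (FD i).
have D a b (xa xb s : nat -> R[i]) : (dphi a ^~ p) = xa -> (dphi b ^~ p) = xb -> (fun j => dC (fun q => dC (phi j) q b) p a) = s ->
    D2 a b (fun q => ln (bergman_diag phi q)) p = 2 * (pr s (phi^~ p) + pr xb xa) / K p
      - 2 * pr xb (phi^~ p) * (2 * pr xa (phi^~ p)) / K p ^+ 2.
  by move=> <- <- <-; exact: D2_lnK.
have hy i : (dphi (ydir R i) ^~ p) = (fun n => I1 * X i n).
  by rewrite -hx; apply/funext => n; exact: dC_ydir.
have [s hs] : exists s : nat -> R[i], (fun n => dC (fun q => dC (phi n) q (xdir R k)) p (xdir R j)) = s by eexists.
have hxy : (fun n => dC (fun q => dC (phi n) q (xdir R k)) p (ydir R j)) = (fun n => I1 * s n).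
  by rewrite -hs; apply/funext => n; exact: dC_ydir.
have hyx v : (fun n => dC (fun q => dC (phi n) q (ydir R k)) p v) = (fun n => I1 * dC (fun q => dC (phi n) q (xdir R k)) p v).
  apply/funext => n; rewrite -(dC_scale v I1 (FDd n (xdir R k)) Wp).
  have D2 : CDon W (fun q => I1 * dC (phi n) q (xdir R k)).
    by move=> q /(FDd n (xdir R k))[L1 [L2 D']]; have := CD_scale I1 D'; eexists; eexists; eauto.
  by apply: (dC_near v D2 Wp) => q; exact: dC_ydir.
have hyx1 : (fun n => dC (fun q => dC (phi n) q (ydir R k)) p (xdir R j)) = (fun n => I1 * s n) by rewrite hyx -hs.
have hyy : (fun n => dC (fun q => dC (phi n) q (ydir R k)) p (ydir R j)) = (fun n => - s n).
  rewrite hyx; apply/funext => n; have := congr1 (fun u => u n) hxy => /= ->.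
  by apply: complexP; rewrite ?reN ?imN ?reM ?imM ?reM ?imM /=; ring.
have [A hA] : exists A, bnd A (phi^~ p) by exact: CDon_bnd fphi Wp.
have bX i : exists B, bnd B (X i) by rewrite -hx; exact: CDon_bnd (fam_d (xdir R i) oW fphi) Wp.
have [B hB] := bX k; have [B' hB'] := bX j.
have [S hS] : exists S, bnd S s by rewrite -hs; exact: CDon_bnd (fam_d (xdir R j) oW (fam_d (xdir R k) oW fphi)) Wp.
rewrite /ddbar (D _ _ _ _ _ (hx j) (hx k) hs) (D _ _ _ _ _ (hy j) (hy k) hyy) (D _ _ _ _ _ (hx j) (hy k) hyx1) (D _ _ _ _ _ (hy j) (hx k) hxy).
rewrite (prNl hS hA) (prI (X k)) (prIr hB hB').
have K0 : K p != 0 by rewrite gt_eqF // Kpos.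
by congr Complex; field; exact: K0.
Qed.

(** The classical [|b|^2 / K - |<b, phi>|^2 / K^2] with [b = d phi (v)]; the two squares are those
    of the real and the imaginary part of [<b, phi>]. *)
Lemma bergman_formE p v (b : nat -> R[i]) : W p -> (dphi v ^~ p) = b ->
  complex.Re (bergman_form phi p v) = pr b b / K p -
    (pr b (phi^~ p) ^+ 2 + pr (fun n => I1 * b n) (phi^~ p) ^+ 2) / K p ^+ 2.
Proof.
move=> Wp hb0; have [FD _] := fphi.
have [x hxE] : exists x : nat -> R[i], (dphi (ex1 R) ^~ p) = x by eexists.
have [y hyE] : exists y : nat -> R[i], (dphi (ex2 R) ^~ p) = y by eexists.
have -> : b = (fun n => z1 v * x n + z2 v * y n).
  rewrite -hb0 -hxE -hyE; apply/funext => n; have [L1 [L2 D]] := FD n p Wp; rewrite (CD_dC v D).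
  by have [<- <-] := CD_dC1 D; ring.
have hX i : (dphi (xdir R i) ^~ p) = (if val i == 0%N then x else y).
  by rewrite /xdir; case: ifP => _; [exact: hxE | exact: hyE].
rewrite /bergman_form !big_ord_recl !big_ord0 !addr0 !(ddbar_lnK _ _ Wp hX).
have c0 : ccoord v ord0 = z1 v by [].
have c1 : ccoord v (lift ord0 ord0) = z2 v by [].
rewrite c0 c1 {c0 c1}.
have [A hA] : exists A, bnd A (phi^~ p) by exact: CDon_bnd fphi Wp.
have [B hx] : exists B, bnd B x by rewrite -hxE; exact: CDon_bnd (fam_d (ex1 R) oW fphi) Wp.
have [C hy] : exists C, bnd C y by rewrite -hyE; exact: CDon_bnd (fam_d (ex2 R) oW fphi) Wp.
have K0 : K p != 0 by rewrite gt_eqF // Kpos.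
case: (z1 v) (z2 v) => [a1 b1] [a2 b2]; rewrite /=.
have ix := bndZ I1 hx; have iy := bndZ I1 hy.
have rx (t : R) := bndZ (RC t) hx; have ry (t : R) := bndZ (RC t) hy.
have rix (t : R) := bndZ (RC t) ix; have riy (t : R) := bndZ (RC t) iy.
have E : (fun n => Complex a1 b1 * x n + Complex a2 b2 * y n) =
   (fun n => (RC a1 * x n + RC b1 * (I1 * x n)) + (RC a2 * y n + RC b2 * (I1 * y n))).
  apply/funext => n; apply: complexP; rewrite !(reD, imD, reM, imM) /=; ring.
have E' : (fun n => I1 * (Complex a1 b1 * x n + Complex a2 b2 * y n)) =
   (fun n => (RC (- b1) * x n + RC a1 * (I1 * x n)) + (RC (- b2) * y n + RC a2 * (I1 * y n))).
  apply/funext => n; apply: complexP; rewrite !(reD, imD, reM, imM) /=; ring.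
have lin (c1 d1 c2 d2 : R) D (w : nat -> R[i]) : bnd D w ->
    pr (fun n => (RC c1 * x n + RC d1 * (I1 * x n)) + (RC c2 * y n + RC d2 * (I1 * y n))) w =
    c1 * pr x w + d1 * pr (fun n => I1 * x n) w + (c2 * pr y w + d2 * pr (fun n => I1 * y n) w).
  move=> hw; rewrite (prD (bndD (rx c1) (rix d1)) (bndD (ry c2) (riy d2)) hw).
  rewrite (prD (rx c1) (rix d1) hw) (prD (ry c2) (riy d2) hw).
  by rewrite (prZ c1 hx hw) (prZ d1 ix hw) (prZ c2 hy hw) (prZ d2 iy hw).
have hb := bndD (bndD (rx a1) (rix b1)) (bndD (ry a2) (riy b2)).
rewrite E' E (lin _ _ _ _ _ _ hA) (lin _ _ _ _ _ _ hA) (lin _ _ _ _ _ _ hb).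
rewrite ![pr _ (fun n => _ + (_ + _))]prC.
rewrite (lin _ _ _ _ _ _ hx) (lin _ _ _ _ _ _ hy) (lin _ _ _ _ _ _ ix) (lin _ _ _ _ _ _ iy).
rewrite !prI (prII hx) (prII hy) (prIr hx hx) (prIr hx hy) (prIr hy hx) (prIr hy hy).
rewrite (prII hx) (prII hy) [pr y x]prC.
have -> : pr (fun n => I1 * y n) x = - pr (fun n => I1 * x n) y by rewrite prC (prIr hx hy).
by field; exact: K0.
Qed.

End BergmanForm.

(** * The inner product of [A^2(W)], orthonormal sums and Bessel's inequality *)

Section HilbertA2.
Variables (R : realType) (W : set (C2 R)).
Hypothesis oW : opn W.
Implicit Types (f g h : C2 R -> R[i]).
Local Notation RC x := (Complex x 0).
Local Notation I1 := (Complex 0 1).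
Local Notation T2 := (measurableTypeR R * measurableTypeR R)%type.
Local Notation T4 := (T2 * T2)%type.

Definition Nm f : \bar R := (\int[mu4 R]_(p in (W : set T4)) (sqmod (f p))%:E)%E.
(** The real part of [inner] as a real integral; [innerE] recovers the imaginary part from [i f]. *)
Definition ip f g : R := \int[mu4 R]_(p in (W : set T4)) complex.Re (f p * (g p)^*).

Lemma A2P f : A2 W f <-> CDon W f /\ (Nm f < +oo)%E.
Proof. by rewrite /A2 holo_CDon. Qed.

Lemma A2_sq f : A2 W f -> (mu4 R).-integrable (W : set T4) (EFin \o (fun p => sqmod (f p))).
Proof.
move=> /A2P[fD fN]; apply/integrableP; split.
  by apply/measurable_EFinP; exact: sqmod_measurable.
by under eq_integral => p _ do rewrite /= ger0_norm ?sqmod_ge0 //.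
Qed.

Lemma sq_A2 f : CDon W f -> (mu4 R).-integrable (W : set T4) (EFin \o (fun p => sqmod (f p))) -> A2 W f.
Proof.
move=> fD /integrableP[_ H]; apply/A2P; split => //; apply: le_lt_trans H.
by rewrite /Nm; under [leRHS]eq_integral => p _ do rewrite /= ger0_norm ?sqmod_ge0 //.
Qed.

Lemma re_mulJ_measurable f g : CDon W f -> CDon W g -> measurable_fun (W : set T4) (fun p : T4 => complex.Re (f p * (g p)^*)).
Proof.
move=> fD gD; have [m1 m2] := holo_measurable oW fD; have [m3 m4] := holo_measurable oW gD.
have -> : (fun p : T4 => complex.Re (f p * (g p)^*)) = (fun p : T4 => complex.Re (f p) * complex.Re (g p) + complex.Im (f p) * complex.Im (g p)).
  by apply/funext => p; rewrite reM reJ imJ; ring.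
by apply: measurable_funD; exact: measurable_funM.
Qed.

Lemma ip_integrable f g : A2 W f -> A2 W g ->
  (mu4 R).-integrable (W : set T4) (EFin \o (fun p => complex.Re (f p * (g p)^*))).
Proof.
move=> hf hg; have [fD _] := A2P f; have [/fD[{}fD _] /(A2P g)[gD _]] := (hf, hg).
have mW := opn_measurable oW.
apply: (le_integrable mW _ _ (integrableD mW (A2_sq hf) (A2_sq hg))).
  by apply/measurable_EFinP; exact: re_mulJ_measurable.
move=> p _; have s0 : 0 <= sqmod (f p) + sqmod (g p) by rewrite addr_ge0 ?sqmod_ge0.
suff H : `|complex.Re (f p * (g p)^*)| <= `|sqmod (f p) + sqmod (g p)| by exact: H.
rewrite [leRHS]ger0_norm //.
apply: le_trans (Re_cabs _) _; rewrite cabsM cabs_conj -!sqr_cabs.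
have := cabs_ge0 (f p); have := cabs_ge0 (g p); have := sqr_ge0 (cabs (f p) - cabs (g p)).
by rewrite !expr2; nra.
Qed.

Lemma A2Z c f : A2 W f -> A2 W (fun p => c * f p).
Proof.
move=> hf; have [fD _] := (A2P f).1 hf; apply: sq_A2.
  by move=> p /fD[L1 [L2 D]]; have := CD_scale c D; eexists; eexists; eauto.
have mW := opn_measurable oW.
have -> : (EFin \o (fun p : T4 => sqmod (c * f p))) = (fun p : T4 => ((sqmod c)%:E * (EFin \o (fun p : T4 => sqmod (f p))) p)%E).
  by apply/funext => p; rewrite /= sqmodM.
exact: (integrableZl mW (sqmod c) (A2_sq hf)).
Qed.

Lemma A2D f g : A2 W f -> A2 W g -> A2 W (fun p => f p + g p).
Proof.
move=> hf hg; have [fD _] := (A2P f).1 hf; have [gD _] := (A2P g).1 hg.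
have D : CDon W (fun p => f p + g p).
  by move=> p Wp; have [L1 [L2 D1]] := fD p Wp; have [M1 [M2 D2]] := gD p Wp; have := CD_add D1 D2; eexists; eexists; eauto.
apply: sq_A2 => //; have mW := opn_measurable oW.
apply: (le_integrable mW _ _ (integrableZl mW (2 : R) (integrableD mW (A2_sq hf) (A2_sq hg)))).
  by apply/measurable_EFinP; exact: sqmod_measurable.
move=> p _; have s0 : 0 <= 2 * (sqmod (f p) + sqmod (g p)) by apply: mulr_ge0 => //; apply: addr_ge0; exact: sqmod_ge0.
suff H : `|sqmod (f p + g p)| <= `|2 * (sqmod (f p) + sqmod (g p))| by exact: H.
rewrite !ger0_norm ?sqmod_ge0 //.
rewrite /sqmod reD imD; have := sqr_ge0 (complex.Re (f p) - complex.Re (g p)).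
by have := sqr_ge0 (complex.Im (f p) - complex.Im (g p)); rewrite !expr2; lra.
Qed.

Lemma ipC f g : ip f g = ip g f.
Proof. by apply: eq_Rintegral => p _; exact: re_mulJC. Qed.

Lemma ipD f f' g : A2 W f -> A2 W f' -> A2 W g -> ip (fun p => f p + f' p) g = ip f g + ip f' g.
Proof.
move=> hf hf' hg; rewrite /ip -(RintegralD (opn_measurable oW) (ip_integrable hf hg) (ip_integrable hf' hg)).
by apply: eq_Rintegral => p _; rewrite mulrDl reD.
Qed.

Lemma ipZ (t : R) f g : A2 W f -> A2 W g -> ip (fun p => RC t * f p) g = t * ip f g.
Proof.
move=> hf hg; rewrite /ip -(RintegralZl t (opn_measurable oW) (ip_integrable hf hg)).
by apply: eq_Rintegral => p _; rewrite -mulrA reM /= mul0r subr0.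
Qed.

Lemma ipIr f g : A2 W f -> A2 W g -> ip f (fun p => I1 * g p) = - ip (fun p => I1 * f p) g.
Proof.
move=> hf hg; have := ipZ (-1) (A2Z I1 hf) hg; rewrite mulN1r => <-.
by apply: eq_Rintegral => p _; rewrite !(reM, reJ, imJ, imM, reM) /=; ring.
Qed.

Lemma ip_ge0 f : 0 <= ip f f.
Proof. by apply: Rintegral_ge0 => p _; rewrite re_mulJ sqmod_ge0. Qed.

Lemma NmE f : A2 W f -> Nm f = (ip f f)%:E.
Proof.
move=> hf; rewrite /ip /Rintegral fineK; last first.
  by have H := ip_integrable hf hf; exact: (integrable_fin_num (opn_measurable oW) H).
by apply: eq_integral => p _; rewrite re_mulJ.
Qed.

Lemma innerE f g : A2 W f -> A2 W g -> inner W f g = Complex (ip f g) (- ip (fun p => I1 * f p) g).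
Proof.
move=> hf hg; rewrite /inner; congr Complex.
have := ipZ (-1) (A2Z I1 hf) hg; rewrite mulN1r => <-.
rewrite leb4E /ip /Rintegral; congr (fine _); apply: eq_integral => p _; congr EFin.
by rewrite !(reM, reJ, imJ, imM, reM) /=; ring.
Qed.

Lemma ip_lin c f g : A2 W f -> A2 W g -> ip (fun p => c * f p) g = complex.Re (c * inner W f g).
Proof.
move=> hf hg; rewrite innerE // reM /= -(ipZ _ hf hg) mulrN opprK -(ipZ _ (A2Z I1 hf) hg) -ipD //; last 2 first.
- exact: A2Z.
- by apply: A2Z; exact: A2Z.
by apply: eq_Rintegral => p _; congr (complex.Re (_ * _)); case: c => a b; apply: complexP; rewrite !(reD, imD, reM, imM) /=; ring.
Qed.

Lemma innerD f f' g : A2 W f -> A2 W f' -> A2 W g -> inner W (fun p => f p + f' p) g = inner W f g + inner W f' g.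
Proof.
move=> hf hf' hg; have iD := A2D hf hf'; rewrite !innerE //; apply: complexP; rewrite !(reD, imD) /=.
  exact: ipD.
rewrite -opprD -ipD //; try exact: A2Z.
by congr (- _); apply: eq_Rintegral => p _; rewrite mulrDr.
Qed.

Lemma innerZ c f g : A2 W f -> A2 W g -> inner W (fun p => c * f p) g = c * inner W f g.
Proof.
move=> hf hg; rewrite (innerE (A2Z c hf) hg) (ip_lin c hf hg).
have -> : (fun p => I1 * (c * f p)) = (fun p => (I1 * c) * f p) by apply/funext => p; rewrite mulrA.
rewrite (ip_lin (I1 * c) hf hg); move: (inner W f g) => w.
by apply: complexP; rewrite !(reM, imM) /=; ring.
Qed.

Lemma ip_expand f g : A2 W f -> A2 W g -> ip (fun p => f p + g p) (fun p => f p + g p) = ip f f + 2 * ip f g + ip g g.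
Proof.
move=> hf hg; have h := A2D hf hg; rewrite (ipD hf hg h) ![ip _ (fun p => _ + _)]ipC.
by rewrite (ipD hf hg hf) (ipD hf hg hg) (ipC g f); ring.
Qed.

Lemma ip_sq c f : A2 W f -> ip (fun p => c * f p) (fun p => c * f p) = sqmod c * ip f f.
Proof.
move=> hf; rewrite /ip -(RintegralZl _ (opn_measurable oW) (ip_integrable hf hf)).
by apply: eq_Rintegral => p _; rewrite !re_mulJ sqmodM.
Qed.

Variable phi : nat -> C2 R -> R[i].
Hypothesis ONB : complete_orthonormal W phi.

Definition comb (c : nat -> R[i]) n m q := \sum_(n <= j < m) c j * phi j q.

Let phiA j : A2 W (phi j). Proof. by have [] := ONB. Qed.
Let phiO i j : inner W (phi i) (phi j) = (i == j)%:R. Proof. by have [] := ONB. Qed.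
Let phiN j : ip (phi j) (phi j) = 1.
Proof. by have := phiO j j; rewrite innerE // eqxx => -[]. Qed.

Lemma A2_0 : A2 W (fun=> 0).
Proof. by have := A2Z 0 (phiA 0%N); rewrite (_ : (fun p => _) = (fun=> 0)) //; apply/funext => p; rewrite mul0r. Qed.

Lemma comb_id c n q : comb c n n q = 0.
Proof. by rewrite /comb big_geq. Qed.

Lemma comb_recr c n m : (n <= m)%N -> comb c n m.+1 = (fun q => comb c n m q + c m * phi m q).
Proof. by move=> nm; apply/funext => q; rewrite /comb big_nat_recr. Qed.

Lemma comb_A2 c n k : A2 W (comb c n (n + k)).
Proof.
elim: k => [|k IH]; first by rewrite addn0 (_ : comb c n n = fun=> 0); [exact: A2_0 | apply/funext => q; exact: comb_id].
by rewrite addnS comb_recr ?leq_addr //; apply: A2D => //; exact: A2Z.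
Qed.

Lemma comb_inner c n k i : inner W (comb c n (n + k)) (phi i) = if (n <= i < n + k)%N then c i else 0.
Proof.
elim: k => [|k IH].
  rewrite addn0 ifF; last by lia.
  have -> : comb c n n = (fun q => 0 * phi 0%N q) by apply/funext => q; rewrite comb_id mul0r.
  by rewrite innerZ // mul0r.
rewrite addnS comb_recr ?leq_addr // innerD ?innerZ ?phiO ?IH //; try exact: comb_A2; last exact: A2Z.
have [e|ne] := eqVneq (n + k)%N i; first by rewrite e mulr1 ltnn andbF add0r -e leq_addr ltnS leqnn.
by rewrite mulr0 addr0; congr (if _ then _ else _); lia.
Qed.

Lemma ip_step f c m : A2 W f -> ip (fun q => f q + c * phi m q) (fun q => f q + c * phi m q) =
  ip f f + 2 * complex.Re (c^* * inner W f (phi m)) + sqmod c.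
Proof.
move=> hf; rewrite (ip_expand hf (A2Z c (phiA m))) ip_sq // phiN mulr1; congr (_ + 2 * _ + _).
rewrite ipC ip_lin // !innerE // ipC [ip _ (phi m)]ipC.
rewrite [ip (fun p => I1 * f p) _]ipC (ipIr _ hf) // opprK; case: c => a b.
by rewrite !reM !reJ !imJ /=; ring.
Qed.

Lemma comb_norm c n k : ip (comb c n (n + k)) (comb c n (n + k)) = sq2 (n + k) c - sq2 n c.
Proof.
elim: k => [|k IH].
  have -> : comb c n (n + 0) = (fun q => 0 * phi 0%N q) by apply/funext => q; rewrite addn0 comb_id mul0r.
  by rewrite ip_sq // addn0 subrr /sqmod /= expr0n addr0 mul0r.
rewrite addnS comb_recr ?leq_addr // ip_step; last exact: comb_A2.
rewrite comb_inner ifF; last lia.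
by rewrite mulr0 /= mulr0 addr0 IH /sq2 big_nat_recr //=; ring.
Qed.

Lemma bessel h n : A2 W h -> let c j := inner W h (phi j) in
  A2 W (fun q => h q - comb c 0 n q) /\ ip (fun q => h q - comb c 0 n q) (fun q => h q - comb c 0 n q) = ip h h - sq2 n c.
Proof.
move=> hh c.
have E m : (fun q => h q - comb c 0 m q) = (fun q => h q + -1 * comb c 0 m q) by apply/funext => q; rewrite mulN1r.
have Am m : A2 W (fun q => h q - comb c 0 m q) by rewrite E; apply: A2D => //; apply: A2Z; exact: (comb_A2 c 0 m).
split=> //; elim: n => [|n IH].
  rewrite /sq2 big_geq // subr0; have -> // : (fun q => h q - comb c 0 0 q) = h.
  by apply/funext => q; rewrite comb_id subr0.
have -> : (fun q => h q - comb c 0 n.+1 q) = (fun q => (h q - comb c 0 n q) + (- c n) * phi n q).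
  by apply/funext => q; rewrite comb_recr // mulNr opprD addrA.
rewrite ip_step // IH E innerD ?innerZ //; try exact: (comb_A2 c 0 n); last by apply: A2Z; exact: (comb_A2 c 0 n).
rewrite (comb_inner c 0 n) add0n ltnn andbF mulr0 addr0 -/(c n) /sq2 big_nat_recr //=.
by rewrite /sqmod !(reM, reJ, imJ, reN, imN) /=; ring.
Qed.

Lemma bessel_le h n : A2 W h -> sq2 n (fun j => inner W h (phi j)) <= ip h h.
Proof. by move=> hh; have [_ E] := bessel n hh; rewrite -subr_ge0 -E ip_ge0. Qed.

Lemma bessel_bnd h : A2 W h -> bnd (Num.sqrt (ip h h)) (fun j => inner W h (phi j)).
Proof. by move=> hh; split=> [|n]; rewrite ?sqrtr_ge0 // sqr_sqrtr ?ip_ge0 //; exact: bessel_le. Qed.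

Lemma mean_value_ip r : 0 < r -> exists2 C, 0 < C & forall f p, pball p r `<=` W -> A2 W f -> sqmod (f p) <= C * ip f f.
Proof.
move=> r0; have [C C0 H] := mean_value_L2 r0; exists (1 + C); first by lra.
move=> f p pW hf; have [fD _] := (A2P f).1 hf.
have := H W f p oW pW fD; rewrite -/(Nm f) (NmE hf) -EFinM lee_fin => h.
by apply: le_trans h _; rewrite ler_wpM2r ?ip_ge0 // lerDr.
Qed.

(** The square sum of the [phi j] at a point is a squared operator norm: a combination with
    coefficients of norm at most 1 has [L^2] norm at most 1, so the mean value inequality bounds its
    value, and [dualize] concludes. This gives local boundedness of the Bergman kernel. *)
Lemma fam_phi : fam W phi.
Proof.
split=> [j|p Wp]; first by have [] := (A2P (phi j)).1 (phiA j).
have [r0 r00 rW] := oW Wp; pose r : R := r0 / 2; have r0' : 0 < r by rewrite divr_gt0.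
have [C C0 hC] := mean_value_ip r0'.
exists r, (Num.sqrt C); split => //.
  by apply: subset_trans rW; apply: pball_sub; rewrite subrr pn0 /r; lra.
move=> q qr; have qW : pball q r `<=` W.
  by apply: subset_trans rW; apply: pball_sub; move: qr; rewrite /pball /= /r; lra.
split=> [|n]; first exact: sqrtr_ge0.
apply: dualize => [|c cn]; first exact: sqrtr_ge0.
rewrite -(@ler_pXn2r _ 2) ?nnegrE ?cabs_ge0 ?sqrtr_ge0 // sqr_cabs sqr_sqrtr ?(ltW C0) //.
have := hC (comb c 0 n) q qW (comb_A2 c 0 n); rewrite (comb_norm c 0 n).
have -> : sq2 0 c = 0 by rewrite /sq2 big_geq.
by rewrite subr0 => h; apply: le_trans h _; rewrite ger_pMr.
Qed.
End HilbertA2.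

(** * Locally uniform convergence of orthonormal expansions *)

Section Expansion.
Variables (R : realType) (W : set (C2 R)) (phi : nat -> C2 R -> R[i]).
Hypotheses (oW : opn W) (ONB : complete_orthonormal W phi).
Implicit Types (f g h : C2 R -> R[i]).
Local Notation T2 := (measurableTypeR R * measurableTypeR R)%type.
Local Notation T4 := (T2 * T2)%type.

Lemma comb_sub c (n m : nat) q : (n <= m)%N -> comb phi c 0 m q - comb phi c 0 n q = comb phi c n m q.
Proof. by move=> nm; rewrite /comb (@big_cat_nat _ _ _ n 0%N m) //= addrAC subrr add0r. Qed.

Lemma fatou_Nm (f : nat -> C2 R -> R[i]) g (e : R) : (forall n, CDon W (f n)) ->
  (forall q, W q -> forall e, 0 < e -> exists N, forall n, (N <= n)%N -> cabs (f n q - g q) <= e) ->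
  (forall n, (Nm W (f n) <= e%:E)%E) -> (Nm W g <= e%:E)%E.
Proof.
move=> fD fg fe; have mW := opn_measurable oW.
have mf n : measurable_fun (W : set T4) (fun p : T4 => (sqmod (f n p))%:E).
  by apply/measurable_EFinP; exact: sqmod_measurable.
have cv q : W q -> (sqmod (f n q))%:E @[n --> \oo] --> (sqmod (g q))%:E.
  move=> Wq; apply: cvg_EFin; first by apply: nearW.
  have c1 : cabs (f n q) @[n --> \oo] --> cabs (g q).
    apply/cvgrPdist_le => d d0; have [N hN] := fg q Wq d d0; exists N => // n /hN; apply: le_trans.
    rewrite distrC ler_norml; have := cabs_subr (f n q) (g q); have := cabs_subr (g q) (f n q).
    by rewrite -(cabsN (g q - f n q)) opprB; lra.
  have -> : fine \o (fun n => (sqmod (f n q))%:E) = (fun n => cabs (f n q) * cabs (f n q)).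
    by apply/funext => n; rewrite /= -sqr_cabs expr2.
  by rewrite -sqr_cabs expr2; exact: cvgM.
have := @fatou _ _ _ (mu4 R) (W : set T4) mW (fun n p => (sqmod (f n p))%:E) mf (fun n x _ => sqmod_ge0 _).
have -> : (\int[mu4 R]_(x in (W : set T4)) limn_einf (fun n => (sqmod (f n x))%:E) = Nm W g)%E.
  apply: eq_integral => q /set_mem Wq; have c := cv q Wq.
  by rewrite is_cvg_limn_einfE; [exact: cvg_lim c | exact: cvgP c].
move=> H; apply: le_trans H _; rewrite limn_einf_lim.
apply: lime_le; first exact: is_cvg_einfs.
apply: nearW => n; apply: le_trans (fe n).
by apply: ereal_inf_lbound; exists n => //=.
Qed.

(** Completeness only says that a function orthogonal to every [phi j] vanishes. The remainders
    [g n] form a Cauchy sequence in norm, hence locally uniformly by the mean value inequality.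
    Their limit [l] is holomorphic, square integrable and orthogonal to the system, so it is 0;
    [weierstrass] gives the statement for derivatives. *)
Lemma expansion h p v : A2 W h -> W p -> let c j := inner W h (phi j) in forall e, 0 < e ->
  exists N, forall n, (N <= n)%N -> cabs (h p - comb phi c 0 n p) <= e /\
    cabs (dC h p v - \sum_(0 <= j < n) c j * dC (phi j) p v) <= e.
Proof.
move=> hh Wp c; have [phiA phiO comp] := ONB; have hc : bnd _ c := bessel_bnd oW ONB hh.
pose g n q := h q - comb phi c 0 n q.
have gA n : A2 W (g n) by have [] := bessel oW ONB n hh.
have gD n : CDon W (g n) by have [] := (A2P W (g n)).1 (gA n).
have Nc : forall e, 0 < e -> exists N, forall n m, (N <= n)%N -> (n <= m)%N -> ip W (comb phi c n m) (comb phi c n m) <= e.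
  move=> e e0; have [N hN] := sq2_eps hc e0; exists N => n m Nn nm.
  have := comb_norm oW ONB c n (m - n); rewrite subnKC // => ->.
  by have := sq2_mono c Nn; have := pr_ge m hc; move: hN; lra.
have combA n m : (n <= m)%N -> A2 W (comb phi c n m).
  by move=> nm; have := comb_A2 oW ONB c n (m - n); rewrite subnKC.
have gsub n m q : (n <= m)%N -> g n q - g m q = comb phi c n m q.
  by move=> nm; rewrite -(comb_sub c q nm) /g; move: (comb _ _ _ _ _) (comb _ _ _ _ _) => a b; ring.
have pc q : W q -> exists2 r, 0 < r & pball q (2 * r) `<=` W /\ forall e, 0 < e ->
    exists N, forall n m, (N <= n)%N -> (n <= m)%N -> forall w, pball q r w -> cabs (g n w - g m w) <= e.
  move=> Wq; have [r0 r00 rW] := oW Wq; pose r : R := r0 / 2; have r1 : 0 < r by rewrite divr_gt0.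
  exists r => //; split; first by rewrite mulrC divfK ?pnatr_eq0.
  have [C C0 hC] := mean_value_ip oW r1; move=> e e0.
  have [N hN] := Nc (e ^+ 2 / C) ltac:(by rewrite divr_gt0 ?exprn_gt0).
  exists N => n m Nn nm w qw; rewrite gsub //.
  have wW : pball w r `<=` W.
    by apply: subset_trans rW; apply: pball_sub; move: qw; rewrite /pball /= /r; lra.
  rewrite -(@ler_pXn2r _ 2) ?nnegrE ?cabs_ge0 ?(ltW e0) // sqr_cabs.
  apply: le_trans (hC _ _ wW (combA n m nm)) _; have := hN n m Nn nm.
  by rewrite ler_pdivlMr // mulrC.
have [l hl] : {l : C2 R -> R[i] & forall q, W q -> forall e, 0 < e -> exists N, forall n, (N <= n)%N -> cabs (g n q - l q) <= e}.
  apply: (choice (P := fun q y => W q -> forall e, 0 < e -> exists N, forall n, (N <= n)%N -> cabs (g n q - y) <= e)) => q.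
  have [Wq|nW] := pselect (W q); last by exists 0 => /nW.
  have [r r0 [rW H]] := pc q Wq.
  have [|y hy] := @complex_cauchy R (g^~ q); last by exists y.
  move=> e /H[N hN]; exists N => n m Nn Nm.
  have [nm|mn] := leqP n m; first by apply: hN => //; exact: pball_center.
  by rewrite -cabsN opprB; apply: hN => //; [exact: ltnW | exact: pball_center].
have unif q : W q -> exists2 r, 0 < r & pball q (2 * r) `<=` W /\ forall e, 0 < e ->
    exists N, forall n, (N <= n)%N -> forall w, pball q r w -> cabs (g n w - l w) <= e.
  move=> Wq; have [r r0 [rW H]] := pc q Wq; exists r => //; split => // e e0.
  have e2 : 0 < e / 2 by rewrite divr_gt0.
  have [N hN] := H _ e2; exists N => n Nn w qw.
  have Ww : W w by apply: rW; move: qw; rewrite /pball /=; lra.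
  have [M hM] := hl w Ww _ e2.
  have h1 := hN n (maxn n M) Nn (leq_maxl _ _) w qw; have h2 := hM (maxn n M) (leq_maxr _ _).
  have -> : g n w - l w = (g n w - g (maxn n M) w) + (g (maxn n M) w - l w) by rewrite addrA subrK.
  by apply: le_trans (cabsD _ _) _; lra.
have wei q : W q -> exists L1 L2, CD l q L1 L2 /\ forall v e, 0 < e -> exists N, forall n, (N <= n)%N -> cabs (dC (g n) q v - dC l q v) <= e.
  move=> Wq; have [r r0 [rW H]] := unif q Wq; have [C C0 hC] := mean_value_ip oW r0.
  apply: (@weierstrass _ g l q r (Num.sqrt (C * ip W h h)) r0) => //.
    by move=> n w qw; apply: gD; apply: rW; move: qw; rewrite /pball /=; lra.
  move=> n w qw; have wW : pball w r `<=` W.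
    by apply: subset_trans rW; apply: pball_sub; move: qw; rewrite /pball /=; lra.
  rewrite -(@ler_pXn2r _ 2) ?nnegrE ?cabs_ge0 ?sqrtr_ge0 // sqr_cabs sqr_sqrtr ?mulr_ge0 ?ip_ge0 ?(ltW C0) //.
  apply: le_trans (hC _ _ wW (gA n)) _; rewrite ler_pM2l //.
  by have [_ ->] := bessel oW ONB n hh; rewrite gerBl sq2_ge0.
have lD : CDon W l by move=> q /wei[L1 [L2 [D _]]]; exists L1, L2.
have dA e : 0 < e -> exists N, forall n, (N <= n)%N -> A2 W (fun q => g n q + -1 * l q) /\ ip W (fun q => g n q + -1 * l q) (fun q => g n q + -1 * l q) <= e.
  move=> e0; have [N hN] := Nc e e0; exists N => n Nn.
  have D : CDon W (fun q => g n q + -1 * l q).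
    move=> q Wq; have [L1 [L2 D1]] := gD n q Wq; have [M1 [M2 D2]] := lD q Wq.
    by have := CD_add D1 (CD_scale (-1) D2); eexists; eexists; eauto.
  (* Fatou for [m] going to infinity: [comb phi c n (n + m)] is [g n - g (n + m)], which tends
     pointwise to [g n - l] and has small norm. *)
  have F : (Nm W (fun q => (g n q + -1 * l q)%R) <= e%:E)%E.
    apply: (@fatou_Nm (fun m => comb phi c n (n + m))).
    - by move=> m; have [] := (A2P W _).1 (combA n (n + m)%N (leq_addr _ _)).
    - move=> q Wq d d0; have [M hM] := hl q Wq d d0; exists M => m Mm.
      rewrite -gsub ?leq_addr //.
      have -> : g n q - g (n + m)%N q - (g n q + -1 * l q) = - (g (n + m)%N q - l q).
        by move: (g n q) (g (n + m)%N q) (l q) => a b d'; ring.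
      rewrite cabsN.
      by apply: hM; apply: leq_trans Mm (leq_addl _ _).
    - by move=> m; rewrite NmE ?lee_fin; [exact: hN _ _ Nn (leq_addr _ _) | exact: oW | exact: combA _ _ (leq_addr _ _)].
  have A : A2 W (fun q => g n q + -1 * l q) by apply/A2P; split => //; apply: le_lt_trans F _; exact: ltry.
  by split => //; move: F; rewrite NmE // lee_fin.
have lA : A2 W l.
  have [N /(_ N (leqnn N))[A _]] := dA 1 ltr01.
  have -> : l = (fun q => g N q + -1 * (g N q + -1 * l q)).
    by apply/funext => q; rewrite !mulN1r opprD opprK addrA subrr add0r.
  by apply: A2D => //; exact: A2Z.
have l0 q : W q -> l q = 0.
  move: q; apply: (comp _ lA) => k; apply/eqP; rewrite -cabs_eq0 -sqrf_eq0 sqr_cabs eq_le sqmod_ge0 andbT.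
  apply/ler_addgt0Pr => e e0; rewrite add0r.
  have [N hN] := dA e e0; have [A hA] := hN (maxn N k.+1) (leq_maxl _ _).
  set n := maxn N k.+1 in A hA.
  (* For [n > k] the remainder [g n] is orthogonal to [phi k]. The coefficient of [l] is thus, up to
     sign, that of [g n - l], and Bessel bounds it by the small norm. *)
  have E : inner W (fun q => g n q + -1 * l q) (phi k) = - inner W l (phi k).
    rewrite (innerD oW (gA n) (A2Z oW (-1) lA) (phiA k)) (innerZ oW _ lA (phiA k)).
    have -> : g n = (fun q => h q + -1 * comb phi c 0 n q) by apply/funext => q; rewrite mulN1r.
    have cA : A2 W (comb phi c 0 n) by exact: combA.
    rewrite (innerD oW hh (A2Z oW (-1) cA) (phiA k)) (innerZ oW _ cA (phiA k)).
    have := comb_inner oW ONB c 0 n k; rewrite add0n => ->.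
    by rewrite /= leq_max ltnSn orbT !mulN1r subrr add0r.
  have := bessel_le oW ONB k.+1 A.
  rewrite /sq2 big_nat_recr //= E => H.
  have s0 : 0 <= \sum_(0 <= i < k) sqmod (inner W (fun q => g n q + -1 * l q) (phi i)).
    by apply: sumr_ge0 => j _; exact: sqmod_ge0.
  have -> : sqmod (inner W l (phi k)) = sqmod (- inner W l (phi k)) by rewrite -!sqr_cabs cabsN.
  by move: s0 H hA; lra.
move=> e e0; have [N1 hN1] := hl p Wp e e0; have [L1 [L2 [D hd]]] := wei p Wp.
have [N2 hN2] := hd v e e0; exists (maxn N1 N2) => n; rewrite geq_max => /andP[n1 n2].
have := hN1 n n1; have := hN2 n n2; rewrite l0 // subr0.
have -> : dC l p v = 0.
  by rewrite (dC_near oW v (fun q _ => ex_intro _ 0 (ex_intro _ 0 (CD_cst 0 q))) Wp l0) (CD_dC v (CD_cst 0 p)) !mul0r addr0.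
have -> : dC (g n) p v = dC h p v - \sum_(0 <= j < n) c j * dC (phi j) p v; last by rewrite subr0.
have [hD _] := (A2P W h).1 hh; have [H1 [H2 Dh]] := hD p Wp.
have pD j : CDon W (phi j) by have [] := (A2P W _).1 (phiA j).
have [La [Lb [Dj dE]]] : exists La Lb : nat -> R[i], (forall j, CD (phi j) p (La j) (Lb j)) /\ forall j, dC (phi j) p v = La j * z1 v + Lb j * z2 v.
  have Dj j := CDon_dC (pD j) Wp.
  by exists (fun j => dC (phi j) p (ex1 R)), (fun j => dC (phi j) p (ex2 R)); split => // j; exact: CD_dC (Dj j).
have -> : \sum_(0 <= j < n) c j * dC (phi j) p v = (\sum_(0 <= j < n) c j * La j) * z1 v + (\sum_(0 <= j < n) c j * Lb j) * z2 v.
  by rewrite !mulr_suml -big_split /=; apply: eq_bigr => j _; rewrite dE; ring.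
have Dg : CD (g n) p (H1 + -1 * \sum_(0 <= j < n) c j * La j) (H2 + -1 * \sum_(0 <= j < n) c j * Lb j).
  apply: CD_eq (CD_add Dh (CD_scale (-1) (CD_sum n c Dj))) _ _ _ => // q.
  by rewrite mulN1r.
rewrite (CD_dC v Dg) (CD_dC v Dh).
by move: (\sum_(0 <= j < n) _) (\sum_(0 <= j < n) _) => a b; ring.
Qed.
End Expansion.

(** * Comparison with the Caratheodory metric and local upper bounds *)

Section BergmanBounds.
Variables (R : realType) (W : set (C2 R)) (phi : nat -> C2 R -> R[i]).
Hypotheses (oW : opn W) (ONB : complete_orthonormal W phi).
Hypothesis nonvanishing : forall p, W p -> exists2 h, A2 W h & h p != 0.
Implicit Types (f g h : C2 R -> R[i]) (p q v : C2 R).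
Local Notation T2 := (measurableTypeR R * measurableTypeR R)%type.
Local Notation T4 := (T2 * T2)%type.
Local Notation RC x := (Complex x 0).
Local Notation I1 := (Complex 0 1).
Local Notation K q := (pr (phi^~ q) (phi^~ q)).

Let fphi : fam W phi. Proof. exact: fam_phi. Qed.

Lemma phi_neq0 p : W p -> exists j, phi j p != 0.
Proof.
move=> Wp; have [h hh hp] := nonvanishing Wp; apply: contrapT => no.
have z j : phi j p = 0 by apply/eqP; apply: contrapT => H; apply: no; exists j; apply/negP.
have hp0 : 0 < cabs (h p) by rewrite cabs_gt0.
have [N /(_ N (leqnn N))[]] := expansion oW ONB 0 hh Wp (e := cabs (h p) / 2) ltac:(by rewrite divr_gt0).
have -> : comb phi (fun j => inner W h (phi j)) 0 N p = 0 by rewrite /comb big1 // => j _; rewrite z mulr0.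
by rewrite subr0; lra.
Qed.

Lemma diag_gt0 p : W p -> 0 < K p.
Proof.
move=> Wp; have [j hj] := phi_neq0 Wp; have [A hA] := CDon_bnd fphi Wp.
apply: lt_le_trans (pr_ge j.+1 hA); rewrite /sq2 big_nat_recr //=.
apply: ltr_wpDl; first by apply: sumr_ge0 => i _; exact: sqmod_ge0.
by rewrite -sqr_cabs exprn_gt0 // cabs_gt0.
Qed.

Lemma A2_mul_bounded f h : CDon W f -> (forall q, W q -> cabs (f q) < 1) -> A2 W h ->
  A2 W (fun q => h q * f q) /\ ip W (fun q => h q * f q) (fun q => h q * f q) <= ip W h h.
Proof.
move=> fD f1 hh; have mW := opn_measurable oW; have [hD _] := (A2P W h).1 hh.
have D : CDon W (fun q => h q * f q).
  move=> q Wq; have [L1 [L2 D1]] := hD q Wq; have [M1 [M2 D2]] := fD q Wq.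
  by have := CD_mul D1 D2; eexists; eexists; eauto.
have le q : W q -> sqmod (h q * f q) <= sqmod (h q).
  move=> /f1 lt1; rewrite sqmodM -[leRHS]mulr1; apply: ler_wpM2l; first exact: sqmod_ge0.
  by rewrite -sqr_cabs; apply: exprn_ile1; [exact: cabs_ge0 | exact: ltW].
have mm := sqmod_measurable oW D.
have N : (Nm W (fun q => (h q * f q)%R) <= Nm W h)%E.
  apply: ge0_le_integral => //; try by [move=> q _; rewrite lee_fin; exact: sqmod_ge0 | apply/measurable_EFinP; exact: sqmod_measurable].
have A : A2 W (fun q => h q * f q).
  apply/A2P; split => //; apply: le_lt_trans N _.
  by have [_] := (A2P W h).1 hh.
by split => //; move: N; rewrite !NmE // lee_fin.
Qed.

(** Since [h p = 0], the sums of [c_j a_j] tend to 0, so any multiple [lam a] can be subtracted from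
    [b] before Cauchy-Schwarz. The best choice of [lam] removes the component of [b] along [a]. *)
Lemma expansion_cs h p v (a b : nat -> R[i]) (lam : R[i]) E : A2 W h -> W p -> h p = 0 ->
  phi^~ p = a -> (fun j => dC (phi j) p v) = b -> (forall n, sq2 n (fun j => b j - lam * a j) <= E) ->
  cabs (dC h p v) ^+ 2 <= ip W h h * E.
Proof.
move=> hh Wp hp ha hb hE; set c := fun j => inner W h (phi j).
have E0 : 0 <= E by apply: le_trans (hE 0%N); exact: sq2_ge0.
have N0 : 0 <= ip W h h by exact: ip_ge0.
rewrite -[leRHS]sqr_sqrtr ?mulr_ge0 // lerXn2r ?nnegrE ?cabs_ge0 ?sqrtr_ge0 //.
apply/ler_addgt0Pr => e e0; pose d : R := e / (1 + (1 + cabs lam)).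
have l0 := cabs_ge0 lam; have d0 : 0 < d by rewrite divr_gt0 //; lra.
have [n /(_ n (leqnn n))[h1 h2]] := expansion oW ONB v hh Wp d0.
rewrite hp sub0r cabsN in h1.
have e1 : \sum_(0 <= j < n) c j * dC (phi j) p v = \sum_(0 <= j < n) c j * (b j - lam * a j) + lam * comb phi c 0 n p.
  by rewrite /comb mulr_sumr -big_split /=; apply: eq_bigr => j _; rewrite -ha -hb; ring.
have h3 : cabs (\sum_(0 <= j < n) c j * (b j - lam * a j)) <= Num.sqrt (ip W h h * E).
  rewrite -(@ler_pXn2r _ 2) ?nnegrE ?cabs_ge0 ?sqrtr_ge0 // sqr_cabs sqr_sqrtr ?mulr_ge0 //.
  apply: le_trans (comb_cs _ _ _) _; apply: ler_pM; rewrite ?sq2_ge0 //; exact: bessel_le.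
move: h2; rewrite -/c e1; move: (dC h p v) h3 => D h3 h2.
have -> : D = (D - (\sum_(0 <= j < n) c j * (b j - lam * a j) + lam * comb phi c 0 n p)) +
   (\sum_(0 <= j < n) c j * (b j - lam * a j) + lam * comb phi c 0 n p) by rewrite subrK.
have t1 := cabsD (D - (\sum_(0 <= j < n) c j * (b j - lam * a j) + lam * comb phi c 0 n p)) (\sum_(0 <= j < n) c j * (b j - lam * a j) + lam * comb phi c 0 n p).
have t2 := cabsD (\sum_(0 <= j < n) c j * (b j - lam * a j)) (lam * comb phi c 0 n p).
have t3 : cabs (lam * comb phi c 0 n p) <= cabs lam * d by rewrite cabsM ler_wpM2l.
have de : d * (1 + (1 + cabs lam)) = e by rewrite divfK // gt_eqF //; lra.
apply: le_trans t1 _; move: t2 t3 h2 h3 de d0; set X := Num.sqrt _; nra.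
Qed.

Lemma pr_project A B (a b : nat -> R[i]) (s t : R) : bnd A a -> bnd B b ->
  let y j := b j + (RC s * a j + RC t * (I1 * a j)) in
  pr y y = pr b b + 2 * s * pr b a - 2 * t * pr (fun j => I1 * b j) a + (s ^+ 2 + t ^+ 2) * pr a a.
Proof.
move=> hA hB; have iA := bndZ I1 hA; have sA := bndZ (RC s) hA; have tA := bndZ (RC t) iA.
have hz := bndD sA tA; pose z j := RC s * a j + RC t * (I1 * a j); rewrite -/z in hz *.
have hy : bnd _ (fun j => b j + z j) := bndD hB hz.
have zl x D : bnd D x -> pr z x = s * pr a x + t * pr (fun j => I1 * a j) x.
  by move=> hx; rewrite (prD sA tA hx) (prZ s hA hx) (prZ t iA hx).
rewrite /= (prD hB hz hy) ![pr _ (fun j => b j + _)]prC (prD hB hz hB) (prD hB hz hz).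
rewrite (prC b z) (zl _ _ hB) (zl _ _ hz) !(prC _ z) (zl _ _ hA) (zl _ _ iA) prI (prII hA) (prC a (fun j => I1 * a j)) (prII hA).
by rewrite (prC a b) (prC (fun j => I1 * a j) b) (prIr hB hA); ring.
Qed.

(** For a Caratheodory competitor [f], let [k] be a partial sum of the Bergman kernel with pole [p].
    Then [k f] vanishes at [p], its derivative there is [k(p) df], and [|k f|^2 <= |k|^2 = k(p)] in
    norm. [expansion_cs] gives [k(p) |df|^2 <= E], and the partial sums [k(p)] tend to the full
    kernel. *)
Lemma bergman_ge p v : W p -> (caratheodory W p v <= bergman_length phi p v)%E.
Proof.
move=> Wp; apply: ub_ereal_sup => _ [f [fH f1 fp] <-]; rewrite lee_fin.
have fD := (holo_CDon W f).1 fH.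
have [a ha] : exists a : nat -> R[i], phi^~ p = a by eexists.
have [b hb] : exists b : nat -> R[i], (fun j => dC (phi j) p v) = b by eexists.
rewrite (bergman_formE oW fphi diag_gt0 Wp hb) ha.
have Kp : 0 < pr a a by rewrite -ha; exact: diag_gt0.
have [A hA] : exists A, bnd A a by rewrite -ha; exact: CDon_bnd fphi Wp.
have [B hB] : exists B, bnd B b by rewrite -hb; exact: CDon_bnd (fam_d v oW fphi) Wp.
(* Minus the real and imaginary coefficients of the projection of [b] on the complex line of [a], up
   to sign conventions: [y] is the component of [b] orthogonal to [a], and [E] its squared norm. *)
set s : R := - pr b a / pr a a; set t : R := pr (fun j => I1 * b j) a / pr a a.
pose y j := b j + (RC s * a j + RC t * (I1 * a j)).
have hy : bnd _ y := bndD hB (bndD (bndZ (RC s) hA) (bndZ (RC t) (bndZ I1 hA))).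
set E := pr b b - (pr b a ^+ 2 + pr (fun j => I1 * b j) a ^+ 2) / pr a a.
have yE : pr y y = E.
  rewrite (pr_project s t hA hB) /E /s /t; move: (pr b a) (pr (fun j => I1 * b j) a) (pr a a) (pr b b) Kp => u w k m k0.
  by field; rewrite gt_eqF.
have Ey n : sq2 n (fun j => b j - Complex (- s) (- t) * a j) <= E.
  rewrite (_ : (fun j => _) = y); first by rewrite -yE; exact: pr_ge hy.
  apply/funext => j; rewrite /y; apply: complexP; rewrite !(reD, imD, reN, imN, reM, imM) /=; ring.
have E0 : 0 <= E by apply: le_trans (Ey 0%N); exact: sq2_ge0.
have key n : sq2 n a * sqmod (dC f p v) <= E.
  have [S0|S0] := eqVneq (sq2 n a) 0; first by rewrite S0 mul0r.
  have Sp : 0 < sq2 n a by rewrite lt_def S0 sq2_ge0.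
  pose k := comb phi (fun j => (a j)^*) 0 n.
  have kA : A2 W k by exact: comb_A2.
  have [hA2 hle] := A2_mul_bounded fD f1 kA.
  have hp0 : k p * f p = 0 by rewrite fp mulr0.
  have kp : k p = RC (sq2 n a).
    rewrite /k /comb -ha /sq2; apply: (big_ind2 (fun x y => x = RC y)) => // [x1 y1 x2 y2 -> ->|j _].
      by apply: complexP; rewrite ?reD ?imD //= addr0.
    by rewrite mulrC mulJ sqr_cabs.
  have dh : dC (fun q => k q * f q) p v = k p * dC f p v.
    have [kD _] := (A2P W k).1 kA; have [L1 [L2 D1]] := kD p Wp; have [M1 [M2 D2]] := fD p Wp.
    by rewrite (CD_dC v (CD_mul D1 D2)) (CD_dC v D2) fp !mulr0 !add0r; ring.
  have := expansion_cs hA2 Wp hp0 ha hb Ey; rewrite dh kp cabsM exprMn cabs_real real_normK ?num_real // sqr_cabs => H.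
  rewrite -(ler_pM2l Sp) mulrA -expr2; apply: le_trans H _.
  apply: ler_wpM2r => //; apply: le_trans hle _; have := comb_norm oW ONB (fun j => (a j)^*) 0 n.
  by rewrite add0n -/k => ->; rewrite sq2J gerBl sq2_ge0.
rewrite /cabs; apply: ler_wsqrtr.
have -> : pr b b / pr a a - (pr b a ^+ 2 + pr (fun j => I1 * b j) a ^+ 2) / pr a a ^+ 2 = E / pr a a.
  by rewrite /E; move: (pr b a) (pr (fun j => I1 * b j) a) (pr a a) (pr b b) Kp => u w k m k0; field; rewrite gt_eqF.
rewrite ler_pdivlMr //; apply/ler_addgt0Pr => e e0; have X0 := sqmod_ge0 (dC f p v).
have d0 : 0 < e / (1 + sqmod (dC f p v)) by rewrite divr_gt0 //; lra.
have [n hn] := sq2_eps hA d0; have := key n.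
have : e / (1 + sqmod (dC f p v)) * (1 + sqmod (dC f p v)) = e by rewrite divfK // gt_eqF //; lra.
move: hn d0 X0; set X := sqmod _; set d := e / _; clearbody d X E; move: (sq2 n a) (pr a a) => S k; nra.
Qed.

(** The subtracted term of the Bergman form is dropped, [|b|] is bounded by [fam_est], and the
    kernel is bounded below near [p] by [|phi j p|^2 / 4] for one [j] with [phi j p] nonzero. *)
Lemma bergman_upper p : W p -> exists r C, [/\ 0 < r, 0 <= C, pball p r `<=` W &
  forall q v, pball p r q -> (bergman_length phi q v <= (C * pn v)%:E)%E].
Proof.
move=> Wp; have [r [A [r0 A0 rW H]]] := fam_est oW fphi Wp.
have [j hj] := phi_neq0 Wp; have [L1 [L2 D]] := fphi.1 j p Wp.
have c0 : 0 < cabs (phi j p) by rewrite cabs_gt0.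
have [d d0 hd] := CD_cont D (e := cabs (phi j p) / 2) ltac:(by rewrite divr_gt0).
exists (Num.min r d), (A / (cabs (phi j p) / 2)); split.
- by rewrite lt_min r0.
- by rewrite divr_ge0 // divr_ge0 // ltW.
- by move=> q; rewrite /pball /= lt_min => /andP[h1 _]; exact: rW.
move=> q v; rewrite /pball /= lt_min => /andP[qr qd]; rewrite lee_fin.
have Wq := rW q qr; have [hA hB _] := H q qr; have {}hB := hB v.
have Kq := diag_gt0 Wq.
have [b hb] : exists b : nat -> R[i], (fun j => dC (phi j) q v) = b by eexists.
rewrite hb in hB; rewrite (bergman_formE oW fphi diag_gt0 Wq hb).
have m0 : 0 <= A / (cabs (phi j p) / 2) * pn v by rewrite mulr_ge0 ?pn_ge0 // divr_ge0 // divr_ge0 // ltW.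
rewrite -(ger0_norm m0) -sqrtr_sqr; apply: ler_wsqrtr.
apply: (@le_trans _ _ (pr b b / K q)).
  rewrite gerBl; apply: divr_ge0; [by apply: addr_ge0; exact: sqr_ge0 | exact: sqr_ge0].
rewrite ler_pdivrMr //; apply: le_trans (pr_le hB) _.
have -> : (A / (cabs (phi j p) / 2) * pn v) ^+ 2 * K q = (A * pn v) ^+ 2 * (K q / (cabs (phi j p) / 2) ^+ 2).
  by field; rewrite gt_eqF.
rewrite ler_peMr ?sqr_ge0 // ler_pdivlMr ?exprn_gt0 ?divr_gt0 // mul1r.
apply: le_trans (pr_ge j.+1 hA); rewrite /sq2 big_nat_recr //=.
apply: ler_wpDl; first by apply: sumr_ge0 => i _; exact: sqmod_ge0.
rewrite -sqr_cabs lerXn2r ?nnegrE ?cabs_ge0 ?divr_ge0 ?cabs_ge0 //.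
by have := hd q qd; have := cabs_subr (phi j p) (phi j q); rewrite -(cabsN (_ - _)) opprB; lra.
Qed.

End BergmanBounds.

Lemma caratheodory_upper (R : realType) (W : set (C2 R)) p : opn W -> W p -> exists r C, [/\ 0 < r, 0 <= C, pball p r `<=` W &
  forall q v, pball p r q -> (caratheodory W q v <= (C * pn v)%:E)%E].
Proof.
move=> oW Wp; have [r0 r00 rW] := oW p Wp; pose r : R := r0 / 2; have r1 : 0 < r by rewrite divr_gt0.
have [C C0 hC] := cauchy_estimate2 R; exists r, (C / r); split => //; first by rewrite divr_ge0 // ltW.
  by apply: subset_trans rW; apply: pball_sub; rewrite subrr pn0 /r; lra.
move=> q v qr; have qW : pball q r `<=` W.
  by apply: subset_trans rW; apply: pball_sub; move: qr; rewrite /pball /= /r; lra.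
apply: ub_ereal_sup => _ [f [/holo_CDon fD f1 fp] <-]; rewrite lee_fin.
have [L1 [L2 D]] := fD q (qW q (pball_center q r1)); rewrite (CD_dC v D).
have [||h _] := hC f q r 1 L1 L2 r1 _ _ D v; last by rewrite mulr1 in h.
  by move=> w /qW/fD.
by move=> w /qW/f1/ltW.
Qed.

(** * The complex exponential and its Taylor estimates *)

Section ComplexExp.
Variable R : realType.
Implicit Types (z w h : R[i]) (K A B : R[i] -> R[i] -> R[i]).
Local Notation RC x := (Complex x 0).

Definition cexp z : R[i] := RC (expR (complex.Re z)) * Complex (cos (complex.Im z)) (sin (complex.Im z)).

Lemma cexpD z w : cexp (z + w) = cexp z * cexp w.
Proof.
rewrite /cexp reD imD expRD cosD sinD.
by apply: complexP; rewrite !(reM, imM) /=; ring.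
Qed.

Lemma cexp0 : cexp 0 = 1.
Proof. by rewrite /cexp /= expR0 cos0 sin0 RC1 mul1r. Qed.

Lemma cabs_cexp z : cabs (cexp z) = expR (complex.Re z).
Proof.
rewrite /cexp cabsM cabs_real ger0_norm ?expR_ge0 // [X in _ * X](_ : _ = 1) ?mulr1 //.
by rewrite /cabs /sqmod /= cos2Dsin2 sqrtr1.
Qed.

Lemma expR_taylor (x : R) : `|x| <= 2^-1 -> `|expR x - 1 - x| <= 2 * x ^+ 2.
Proof.
rewrite ler_norml => /andP[x1 x2].
have h1 := expR_ge1Dx x; have h2 := expR_ge1Dx (- x).
have e0 := expR_gt0 x; have ee : expR x * expR (- x) = 1 by rewrite -expRD subrr expR0.
rewrite ger0_norm; last lra.
have : expR x * (1 - x) <= 1 by rewrite -ee; apply: ler_wpM2l; [exact: ltW | lra].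
rewrite expr2; nra.
Qed.

Lemma sin_le (y : R) : `|sin y| <= `|y|.
Proof.
wlog y0 : y / 0 < y.
  move=> H; have [y0|y0|->] := ltgtP y 0; last by rewrite sin0 normr0.
    by rewrite -normrN -sinN -(normrN y); apply: H; rewrite oppr_gt0.
  exact: H.
have [|c _ E] := @MVT R sin cos 0 y y0 (fun x _ => is_derive_sin x).
  by apply: continuous_subspaceT => x; exact: continuous_sin.
rewrite sin0 !subr0 in E; rewrite E normrM; apply: ler_piMl => //.
by rewrite ler_norml cos_geN1 cos_le1.
Qed.

Lemma cos_le (y : R) : `|cos y - 1| <= y ^+ 2.
Proof.
wlog y0 : y / 0 < y.
  move=> H; have [y0|y0|->] := ltgtP y 0; last by rewrite cos0 subrr normr0 expr0n.
    by rewrite -cosN -sqrrN; apply: H; rewrite oppr_gt0.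
  exact: H.
have [|c cy E] := @MVT R cos (fun x => - sin x) 0 y y0 (fun x _ => is_derive_cos x).
  by apply: continuous_subspaceT => x; exact: continuous_cos.
rewrite cos0 subr0 in E; rewrite E normrM normrN (gtr0_norm y0) expr2 ler_pM2r //.
apply: le_trans (sin_le c) _; move: cy; rewrite in_itv /= => /andP[c0 /ltW cy].
by rewrite ger0_norm // ltW.
Qed.

Lemma sin_taylor (y : R) : `|y| <= 1 -> `|sin y - y| <= y ^+ 2.
Proof.
wlog y0 : y / 0 < y.
  move=> H; have [y0|y0|->] := ltgtP y 0; last by rewrite sin0 subrr normr0 expr0n.
    have -> : sin y - y = - (sin (- y) - - y) by rewrite sinN; ring.
    by rewrite normrN -sqrrN -(normrN y); apply: H; rewrite oppr_gt0.
  exact: H.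
rewrite gtr0_norm // => y1.
have [|c cy E] := @MVT R (fun x => sin x - x) (fun x => cos x - 1) 0 y y0 (fun x _ => is_deriveB (is_derive_sin x) (is_derive_id x 1)).
  by apply: continuous_subspaceT => x; apply: cvgB; [exact: continuous_sin | exact: cvg_id].
rewrite sin0 !subr0 in E; rewrite E normrM (gtr0_norm y0) expr2 ler_pM2r //.
apply: le_trans (cos_le c) _; move: cy; rewrite in_itv /= => /andP[/ltW c0 /ltW cy].
by rewrite expr2; nra.
Qed.

Lemma cexp_taylor0 w : cabs w <= 2^-1 -> cabs (cexp w - 1 - w) <= 8 * cabs w ^+ 2.
Proof.
move=> w1; have hx := le_trans (Re_cabs w) w1; have hy := le_trans (Im_cabs w) w1.
apply: le_trans (cabs_ReIm _) _.
have -> : complex.Re (cexp w - 1 - w) = (expR (complex.Re w) - 1 - complex.Re w) * cos (complex.Im w) + (1 + complex.Re w) * (cos (complex.Im w) - 1).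
  by rewrite /cexp !reD !reN reM /=; ring.
have -> : complex.Im (cexp w - 1 - w) = (expR (complex.Re w) - 1 - complex.Re w) * sin (complex.Im w) + complex.Re w * sin (complex.Im w) + (sin (complex.Im w) - complex.Im w).
  by rewrite /cexp !imD !imN imM /=; ring.
have e1 := expR_taylor hx; have e2 := cos_le (complex.Im w).
have e3 : `|sin (complex.Im w) - complex.Im w| <= complex.Im w ^+ 2 by apply: sin_taylor; lra.
have e4 := sin_le (complex.Im w); have e5 : `|cos (complex.Im w)| <= 1 by rewrite ler_norml cos_geN1 cos_le1.
have e6 : `|sin (complex.Im w)| <= 1 by rewrite ler_norml sin_geN1 sin_le1.
rewrite sqr_cabs /sqmod; move: e1 e2 e3 e4 e5 e6 hx hy.
move: (complex.Re w) (complex.Im w) => x y; move: (cos y) (sin y) (expR x - 1 - x) (cos y - 1) (sin y - y) => co si a b c e1 e2 e3 e4 e5 e6 hx hy.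
have n1 := normr_ge0 x; have n2 := normr_ge0 y; have n3 := normr_ge0 a; have n4 := normr_ge0 b; have n5 := normr_ge0 si.
have xx : x ^+ 2 = `|x| ^+ 2 by rewrite real_normK ?num_real.
have yy : y ^+ 2 = `|y| ^+ 2 by rewrite real_normK ?num_real.
have t1 : `|a * co + (1 + x) * b| <= `|a| + 2 * `|b|.
  apply: le_trans (ler_normD _ _) _; rewrite !normrM; apply: lerD; first by rewrite ler_piMr.
  by apply: ler_wpM2r => //; have := ler_normD 1 x; rewrite normr1; lra.
have t2 : `|a * si + x * si + c| <= `|a| + `|x| * `|y| + `|c|.
  apply: le_trans (ler_normD _ _) _; apply: lerD => //; apply: le_trans (ler_normD _ _) _; rewrite !normrM; apply: lerD.
    by rewrite ler_piMr.
  exact: ler_wpM2l.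
have := sqr_ge0 (`|x| - `|y|); move: t1 t2 e1 e2 e3; rewrite xx yy !expr2; nra.
Qed.

Lemma cexp_taylor r : 0 <= r -> exists2 C, 0 <= C & forall w, cabs w <= r -> cabs (cexp w - 1 - w) <= C * cabs w ^+ 2.
Proof.
move=> r0; have e0 := expR_gt0 r; exists (8 + 4 * (expR r + 1 + r)); first by lra.
move=> w wr; have s0 : 0 <= cabs w ^+ 2 := sqr_ge0 _.
have [w1|w1] := leP (cabs w) 2^-1.
  by apply: le_trans (cexp_taylor0 w1) _; apply: ler_wpM2r => //; lra.
have t : cabs (cexp w - 1 - w) <= expR r + 1 + r.
  apply: le_trans (cabsBD _ _) _; apply: lerD => //; apply: le_trans (cabsBD _ _) _.
  rewrite cabs1 lerD2r cabs_cexp ler_expR; apply: le_trans wr; apply: le_trans (Re_cabs w).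
  exact: ler_norm.
have w2 : 4^-1 <= cabs w ^+ 2 by rewrite expr2; nra.
nra.
Qed.

Lemma cderiv_cexp z : cderiv cexp z (cexp z).
Proof.
have [C C0 hC] := cexp_taylor (r := 1) ler01.
move=> e e0; have c0 := cabs_ge0 (cexp z); pose X := cabs (cexp z) * C + 1.
have X0 : 0 < X by rewrite /X; nra.
exists (Num.min 1 (e / X)) => [|h]; first by rewrite lt_min ltr01 divr_gt0.
rewrite lt_min => /andP[/ltW h1]; rewrite ltr_pdivlMr // => /ltW h2.
have -> : cexp (z + h) - cexp z - cexp z * h = cexp z * (cexp h - 1 - h) by rewrite cexpD; ring.
rewrite cabsM; apply: le_trans (ler_wpM2l c0 (hC h h1)) _.
have := cabs_ge0 h; move: h2; rewrite /X expr2; nra.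
Qed.

Lemma D11p_conj K A B : D11p K A B -> D11p (fun z w => (K z w)^*) (fun z w => (B z w)^*) (fun z w => (A z w)^*).
Proof.
move=> D r; have [C C0 hC] := D r; exists C => // z w zr wr; have [h1 h2 h3 E] := hC z w zr wr.
rewrite !cabs_conj; split => // h /E; rewrite -cabs_conj !rmorphB !rmorphM /= conjCK.
by rewrite addrAC.
Qed.

Lemma D11p_sh u al be : D11 u al be -> D11p (fun z h => u (z + h)) (fun z h => al (z + h)) (fun z h => be (z + h)).
Proof.
move=> /D11E D r; have [C C0 hC] := D (r + r); exists C => // z w zr wr.
have [|p1 p2 p3 E] := hC (z + w); first by have := cabsD z w; lra.
by split => // h /E; rewrite (addrAC z w h).
Qed.

Lemma D11p_exp K A B : D11p K A B -> D11p (fun z w => cexp (K z w)) (fun z w => cexp (K z w) * A z w) (fun z w => cexp (K z w) * B z w).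
Proof.
move=> D r; have [C C0 hC] := D r.
have [C2 C20 hC2] := cexp_taylor (r := 3 * C) ltac:(lra).
have e0 := expR_gt0 C; pose X := expR C * (1 + C + C2 * (3 * C) ^+ 2).
have X1 : expR C <= X.
  by rewrite /X; apply: ler_peMr; [exact: ltW | have := mulr_ge0 C20 (sqr_ge0 (3 * C)); lra].
have X2 : expR C * C <= X.
  by rewrite /X ler_pM2l //; have := mulr_ge0 C20 (sqr_ge0 (3 * C)); lra.
exists X; first by apply: le_trans X1; exact: ltW.
move=> z w zr wr; have [h1 h2 h3 E] := hC z w zr wr.
have eK : cabs (cexp (K z w)) <= expR C.
  by rewrite cabs_cexp ler_expR; apply: le_trans h1; apply: le_trans (Re_cabs _); exact: ler_norm.
have eKC x : cabs x <= C -> cabs (cexp (K z w) * x) <= X.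
  by move=> xC; apply: le_trans X2; rewrite cabsM; apply: ler_pM => //; exact: cabs_ge0.
split; [exact: le_trans X1 | exact: eKC | exact: eKC | move=> h hh].
have Eh := E h hh; have := lin_est h2 h3 hh Eh.
have -> : K (z + h) w - K z w - A z w * h - B z w * h^* + (A z w * h + B z w * h^*) = K (z + h) w - K z w by ring.
set Dl := K (z + h) w - K z w => hD; have h0 := cabs_ge0 h.
have D3 : cabs Dl <= 3 * C by apply: le_trans hD _; rewrite ler_piMr //; lra.
have -> : cexp (K (z + h) w) - cexp (K z w) - cexp (K z w) * A z w * h - cexp (K z w) * B z w * h^* =
   cexp (K z w) * ((cexp Dl - 1 - Dl) + (Dl - A z w * h - B z w * h^*)).
  have -> : K (z + h) w = K z w + Dl by rewrite /Dl; ring.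
  by rewrite cexpD; ring.
rewrite cabsM /X -mulrA; apply: ler_pM; rewrite ?cabs_ge0 //.
apply: le_trans (cabsD _ _) _.
have q1 := hC2 Dl D3; have q2 : cabs Dl ^+ 2 <= (3 * C * cabs h) ^+ 2 by rewrite lerXn2r ?nnegrE ?cabs_ge0 // !mulr_ge0.
have q3 := ler_wpM2l C20 q2; move: Eh q3 q1; rewrite exprMn /Dl.
have := sqr_ge0 (cabs h); set Y := cabs h ^+ 2; set Z := (3 * C) ^+ 2; nra.
Qed.

End ComplexExp.

(** * Limits of functions whose dbar-derivative tends to 0 *)

Section HolomorphicLimit.
Variable R : realType.
Implicit Types (z w h : R[i]) (u g al be : R[i] -> R[i]).
Local Notation RC x := (Complex x 0).

Lemma D11_cderiv u al be z : D11 u al be -> be z = 0 -> cderiv u z (al z).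
Proof.
move=> /D11E/(_ (cabs z))[C C0 /(_ z (lexx _))[_ _ _ E]] b0 e e0.
have C1 : 0 < C + 1 by lra.
exists (Num.min 1 (e / (C + 1))) => [|h]; first by rewrite lt_min ltr01 divr_gt0.
rewrite lt_min => /andP[/ltW h1]; rewrite ltr_pdivlMr // => /ltW h2.
have := E h h1; rewrite b0 mul0r subr0 => H; apply: le_trans H _.
have := cabs_ge0 h; move: h2; rewrite expr2; nra.
Qed.

Lemma cderiv_local f g z a r : 0 < r -> (forall w, cabs (w - z) < r -> f w = g w) -> cderiv f z a -> cderiv g z a.
Proof.
move=> r0 fg D e /D[d d0 hd]; exists (Num.min d r) => [|h]; first by rewrite lt_min d0.
rewrite lt_min => /andP[h1 h2]; rewrite -!fg; first exact: hd.
  by rewrite subrr cabs0.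
by rewrite addrAC subrr add0r.
Qed.

Lemma zl_in (d : R) h : 0 < d -> cabs h ^+ 2 <= d ^+ 2 / 2 -> zl d h = 1.
Proof.
move=> d0 H; apply: zeta_in; rewrite addr0 mulrC ler_pdivrMr ?exprn_gt0 //.
by rewrite mulrC.
Qed.

Lemma tame_conv (k : R[i] -> R[i]) z : tame k -> tame (fun w => k (w - z)).
Proof.
move=> /(tame_shift (- z)); rewrite (_ : (fun w => k (- z + w)) = (fun w => k (w - z))) //.
by apply/funext => w; rewrite addrC.
Qed.

Lemma dmk_out (d : R) h : 0 < d -> d <= cabs h -> dmk d h = 0.
Proof. by move=> d0 /(scaled_ge d0) H; rewrite /dmk dbspline_le0 ?mulr0 //; lra. Qed.

(* The reproducing identity for the limit comes from [pompeiu]; differentiating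
   the smooth kernel under the integral then shows that the limit is holomorphic. *)
Lemma holomorphic_limit (u al be : nat -> R[i] -> R[i]) g : (forall n, D11 (u n) (al n) (be n)) ->
  (forall r e, 0 < e -> exists N, forall n, (N <= n)%N -> forall z, cabs z <= r -> cabs (be n z) <= e /\ cabs (u n z - g z) <= e) ->
  forall z, exists a, cderiv g z a.
Proof.
move=> Du H z0.
have d0 : 0 < 1 :> R by []; have tm := tame_mk d0; have ms := mass_gt0 d0.
have cg : cont g.
  move=> z e e0; have e3 : 0 < e / 3 by lra.
  have [N /(_ N (leqnn N)) hN] := H (cabs z + 1) (e / 3) e3.
  have [cu _ _] := D11_cont (Du N); have [d dd hd] := cu z (e / 3) e3.
  exists (Num.min 1 d) => [|w]; first by rewrite lt_min ltr01.
  rewrite lt_min => /andP[w1 wd]; have := hd w wd.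
  have [|_] := hN w; first by have := cabs_subr w z; lra.
  have [|_] := hN z; first by lra.
  have -> : g w - g z = (u N w - u N z) - (u N w - g w) + (u N z - g z) by ring.
  have := cabsD (u N w - u N z - (u N w - g w)) (u N z - g z).
  by have := cabsBD (u N w - u N z) (u N w - g w); lra.
(* A cut-off equal to 1 within distance 2 of [z0] (indeed while [|w - z0|^2 <= 8]). It makes the
   integrands tame without changing integrals against the unit kernel placed at distance at most
   1. *)
pose chi w := RC (zl 4 (w - z0)).
have d4 : 0 < 4 :> R by [].
have tchi : tame chi by exact: (tame_conv z0 (tame_zl d4)).
have chi1 z w : cabs (z - z0) <= 1 -> cabs (w - z) <= 1 -> chi w = 1.
  move=> h1 h2; rewrite /chi zl_in // -?RC1 //; have := cabsD (w - z) (z - z0); rewrite addrA subrK => h3.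
  have h4 := cabs_ge0 (w - z0); have : cabs (w - z0) <= 2 by lra.
  by rewrite !expr2; nra.
have conv_chi v z : cabs (z - z0) <= 1 -> (fun w => RC (mk 1 (w - z)) * (chi w * v w)) = (fun w => RC (mk 1 (w - z)) * v w).
  move=> h1; apply/funext => w; have [h2|h2] := leP (cabs (w - z)) 1; first by rewrite (chi1 z) // mul1r.
  by rewrite (mk_out d0 (ltW h2)) !mul0r.
have far z w : cabs (z - z0) <= 1 -> cabs w <= 1 -> cabs (z + w) <= cabs z0 + 2.
  move=> h1 h2; have -> : z + w = z0 + ((z - z0) + w) by ring.
  have := cabsD z0 (z - z0 + w); have := cabsD (z - z0) w; lra.
have shiftJ z v : cont v -> J (fun h => RC (mk 1 h) * v (z + h)) = J (fun w => RC (mk 1 (w - z)) * v w).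
  move=> cv; have t : tame (fun w => RC (mk 1 (w - z)) * v w) by exact: tameMr (tame_conv z tm) cv.
  rewrite -(J_shift z t); congr J; apply/funext => h.
  by rewrite (addrC z h) addrK.
have rep z : cabs (z - z0) <= 1 -> J (fun w => RC (mk 1 (w - z)) * g w) = RC (mass 1) * g z.
  move=> h1; apply/eqP; rewrite -subr_eq0 -cabs_eq0 eq_le cabs_ge0 andbT.
  apply/ler_addgt0Pr => e e0; rewrite add0r; pose e1 : R := e / (4 * mass 1).
  have e10 : 0 < e1 by rewrite divr_gt0 // mulr_gt0.
  have [N /(_ N (leqnn N)) hN] := H (cabs z0 + 2) e1 e10.
  have [cu _ _] := D11_cont (Du N).
  have P := pompeiu d0 (D11_shift z (Du N)) (m := e1) _; rewrite addr0 in P.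
  have {}P := P ltac:(by move=> h hh; have [] := hN (z + h) (far _ _ h1 hh)).
  have hz : cabs (u N z - g z) <= e1.
    by have [] := hN z; rewrite // -[z]addr0; apply: far; rewrite ?addr0 ?cabs0.
  have cd : cont (fun h => u N (z + h) - g (z + h)).
    apply: contD; first exact: cont_shift.
    have -> : (fun h => - g (z + h)) = (fun h => -1 * g (z + h)) by apply/funext => h; rewrite mulN1r.
    by apply: contZ; exact: cont_shift.
  have Q := J_kernel_bound (M := e1) tm cd (mk_ge0 d0) _.
  have {}Q := Q ltac:(by move=> h mh; have [_ hh] := mk_supp d0 mh; have [] := hN (z + h) (far _ _ h1 hh)).
  have E : J (fun h => RC (mk 1 h) * (u N (z + h) - g (z + h))) = J (fun h => RC (mk 1 h) * u N (z + h)) - J (fun h => RC (mk 1 h) * g (z + h)).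
    rewrite -JB; last 2 first.
    - exact: tameMr tm (cont_shift z cu).
    - exact: tameMr tm (cont_shift z cg).
    by congr J; apply/funext => h; rewrite mulrBr.
  rewrite E shiftJ // shiftJ // in Q; rewrite shiftJ // in P.
  have -> : J (fun w => RC (mk 1 (w - z)) * g w) - RC (mass 1) * g z =
     (J (fun w => RC (mk 1 (w - z)) * u N w) - RC (mass 1) * u N z) -
     (J (fun w => RC (mk 1 (w - z)) * u N w) - J (fun w => RC (mk 1 (w - z)) * g w)) + RC (mass 1) * (u N z - g z) by ring.
  apply: le_trans (cabsD _ _) _; rewrite [cabs (RC (mass 1) * _)]cabsM cabs_real (gtr0_norm ms).
  have B := cabsBD (J (fun w => RC (mk 1 (w - z)) * u N w) - RC (mass 1) * u N z) (J (fun w => RC (mk 1 (w - z)) * u N w) - J (fun w => RC (mk 1 (w - z)) * g w)).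
  have m2 := ler_wpM2l (ltW ms) hz.
  have e1E : e1 * mass 1 = e / 4 by rewrite /e1; field; rewrite gt_eqF.
  move: B P Q m2; rewrite -[complex.Re (J (fun h => RC (mk 1 h)))]/(mass 1) => B P Q m2; nra.
have Dk := D11p_conv (D11_mk (1 : R)).
have [ck ca cb] := D11_cont (D11_mk (1 : R)).
have conts z : [/\ cont (fun w => RC (mk 1 (w - z))), cont (fun w => - (RC (dmk 1 (w - z)) * (w - z)^*)) & cont (fun w => - (RC (dmk 1 (w - z)) * (w - z)))].
  have sh v : cont v -> cont (fun w => v (w - z)).
    move=> /(cont_shift (- z)); rewrite (_ : (fun w => v (- z + w)) = (fun w => v (w - z))) //.
    by apply/funext => w; rewrite addrC.
  have ng v : cont v -> cont (fun w => - v w).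
    by move=> /(contZ (-1)); rewrite (_ : (fun w => -1 * v w) = (fun w => - v w)) //; apply/funext => w; rewrite mulN1r.
  by split; [exact: sh ck | exact/ng/(sh _ ca) | exact/ng/(sh _ cb)].
have tcg : tame (fun w => chi w * g w) by exact: tameMr.
have DG := D11p_integral Dk tcg conts.
(* In this integral [g] is close to [u N]; for [u N], Stokes moves dbar from the kernel onto [u N],
   whose dbar-derivative is small. *)
have be0 z : cabs (z - z0) <= 1 -> J (fun w => - (RC (dmk 1 (w - z)) * (w - z)) * (chi w * g w)) = 0.
  move=> h1.
  pose b w := RC (dmk 1 w) * w.
  have tb : tame b.
    by split=> //; exists 1 => w w1; rewrite /b (dmk_out d0 w1) mul0r.
  have [M [r [M0 r0 hM hr]]] := tame_bounded tb.
  have tbz : tame (fun w => b (w - z)) := tame_conv z tb.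
  apply/eqP; rewrite -cabs_eq0 eq_le cabs_ge0 andbT.
  apply/ler_addgt0Pr => e e0; rewrite add0r; pose X : R := mass 1 + 8 * M + 1.
  have X0 : 0 < X by rewrite /X; lra.
  have e10 : 0 < e / X by rewrite divr_gt0.
  have [N /(_ N (leqnn N)) hN] := H (cabs z0 + 2) (e / X) e10.
  have [cu _ cbe] := D11_cont (Du N).
  have near1 w : cabs (w - z) <= 1 -> cabs w <= cabs z0 + 2.
    by move=> h2; have := far z (w - z) h1 h2; rewrite addrC subrK.
  have bchi v : (fun w => b (w - z) * (chi w * v w)) = (fun w => b (w - z) * v w).
    apply/funext => w; have [h2|h2] := leP (cabs (w - z)) 1; first by rewrite (chi1 z) // mul1r.
    by rewrite /b (dmk_out d0 (ltW h2)) !mul0r.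
  have t1 : tame (fun w => b (w - z) * u N w) by exact: tameMr.
  have t2 : tame (fun w => b (w - z) * g w) by exact: tameMr.
  have t3 : tame (fun w => RC (mk 1 (w - z)) * be N w) by exact: tameMr (tame_conv z tm) cbe.
  have jg : J (fun w => - (RC (dmk 1 (w - z)) * (w - z)) * (chi w * g w)) = - J (fun w => b (w - z) * g w).
    rewrite -(JN t2); congr J; apply/funext => w; have := congr1 (fun f => f w) (bchi g) => /= <-.
    by rewrite /b mulNr.
  have js : J (fun w => b (w - z) * u N w) = - J (fun w => RC (mk 1 (w - z)) * be N w).
    have D1 := D11M (D11_shift (- z) (D11_mk (1 : R))) (Du N).
    have cs : compact_supp (fun w => RC (mk 1 (- z + w)) * u N w).
      have [_ [rr hrr]] := tame_conv z tm; exists rr => w /hrr; rewrite (addrC w) => ->; by rewrite mul0r.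
    have [_ _ _ j0] := stokes cs D1.
    apply/eqP; rewrite -subr_eq0 opprK -(JD t1 t3) -j0; apply/eqP; congr J; apply/funext => w.
    by rewrite /b (addrC (- z) w).
  rewrite jg cabsN.
  have -> : J (fun w => b (w - z) * g w) = - J (fun w => b (w - z) * (u N w - g w)) - J (fun w => RC (mk 1 (w - z)) * be N w).
    have -> : (fun w => b (w - z) * (u N w - g w)) = (fun w => b (w - z) * u N w - b (w - z) * g w) by apply/funext => w; rewrite mulrBr.
    by rewrite (JB t1 t2) js; ring.
  apply: le_trans (cabsBD _ _) _; rewrite cabsN.
  have k1 : cabs (J (fun w => RC (mk 1 (w - z)) * be N w)) <= e / X * mass 1.
    rewrite -shiftJ //; apply: (J_kernel_bound tm (cont_shift z cbe) (mk_ge0 d0)) => h mh.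
    by have [_ hh] := mk_supp d0 mh; have [] := hN (z + h) (far _ _ h1 hh).
  have k2 : cabs (J (fun w => b (w - z) * (u N w - g w))) <= 8 * (M * (e / X)).
    have tt : tame (fun w => b (w - z) * (u N w - g w)).
      by have := tameB t1 t2; congr tame; apply/funext => w; rewrite mulrBr.
    rewrite -(J_shift z tt) -[leRHS]mulr1 -[X in _ * X](expr1n _ 2).
    apply: (J_bound (tame_shift z tt) ler01) => h.
      rewrite addrAC subrr add0r; have [hh|hh] := leP (cabs h) 1.
        rewrite cabsM; apply: ler_pM; rewrite ?cabs_ge0 //.
        by have [] := hN (z + h) (far _ _ h1 hh).
      by rewrite /b (dmk_out d0 (ltW hh)) !mul0r cabs0; apply: mulr_ge0 => //; exact: ltW.
    by move=> /ltW hh; rewrite addrAC subrr add0r /b (dmk_out d0 hh) !mul0r.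
  have eX : e / X * X = e by rewrite divfK // gt_eqF.
  move: k1 k2 eX; rewrite /X; move: (e / _) e10 => y y0; nra.
have [c mi] : exists c : R[i], c * RC (mass 1) = 1.
  have m0 := lt0r_neq0 ms; exists (RC ((mass (1 : R))^-1)).
  by have := congr1 (fun x : R => RC x) (mulVf m0); rewrite RCM RC1.
have [a Da] : exists a, cderiv (fun z => J (fun w => RC (mk 1 (w - z)) * (chi w * g w))) z0 a.
  eexists; apply: D11_cderiv DG _; apply: be0; rewrite subrr cabs0 //.
exists (c * a).
apply: (@cderiv_local (fun z => c * J (fun w => RC (mk 1 (w - z)) * (chi w * g w))) _ _ _ 1) => //.
  by move=> w /ltW w1; rewrite conv_chi // rep // mulrA mi mul1r.
move=> e e0; have c0 := cabs_ge0 (c); have c1 : 0 < cabs (c) + 1 by lra.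
have [d dd hd] := Da (e / (cabs (c) + 1)) ltac:(by rewrite divr_gt0).
exists d => // h /hd; move: (J _) (J _) => y x hx.
have -> : c * x - c * y - c * a * h = c * (x - y - a * h) by ring.
rewrite cabsM; apply: le_trans (ler_wpM2l c0 hx) _.
have -> : cabs (c) * (e / (cabs (c) + 1) * cabs h) = e * cabs h * (cabs (c) / (cabs (c) + 1)).
  by field; rewrite gt_eqF.
by apply: ler_piMr; [rewrite mulr_ge0 ?cabs_ge0 // ltW | rewrite ler_pdivrMr // mul1r; lra].
Qed.
End HolomorphicLimit.

(** * Solving the dbar-equation in a weighted sup norm by iteration *)

Section DbarIteration.
Variables (R : realType) (d : R).
Hypothesis d0 : 0 < d.
(** [E z h] carries a value at [z + h] back to [z] at the cost recorded in [weight]. Its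
    dbar-derivatives in [z] and in [h] coincide and are divisible by [h], with [- Y E] as quotient;
    the dbar-derivatives [Y2] of [Y] in [z] and in [h] coincide as well. These coincidences make the
    iteration work. *)
Variables (E Y E1 Y1 Y2 : R[i] -> R[i] -> R[i]) (Psi : R[i] -> R).
Implicit Types (z w : R[i]) (u al be : R[i] -> R[i]).
Local Notation RC x := (Complex x 0).
Hypothesis E0 : forall z, E z 0 = 1.
Hypothesis DE : D11p E E1 (fun z h => - (h * Y z h * E z h)).
Hypothesis DEh : forall z, exists a, D11 (E z) a (fun h => - (h * Y z h * E z h)).
Hypothesis DY : D11p Y Y1 Y2.
Hypothesis DYh : forall z, exists a, D11 (Y z) a (Y2 z).
Hypothesis cE1 : forall z, cont (E1 z).
Hypothesis cY1 : forall z, cont (Y1 z).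
Hypothesis weight : forall z h, cabs h <= d -> cabs (E z h) * expR (Psi (z + h)) <= expR (Psi z).
Hypothesis weight_half : forall z h, cabs h <= d -> d ^+ 2 / 2 <= cabs h ^+ 2 ->
  cabs (E z h) * expR (Psi (z + h)) <= expR (Psi z) / 2.
Hypothesis Psi_bounded : forall r, exists B, forall z, cabs z <= r -> Psi z <= B.

Let tm : tame (fun h => RC (mk d h)). Proof. exact: tame_mk. Qed.
Let tz : tame (fun h => RC (zl d h)). Proof. exact: tame_zl. Qed.
Let ms : 0 < mass d. Proof. exact: mass_gt0. Qed.

(* Correcting the averaging kernel by the [Y]-term makes [u - T u] depend only on dbar u,
   and dbar (T u) is the average of dbar u over the annulus where the weight is small. *)
Definition dbar_step u z := (RC (mass d))^-1 *
  (J (fun h => E z h * u (z + h) * RC (mk d h)) + J (fun h => Y z h * (E z h * u (z + h)) * RC (zl d h))).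

Lemma dbar_stepP u al be m : D11 u al be -> (forall z, cabs (be z) <= m * expR (Psi z)) ->
  exists al' be', [/\ D11 (dbar_step u) al' be', forall z, cabs (be' z) <= m / 2 * expR (Psi z) &
    forall z, cabs (dbar_step u z - u z) <= 2 * d * m * expR (Psi z)].
Proof.
move=> Du hbe; have [cu cal cbe] := D11_cont Du.
have m0 : 0 <= m.
  by have := hbe 0; have := cabs_ge0 (be 0); have := expR_gt0 (Psi 0); nra.
have cE z : cont (E z) by have [a D] := DEh z; have [] := D11_cont D.
have cY z : cont (Y z) by have [a D] := DYh z; have [] := D11_cont D.
have cY2 z : cont (Y2 z) by have [a D] := DYh z; have [] := D11_cont D.
have ceb z : cont (fun h => - (h * Y z h * E z h)) by have [a D] := DEh z; have [] := D11_cont D.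
have KU := D11pM DE (D11p_sh Du); have KY := D11pM DY KU.
have cU z : [/\ cont (fun h => E z h * u (z + h)), cont (fun h => E1 z h * u (z + h) + E z h * al (z + h)) &
    cont (fun h => - (h * Y z h * E z h) * u (z + h) + E z h * be (z + h))].
  have := cont_shift z cu; have := cont_shift z cal; have := cont_shift z cbe => c3 c2 c1.
  split; first exact: contM.
    by apply: contD; exact: contM.
  by apply: contD; exact: contM.
have DI1 := D11p_integral KU tm cU.
have DI2 : D11 _ _ _ := D11p_integral KY tz (fun z => let: And3 a b c := cU z in
  And3 (contM (cY z) a) (contD (contM (cY1 z) a) (contM (cY z) b)) (contD (contM (cY2 z) a) (contM (cY z) c))).
have D := D11Z (RC (mass d))^-1 (D11D DI1 DI2).
have mn : RC (mass d) != 0 by apply/eqP => -[]; apply/eqP; rewrite gt_eqF.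
have mV : cabs (RC (mass d))^-1 = (mass d)^-1 by rewrite cabsV cabs_real gtr0_norm.
have tE z : tame (fun h => RC (mk d h) * (E z h * be (z + h))).
  by apply: tameMr tm _; apply: contM => //; exact: cont_shift.
(* Because dbar in [z] of [Y E u] is also its dbar in [h], Stokes in [h] moves it onto [zl], where
   it becomes [h mk]. The result cancels the contribution [- h Y E u] of the phase in the first
   integral, and only the average of [E be] survives. *)
have key z : J (fun h => (- (h * Y z h * E z h) * u (z + h) + E z h * be (z + h)) * RC (mk d h)) +
    J (fun h => (Y2 z h * (E z h * u (z + h)) + Y z h * (- (h * Y z h * E z h) * u (z + h) + E z h * be (z + h))) * RC (zl d h)) =
    J (fun h => RC (mk d h) * (E z h * be (z + h))).
  have [a1 D1] := DYh z; have [a2 D2] := DEh z; have [c1 c2 c3] := cU z.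
  have D3 := D11M (D11M D1 (D11M D2 (D11_shift z Du))) (D11_zl d).
  have cs : compact_supp (fun h => Y z h * (E z h * u (z + h)) * RC (zl d h)).
    by exists d => h /(zl_out d0) ->; rewrite mulr0.
  have [_ tb _ j0] := stokes cs D3.
  have t1 : tame (fun h => (- (h * Y z h * E z h) * u (z + h) + E z h * be (z + h)) * RC (mk d h)) by exact: tameM.
  have t2 : tame (fun h => (Y2 z h * (E z h * u (z + h)) + Y z h * (- (h * Y z h * E z h) * u (z + h) + E z h * be (z + h))) * RC (zl d h)).
    by apply: tameM tz; apply: contD; exact: contM.
  rewrite -[LHS]subr0 -j0 -(JD t1 t2) -(JB (tameD t1 t2) tb); congr J; apply/funext => h.
  by move: (mk d h) (zl d h) => k l; rewrite RCN; ring.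
pose b' z := (RC (mass d))^-1 * J (fun h => RC (mk d h) * (E z h * be (z + h))).
have D' := @D11_eq R _ _ _ (dbar_step u) _ b' D (fun z => erefl) (fun z => erefl) (fun z => congr1 (fun x => (RC (mass d))^-1 * x) (key z)).
eexists; exists b'; split; [exact: D' | | ].
- move=> z; rewrite cabsM mV ler_pdivrMl // mulrC.
  apply: (J_kernel_bound tm) => [||h mh]; [|exact: mk_ge0|].
    by apply: contM => //; exact: cont_shift.
  have [h1 h2] := mk_supp d0 mh; have W := weight_half z h2 h1.
  rewrite cabsM; have := hbe (z + h); have := cabs_ge0 (E z h); move: W => W c0 hb.
  apply: le_trans (ler_wpM2l c0 hb) _; have := ler_wpM2l m0 W; lra.
- move=> z; have [a1 D1] := DEh z; have Dv := D11M D1 (D11_shift z Du).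
  have [c1 c2 c3] := cU z.
  have b1c : cont (fun h => E z h * be (z + h)) by apply: contM => //; exact: cont_shift.
  have b2c : cont (fun h => Y z h * (E z h * u (z + h))) by exact: contM.
  (* In [h], the dbar-derivative of [E u] is [E be - h (Y E u)], the form that [pompeiu_split]
     expects. The error involves [E be] only, which is bounded through [weight]. *)
  have P := pompeiu_split d0 Dv (m := m * expR (Psi z)) _ b1c b2c.
  have {}P := P ltac:(by move=> h; ring).
  have {}P := P ltac:(by move=> h hd; rewrite cabsM; apply: le_trans (ler_wpM2l (cabs_ge0 _) (hbe (z + h))) _;
     have := ler_wpM2l m0 (weight z hd); lra).
  rewrite E0 mul1r addr0 in P.
  have -> : dbar_step u z - u z = (RC (mass d))^-1 * (J (fun h => RC (mk d h) * (E z h * u (z + h)) + RC (zl d h) * (Y z h * (E z h * u (z + h)))) - RC (mass d) * u z).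
    rewrite /dbar_step mulrBr mulKf //; congr (_ * _ - _).
    rewrite -JD; [congr J; apply/funext => h; ring | exact: tameM | exact: tameM].
  rewrite cabsM mV ler_pdivrMl //; apply: le_trans P _; rewrite le_eqVlt; apply/orP; left; apply/eqP; ring.
Qed.

Lemma pow_half_small (M e : R) : 0 <= M -> 0 < e -> exists N, forall n, (N <= n)%N -> M / 2 ^+ n <= e.
Proof.
move=> M0 e0; have [N hN] := inv_small M0 e0; exists N => n /hN; apply: le_trans.
apply: ler_wpM2l => //; rewrite lef_pV2 ?posrE ?exprn_gt0 ?ltr0n //.
by rewrite -natrX ler_nat ltn_expl.
Qed.

(** The dbar-derivatives of the iterates decay like [2^-n], and the steps [2 d m 2^-n] sum to
    [4 d m]. [Psi_bounded] turns the weighted estimates into locally uniform ones, as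
    [holomorphic_limit] needs. *)
Lemma dbar_solution u al be m : D11 u al be -> (forall z, cabs (be z) <= m * expR (Psi z)) ->
  exists2 g, forall z, exists a, cderiv g z a & forall z, cabs (u z - g z) <= 4 * d * m * expR (Psi z).
Proof.
move=> Du hbe; pose un n := iter n dbar_step u.
have m0 : 0 <= m.
  by have := hbe 0; have := cabs_ge0 (be 0); have := expR_gt0 (Psi 0); nra.
have data n : exists ab : (R[i] -> R[i]) * (R[i] -> R[i]), D11 (un n) ab.1 ab.2 /\
    (forall z, cabs (ab.2 z) <= m / 2 ^+ n * expR (Psi z)) /\
    forall z, cabs (un n.+1 z - un n z) <= 2 * d * (m / 2 ^+ n) * expR (Psi z).
  elim: n => [|n [[a b] [/= D [hb _]]]].
    have [a' [b' [D' _ hd]]] := dbar_stepP Du hbe.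
    exists (al, be); split => //; split=> z; rewrite expr0 divr1; [exact: hbe | exact: hd].
  have [a' [b' [D' hb' _]]] := dbar_stepP D hb.
  have hb2 z : cabs (b' z) <= m / 2 ^+ n.+1 * expR (Psi z).
    apply: le_trans (hb' z) _; rewrite exprS invfM; lra.
  by have [_ [_ [_ _ hd]]] := dbar_stepP D' hb2; exists (a', b').
have [ab hab] := choice data.
have tele n k z : cabs (un (n + k)%N z - un n z) <= 4 * d * (m / 2 ^+ n) * (1 - (2 ^+ k)^-1) * expR (Psi z).
  elim: k => [|k IH]; first by rewrite addn0 subrr cabs0 expr0 invr1 subrr mulr0 mul0r.
  have [_ [_ /(_ z) hd]] := hab (n + k)%N.
  have -> : un (n + k.+1)%N z - un n z = (un (n + k).+1 z - un (n + k)%N z) + (un (n + k)%N z - un n z).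
    by rewrite addnS addrA subrK.
  apply: le_trans (cabsD _ _) _; apply: le_trans (lerD hd IH) _.
  rewrite le_eqVlt; apply/orP; left; apply/eqP; rewrite exprS exprD.
  by field; rewrite !expf_neq0.
have tele2 n k z : cabs (un (n + k)%N z - un n z) <= 4 * d * m * expR (Psi z) / 2 ^+ n.
  apply: le_trans (tele n k z) _.
  have -> : 4 * d * m * expR (Psi z) / 2 ^+ n = 4 * d * (m / 2 ^+ n) * 1 * expR (Psi z) by ring.
  apply: ler_wpM2r; first exact: expR_ge0.
  apply: ler_wpM2l; first by rewrite !mulr_ge0 ?invr_ge0 ?exprn_ge0 // ltW.
  by rewrite gerBl invr_ge0 exprn_ge0.
have X0 z : 0 <= 4 * d * m * expR (Psi z) by rewrite !mulr_ge0 ?expR_ge0 // ltW.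
have [g hg] : {g : R[i] -> R[i] & forall z e, 0 < e -> exists N, forall n, (N <= n)%N -> cabs (un n z - g z) <= e}.
  apply: (choice (P := fun z y => forall e, 0 < e -> exists N, forall n, (N <= n)%N -> cabs (un n z - y) <= e)) => z.
  apply: (@complex_cauchy R (un^~ z)) => e e0; have [N hN] := pow_half_small (X0 z) e0.
  exists N => n k Nn Nk; have [nk|kn] := leqP n k.
    by rewrite -cabsN opprB -(subnKC nk); apply: le_trans (tele2 _ _ _) _; exact: hN.
  by rewrite -(subnKC (ltnW kn)); apply: le_trans (tele2 _ _ _) _; exact: hN.
have close n z : cabs (un n z - g z) <= 4 * d * m * expR (Psi z) / 2 ^+ n.
  apply/ler_addgt0Pr => e e0; have [N hN] := hg z e e0.
  have h1 := hN (n + N)%N (leq_addl _ _); have h2 := tele2 n N z.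
  have -> : un n z - g z = (un (n + N)%N z - g z) - (un (n + N)%N z - un n z) by ring.
  by apply: le_trans (cabsBD _ _) _; lra.
exists g => [|z]; last by have := close 0%N z; rewrite expr0 divr1.
apply: (@holomorphic_limit _ un (fun n => (ab n).1) (fun n => (ab n).2)).
  by move=> n; have [] := hab n.
move=> r e e0; have [B hB] := Psi_bounded r.
have K0 : 0 <= (4 * d * m + m) * expR B.
  by rewrite mulr_ge0 ?expR_ge0 // addr_ge0 // !mulr_ge0 // ltW.
have [N hN] := pow_half_small K0 e0; exists N => n /hN hn z zr.
have eB : expR (Psi z) <= expR B by rewrite ler_expR; exact: hB.
have p0 : 0 <= (2 ^+ n : R)^-1 by rewrite invr_ge0 exprn_ge0.
have dm : 0 <= 4 * d * m by rewrite !mulr_ge0 // ltW.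
have q1 : 4 * d * m * expR (Psi z) / 2 ^+ n <= 4 * d * m * expR B / 2 ^+ n by apply: ler_wpM2r => //; exact: ler_wpM2l.
have q2 : m / 2 ^+ n * expR (Psi z) <= m * expR B / 2 ^+ n by rewrite mulrAC; apply: ler_wpM2r => //; exact: ler_wpM2l.
have z1 : 0 <= 4 * d * m * expR B / 2 ^+ n by rewrite mulr_ge0 // mulr_ge0 ?expR_ge0.
have z2 : 0 <= m * expR B / 2 ^+ n by rewrite mulr_ge0 // mulr_ge0 ?expR_ge0.
have hE : (4 * d * m + m) * expR B / 2 ^+ n = 4 * d * m * expR B / 2 ^+ n + m * expR B / 2 ^+ n by ring.
have [_ [hb _]] := hab n; split.
  by apply: le_trans (hb z) _; move: hn; rewrite hE; lra.
by apply: le_trans (close n z) _; move: hn; rewrite hE; lra.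
Qed.
End DbarIteration.

(** * Polarized polynomials and peak functions for strictly subharmonic weights *)

Section PolynomialPhase.
Variable R : realType.
Implicit Types (z w h : R[i]) (F G B : R[i] -> R[i] -> R[i]).
Local Notation RC x := (Complex x 0).
Local Notation term := (R[i] * (nat * nat))%type.
Implicit Types (s : seq term).

(* [F] is a smooth function of [z] and [h] whose dbar-derivatives with respect to [z] and to [h] are both [B]. *)
Definition DB F B := (exists2 A, D11p F A B & forall z, cont (A z)) /\ forall z, exists a, D11 (F z) a (B z).

Lemma DB_eq F F' B B' : DB F B -> (forall z h, F z h = F' z h) -> (forall z h, B z h = B' z h) -> DB F' B'.
Proof.
move=> D eF eB; have -> : F' = F by apply/funext => z; apply/funext => h; rewrite eF.
by have -> : B' = B by apply/funext => z; apply/funext => h; rewrite eB.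
Qed.

Lemma DB_fst : DB (fun z _ => z) (fun _ _ => 0).
Proof.
split=> [|z]; last by exists (fun=> 0); exact: D11_cst.
by exists (fun _ _ => 1); [exact: D11p_of (@D11_id R) | move=> z; exact: cont_cst].
Qed.

Lemma DB_cst (c : R[i]) : DB (fun _ _ => c) (fun _ _ => 0).
Proof.
split=> [|z]; last by exists (fun=> 0); exact: D11_cst.
by exists (fun _ _ => 0); [exact: D11p_of (D11_cst c) | move=> z; exact: cont_cst].
Qed.

Lemma DB_add : DB (fun z h => z + h) (fun _ _ => 0).
Proof.
split=> [|z]; last by exists (fun=> 1); exact: (D11_shift z (@D11_id R)).
by exists (fun _ _ => 1); [exact: D11p_sh (@D11_id R) | move=> z; exact: cont_cst].
Qed.

Lemma DB_conj : DB (fun z h => (z + h)^*) (fun _ _ => 1).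
Proof.
have D := D11_conj (@D11_id R); rewrite rmorph0 rmorph1 in D.
split=> [|z]; last by exists (fun=> 0); exact: (D11_shift z D).
by exists (fun _ _ => 0); [exact: (D11p_sh D) | move=> z; exact: cont_cst].
Qed.

Lemma DB_cont F B z : DB F B -> cont (F z) /\ cont (B z).
Proof. by move=> [_ /(_ z)[a D]]; have [] := D11_cont D. Qed.

Lemma DB_D F B F' B' : DB F B -> DB F' B' -> DB (fun z h => F z h + F' z h) (fun z h => B z h + B' z h).
Proof.
move=> [[A D cA] H] [[A' D' cA'] H']; split=> [|z].
  by exists (fun z h => A z h + A' z h); [exact: D11pD | move=> z; exact: contD].
by have [a Da] := H z; have [a' Da'] := H' z; eexists; exact: D11D Da Da'.
Qed.

Lemma DB_M F B F' B' : DB F B -> DB F' B' -> DB (fun z h => F z h * F' z h) (fun z h => B z h * F' z h + F z h * B' z h).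
Proof.
move=> HF HF'; have [[A D cA] H] := HF; have [[A' D' cA'] H'] := HF'; split=> [|z].
  exists (fun z h => A z h * F' z h + F z h * A' z h); first exact: D11pM.
  by move=> z; have [c1 _] := DB_cont z HF; have [c2 _] := DB_cont z HF'; apply: contD; exact: contM.
by have [a Da] := H z; have [a' Da'] := H' z; eexists; exact: D11M Da Da'.
Qed.

Lemma D11_exp u al be : D11 u al be -> D11 (fun z => cexp (u z)) (fun z => cexp (u z) * al z) (fun z => cexp (u z) * be z).
Proof. exact: D11p_exp. Qed.

Lemma cont_cexp u : cont u -> cont (fun z => cexp (u z)).
Proof. by move=> cu z; apply: cont_comp cu _; move=> w; exact: cderiv_cont (cderiv_cexp w). Qed.

Lemma DB_exp F B : DB F B -> DB (fun z h => cexp (F z h)) (fun z h => cexp (F z h) * B z h).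
Proof.
move=> HF; have [[A D cA] H] := HF; split=> [|z].
  exists (fun z h => cexp (F z h) * A z h); first exact: D11p_exp.
  by move=> z; have [c1 _] := DB_cont z HF; apply: contM => //; exact: cont_cexp.
by have [a Da] := H z; eexists; exact: D11_exp Da.
Qed.

Lemma DB_holX F n : DB F (fun _ _ => 0) -> DB (fun z h => F z h ^+ n) (fun _ _ => 0).
Proof.
move=> D; elim: n => [|n IH].
  by apply: DB_eq (DB_cst 1) _ _ => z h; rewrite ?expr0.
by apply: DB_eq (DB_M D IH) _ _ => z h; rewrite ?exprS // mul0r mulr0 addr0.
Qed.

Lemma DB_conjX n : DB (fun z h => (z + h)^* ^+ n) (fun z h => n%:R * (z + h)^* ^+ n.-1).
Proof.
elim: n => [|n IH].
  by apply: DB_eq (DB_cst 1) _ _ => z h; rewrite ?expr0 ?mul0r.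
apply: DB_eq (DB_M DB_conj IH) _ _ => z h; first by rewrite exprS.
case: n {IH} => [|n]; first by rewrite !expr0 mul0r mulr0 addr0 !mul1r.
by rewrite /= [in RHS]mulrSr mulrDl !mul1r mulrCA -exprS addrC.
Qed.

Lemma DB_sum (I : Type) (r : seq I) (F B : I -> R[i] -> R[i] -> R[i]) : (forall i, DB (F i) (B i)) ->
  DB (fun z h => \sum_(i <- r) F i z h) (fun z h => \sum_(i <- r) B i z h).
Proof.
move=> D; elim: r => [|i r IH].
  by apply: DB_eq (DB_cst 0) _ _ => z h; rewrite big_nil.
by apply: DB_eq (DB_D (D i) IH) _ _ => z h; rewrite big_cons.
Qed.

(** [ppol] polarizes the polynomial [ppol s z z]: holomorphic in [z], antiholomorphic in [w]. [Sg n]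
    is the divided difference of the [n]-th power, so that [gform] is a divided difference in both
    variables. On the diagonal it is the mixed second derivative ([gform_diag]). *)
Definition ppol s z w : R[i] := \sum_(t <- s) t.1 * z ^+ t.2.1 * w^* ^+ t.2.2.
Definition Sg n z w : R[i] := \sum_(i < n) z ^+ (n.-1 - i) * w ^+ i.
Definition gform s z w : R[i] := \sum_(t <- s) t.1 * Sg t.2.1 z w * (Sg t.2.2 z w)^*.

Lemma SgE n z w : z ^+ n - w ^+ n = (z - w) * Sg n z w.
Proof. exact: subrXX. Qed.

(** Each monomial contributes its coefficient times [(z^a - w^a) (z^b - w^b)^*], and [z - w] factors
    out of both differences. *)
Lemma polarization s z w : ppol s z z + ppol s w w - ppol s z w - ppol s w z = RC (cabs (z - w) ^+ 2) * gform s z w.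
Proof.
rewrite /ppol /gform -mulJ mulr_sumr -big_split /= -!sumrB; apply: eq_bigr => t _.
have h1 := SgE t.2.1 z w; have h2 := SgE t.2.2 z w.
have -> : (z - w) * (z - w)^* * (t.1 * Sg t.2.1 z w * (Sg t.2.2 z w)^*) = t.1 * ((z - w) * Sg t.2.1 z w) * ((z - w) * Sg t.2.2 z w)^*.
  by rewrite rmorphM; ring.
by rewrite -h1 -h2 rmorphB !rmorphXn /=; ring.
Qed.

Lemma DB_Sg n : DB (fun z h => Sg n z (z + h)) (fun _ _ => 0).
Proof.
have D (i : 'I_n) := DB_M (DB_holX (n.-1 - i) DB_fst) (DB_holX i DB_add).
apply: DB_eq (DB_sum (index_enum 'I_n) D) _ _ => z h //.
by apply: big1 => i _; rewrite mul0r mulr0 addr0.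
Qed.

Lemma ppol_D11 s w : exists a, D11 (fun z => ppol s z w) a (fun=> 0).
Proof.
have X n : exists a, D11 (fun z => z ^+ n) a (fun=> 0).
  elim: n => [|n [a IH]].
    by exists (fun=> 0); apply: D11_eq (D11_cst 1) _ _ _ => z.
  eexists; apply: D11_eq (D11M (@D11_id R) IH) _ (fun z => erefl) _ => z; rewrite ?exprS //.
  by rewrite mul0r mulr0 addr0.
rewrite /ppol; elim: s => [|t s [a IH]].
  by exists (fun=> 0); apply: D11_eq (D11_cst 0) _ _ _ => z; rewrite ?big_nil.
have [b D] := X t.2.1.
eexists; apply: D11_eq (D11D (D11Z (t.1 * w^* ^+ t.2.2) D) IH) _ (fun z => erefl) _ => z.
  by rewrite big_cons mulrAC.
by rewrite mulr0 addr0.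
Qed.

Section Peak.
Variables (s : seq term) (d c0 : R).
Hypotheses (d0 : 0 < d) (c00 : 0 < c0).
Hypothesis sym : forall z w, complex.Re (ppol s z w) = complex.Re (ppol s w z).
Hypothesis lower : forall z w, cabs (z - w) <= d -> c0 <= complex.Re (gform s z w).
Local Notation Phi z := (complex.Re (ppol s z z)).

(** Here positivity of [gform] near the diagonal acts: [exp(2 p(z, w) - p(w, w))], holomorphic in
    [z], equals the weight in modulus at [z = w] and falls below it by a Gaussian in [z - w]. *)
Lemma phase_decay z w : cabs (z - w) <= d ->
  2 * complex.Re (ppol s z w) - Phi w <= Phi z - c0 * cabs (z - w) ^+ 2.
Proof.
move=> zw; have := congr1 (fun x => complex.Re x) (polarization s z w).
rewrite RC_re !(reD, reN) [complex.Re (ppol s w z)]sym => H.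
move: H (ler_wpM2r (sqr_ge0 (cabs (z - w))) (lower zw)).
move: (complex.Re (ppol s z w)) (Phi z) (Phi w) => *; lra.
Qed.

Lemma expR_half (x : R) : 1 <= x -> expR (- x) <= 2^-1.
Proof. by move=> x1; rewrite expRN lef_pV2 ?posrE ?expR_gt0 //; have := expR_ge1Dx x; lra. Qed.

(** The holomorphic Gaussian of [phase_decay] centred at [a] is cut off by [zl]. The cut-off creates
    a dbar-derivative only on the annulus, where the Gaussian is tiny for large [t]; [dbar_solution]
    removes it at an error of half the weight, so half of the value at [a] survives. *)
Lemma peak_functions : exists2 t0, 0 < t0 & forall t, t0 <= t -> forall a, exists2 g,
  forall z, exists b, cderiv g z b &
  (forall z, cabs (g z) <= 2 * expR (t * Phi z)) /\ expR (t * Phi a) / 2 <= cabs (g a).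
Proof.
have tm := tame_mk d0; have [M [r [M0 r0 hM _]]] := tame_bounded tm.
have mkM h : mk d h <= M by have := hM h; rewrite cabs_real ger0_norm // mk_ge0.
have cd : 0 < c0 * d ^+ 2 / 2 by rewrite divr_gt0 // mulr_gt0 // exprn_gt0.
(* [t] is taken so large that the Gaussian on the annulus is at most [exp(- X)]. Since
   [exp(- X) <= 1 / X], the part [X >= 1] gives the factor [1/2] in the weight, and [X >= 8 d^2 M]
   gives [4 d m <= 1/2]. *)
pose X : R := 1 + 8 * d ^+ 2 * M; have X1 : 1 <= X by rewrite /X lerDl; apply: mulr_ge0 => //; apply: mulr_ge0 => //; exact: sqr_ge0.
exists (X / (c0 * d ^+ 2 / 2)); first by rewrite divr_gt0 //; lra.
move=> t; rewrite ler_pdivrMr // => tX a; have t0 : 0 < t by nra.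
pose Psi z := t * Phi z.
(* The modulus of [E] times the weight at [z + h] is governed by [phase_decay]. The conjugate
   variable occurs only as [z + h], so dbar in [z] and in [h] agree; and since [z^a - (z + h)^a] is
   divisible by [h], [Y] is the polynomial quotient. *)
pose E z h := cexp (RC (2 * t) * (ppol s z (z + h) - ppol s (z + h) (z + h))).
pose Yb (c : R[i]) n m z h := c * (Sg n z (z + h) * (m%:R * (z + h)^* ^+ m.-1)).
pose Y z h := RC (2 * t) * \sum_(u <- s) Yb u.1 u.2.1 u.2.2 z h.
have DX : DB (fun z h => RC (2 * t) * (ppol s z (z + h) - ppol s (z + h) (z + h))) (fun z h => - (h * Y z h)).
  have Du (u : term) := DB_M (DB_cst u.1) (DB_M (DB_D (DB_holX u.2.1 DB_fst) (DB_M (DB_cst (-1)) (DB_holX u.2.1 DB_add))) (DB_conjX u.2.2)).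
  apply: DB_eq (DB_M (DB_cst (RC (2 * t))) (DB_sum s Du)) _ _ => z h.
    by congr (_ * _); rewrite /ppol -sumrB; apply: eq_bigr => u _; ring.
  rewrite mul0r add0r /Y mulrCA -mulrN; congr (_ * _); rewrite mulr_sumr -sumrN; apply: eq_bigr => u _.
  have := SgE u.2.1 z (z + h); rewrite opprD addrA subrr add0r /Yb => e.
  by rewrite mulN1r e; ring.
have DE := DB_exp DX.
have [Y2 DY] : exists Y2, DB Y Y2.
  have Du (u : term) := DB_M (DB_cst u.1) (DB_M (DB_Sg u.2.1) (DB_M (DB_cst u.2.2%:R) (DB_conjX u.2.2.-1))).
  by eexists; exact: DB_M (DB_cst (RC (2 * t))) (DB_sum s Du).
have {}DE : DB E (fun z h => - (h * Y z h * E z h)).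
  by apply: DB_eq DE _ _ => z h //; rewrite /E; ring.
have [[E1 DE1 cE1] DEh] := DE; have [[Y1 DY1 cY1] DYh] := DY.
have E0 z : E z 0 = 1 by rewrite /E addr0 subrr mulr0 cexp0.
have weightE z h : cabs h <= d -> cabs (E z h) * expR (Psi (z + h)) <= expR (Psi z) * expR (- (t * (c0 * cabs h ^+ 2))).
  move=> hd; rewrite cabs_cexp -!expRD ler_expR RC_re reD reN.
  have := @phase_decay z (z + h); rewrite opprD addrA subrr add0r cabsN => /(_ hd).
  move=> /(ler_wpM2l (ltW t0)); rewrite /Psi.
  move: (complex.Re (ppol s z (z + h))) (Phi z) (Phi (z + h)) => *; lra.
have half x : d ^+ 2 / 2 <= x -> expR (- (t * (c0 * x))) <= expR (- X).
  move=> hx; rewrite ler_expR lerN2; apply: le_trans tX _; rewrite ler_pM2l // -mulrA ler_pM2l //.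
have w1 z h : cabs h <= d -> cabs (E z h) * expR (Psi (z + h)) <= expR (Psi z).
  move=> /(weightE z) H; apply: le_trans H _; apply: ler_piMr; first exact: expR_ge0.
  rewrite -expR0 ler_expR oppr_le0; apply: mulr_ge0; [exact: ltW | apply: mulr_ge0; [exact: ltW | exact: sqr_ge0]].
have w2 z h : cabs h <= d -> d ^+ 2 / 2 <= cabs h ^+ 2 -> cabs (E z h) * expR (Psi (z + h)) <= expR (Psi z) / 2.
  move=> /(weightE z) H hh; apply: le_trans H _; apply: ler_wpM2l; first exact: expR_ge0.
  by apply: le_trans (half _ hh) _; exact: expR_half.
have Pb r' : exists Bd, forall z, cabs z <= r' -> Psi z <= Bd.
  have cP : cont (fun z => ppol s z z).
    have D := DB_sum s (fun u : term => DB_M (DB_cst u.1) (DB_M (DB_holX u.2.1 DB_add) (DB_conjX u.2.2))).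
    have [c _] := DB_cont 0 D; move: c; congr cont; apply/funext => z; apply: eq_bigr => u _.
    by rewrite add0r mulrA.
  have [Bd _ hB] := cont_bounded cP r'; exists (t * Bd) => z /hB H; rewrite /Psi ler_pM2l //.
  by apply: le_trans (Re_le_cabs _) H.
have [al Dal] := ppol_D11 s a.
have De : D11 (fun z => cexp (RC (2 * t) * ppol s z a + RC (- t) * ppol s a a)) _ _ :=
  D11_exp (D11D (D11Z (RC (2 * t)) Dal) (D11_cst (RC (- t) * ppol s a a))).
set e := fun z => cexp _ in De.
have Du := D11M (D11_shift (- a) (D11_zl d)) De.
have eW z : cabs (z - a) <= d -> cabs (e z) <= expR (Psi z) * expR (- (t * (c0 * cabs (z - a) ^+ 2))).
  move=> /phase_decay/(ler_wpM2l (ltW t0)) H; rewrite /e cabs_cexp -expRD ler_expR reD !RC_re /Psi; move: H.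
  move: (complex.Re (ppol s z a)) (Phi z) (Phi a) => *; lra.
(* The dbar-derivative of the cut-off Gaussian is [- mk (z - a) e] with the factor [z - a]: at most
   [M], times [d], times [exp(- X)] relative to the weight. *)
pose m : R := M * d * expR (- X).
have be_le z : cabs ((RC (- mk d (- a + z)) * (- a + z)) * e z + RC (zl d (- a + z)) * (cexp (RC (2 * t) * ppol s z a + RC (- t) * ppol s a a) * (RC (2 * t) * 0 + 0))) <= m * expR (Psi z).
  rewrite !mulr0 add0r !mulr0 addr0 (addrC (- a)).
  have [->|mn] := eqVneq (mk d (z - a)) 0.
    by rewrite oppr0 !mul0r cabs0 !mulr_ge0 ?expR_ge0 // ltW.
  have [h1 h2] := mk_supp d0 mn; have := eW z h2; move: (e z) => ez hez; rewrite !cabsM (_ : cabs (RC (- mk d (z - a))) = mk d (z - a)); last first.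
    by rewrite cabs_real normrN ger0_norm // mk_ge0.
  have -> : m * expR (Psi z) = M * d * (expR (Psi z) * expR (- X)) by rewrite /m; ring.
  have k0 := mk_ge0 d0 (z - a).
  apply: ler_pM; [apply: mulr_ge0; [exact: k0 | exact: cabs_ge0] | exact: cabs_ge0 | | ].
    by apply: ler_pM; [exact: k0 | exact: cabs_ge0 | exact: mkM | exact: h2].
  by apply: le_trans hez _; apply: ler_wpM2l; [exact: expR_ge0 | exact: half].
have [g gD hg] := dbar_solution d0 E0 DE1 DEh DY1 DYh cE1 cY1 w1 w2 Pb Du be_le.
have dm : 4 * d * m <= 2^-1.
  have : expR (- X) * X <= 1.
    rewrite expRN mulrC ler_pdivrMr ?expR_gt0 // mul1r; have := expR_ge1Dx X; lra.
  have := expR_ge0 (- X); rewrite /m /X; move: (expR _) => ex ex0; rewrite expr2.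
  have := mulr_ge0 M0 (sqr_ge0 d); rewrite expr2; nra.
have hg2 z : cabs (RC (zl d (- a + z)) * e z - g z) <= expR (Psi z) / 2.
  by apply: le_trans (hg z) _; rewrite [leRHS]mulrC; apply: ler_wpM2r => //; exact: expR_ge0.
exists g => //; split=> [z|].
  have h1 := cabs_subr (g z) (RC (zl d (- a + z)) * e z); have h2 := hg2 z.
  rewrite -(cabsN (g z - _)) opprB in h1.
  suff h3 : cabs (RC (zl d (- a + z)) * e z) <= expR (Psi z) by have := expR_ge0 (Psi z); rewrite -/(Psi z); lra.
  rewrite (addrC (- a)); have [hd|hd] := leP (cabs (z - a)) d; last first.
    by rewrite (zl_out d0 (ltW hd)) mul0r cabs0 expR_ge0.
  rewrite cabsM cabs_real ger0_norm ?zl_ge0 //; apply: (@le_trans _ _ (1 * cabs (e z))).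
    by apply: ler_wpM2r; [exact: cabs_ge0 | exact: zl_le1].
  rewrite mul1r; apply: le_trans (eW z hd) _; apply: ler_piMr; first exact: expR_ge0.
  rewrite -expR0 ler_expR oppr_le0; apply: mulr_ge0; [exact: ltW | apply: mulr_ge0; [exact: ltW | exact: sqr_ge0]].
have := hg2 a; rewrite addNr zl0 ?RC1 ?mul1r // => h1.
have := cabs_subr (e a) (g a).
have -> : cabs (e a) = expR (Psi a) by rewrite /e cabs_cexp reD !RC_re; congr expR; rewrite /Psi; ring.
by rewrite -/(Psi a); lra.
Qed.
End Peak.
End PolynomialPhase.

(** * Strict positivity near the diagonal for the homogeneous polynomial *)

Section KohnNirenbergPolynomial.
Variable R : realType.
Implicit Types (z w h : R[i]) (F : R[i] -> R[i] -> R[i]).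
Local Notation RC x := (Complex x 0).
Local Notation term := (R[i] * (nat * nat))%type.
Implicit Types (s : seq term).

Lemma cjM (x y : R[i]) : (x * y)^* = x^* * y^*. Proof. exact: rmorphM. Qed.
Lemma cjD (x y : R[i]) : (x + y)^* = x^* + y^*. Proof. exact: rmorphD. Qed.
Lemma cjN (x : R[i]) : (- x)^* = - x^*. Proof. exact: rmorphN. Qed.
Lemma cjX (x : R[i]) n : (x ^+ n)^* = x^* ^+ n. Proof. exact: rmorphXn. Qed.
Lemma cj_real (r : R) : (RC r)^* = RC r. Proof. by congr Complex; rewrite oppr0. Qed.
Lemma cj_half : (2^-1 : R[i])^* = 2^-1. Proof. by rewrite fmorphV rmorph_nat. Qed.
Lemma cj_sum I (r : seq I) (P : pred I) (F : I -> R[i]) : (\sum_(i <- r | P i) F i)^* = \sum_(i <- r | P i) (F i)^*.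
Proof. exact: rmorph_sum. Qed.

Lemma Sg1 z w : Sg 1 z w = 1. Proof. by rewrite /Sg big_ord1 !expr0 mulr1. Qed.
Lemma Sg0 z w : Sg 0 z w = 0. Proof. by rewrite /Sg big_ord0. Qed.
Lemma ppol_cons t s z w : ppol (t :: s) z w = t.1 * z ^+ t.2.1 * w^* ^+ t.2.2 + ppol s z w.
Proof. by rewrite /ppol big_cons. Qed.
Lemma gform_cons t s z w : gform (t :: s) z w = t.1 * Sg t.2.1 z w * (Sg t.2.2 z w)^* + gform s z w.
Proof. by rewrite /gform big_cons. Qed.
Lemma ppol_cat s s' z w : ppol (s ++ s') z w = ppol s z w + ppol s' z w.
Proof. by rewrite /ppol big_cat. Qed.
Lemma gform_cat s s' z w : gform (s ++ s') z w = gform s z w + gform s' z w.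
Proof. by rewrite /gform big_cat. Qed.
Lemma ppol_seq1 t z w : ppol [:: t] z w = t.1 * z ^+ t.2.1 * w^* ^+ t.2.2.
Proof. by rewrite /ppol big_seq1. Qed.
Lemma gform_seq1 t z w : gform [:: t] z w = t.1 * Sg t.2.1 z w * (Sg t.2.2 z w)^*.
Proof. by rewrite /gform big_seq1. Qed.

Lemma SgZ (r : R) n z w : Sg n (RC r * z) (RC r * w) = RC r ^+ n.-1 * Sg n z w.
Proof.
rewrite /Sg mulr_sumr; apply: eq_bigr => i _; rewrite !exprMn mulrACA -exprD subnK //.
by case: n i => [|n] [i /= hi] //; rewrite -ltnS.
Qed.

Lemma Sg_diag n w : Sg n w w = n%:R * w ^+ n.-1.
Proof.
rewrite /Sg (eq_bigr (fun=> w ^+ n.-1)) => [|i _].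
  by rewrite sumr_const card_ord mulr_natl.
by rewrite -exprD subnK //; case: n i => [|n] [i /= hi] //; rewrite -ltnS.
Qed.

Lemma gformZ (k : nat) s (r : R) z w : all (fun t : term => t.2.1 + t.2.2 == 2 * k)%N s ->
  gform s (RC r * z) (RC r * w) = RC (r ^+ (2 * k - 2)) * gform s z w.
Proof.
move=> /allP hs; rewrite /gform mulr_sumr; apply: eq_big_seq => -[c [a b]] /hs /= /eqP ab.
rewrite !SgZ rmorphM rmorphXn /=.
have -> : (RC r)^* = RC r by congr Complex; rewrite oppr0.
have [a0|a0] := posnP a; first by rewrite a0 /Sg big_ord0; ring.
have [b0|b0] := posnP b; first by rewrite b0 /Sg big_ord0 rmorph0; ring.
rewrite RCX; have -> : (2 * k - 2 = a.-1 + b.-1)%N by lia.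
by rewrite exprD; ring.
Qed.

Definition dz s : seq term := [seq (t.1 * t.2.1%:R, (t.2.1.-1, t.2.2)) | t <- s].
Definition dzb s : seq term := [seq (t.1 * t.2.2%:R, (t.2.1, t.2.2.-1)) | t <- s].

Lemma D11_pow n : D11 (fun z : R[i] => z ^+ n) (fun z => n%:R * z ^+ n.-1) (fun=> 0).
Proof.
elim: n => [|n IH]; first by apply: D11_eq (D11_cst 1) _ _ _ => z; rewrite ?expr0 ?mul0r.
apply: D11_eq (D11M (@D11_id R) IH) _ _ _ => z; rewrite ?exprS //; last by rewrite mul0r mulr0 addr0.
case: n {IH} => [|n]; first by rewrite !expr0 mul0r mulr0 addr0.
by rewrite /= [in RHS]mulrSr mulrDl mul1r mulrCA -exprS addrC.
Qed.

Lemma D11_ppol s : D11 (fun z => ppol s z z) (fun z => ppol (dz s) z z) (fun z => ppol (dzb s) z z).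
Proof.
elim: s => [|[c [a b]] s IH].
  by apply: D11_eq (D11_cst 0) _ _ _ => z; rewrite /ppol big_nil.
have D := D11M (D11Z c (D11_pow a)) (D11_conj (D11_pow b)).
apply: D11_eq (D11D D IH) _ _ _ => z; rewrite /ppol big_cons /= ?rmorph0 ?rmorphM ?rmorphXn ?rmorph_nat /=.
- by [].
- by rewrite mulr0 addr0 mulrA.
- by rewrite mulr0 mul0r add0r; congr (_ + _); ring.
Qed.

Lemma gform_diag s w : gform s w w = ppol (dzb (dz s)) w w.
Proof.
rewrite /gform /ppol /dzb /dz !big_map; apply: eq_bigr => -[c [a b]] _ /=.
by rewrite !Sg_diag rmorphM rmorph_nat rmorphXn /=; ring.
Qed.

Lemma dz_dzb s w : ppol (dzb (dz s)) w w = ppol (dz (dzb s)) w w.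
Proof. by rewrite /ppol /dzb /dz !big_map; apply: eq_bigr => -[c [a b]] _ /=; ring. Qed.

Local Notation V := (R^o * R^o)%type.

Lemma D11_derive u al be (x v : V) : D11 u al be ->
  'D_v (fun y : V => complex.Re (u (cplx y)) : R^o) x = complex.Re (al (cplx x) * cplx v + be (cplx x) * (cplx v)^*).
Proof.
move=> /D11E/(_ (cabs (cplx x)))[C C0 /(_ _ (lexx _))[_ _ _ E]].
rewrite /derive; apply: cvg_lim => //; apply/cvgrPdist_le => e e0.
have c0 := cabs_ge0 (cplx v); have v0 : 0 < 1 + cabs (cplx v) by lra.
have K0 : 0 < 1 + C * cabs (cplx v) ^+ 2 by have := mulr_ge0 C0 (sqr_ge0 (cabs (cplx v))); lra.
near=> t.
have t0 : t != 0 by near: t; exact: nbhs_dnbhs_neq.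
have t1 : `|t| < (1 + cabs (cplx v))^-1 by near: t; apply: dnbhs0_lt; rewrite invr_gt0.
have t2 : `|t| < e / (1 + C * cabs (cplx v) ^+ 2) by near: t; apply: dnbhs0_lt; rewrite divr_gt0.
have tE : cplx (t *: v + x) = cplx x + RC t * cplx v.
  by apply: complexP; rewrite /= ?mul0r ?subr0 ?addr0 addrC.
have hn : cabs (RC t * cplx v) <= 1.
  rewrite cabsM cabs_real; have := ler_pM (normr_ge0 t) c0 (ltW t1) (lexx (cabs (cplx v))) => H.
  by apply: le_trans H _; rewrite ler_pdivrMl // mulr1 lerDr.
have := E _ hn; rewrite -tE /= => H.
rewrite distrC.
have -> : t^-1 *: (complex.Re (u (cplx (t *: v + x))) - complex.Re (u (cplx x))) - complex.Re (al (cplx x) * cplx v + be (cplx x) * (cplx v)^*) =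
  t^-1 * complex.Re (u (cplx (t *: v + x)) - u (cplx x) - al (cplx x) * (RC t * cplx v) - be (cplx x) * (RC t * cplx v)^*).
  rewrite -[X in _ - X](mulKf t0) /GRing.scale /= -mulrBr; congr (_ * _).
  by rewrite !(reD, reN, reM, imM, reJ, imJ) /=; ring.
rewrite normrM normfV ler_pdivrMl ?normr_gt0 //; apply: le_trans (Re_cabs _) _; apply: le_trans H _.
rewrite cabsM cabs_real exprMn; move: t2; rewrite ltr_pdivlMr // => t2.
have n0 : 0 < `|t| by rewrite normr_gt0.
have -> : C * (`|t| ^+ 2 * cabs (cplx v) ^+ 2) = `|t| * (`|t| * (C * cabs (cplx v) ^+ 2)) by ring.
by rewrite ler_pM2l //; apply: ltW; apply: le_lt_trans t2; rewrite ler_pM2l // lerDr.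
Unshelve. all: by end_near. Qed.

(** All second directional derivatives come from the symbolic derivatives [dz] and [dzb]; in the
    combination taken by [ddbar] only the mixed coefficient survives, and that is [gform] on the
    diagonal. *)
Lemma ddbar_ppol s (x : V) : complex.Re (ddbar (ex R) (ey R) (ex R) (ey R) (fun y : V => complex.Re (ppol s (cplx y) (cplx y))) x) =
  complex.Re (gform s (cplx x) (cplx x)).
Proof.
have key (v w : V) : D2 v w (fun y : V => complex.Re (ppol s (cplx y) (cplx y))) x =
    complex.Re ((ppol (dz (dz s)) (cplx x) (cplx x) * cplx w + ppol (dz (dzb s)) (cplx x) (cplx x) * (cplx w)^*) * cplx v +
      (ppol (dzb (dz s)) (cplx x) (cplx x) * cplx w + ppol (dzb (dzb s)) (cplx x) (cplx x) * (cplx w)^*) * (cplx v)^*).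
  rewrite /D2; have -> : (fun q : V => 'D_w (fun y : V => complex.Re (ppol s (cplx y) (cplx y)) : R^o) q) =
      (fun y : V => complex.Re (cplx w * ppol (dz s) (cplx y) (cplx y) + (cplx w)^* * ppol (dzb s) (cplx y) (cplx y)) : R^o).
    by apply/funext => q; rewrite (D11_derive _ _ (D11_ppol s)) mulrC (mulrC (ppol (dzb s) _ _)).
  rewrite (D11_derive x v (D11D (D11Z (cplx w) (D11_ppol (dz s))) (D11Z (cplx w)^* (D11_ppol (dzb s))))).
  by congr (complex.Re (_ * _ + _ * _)); ring.
rewrite gform_diag /ddbar !key /= -dz_dzb.
move: (ppol _ _ _) (ppol _ _ _) (ppol _ _ _) => [a1 a2] [b1 b2] [c1 c2] /=.
by field.
Qed.

Definition DP F := exists A B, D11p F A B.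

Lemma DP_M F F' : DP F -> DP F' -> DP (fun z w => F z w * F' z w).
Proof. by move=> [A [B D]] [A' [B' D']]; eexists; eexists; exact: D11pM D D'. Qed.
Lemma DP_D F F' : DP F -> DP F' -> DP (fun z w => F z w + F' z w).
Proof. by move=> [A [B D]] [A' [B' D']]; eexists; eexists; exact: D11pD D D'. Qed.
Lemma DP_cst c : DP (fun _ _ => c).
Proof. by eexists; eexists; exact: D11p_of (D11_cst c). Qed.
Lemma DP_X F n : DP F -> DP (fun z w => F z w ^+ n).
Proof.
move=> D; elim: n => [|n IH].
  by rewrite (_ : (fun z w => _) = (fun _ _ => 1)); [exact: DP_cst | apply/funext => z; apply/funext => w; rewrite expr0].
rewrite (_ : (fun z w => _) = (fun z w => F z w * F z w ^+ n)); first exact: DP_M.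
by apply/funext => z; apply/funext => w; rewrite exprS.
Qed.
Lemma DP_sum (I : Type) (r : seq I) (F : I -> R[i] -> R[i] -> R[i]) : (forall i, DP (F i)) -> DP (fun z w => \sum_(i <- r) F i z w).
Proof.
move=> D; elim: r => [|i r IH].
  by rewrite (_ : (fun z w => _) = (fun _ _ => 0)); [exact: DP_cst | apply/funext => z; apply/funext => w; rewrite big_nil].
rewrite (_ : (fun z w => _) = (fun z w => F i z w + \sum_(i <- r) F i z w)); first exact: DP_D.
by apply/funext => z; apply/funext => w; rewrite big_cons.
Qed.

Lemma DP_Sg n : DP (Sg n).
Proof.
apply: DP_sum => i; apply: DP_M; apply: DP_X.
  by eexists; eexists; exact: D11p_of (@D11_id R).
by eexists; eexists; apply: D11p_par; exact: cont_at_id.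
Qed.

Lemma DP_gform s : DP (gform s).
Proof.
apply: DP_sum => t; apply: DP_M; first by apply: DP_M; [exact: DP_cst | exact: DP_Sg].
by have [A [B D]] := DP_Sg t.2.2; eexists; eexists; exact: D11p_conj D.
Qed.

Lemma DP_lip F r : DP F -> exists2 C, 0 <= C & forall z w, cabs z <= r -> cabs w <= r ->
  cabs (F z w) <= C /\ forall h, cabs h <= 1 -> cabs (F (z + h) w - F z w) <= 3 * C * cabs h.
Proof.
move=> [A [B D]]; have [C C0 hC] := D r; exists C => // z w zr wr; have [h1 h2 h3 E] := hC z w zr wr.
split=> // h hh; have := lin_est h2 h3 hh (E h hh); congr (cabs _ <= _); ring.
Qed.

Section Homogeneous.
Variables (k : nat) (s : seq term).
Hypotheses (k1 : (1 < k)%N) (hs : all (fun t : term => t.2.1 + t.2.2 == 2 * k)%N s).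
Hypothesis pos : forall w, w != 0 -> 0 < complex.Re (gform s w w).

Lemma polar (w : R[i]) : w != 0 -> exists2 v, cabs v = 1 & w = RC (cabs w) * v.
Proof.
move=> w0; have c0 : 0 < cabs w by rewrite cabs_gt0.
exists (RC (cabs w)^-1 * w); first by rewrite cabsM cabs_real ger0_norm ?invr_ge0 ?cabs_ge0 // mulVf // gt_eqF.
by rewrite mulrA -RCM divff ?gt_eqF // RC1 mul1r.
Qed.

(** A positive minimum on the unit circle, by compactness, extended by homogeneity of degree
    [2k - 2]. *)
Lemma gform_lower : exists2 c1, 0 < c1 & forall w, w != 0 -> c1 * cabs w ^+ (2 * k - 2) <= complex.Re (gform s w w).
Proof.
have cG : cont (fun w => gform s w w).
  have [c _ _] := D11_cont (D11_ppol (dzb (dz s))); move: c; congr cont.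
  by apply/funext => w; rewrite gform_diag.
have [|M0 hM] := @plane_covering R (fun M w => 0 < M -> cabs w = 1 -> M^-1 <= complex.Re (gform s w w)) _ 1.
  move=> z; have [z1|z1] := eqVneq (cabs z) 1.
    have z0 : z != 0 by apply/eqP => z0; move: z1; rewrite z0 cabs0 => /eqP; rewrite eq_sym oner_eq0.
    have g0 := pos z0; set g := complex.Re _ in g0.
    have [d d0 hd] := cG z (g / 2) ltac:(by rewrite divr_gt0).
    exists d, (2 / g); split; first exact: d0.
    move=> w M wz hM M0 _; have H := hd w wz.
    have : M^-1 <= g / 2 by rewrite -[g / 2]invrK lef_pV2 ?posrE // ?invr_gt0 ?divr_gt0 // invf_div.
    have := Re_le_cabs (gform s z z - gform s w w); rewrite -cabsN opprB reD reN -/g; move: H.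
    move: (complex.Re (gform s w w)) (cabs (_ - _)) => *; lra.
  exists `|cabs z - 1|, 0; split; first by rewrite normr_gt0 subr_eq0.
  move=> w M wz _ _ w1; exfalso; move: wz; rewrite ltNge => /negP; apply.
  by rewrite -w1 ler_norml; have := cabs_subr w z; have := cabs_subr z w; rewrite -(cabsN (z - w)) opprB; lra.
have m0 : 0 < Num.max 1 M0 by rewrite lt_max ltr01.
exists (Num.max 1 M0)^-1; first by rewrite invr_gt0.
move=> w w0; have [v v1 wE] := polar w0; rewrite {2 3}wE (gformZ _ _ _ hs) RC_re mulrC.
apply: ler_wpM2l; first by rewrite exprn_ge0 ?cabs_ge0.
by apply: hM; rewrite ?v1 // le_max lexx orbT.
Qed.

(** With truncated subtraction, [1 < k] is what makes this exponent a successor; hence [gform] is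
    small near the origin. *)
Lemma exponent_gt0 : (2 * k - 2 = (2 * k - 3).+1)%N.
Proof. by have := k1; lia. Qed.

(** Positivity on the diagonal degenerates at 0, so closeness is measured relative to [|w|]. If
    [|z - w| <= th |w|], rescaling to [|w| = 1] and the Lipschitz bound keep the form nonnegative.
    Otherwise both points are near 0, where a form of positive degree is below [eta]. *)
Lemma gform_near_diag (eta : R) : 0 < eta -> exists2 d, 0 < d & forall z w, cabs (z - w) <= d -> - eta <= complex.Re (gform s z w).
Proof.
move=> e0; have [c1 c10 hc1] := gform_lower; have [C C0 hC] := DP_lip 1 (DP_gform s).
(* The Lipschitz loss [3 C th] on the unit circle stays below the minimum [c1]. *)
pose th : R := Num.min 1 (c1 / (3 * C + 1)); have C3 : 0 < 3 * C + 1 by lra.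
have th0 : 0 < th by rewrite lt_min ltr01 divr_gt0.
have [th1 thc] : th <= 1 /\ th * (3 * C + 1) <= c1 by rewrite -ler_pdivlMr // /th !ge_min !lexx orbT.
(* For [|z|, |w| <= tau] the form is at most [C tau^(2k-2) <= C tau <= eta]; the choice [tau th / 2]
   below forces this in the second case. *)
pose tau : R := Num.min 1 (eta / (C + 1)); have C1 : 0 < C + 1 by lra.
have tau0 : 0 < tau by rewrite lt_min ltr01 divr_gt0.
have [tau1 tauC] : tau <= 1 /\ tau * (C + 1) <= eta by rewrite -ler_pdivlMr // /tau !ge_min !lexx orbT.
exists (tau * th / 2) => [|z w zw]; first by rewrite divr_gt0 // mulr_gt0.
have [near|far] := leP (cabs (z - w)) (th * cabs w).
  apply: (@le_trans _ _ 0); first by rewrite oppr_le0 ltW.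
  have [w0|w0] := eqVneq w 0.
    have z0 : z = 0 by apply/eqP; move: near; rewrite w0 cabs0 mulr0 subr0 => H; rewrite -cabs_eq0 eq_le H cabs_ge0.
    rewrite w0 z0; have := gformZ 0 0 0 hs; rewrite mulr0 expr0n => ->.
    by rewrite exponent_gt0 mul0r.
  have [v v1 wE] := polar w0; have cw : 0 < cabs w by rewrite cabs_gt0.
  pose h := RC (cabs w)^-1 * (z - w).
  have zE : z = RC (cabs w) * (v + h).
    rewrite mulrDr -wE /h mulrA -RCM divff ?gt_eqF // RC1 mul1r; ring.
  have hh : cabs h <= th by rewrite /h cabsM cabs_real ger0_norm ?invr_ge0 ?cabs_ge0 // ler_pdivrMl // mulrC.
  rewrite zE {2}wE (gformZ _ _ _ hs) RC_re; apply: mulr_ge0; first by rewrite exprn_ge0 ?cabs_ge0.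
  have v1' : cabs v <= 1 by rewrite v1.
  have [_ /(_ h (le_trans hh th1)) L] := hC v v v1' v1'.
  have v0 : v != 0 by rewrite -cabs_eq0 v1 oner_eq0.
  have := hc1 v v0; rewrite v1 expr1n mulr1.
  have := Re_le_cabs (gform s v v - gform s (v + h) v); rewrite -cabsN opprB reD reN.
  have C30 : 0 <= 3 * C by lra.
  have := ler_wpM2l C30 hh; move: L thc th0; lra.
have tw : cabs w <= tau.
  have : th * cabs w <= th * (tau / 2) by apply: le_trans (ltW far) (le_trans zw _); rewrite le_eqVlt; apply/orP; left; apply/eqP; field.
  by rewrite ler_pM2l //; lra.
have tz : cabs z <= tau.
  have t2 : th * cabs w <= th * (tau / 2) by apply: le_trans (ltW far) (le_trans zw _); rewrite le_eqVlt; apply/orP; left; apply/eqP; field.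
  have : cabs w <= tau / 2 by rewrite -(ler_pM2l th0).
  have : tau * th / 2 <= tau / 2 by have := ler_wpM2l (ltW tau0) th1; lra.
  by have := cabsD (z - w) w; rewrite subrK; lra.
have scale x : x = RC tau * (RC tau^-1 * x) by rewrite mulrA -RCM divff ?gt_eqF // RC1 mul1r.
have sc x : cabs x <= tau -> cabs (RC tau^-1 * x) <= 1.
  by move=> xt; rewrite cabsM cabs_real ger0_norm ?invr_ge0 ?(ltW tau0) // ler_pdivrMl // mulr1.
rewrite (scale z) (scale w) (gformZ _ _ _ hs) RC_re.
have [B _] := hC _ _ (sc z tz) (sc w tw); have := le_trans (Re_cabs _) B; move: (complex.Re _) => x.
rewrite ler_norml => /andP[x1 _].
have p0 : 0 <= tau ^+ (2 * k - 2) by rewrite exprn_ge0 // ltW.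
have p1 : tau ^+ (2 * k - 2) <= tau.
  by rewrite exponent_gt0 exprS; apply: ler_piMr; [exact: ltW | apply: exprn_ile1 => //; exact: ltW].
have := ler_wpM2l p0 x1; have := ler_wpM2r C0 p1; move: tauC tau0; rewrite mulrN; lra.
Qed.
End Homogeneous.


Lemma RC_nat n : RC n%:R = n%:R :> R[i].
Proof. by elim: n => [|n IH] //; rewrite -natr1 RCD IH RC1 natr1. Qed.

Section KN.
Variables (N : nat) (c : nat -> nat -> R[i]) (k : nat).
Hypothesis P_real : forall z : R[i], complex.Im (zzpoly N c z) = 0.
Hypothesis k_gt1 : (1 < k)%N.
Hypothesis P_hom : forall (r : R) (z : R[i]), zzpoly N c (Complex r 0 * z) = Complex (r ^+ (2 * k)) 0 * zzpoly N c z.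
Hypothesis P_subh : forall x : R * R, x != 0 -> 0 < ddbar (ex R) (ey R) (ex R) (ey R) (KN_P N c) x.

Definition top_part z : R[i] := \sum_(0 <= a < N) \sum_(0 <= b < N | (a + b == 2 * k)%N) c a b * z ^+ a * (z^*) ^+ b.

Lemma zzpolyE z : zzpoly N c z = \sum_(0 <= a < N) \sum_(0 <= b < N) c a b * z ^+ a * (z^*) ^+ b.
Proof. by rewrite /zzpoly big_mkord; apply: eq_bigr => a _; rewrite big_mkord. Qed.

(* Both sides of [P_hom] are polynomials in [r]; compare their coefficients of degree [2 k]. *)
Lemma top_partE z : zzpoly N c z = top_part z.
Proof.
pose q : {poly R[i]} := \sum_(0 <= a < N) \sum_(0 <= b < N) (c a b * z ^+ a * (z^*) ^+ b) *: 'X^(a + b) - zzpoly N c z *: 'X^(2 * k).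
have q0 : q = 0.
  have [//|qn] := eqVneq q 0; pose rs := [seq RC (n%:R : R) | n <- iota 0 (size q)].
  have : (size rs < size q)%N.
    apply: max_poly_roots => //.
      apply/allP => _ /mapP[n _ ->]; apply/rootP.
      rewrite /q hornerD hornerN hornerZ hornerXn -RCX mulrC -P_hom; apply/eqP; rewrite subr_eq0 zzpolyE; apply/eqP.
      rewrite horner_sum; apply: eq_bigr => a _; rewrite horner_sum; apply: eq_bigr => b _.
      by rewrite hornerZ hornerXn exprD cjM cj_real !exprMn; ring.
    rewrite map_inj_uniq ?iota_uniq // => m n [] /eqP; rewrite eqr_nat => /eqP //.
  by rewrite size_map size_iota ltnn.
have := congr1 (fun p : {poly R[i]} => p`_(2 * k)) q0.
rewrite /q coefB coefZ coefXn eqxx mulr1 coef0 => /eqP; rewrite subr_eq0 => /eqP <-.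
rewrite coef_sum; apply: eq_bigr => a _; rewrite coef_sum [RHS]big_mkcond; apply: eq_bigr => b _.
by rewrite coefZ coefXn eq_sym; case: ifP; rewrite ?mulr1 ?mulr0.
Qed.

(** The coefficients of degree [2k], symmetrized to be Hermitian so that [ppol] satisfies
    [ppol w z = (ppol z w)^*]. Neither operation changes values on the diagonal: homogeneity removes
    the other degrees, and symmetrization replaces a real value by its real part. *)
Definition KN_terms : seq term :=
  [seq ((c t.1 t.2 + (c t.2 t.1)^*) * 2^-1, t) | t <- [seq (a, b) | a <- index_iota 0 N, b <- index_iota 0 N] & (t.1 + t.2 == 2 * k)%N].

Lemma KN_terms_hom : all (fun t : term => t.2.1 + t.2.2 == 2 * k)%N KN_terms.
Proof. by apply/allP => u /mapP[t]; rewrite mem_filter => /andP[h _] ->. Qed.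

Lemma ppol_KN z w : ppol KN_terms z w = \sum_(0 <= a < N) \sum_(0 <= b < N | (a + b == 2 * k)%N) (c a b + (c b a)^*) * 2^-1 * z ^+ a * w^* ^+ b.
Proof.
rewrite /ppol /KN_terms big_map big_filter big_mkcond big_allpairs_dep; apply: eq_bigr => a _.
by rewrite [RHS]big_mkcond.
Qed.

Lemma ppol_KN_conj z w : ppol KN_terms w z = (ppol KN_terms z w)^*.
Proof.
rewrite !ppol_KN cj_sum /=.
under eq_bigr => a _ do rewrite big_mkcond.
under [RHS]eq_bigr => a _ do rewrite big_mkcond cj_sum.
rewrite exchange_big; apply: eq_bigr => a _; apply: eq_bigr => b _.
rewrite addnC; case: ifP => _; last by rewrite rmorph0.
rewrite !(cjM, cjD, cjX, cj_half) !conjCK; ring.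
Qed.

Lemma ppol_KN_diag z : ppol KN_terms z z = zzpoly N c z.
Proof.
have E : ppol KN_terms z z = (top_part z + (top_part z)^*) * 2^-1.
  rewrite ppol_KN /top_part cj_sum /=.
  have -> : \sum_(0 <= a < N) (\sum_(0 <= b < N | (a + b == 2 * k)%N) c a b * z ^+ a * z^* ^+ b)^* =
    \sum_(0 <= a < N) \sum_(0 <= b < N | (a + b == 2 * k)%N) (c b a)^* * z ^+ a * z^* ^+ b.
    under eq_bigr => a _ do rewrite big_mkcond cj_sum.
    under [RHS]eq_bigr => a _ do rewrite big_mkcond.
    rewrite exchange_big; apply: eq_bigr => a _; apply: eq_bigr => b _.
    rewrite addnC; case: ifP => _; last by rewrite rmorph0.
    by rewrite !(cjM, cjX) !conjCK; ring.
  rewrite -big_split /= mulr_suml; apply: eq_bigr => a _; rewrite -big_split /= mulr_suml; apply: eq_bigr => b _.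
  ring.
rewrite E -top_partE; apply: complexP; have := P_real z; case: (zzpoly N c z) => u v /= ->.
  by rewrite !(oppr0, addr0, mulr0, mul0r, subr0, expr0n); field.
by rewrite !(oppr0, addr0, mulr0, mul0r, subr0); field.
Qed.

Lemma KN_form_pos w : w != 0 -> 0 < complex.Re (gform KN_terms w w).
Proof.
move=> w0; pose x : R * R := (complex.Re w, complex.Im w).
have x0 : x != 0.
  apply: contra_neq w0 => /(congr1 (fun y => cplx y)); rewrite /x cplxK => ->; by [].
have := P_subh x0; have -> : KN_P N c = (fun y => complex.Re (ppol KN_terms (cplx y) (cplx y))).
  by apply/funext => y; rewrite ppol_KN_diag.
by rewrite ltcE => /andP[_]; rewrite ddbar_ppol /x cplxK.
Qed.

(** The modified weight has a positive form near the whole diagonal: the part in [|z|^(2k)] costs at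
    most half of the form of [P], and the part in [|z|^2] adds the constant [eps k]. *)
Lemma KN_peak : exists eps t0 : R, [/\ 0 < eps, 0 < t0 & forall t, t0 <= t -> forall a, exists2 g,
  forall z, exists b, cderiv g z b &
  let Phi z := complex.Re (zzpoly N c z) - eps * (cabs z ^+ (2 * k) - k%:R * cabs z ^+ 2 + k%:R - 1) in
  (forall z, cabs (g z) <= 2 * expR (t * Phi z)) /\ expR (t * Phi a) / 2 <= cabs (g a)].
Proof.
have [c1 c10 hc1] := gform_lower KN_terms_hom KN_form_pos.
have kp : 0 < (k%:R : R) by rewrite ltr0n; exact: leq_trans k_gt1.
(* The form of [|z|^(2k)] on the diagonal is [k^2 |z|^(2k-2)], so this [eps] uses up half of
   [c1]. *)
pose eps : R := c1 / (2 * k%:R ^+ 2).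
have e0 : 0 < eps by rewrite divr_gt0 // mulr_gt0 // exprn_gt0.
pose s1 := KN_terms ++ [:: (RC (- eps), (k, k))].
have hs1 : all (fun t : term => t.2.1 + t.2.2 == 2 * k)%N s1.
  by rewrite all_cat KN_terms_hom /= andbT; apply/eqP; lia.
have pos1 w : w != 0 -> 0 < complex.Re (gform s1 w w).
  move=> w0; rewrite gform_cat gform_seq1 /= reD Sg_diag -mulrA mulJ -RCM /= cabsM.
  have -> : cabs (k%:R : R[i]) = k%:R.
    by rewrite -RC_nat cabs_real ger0_norm // ltW.
  rewrite exprMn cabsX -exprM (_ : (k.-1 * 2 = 2 * k - 2)%N); last by lia.
  have c0 : 0 < cabs w ^+ (2 * k - 2) by rewrite exprn_gt0 // cabs_gt0.
  have := hc1 w w0; have -> : - eps * (k%:R ^+ 2 * cabs w ^+ (2 * k - 2)) = - (c1 / 2 * cabs w ^+ (2 * k - 2)).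
    by rewrite /eps; field; rewrite gt_eqF.
  have := mulr_gt0 c10 c0; lra.
(* The term in [z w^*] adds [eps k] to the form everywhere, and [gform_near_diag] with
   [eta = eps k / 2] leaves half of it. The constant term does not affect the form; it normalizes
   the gap to vanish on the unit circle. *)
pose s2 := s1 ++ [:: (RC (eps * k%:R), (1%N, 1%N)); (RC (- eps * (k%:R - 1)), (0%N, 0%N))].
have ek : 0 < eps * k%:R / 2 by rewrite divr_gt0 // mulr_gt0.
have [d d0 hd] := gform_near_diag k_gt1 hs1 pos1 ek.
have low z w : cabs (z - w) <= d -> eps * k%:R / 2 <= complex.Re (gform s2 z w).
  have -> : gform s2 z w = gform s1 z w + RC (eps * k%:R).
    by rewrite /s2 (gform_cat s1) (gform_cons _ [:: _]) gform_seq1 /= Sg1 Sg0 rmorph1 rmorph0 !mulr0 !mulr1 addr0.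
  by move=> /hd; rewrite reD /=; lra.
have s2E z w : ppol s2 z w = ppol KN_terms z w - RC eps * (z * w^*) ^+ k + RC (eps * k%:R) * (z * w^*) - RC (eps * (k%:R - 1)).
  by rewrite /s2 (ppol_cat s1) /s1 (ppol_cat KN_terms) (ppol_cons _ [:: _]) !ppol_seq1 /= !expr0 !expr1 exprMn mulNr !RCN; ring.
have sym z w : complex.Re (ppol s2 z w) = complex.Re (ppol s2 w z).
  rewrite -[RHS]reJ; congr (complex.Re _); rewrite !s2E ppol_KN_conj !(cjM, cjD, cjN, cjX) !conjCK.
  by rewrite !cj_real (mulrC w^*).
have [t0 t00 H] := peak_functions d0 ek sym low.
exists eps, t0; split=> // t /H{}H a; have [g gD [g1 g2]] := H a.
have PE z : complex.Re (ppol s2 z z) = complex.Re (zzpoly N c z) - eps * (cabs z ^+ (2 * k) - k%:R * cabs z ^+ 2 + k%:R - 1).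
  rewrite s2E ppol_KN_diag mulJ -RCX -!RCM !(reD, reN) /= -exprM; ring.
by exists g => //=; rewrite -PE; split=> // z; rewrite -PE.
Qed.
End KN.
End KohnNirenbergPolynomial.

(** * The entire function [(e^w - 1) / w] and two convexity inequalities *)

Section DividedExponential.
Variable R : realType.
Implicit Types (z w h : R[i]).
Local Notation RC x := (Complex x 0).

(* Along a segment, by the mean value theorem for the real function t -> Re (c b(t h)), c = conj (b h). *)
Lemma cderiv_segment_bound (b a : R[i] -> R[i]) h (K : R) : (forall w, cderiv b w (a w)) -> b 0 = 0 ->
  (forall t : R, 0 <= t <= 1 -> cabs (a (RC t * h)) <= K) -> cabs (b h) <= K * cabs h.
Proof.
move=> Db b0 aK; have K0 : 0 <= K by apply: le_trans (aK 0 _); rewrite ?cabs_ge0 ?lexx ?ler01.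
pose psi (t : R) : R := complex.Re ((b h)^* * b (RC t * h)).
have Dp (t : R) : is_derive t (1 : R) psi (complex.Re ((b h)^* * (a (RC t * h) * h))).
  have C : (fun s : R => s^-1 *: ((psi \o shift t) (s *: (1 : R)) - psi t)) @ 0^' --> complex.Re ((b h)^* * (a (RC t * h) * h)).
    apply/cvgrPdist_le => e e0; pose X : R := 1 + cabs (b h) * cabs h.
    have X0 : 0 < X by rewrite /X; have := mulr_ge0 (cabs_ge0 (b h)) (cabs_ge0 h); lra.
    have [d d0 hd] := Db (RC t * h) (e / X) ltac:(by rewrite divr_gt0).
    have c1 : 0 < 1 + cabs h by have := cabs_ge0 h; lra.
    near=> s.
    have s0 : s != 0 by near: s; exact: nbhs_dnbhs_neq.
    have s1 : `|s| < d / (1 + cabs h) by near: s; apply: dnbhs0_lt; rewrite divr_gt0.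
    have sh : cabs (RC s * h) < d.
      rewrite cabsM cabs_real; move: s1; rewrite ltr_pdivlMr //; apply: le_lt_trans.
      by apply: ler_wpM2l => //; lra.
    have := hd _ sh; move=> H.
    rewrite distrC /psi /= (_ : RC (s *: (1 : R) + t) * h = RC t * h + RC s * h); last first.
      by rewrite /GRing.scale /= mulr1 RCD; ring.
    have -> : s^-1 *: (complex.Re ((b h)^* * b (RC t * h + RC s * h)) - complex.Re ((b h)^* * b (RC t * h))) - complex.Re ((b h)^* * (a (RC t * h) * h)) =
       s^-1 * complex.Re ((b h)^* * (b (RC t * h + RC s * h) - b (RC t * h) - a (RC t * h) * (RC s * h))).
      rewrite -[X in _ - X](mulKf s0) /GRing.scale /= -mulrBr; congr (_ * _).
      by rewrite -RC_re -!reN -!reD; congr complex.Re; ring.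
    rewrite normrM normfV ler_pdivrMl ?normr_gt0 //; apply: le_trans (Re_cabs _) _; rewrite cabsM cabs_conj.
    apply: le_trans (ler_wpM2l (cabs_ge0 _) H) _; rewrite cabsM cabs_real.
    have -> : cabs (b h) * (e / X * (`|s| * cabs h)) = `|s| * e * (cabs (b h) * cabs h / X) by ring.
    by apply: ler_piMr; [rewrite mulr_ge0 // ltW | rewrite ler_pdivrMr // mul1r /X lerDr].
  by apply: DeriveDef; [exact: cvgP C | exact: cvg_lim C].
have [|t tI E] := @MVT R psi _ 0 1 ltr01 (fun t _ => Dp t).
  apply: continuous_subspaceT => t; apply: differentiable_continuous; apply/derivable1_diffP.
  exact: ex_derive.
move: E; rewrite subr0 mulr1 /psi RC1 mul1r mul0r b0 mulr0 subr0.
rewrite mulrC mulJ /= => E.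
have t1 : 0 <= t <= 1 by move: tI; rewrite in_itv /= => /andP[/ltW -> /ltW ->].
have := Re_le_cabs ((b h)^* * (a (RC t * h) * h)); rewrite -E !cabsM cabs_conj expr2 => H.
have [->|bn] := eqVneq (cabs (b h)) 0; first by rewrite mulr_ge0 ?cabs_ge0.
have bp : 0 < cabs (b h) by rewrite lt_def bn cabs_ge0.
move: H; rewrite ler_pM2l // => H; apply: le_trans H _.
by apply: ler_wpM2r; [exact: cabs_ge0 | exact: aK].
Unshelve. all: by end_near. Qed.

(** The slowly growing factor in [z_2]. It is bounded by a multiple of [1 + e^(Re w)] and decays
    like [1 / |w|] where [Re w] is bounded above; [exp(T z_2)] has no decay in [Im z_2], so this
    factor must supply it. *)
Definition expdiv w : R[i] := if w == 0 then 1 else (cexp w - 1) / w.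

Lemma expdivE w : w * expdiv w = cexp w - 1.
Proof.
rewrite /expdiv; case: eqVneq => [->|w0]; first by rewrite mul0r cexp0 subrr.
by rewrite mulrCA divff // mulr1.
Qed.

Lemma cderivB f g z a b : cderiv f z a -> cderiv g z b -> cderiv (fun w => f w - g w) z (a - b).
Proof.
move=> Df Dg e e0; have e2 : 0 < e / 2 by lra.
have [d1 d10 h1] := Df _ e2; have [d2 d20 h2] := Dg _ e2.
exists (Num.min d1 d2) => [|h]; first by rewrite lt_min d10.
rewrite lt_min => /andP[/h1 k1 /h2 k2].
have -> : f (z + h) - g (z + h) - (f z - g z) - (a - b) * h = (f (z + h) - f z - a * h) - (g (z + h) - g z - b * h) by ring.
by apply: le_trans (cabsBD _ _) _; lra.
Qed.

Lemma cderiv_id z : cderiv (fun w => w) z 1.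
Proof. by move=> e e0; exists 1 => // h _; rewrite (_ : z + h - z - 1 * h = 0); [rewrite cabs0 mulr_ge0 ?cabs_ge0 // ltW | ring]. Qed.

Lemma cderiv_cst (c z : R[i]) : cderiv (fun=> c) z 0.
Proof. by move=> e e0; exists 1 => // h _; rewrite subrr mul0r subr0 cabs0 mulr_ge0 ?cabs_ge0 // ltW. Qed.

(** The second-order estimate integrated along segments from 0; the cubic order is needed for the
    derivative of [expdiv] at 0. *)
Lemma cexp_taylor3 : exists2 C, 0 <= C & forall w, cabs w <= 1 -> cabs (cexp w - 1 - w - 2^-1 * w ^+ 2) <= C * cabs w ^+ 3.
Proof.
have [C C0 hC] := cexp_taylor (ler01 (R := R)); exists C => // w w1.
have -> : C * cabs w ^+ 3 = C * cabs w ^+ 2 * cabs w by ring.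
apply: (@cderiv_segment_bound (fun w => cexp w - 1 - w - 2^-1 * w ^+ 2) (fun w => cexp w - 1 - w)).
- move=> z; have D : cderiv (fun w => cexp w - 1 - w - 2^-1 * w ^+ 2) z (cexp z - 0 - 1 - 2^-1 * (z + z)).
    apply: cderivB; first by apply: cderivB (cderiv_id z); apply: cderivB (cderiv_cexp z) (cderiv_cst 1 z).
    move=> e e0; have [d d0 hd] := cderiv_sq z e0; exists d => // h /hd; rewrite !expr2 => H.
    have -> : 2^-1 * ((z + h) * (z + h)) - 2^-1 * (z * z) - 2^-1 * (z + z) * h = RC 2^-1 * ((z + h) * (z + h) - z * z - (z + z) * h).
      by rewrite RCV RC2; ring.
    rewrite cabsM cabs_real ger0_norm ?invr_ge0 //.
    have := cabs_ge0 ((z + h) * (z + h) - z * z - (z + z) * h); lra.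
  rewrite (_ : cexp z - 0 - 1 - 2^-1 * (z + z) = cexp z - 1 - z) in D; first exact: D.
  by rewrite -mulr2n mulrnAr -mulr_natl mulrA divff ?mul1r ?pnatr_eq0 // subr0.
- by rewrite cexp0 !subrr expr0n mulr0 subr0.
move=> t /andP[t0 t1]; have tw : cabs (RC t * w) <= cabs w.
  by rewrite cabsM cabs_real ger0_norm //; apply: ler_piMl; rewrite ?cabs_ge0.
apply: le_trans (hC _ (le_trans tw w1)) _; apply: ler_wpM2l => //.
by rewrite lerXn2r ?nnegrE ?cabs_ge0.
Qed.

Lemma cderiv_expdiv w : exists a, cderiv expdiv w a.
Proof.
have [w0|w0] := eqVneq w 0.
  exists (2^-1); rewrite w0 => e e0; have [C C0 hC] := cexp_taylor3.
  have C1 : 0 < C + 1 by lra.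
  exists (Num.min 1 (e / (C + 1))) => [|h]; first by rewrite lt_min ltr01 divr_gt0.
  rewrite lt_min => /andP[/ltW h1]; rewrite ltr_pdivlMr // => /ltW h2.
  rewrite add0r {2}/expdiv eqxx; have [->|hn] := eqVneq h 0.
    by rewrite /expdiv eqxx subrr mulr0 subr0 cabs0 mulr0.
  have hp : 0 < cabs h by rewrite cabs_gt0.
  have E : h * (expdiv h - 1 - 2^-1 * h) = cexp h - 1 - h - 2^-1 * h ^+ 2 by rewrite !mulrBr expdivE expr2; ring.
  have := hC h h1; rewrite -E cabsM exprS (mulrCA C) ler_pM2l // => H; apply: le_trans H _.
  by rewrite expr2 mulrA; apply: ler_wpM2r; rewrite ?(ltW hp) //; nra.
have [L1 D] : exists a, cderiv (fun z => (cexp z - 1) * z^-1) w a.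
  have w1 : 0 < cabs w by rewrite cabs_gt0.
  pose a := (cexp w - (cexp w - 1) / w) / w; exists a => e e0.
  have D := cderivB (cderiv_cexp w) (cderiv_cst 1 w); rewrite subr0 in D.
  have [d d0 hd] := D (e / 4 * cabs w) ltac:(by rewrite !mulr_gt0 // invr_gt0).
  have ca := cabs_ge0 a; have a1 : 0 < cabs a + 1 by lra.
  exists (Num.min d (Num.min (cabs w / 2) (e / 4 * cabs w / (cabs a + 1)))) => [|h].
    by rewrite !lt_min d0 !divr_gt0 // !mulr_gt0 // invr_gt0.
  rewrite !lt_min => /andP[/hd k1 /andP[k2 k3]].
  have wh : cabs w / 2 <= cabs (w + h) by have := cabs_subr w (- h); rewrite opprK cabsN; lra.
  have wh0 : w + h != 0 by rewrite -cabs_gt0; apply: lt_le_trans wh; rewrite divr_gt0.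
  have E : (w + h) * ((cexp (w + h) - 1) * (w + h)^-1 - (cexp w - 1) * w^-1 - a * h) =
     (cexp (w + h) - 1 - (cexp w - 1) - cexp w * h) - a * h * h.
    by rewrite /a; field; rewrite w0 wh0.
  have P : cabs (w + h) * cabs ((cexp (w + h) - 1) * (w + h)^-1 - (cexp w - 1) * w^-1 - a * h) <= cabs w / 2 * (e * cabs h).
    rewrite -cabsM E; apply: le_trans (cabsBD _ _) _; rewrite [cabs (a * h * h)]cabsM [cabs (a * h)]cabsM.
    have -> : cabs w / 2 * (e * cabs h) = e / 4 * cabs w * cabs h + e / 4 * cabs w * cabs h by field.
    apply: lerD; first exact: k1.
    have : cabs a * cabs h <= e / 4 * cabs w.
      by move: k3; rewrite ltr_pdivlMr // => /ltW k3; apply: le_trans k3; have := cabs_ge0 h; nra.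
    by move=> /(ler_wpM2r (cabs_ge0 h)).
  have h0 := cabs_ge0 h; have eh : 0 <= e * cabs h by rewrite mulr_ge0 // ltW.
  have := ler_wpM2r (cabs_ge0 ((cexp (w + h) - 1) * (w + h)^-1 - (cexp w - 1) * w^-1 - a * h)) wh.
  move=> /le_trans/(_ P); rewrite ler_pM2l // divr_gt0 //.
exists L1; apply: (@cderiv_local _ (fun z => (cexp z - 1) * z^-1) _ _ _ (cabs w)) => //; first by rewrite cabs_gt0.
move=> v vw; rewrite /expdiv ifF //; apply/eqP => v0; move: vw; rewrite v0 sub0r cabsN ltxx //.
Qed.

Lemma expdiv_bounds : exists2 K, 1 <= K & forall w,
  [/\ cabs (expdiv w) <= K * (1 + expR (complex.Re w)), cabs w * cabs (expdiv w) <= 1 + expR (complex.Re w) &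
      cabs w <= (2 * K)^-1 -> 2^-1 <= cabs (expdiv w)].
Proof.
have [C C0 hC] := cexp_taylor (ler01 (R := R)); exists (1 + C); first by lra.
move=> w; have e0 := expR_gt0 (complex.Re w).
have B : cabs w * cabs (expdiv w) <= 1 + expR (complex.Re w).
  by rewrite -cabsM expdivE; apply: le_trans (cabsBD _ _) _; rewrite cabs_cexp cabs1 addrC.
have near1 : cabs w <= 1 -> cabs (expdiv w - 1) <= C * cabs w.
  move=> w1; have [->|wn] := eqVneq w 0; first by rewrite /expdiv eqxx subrr !cabs0 mulr0.
  have wp : 0 < cabs w by rewrite cabs_gt0.
  by have := hC w w1; rewrite (_ : cexp w - 1 - w = w * (expdiv w - 1)) ?cabsM ?expr2; [rewrite mulrCA ler_pM2l | rewrite mulrBr expdivE mulr1].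
have w0 := cabs_ge0 w; split=> //.
  have [w1|w1] := leP (cabs w) 1.
    have := near1 w1; have := cabs_subr (expdiv w) 1; rewrite cabs1; have := mulr_ge0 C0 (ltW e0); nra.
  have c0 := cabs_ge0 (expdiv w); have := mulr_ge0 C0 (ltW e0); nra.
move=> ws; have K0 : 0 < 1 + C by lra.
have wK : cabs w * (2 * (1 + C)) <= 1 by rewrite -ler_pdivlMr ?mulr_gt0 // mul1r.
have w1 : cabs w <= 1 by have := mulr_ge0 w0 C0; nra.
have := near1 w1; have := cabs_subr 1 (expdiv w); rewrite cabs1 -(cabsN (1 - _)) opprB.
have := mulr_ge0 w0 C0; nra.
Qed.

Lemma bernoulli (n : nat) (x : R) : 0 <= x -> 1 + n%:R * (x - 1) <= x ^+ n.
Proof.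
move=> x0; elim: n => [|n IH]; first by rewrite mul0r addr0 expr0.
rewrite exprS -natr1; have := ler_wpM2l x0 IH; have := mulr_ge0 (ler0n R n) (sqr_ge0 (x - 1)).
rewrite expr2; nra.
Qed.

(* [x^k] dominates its tangent at 1, and half of it dominates the tangent up to a constant (tangent at 2). *)
Lemma tangent_gap (k : nat) (x : R) : (1 < k)%N -> 0 <= x ->
  0 <= x ^+ k - k%:R * x + k%:R - 1 /\ x ^+ k / 2 - (2 ^+ k * k%:R) <= x ^+ k - k%:R * x + k%:R - 1.
Proof.
move=> k1 x0; have h1 := bernoulli k x0.
have x2 : 0 <= x / 2 by rewrite divr_ge0.
have := bernoulli k x2; rewrite exprMn exprVn => h2.
have p : 0 < (2 ^+ k : R) by rewrite exprn_gt0.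
have h3 : 2 ^+ k * (1 + k%:R * (x / 2 - 1)) <= x ^+ k.
  by rewrite mulrC -ler_pdivlMr.
have k2 : 2 <= (k%:R : R) by rewrite (ler_nat _ 2).
have p4 : 4 <= (2 ^+ k : R).
  by rewrite -natrX (ler_nat _ 4) -[4%N]/(2 ^ 2)%N leq_exp2l.
split; first lra.
have kx : 0 <= k%:R * x by rewrite mulr_ge0.
have := ler_wpM2r kx p4; nra.
Qed.
End DividedExponential.

(** * Decay estimates and the rescaled peak functions *)

Section KohnNirenbergFunctions.
Variable R : realType.
Variables (N : nat) (c : nat -> nat -> R[i]) (k : nat).
Hypothesis P_real : forall z : R[i], complex.Im (zzpoly N c z) = 0.
Hypothesis k_gt1 : (1 < k)%N.
Hypothesis P_hom : forall (r : R) (z : R[i]), zzpoly N c (Complex r 0 * z) = Complex (r ^+ (2 * k)) 0 * zzpoly N c z.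
Hypothesis P_subh : forall x : R * R, x != 0 -> 0 < ddbar (ex R) (ey R) (ex R) (ey R) (KN_P N c) x.
Implicit Types (z w : R[i]) (p q v : C2 R).
Local Notation RC x := (Complex x 0).
Local Notation P z := (complex.Re (zzpoly N c z)).
Local Notation W := (KN_domain N c).

Definition KN_r p : R := complex.Re (z2 p) + P (z1 p).

Lemma KN_domainE p : W p = (KN_r p < 0) :> Prop.
Proof. by []. Qed.

Lemma P_homE (x : R) z : P (RC x * z) = x ^+ (2 * k) * P z.
Proof. by rewrite P_hom RC_re. Qed.

Lemma P_cont : cont (fun z => zzpoly N c z).
Proof.
have [ct _ _] := D11_cont (D11_ppol (KN_terms N c k)); move: ct; congr cont.
by apply/funext => z; exact: ppol_KN_diag.
Qed.

Lemma P_growth : exists2 C, 0 < C & forall z, `|P z| <= C * cabs z ^+ (2 * k).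
Proof.
have [M M0 hM] := cont_bounded P_cont 1; exists (M + 1); first lra.
move=> z; have [->|z0] := eqVneq z 0.
  have k0 : (2 * k == 0)%N = false by apply/negbTE; rewrite muln_eq0 negb_or /= -lt0n (ltn_trans _ k_gt1).
  by have := P_homE 0 0; rewrite mulr0 => ->; rewrite cabs0 expr0n k0 mulr0n mul0r normr0 mulr0.
have [v v1 {1}->] := polar z0; rewrite P_homE normrM ger0_norm ?exprn_ge0 ?cabs_ge0 // mulrC.
apply: ler_wpM2r; first by rewrite exprn_ge0 ?cabs_ge0.
by apply: le_trans (Re_cabs _) _; have := hM v; rewrite v1 lexx => /(_ isT); lra.
Qed.

Let KN_opn_lin (a b x y u n w r : R) : n + w < r / 2 -> 0 <= n -> u < r / 2 -> b - a <= u -> y - x <= w -> - r = x + a -> y + b < 0.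
Proof. lra. Qed.

Lemma KN_opn : opn W.
Proof.
move=> p; rewrite KN_domainE => rp; have r0 : 0 < - KN_r p / 2 by lra.
have [d d0 hd] := P_cont (z1 p) r0.
exists (Num.min d (- KN_r p / 2)) => [|q]; first by rewrite lt_min d0.
rewrite /pball /= lt_min => /andP[h1 h2]; rewrite KN_domainE /KN_r.
have n1 := cabs_ge0 (z1 (q - p)); have n2 := cabs_ge0 (z2 (q - p)); rewrite /pn in h1 h2.
have h3 : cabs (zzpoly N c (z1 q) - zzpoly N c (z1 p)) < - KN_r p / 2.
  by apply: hd; rewrite -z1N -z1D; apply: le_lt_trans h1; rewrite lerDl.
have e1 : P (z1 q) - P (z1 p) <= cabs (zzpoly N c (z1 q) - zzpoly N c (z1 p)).
  by apply: le_trans (Re_le_cabs _); rewrite reD reN.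
have e2 : complex.Re (z2 q) - complex.Re (z2 p) <= cabs (z2 (q - p)).
  by apply: le_trans (Re_le_cabs _); rewrite z2D z2N reD reN.
by apply: (KN_opn_lin h2 n1 h3 e1 e2); rewrite opprK.
Qed.

Lemma exists_root (T t : R) : 0 < T -> 0 < t -> exists2 rho, 0 < rho & T * rho ^+ (2 * k) = t.
Proof.
move=> T0 t0; have k0 : ((2 * k)%N%:R : R) != 0 by rewrite pnatr_eq0; lia.
exists (expR (ln (t / T) / (2 * k)%N%:R)); first exact: expR_gt0.
rewrite -expRM_natl mulrCA divff // mulr1 lnK ?posrE ?divr_gt0 //.
by rewrite mulrC divfK // gt_eqF.
Qed.

Definition weight4 p : R := (1 + p.1.1 ^+ 2) * (1 + p.1.2 ^+ 2) * (1 + p.2.1 ^+ 2) * (1 + p.2.2 ^+ 2).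

Lemma exp_decay1 (s x : R) : 0 < s -> (1 + x ^+ 2) * expR (- (s * `|x|)) ^+ 2 <= 1 + s^-1 ^+ 2.
Proof.
move=> s0; have sx : 0 <= s * `|x| by rewrite mulr_ge0 // ltW.
have e0 := expR_ge0 (- (s * `|x|)).
have e1 : (1 + s * `|x|) * expR (- (s * `|x|)) <= 1.
  by rewrite expRN ler_pdivrMr ?expR_gt0 // mul1r expR_ge1Dx.
have p0 : 0 <= (1 + s * `|x|) * expR (- (s * `|x|)) by apply: mulr_ge0 => //; lra.
have e2 : ((1 + s * `|x|) * expR (- (s * `|x|))) ^+ 2 <= 1 by apply: exprn_ile1.
have i0 : 0 <= s^-1 ^+ 2 := sqr_ge0 _.
have key : 1 + x ^+ 2 <= (1 + s^-1 ^+ 2) * (1 + s * `|x|) ^+ 2.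
  have xx : x ^+ 2 = `|x| ^+ 2 by rewrite real_normK ?num_real.
  have -> : (1 + s^-1 ^+ 2) * (1 + s * `|x|) ^+ 2 = 1 + `|x| ^+ 2 + (2 * (s * `|x|) + (s * `|x|) ^+ 2 + s^-1 ^+ 2 * (1 + 2 * (s * `|x|))).
    by field; rewrite gt_eqF.
  rewrite xx lerDl; have := sqr_ge0 (s * `|x|); have : 0 <= s^-1 ^+ 2 * (1 + 2 * (s * `|x|)) by apply: mulr_ge0 => //; lra.
  lra.
apply: le_trans (ler_wpM2r (sqr_ge0 _) key) _; rewrite -mulrA -exprMn.
by apply: ler_piMr => //; lra.
Qed.

(** By Bernoulli, [u^k >= u - k] for [u >= 0], so the decay is at least exponential in
    [u = x^2 + y^2], and [(1 + y) e^(-y) <= 1] absorbs the weight. *)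
Lemma exp_decay2 (s : R) : 0 < s -> exists2 C, 0 <= C & forall x y : R,
  (1 + x ^+ 2) * (1 + y ^+ 2) * expR (- (s * (x ^+ 2 + y ^+ 2) ^+ k)) <= C.
Proof.
move=> s0; exists (expR (s * k%:R) * (1 + 2 / s) ^+ 2) => [|x y].
  by apply: mulr_ge0; rewrite ?expR_ge0 ?sqr_ge0.
have [u uE] : exists u, u = x ^+ 2 + y ^+ 2 by eexists.
have [x0 y0] : 0 <= x ^+ 2 /\ 0 <= y ^+ 2 by rewrite !sqr_ge0.
have u0 : 0 <= u by rewrite uE addr_ge0.
have b := bernoulli k u0; have k1 : 1 <= (k%:R : R) by rewrite (ler_nat _ 1) ltnW.
have ub : u - k%:R <= u ^+ k.
  by apply: le_trans b; have := ler_wpM2r u0 k1; lra.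
have su : 0 <= s / 2 * u by apply: mulr_ge0 => //; rewrite divr_ge0 // ltW.
have is0 : 0 <= 2 / s by rewrite divr_ge0 // ltW.
have e0 := expR_ge0 (- (s / 2 * u)).
have e1 : (1 + s / 2 * u) * expR (- (s / 2 * u)) <= 1.
  by rewrite expRN ler_pdivrMr ?expR_gt0 // mul1r expR_ge1Dx.
have e2 : expR (- (s * u ^+ k)) <= expR (s * k%:R) * expR (- (s / 2 * u)) ^+ 2.
  by rewrite expr2 -!expRD ler_expR; have := ler_wpM2l (ltW s0) ub; lra.
have w0 : 0 <= (1 + x ^+ 2) * (1 + y ^+ 2) by apply: mulr_ge0; lra.
rewrite -uE; apply: le_trans (ler_wpM2l w0 e2) _; rewrite mulrCA; apply: ler_wpM2l; first exact: expR_ge0.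
have p1 : (1 + x ^+ 2) * (1 + y ^+ 2) <= (1 + u) ^+ 2.
  by rewrite uE; have := mulr_ge0 x0 y0; have := sqr_ge0 (x ^+ 2); have := sqr_ge0 (y ^+ 2); rewrite ![(_ + _) ^+ 2]expr2 ![(_ ^+ 2) ^+ 2]expr2; lra.
apply: le_trans (ler_wpM2r (sqr_ge0 _) p1) _; rewrite -exprMn.
apply: lerXn2r; rewrite ?nnegrE; [apply: mulr_ge0 => //; lra | lra | ].
have e3 : 1 + u <= (1 + 2 / s) * (1 + s / 2 * u).
  have -> : (1 + 2 / s) * (1 + s / 2 * u) = 1 + u + (2 / s + s / 2 * u) by field; rewrite gt_eqF.
  lra.
by apply: le_trans (ler_wpM2r e0 e3) _; rewrite -[leLHS]mulrA; apply: ler_piMr => //; lra.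
Qed.

(** The divided exponential decays in [Im z_2] around the ordinate [b] of the given point; this
    transfers the decay to the weight centred at 0. The constants reflect
    [y^2 <= 2 b^2 + 2 (y - b)^2]. *)
Lemma weight_shift (s b y : R) : 0 < s -> 1 + y ^+ 2 <= (1 + 2 * b ^+ 2 + 2 * s^-1 ^+ 2) * (1 + s ^+ 2 * (y - b) ^+ 2).
Proof.
move=> s0; have -> : (1 + 2 * b ^+ 2 + 2 * s^-1 ^+ 2) * (1 + s ^+ 2 * (y - b) ^+ 2) =
   1 + 2 * b ^+ 2 + 2 * (y - b) ^+ 2 + (2 * s^-1 ^+ 2 + s ^+ 2 * (y - b) ^+ 2 + 2 * b ^+ 2 * (s ^+ 2 * (y - b) ^+ 2)).
  by field; rewrite gt_eqF.
have a1 : 0 <= s^-1 ^+ 2 := sqr_ge0 _; have a2 : 0 <= s ^+ 2 * (y - b) ^+ 2 by rewrite mulr_ge0 // sqr_ge0.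
have a3 : 0 <= 2 * b ^+ 2 * (s ^+ 2 * (y - b) ^+ 2) by rewrite mulr_ge0 // mulr_ge0 // sqr_ge0.
have a4 : 0 <= b ^+ 2 := sqr_ge0 b; have := sqr_ge0 (y - 2 * b); move: a1 a2 a3 a4; rewrite !expr2; lra.
Qed.

Lemma weight4_decay (s b sg et D : R) : 0 < s -> 0 < sg -> 0 < et -> exists C, forall q F A, 0 <= F -> 0 <= A ->
  A <= D * expR (- (sg * `|q.2.1|)) * expR (- (et / 2 * (q.1.1 ^+ 2 + q.1.2 ^+ 2) ^+ k)) ->
  (1 + s ^+ 2 * (q.2.2 - b) ^+ 2) * F <= 2 * A ^+ 2 -> F * weight4 q <= C.
Proof.
move=> s0 sg0 et0; have [C2 C20 h2] := exp_decay2 et0.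
pose Cs : R := 1 + 2 * b ^+ 2 + 2 * s^-1 ^+ 2.
have Cs0 : 0 <= Cs by rewrite /Cs; have := sqr_ge0 b; have := sqr_ge0 s^-1; lra.
exists (Cs * (2 * D ^+ 2) * (C2 * (1 + sg^-1 ^+ 2))).
move=> [[x1 y1] [x2 y2]] F A F0 A0 /= hA hF; rewrite /weight4 /=.
have := h2 x1 y1; have := exp_decay1 x2 sg0; have := weight_shift b y2 s0.
move: hA; set u := (x1 ^+ 2 + y1 ^+ 2) ^+ k.
have -> : expR (- (et * u)) = expR (- (et / 2 * u)) ^+ 2 by rewrite expr2 -expRD; congr expR; lra.
have w0 (x : R) : 0 <= 1 + x ^+ 2 by have := sqr_ge0 x; lra.
have w12 := mulr_ge0 (w0 x1) (w0 y1); move: (expR_ge0 (- (sg * `|x2|))) (expR_ge0 (- (et / 2 * u))).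
move: (expR (- (sg * `|x2|))) (expR (- (et / 2 * u))) => E1 E2 E10 E20 hA ws d1 d2.
have A2 : A ^+ 2 <= D ^+ 2 * (E1 ^+ 2 * E2 ^+ 2).
  have hA' : A <= D * (E1 * E2) by rewrite mulrA.
  by rewrite -!exprMn; apply: lerXn2r; rewrite ?nnegrE //; exact: le_trans A0 hA'.
have s1 : (1 + y2 ^+ 2) * F <= Cs * (2 * (D ^+ 2 * (E1 ^+ 2 * E2 ^+ 2))).
  apply: le_trans (ler_wpM2r F0 ws) _; rewrite -mulrA; apply: ler_wpM2l => //; lra.
have w3 := mulr_ge0 w12 (w0 x2).
have := ler_wpM2l w3 s1.
have c1 : 0 <= Cs * (2 * D ^+ 2) by apply: mulr_ge0 => //; have := sqr_ge0 D; lra.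
have m1 : (1 + x1 ^+ 2) * (1 + y1 ^+ 2) * E2 ^+ 2 * ((1 + x2 ^+ 2) * E1 ^+ 2) <= C2 * (1 + sg^-1 ^+ 2).
  apply: ler_pM => //; apply: mulr_ge0 => //; exact: sqr_ge0.
have := ler_wpM2l c1 m1.
move=> q1 q2.
have -> : F * ((1 + x1 ^+ 2) * (1 + y1 ^+ 2) * (1 + x2 ^+ 2) * (1 + y2 ^+ 2)) = (1 + x1 ^+ 2) * (1 + y1 ^+ 2) * (1 + x2 ^+ 2) * ((1 + y2 ^+ 2) * F) by ring.
apply: le_trans q2 _; apply: le_trans q1; rewrite le_eqVlt; apply/orP; left; apply/eqP; ring.
Qed.

(** Replacing [z] by [z / rho] turns the weight [T P] into [t P] with [t = T rho^(2k)], while the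
    gap term becomes [B]. The constant [m] does not depend on [z0] and [T] because the loss at [z0]
    is 0 or at most [t0 eps k]. *)
Lemma KN_peak_scaled : exists2 m : R, 0 < m & forall z0 (T : R), 0 < T -> exists (G : R[i] -> R[i]) (B : R[i] -> R) (et D : R),
  [/\ forall q, exists L1 L2, CD (fun q => G (z1 q)) q L1 L2, 0 < et, 0 < D, forall z, 0 <= B z /\ 2 * (et * cabs z ^+ (2 * k) - D) <= B z &
   (forall z, cabs (G z) <= 2 * expR (T * P z - B z)) /\ m * expR (T * P z0) <= cabs (G z0)].
Proof.
have [eps [t0 [e0 t00 peak]]] := KN_peak P_real k_gt1 P_hom P_subh.
have kp : 0 < (k%:R : R) by rewrite ltr0n; exact: leq_trans k_gt1.
pose Ck : R := 2 ^+ k * k%:R; have Ck0 : 0 < Ck by rewrite mulr_gt0 // exprn_gt0.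
exists (expR (- (t0 * eps * k%:R)) / 2); first by rewrite divr_gt0 ?expR_gt0.
move=> z0 T T0.
(* If [T |z0|^(2k) > t0], the radius is [|z0|] and the rescaled point lies on the unit circle, where
   the gap vanishes. Otherwise [t = t0] exactly and the rescaled point lies in the unit disc, where
   the gap is at most [k]. *)
have [rho [rho0 tle cases]] : exists rho, [/\ 0 < rho, t0 <= T * rho ^+ (2 * k) &
    cabs z0 = rho \/ cabs z0 <= rho /\ T * rho ^+ (2 * k) = t0].
  have [r0 r00 r0E] := exists_root T0 t00; have [h|h] := leP (cabs z0) r0.
    by exists r0; split=> //; [rewrite r0E | right].
  exists (cabs z0); split; [exact: lt_trans h | | by left].
  by rewrite -r0E ler_pM2l // lerXn2r ?nnegrE ?cabs_ge0 ?ltW.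
have [t tE] : exists t, t = T * rho ^+ (2 * k) by eexists.
rewrite -tE in tle cases; have t_gt0 : 0 < t by exact: lt_le_trans tle.
have rk : 0 < rho ^+ (2 * k) by rewrite exprn_gt0.
have [g gD [g1 g2]] := peak t tle (RC rho^-1 * z0).
pose gap z := cabs (RC rho^-1 * z) ^+ (2 * k) - k%:R * cabs (RC rho^-1 * z) ^+ 2 + k%:R - 1.
have PE z : t * (P (RC rho^-1 * z) - eps * gap z) = T * P z - t * eps * gap z.
  by rewrite mulrBr P_homE exprVn tE; field; rewrite gt_eqF.
have gapE z : 0 <= gap z /\ cabs (RC rho^-1 * z) ^+ (2 * k) / 2 - Ck <= gap z.
  by rewrite /gap exprM; apply: tangent_gap; rewrite // sqr_ge0.
have cE z : cabs (RC rho^-1 * z) = rho^-1 * cabs z by rewrite cabsM cabs_real ger0_norm // invr_ge0 ltW.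
have yE z : cabs (RC rho^-1 * z) ^+ (2 * k) = cabs z ^+ (2 * k) / rho ^+ (2 * k).
  by rewrite cE exprMn exprVn mulrC.
have te : 0 < t * eps by rewrite mulr_gt0.
exists (fun z => g (RC rho^-1 * z)), (fun z => t * eps * gap z), (t * eps / (4 * rho ^+ (2 * k))), (t * eps * Ck / 2).
split.
- move=> q; have [a Da] := gD (RC rho^-1 * z1 q).
  have := CD_comp Da (CD_scale (RC rho^-1) (CD_z1 q)); by do 2 eexists; eauto.
- by rewrite divr_gt0 // mulr_gt0.
- by rewrite divr_gt0 // mulr_gt0.
- move=> z; have [a1 a2] := gapE z; split; first by rewrite mulr_ge0 // ltW.
  apply: le_trans (ler_wpM2l (ltW te) a2); rewrite yE le_eqVlt; apply/orP; left; apply/eqP.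
  by field; rewrite gt_eqF.
split=> [z|]; first by have := g1 (RC rho^-1 * z); rewrite -/(gap z) PE.
apply: le_trans g2; rewrite -/(gap z0) PE mulrAC -expRD ler_pM2r ?invr_gt0 // ler_expR addrC lerD2l lerN2.
case: cases => [ze|[zr ->]].
  have -> : gap z0 = 0 by rewrite /gap cE ze mulVf ?gt_eqF // !expr1n; lra.
  by rewrite mulr0 mulr_ge0 // ?mulr_ge0 // ltW.
rewrite -mulrA -[leRHS]mulrA; apply: ler_wpM2l; first exact: ltW.
apply: ler_wpM2l; first exact: ltW.
have y1 : cabs (RC rho^-1 * z0) <= 1 by rewrite cE mulrC ler_pdivrMr // mul1r.
have y0 := cabs_ge0 (RC rho^-1 * z0); rewrite /gap.
have := exprn_ile1 (2 * k) y0 y1; have := mulr_ge0 (ltW kp) (sqr_ge0 (cabs (RC rho^-1 * z0))); lra.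
Qed.

End KohnNirenbergFunctions.

(** * The family of peak functions on the domain *)

Section KohnNirenbergFamily.
Variable R : realType.
Variables (N : nat) (c : nat -> nat -> R[i]) (k : nat).
Hypothesis P_real : forall z : R[i], complex.Im (zzpoly N c z) = 0.
Hypothesis k_gt1 : (1 < k)%N.
Hypothesis P_hom : forall (r : R) (z : R[i]), zzpoly N c (Complex r 0 * z) = Complex (r ^+ (2 * k)) 0 * zzpoly N c z.
Hypothesis P_subh : forall x : R * R, x != 0 -> 0 < ddbar (ex R) (ey R) (ex R) (ey R) (KN_P N c) x.
Implicit Types (z w : R[i]) (p q v : C2 R).
Local Notation RC x := (Complex x 0).
Local Notation P z := (complex.Re (zzpoly N c z)).
Local Notation W := (KN_domain N c).
Local Notation r := (KN_r N c).

Let lin1 (K X1 X2 X3 : R) : 0 <= K -> X1 <= X3 -> X1 * X2 <= X3 -> 2 * X1 * (K * (1 + X2)) <= 4 * K * X3.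
Proof. by move=> K0 u1 u2; have := ler_wpM2l K0 u1; have := ler_wpM2l K0 u2; lra. Qed.
Let lin2 (s x C Y lam et D B : R) : s * x <= s * (C * Y) -> s * C * Y <= lam * et * Y -> lam * (2 * (et * Y - D)) <= lam * B ->
  lam * B <= 1 * B -> lam * D <= 1 -> s * x <= B / 2 + 1.
Proof. lra. Qed.
Let lin3 (T r sg a C Y et D B : R) : T * r <= sg * r -> sg * r <= - (sg * a) + sg * (C * Y) -> sg * (2 * C) * Y <= et * Y ->
  2 * (et * Y - D) <= B -> T * r - B / 2 <= D + - (sg * a) + - (et / 2 * Y).
Proof. lra. Qed.
Let lin4 (F w V A : R) : F <= A -> w * F <= V -> V <= A -> (1 + w) * F <= 2 * A.
Proof. lra. Qed.
Let lin5 (T p B x : R) : 0 <= B -> T * p - B + T * x <= 1 + (T * (x + p) - B / 2).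
Proof. lra. Qed.
Let lin6 (T p B x s : R) : s * x <= B / 2 + 1 -> T * p - B + T * x + s * x <= 1 + (T * (x + p) - B / 2).
Proof. lra. Qed.
Let lin7 (x p u : R) : - u <= p -> x + p < 0 -> x <= u.
Proof. lra. Qed.
Let lin8 (x p u : R) : p <= u -> - u <= p -> x + p < 0 -> x + p <= - `|x| + u.
Proof. by case: (lerP 0 x) => [/ger0_norm|/ltr0_norm] ->; lra. Qed.
Let lin9 (T p B : R) : 0 <= B -> T * p - B / 2 <= T * p.
Proof. lra. Qed.

(** The gain [B] in the weight is spent in two halves: one absorbs the growth of the divided
    exponential, the other gives decay in [z_1]. Decay in [Re z_2] is taken from [T r], and decay in
    [Im z_2] from the divided exponential. Only the decay constant [C] depends on [p] and [T]. *)
Lemma KN_family : exists m K : R, [/\ 0 < m, 0 < K & forall p (T : R), 0 < T -> r p < 0 -> exists f C,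
  [/\ forall q, exists L1 L2, CD f q L1 L2, forall q, W q -> cabs (f q) <= K * expR (T * r q),
      m * expR (T * r p) <= cabs (f p) & forall q, W q -> sqmod (f q) * weight4 q <= C]].
Proof.
have [m m0 peak] := KN_peak_scaled P_real k_gt1 P_hom P_subh.
have [CP CP0 hP] := P_growth P_real k_gt1 P_hom; have [K1 K11 hphi] := expdiv_bounds R.
have ee : 0 < expR (1 : R) := expR_gt0 1.
have K10 : 0 < K1 by lra.
have K4 : 0 < 4 * K1 by rewrite mulr_gt0.
have Kp : 0 < 4 * K1 * expR 1 by rewrite mulr_gt0 // mulr_gt0.
exists (m / 2), (4 * K1 * expR 1); split => //; first by rewrite divr_gt0.
move=> p T T0 rp; have [G [B [et [D [GD et0 D0 hB [G1 G2]]]]]] := peak (z1 p) T T0.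
pose x2 := complex.Re (z2 p); pose b := complex.Im (z2 p).
(* With [lam <= 1] and [lam D <= 1], the lower bound on [B] gives
   [lam et |z_1|^(2k) <= B / 2 + 1]. *)
pose lam : R := Num.min 1 D^-1.
have lam0 : 0 < lam by rewrite lt_min ltr01 invr_gt0.
have [lam1 lam2] : lam <= 1 /\ lam * D <= 1.
  by rewrite -ler_pdivlMr // mul1r /lam !ge_min !lexx orbT.
have x21 : 0 < `|x2| + 1 by have := normr_ge0 x2; lra.
(* The first bound on [s] makes [s Re z_2 <= B / 2 + 1] on the domain, so the growth of [expdiv] is
   absorbed. The second places [ww p] where [expdiv] is at least [1/2] in modulus. *)
have [s [s0 s1 s2]] : exists s : R, [/\ 0 < s, s * CP <= lam * et & s * (2 * K1 * (`|x2| + 1)) <= 1].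
  exists (Num.min (lam * et / CP) (2 * K1 * (`|x2| + 1))^-1); split.
  - by rewrite lt_min divr_gt0 ?mulr_gt0 // invr_gt0 !mulr_gt0.
  - by rewrite -ler_pdivlMr // ge_min lexx.
  - by rewrite -ler_pdivlMr ?mulr_gt0 // mul1r ge_min lexx orbT.
(* Centred at the imaginary part of [z_2(p)], so that [ww p] is real and equal to [s Re z_2(p)]. *)
pose ww q := RC s * (z2 q - Complex 0 b).
pose f q := G (z1 q) * cexp (RC T * z2 q) * expdiv (ww q).
have ReW q : complex.Re (ww q) = s * complex.Re (z2 q) by rewrite RC_re reD reN /= subr0.
have ImW q : complex.Im (ww q) = s * (complex.Im (z2 q) - b) by rewrite /ww imM imD imN /= mul0r addr0.
(* A common bound for [|f|] and [|ww f|]; together they give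
   [(1 + s^2 (Im z_2 - b)^2) |f|^2 <= 2 A^2]. *)
pose A q : R := 4 * K1 * (expR 1 * expR (T * r q - B (z1 q) / 2)).
have A0 q : 0 <= A q by apply: mulr_ge0; [exact: ltW | rewrite mulr_ge0 ?expR_ge0].
have main q : W q -> 2 * (expR (T * P (z1 q) - B (z1 q)) * expR (T * complex.Re (z2 q))) * (K1 * (1 + expR (s * complex.Re (z2 q)))) <= A q.
  rewrite KN_domainE => rq; have [b1 b2] := hB (z1 q).
  have sx : s * complex.Re (z2 q) <= B (z1 q) / 2 + 1.
    have h1 : s * complex.Re (z2 q) <= s * (CP * cabs (z1 q) ^+ (2 * k)).
      by rewrite ler_pM2l //; have := hP (z1 q); rewrite ler_norml => /andP[h _]; exact: lin7 h rq.
    have h2 : s * CP * cabs (z1 q) ^+ (2 * k) <= lam * et * cabs (z1 q) ^+ (2 * k).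
      by apply: ler_wpM2r => //; rewrite exprn_ge0 ?cabs_ge0.
    have h3 := ler_wpM2l (ltW lam0) b2.
    have h4 := ler_wpM2r b1 lam1; exact: lin2 h1 h2 h3 h4 lam2.
  have [X1 X1E] : exists X, X = expR (T * P (z1 q) - B (z1 q)) * expR (T * complex.Re (z2 q)) by eexists.
  have [X2 X2E] : exists X, X = expR (s * complex.Re (z2 q)) by eexists.
  have [X3 X3E] : exists X, X = expR 1 * expR (T * r q - B (z1 q) / 2) by eexists.
  have u1 : X1 <= X3 by rewrite X1E X3E -!expRD ler_expR; exact: lin5.
  have u2 : X1 * X2 <= X3 by rewrite X1E X2E X3E -!expRD ler_expR; exact: lin6.
  rewrite -X1E -X2E /A -X3E.
  exact: lin1 (ltW K10) u1 u2.
have fE q : cabs (f q) = cabs (G (z1 q)) * expR (T * complex.Re (z2 q)) * cabs (expdiv (ww q)).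
  by rewrite /f cabsM cabsM cabs_cexp RC_re.
have GE q : 0 <= cabs (G (z1 q)) * expR (T * complex.Re (z2 q)) <= 2 * (expR (T * P (z1 q) - B (z1 q)) * expR (T * complex.Re (z2 q))).
  by rewrite mulr_ge0 ?cabs_ge0 ?expR_ge0 //= mulrA ler_wpM2r ?expR_ge0.
have fA q : W q -> cabs (f q) <= A q.
  move=> /main; apply: le_trans; rewrite fE; have /andP[c1 c2] := GE q.
  by apply: ler_pM => //; rewrite ?cabs_ge0 //; have [h _ _] := hphi (ww q); rewrite -ReW.
have fA2 q : W q -> cabs (ww q) * cabs (f q) <= A q.
  move=> /main; apply: le_trans; rewrite fE mulrCA; have /andP[c1 c2] := GE q.
  apply: ler_pM => //; first by rewrite mulr_ge0 ?cabs_ge0.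
  have [_ h _] := hphi (ww q); rewrite -ReW; apply: le_trans h _.
  by apply: ler_peMl => //; rewrite addr_ge0 ?expR_ge0.
(* As [r < 0] and [sg <= T], [T r] may be replaced by [sg r], which is at most [- sg |Re z_2|] plus
   a multiple of [|z_1|^(2k)]; the second bound keeps that multiple within [et / 2]. *)
pose sg : R := Num.min T (et / (2 * CP)).
have sg0 : 0 < sg by rewrite lt_min T0 divr_gt0 // mulr_gt0.
have [sgT sgE] : sg <= T /\ sg * (2 * CP) <= et by rewrite -ler_pdivlMr ?mulr_gt0 // /sg !ge_min !lexx orbT.
have [C hC] := weight4_decay k_gt1 b (4 * K1 * expR 1 * expR D) s0 sg0 et0.
exists f, C; split.
- move=> q; have [M1 [M2 F1]] := GD q.
  have F2 := CD_comp (cderiv_cexp (RC T * z2 q)) (CD_scale (RC T) (CD_z2 q)).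
  have [a Da] := cderiv_expdiv (ww q).
  have F3 := CD_comp Da (CD_scale (RC s) (CD_add (CD_z2 q) (CD_cst (- Complex 0 b) q))).
  by have := CD_mul (CD_mul F1 F2) F3; eexists; eexists; eauto.
- move=> q Wq; apply: le_trans (fA q Wq) _; rewrite -[leRHS]mulrA; apply: ler_wpM2l; first exact: ltW.
  apply: ler_wpM2l => //.
  by rewrite ler_expR; have [b1 _] := hB (z1 q); exact: lin9.
- have h : 2^-1 <= cabs (expdiv (ww p)).
    have [_ _] := hphi (ww p); apply.
    have -> : ww p = RC (s * x2).
      by apply: complexP; [rewrite ReW | rewrite ImW subrr mulr0].
    rewrite cabs_real normrM (ger0_norm (ltW s0)) -[leRHS]mul1r ler_pdivlMr ?mulr_gt0 //.
    apply: le_trans s2; rewrite -[leLHS]mulrA; apply: ler_wpM2l; first exact: ltW.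
    rewrite [leLHS]mulrC; apply: ler_wpM2l; first by rewrite mulr_ge0 // ltW.
    by rewrite lerDl.
  have -> : m / 2 * expR (T * r p) = m * expR (T * P (z1 p)) * expR (T * complex.Re (z2 p)) * 2^-1.
    by rewrite mulrAC -[m * _ * _ in RHS]mulrA -expRD -mulrDr [P _ + _]addrC.
  rewrite fE; apply: ler_pM => //; first by rewrite !mulr_ge0 ?expR_ge0 // ltW.
  by apply: ler_wpM2r; rewrite ?expR_ge0.
move=> q Wq; apply: (hC q _ (A q)) => //; first by rewrite -sqr_cabs sqr_ge0.
  have /= cz : cabs (z1 q) ^+ 2 = q.1.1 ^+ 2 + q.1.2 ^+ 2 by rewrite sqr_cabs.
  have -> : 4 * K1 * expR 1 * expR D * expR (- (sg * `|q.2.1|)) * expR (- (et / 2 * (q.1.1 ^+ 2 + q.1.2 ^+ 2) ^+ k)) =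
    4 * K1 * (expR 1 * (expR D * expR (- (sg * `|q.2.1|)) * expR (- (et / 2 * (q.1.1 ^+ 2 + q.1.2 ^+ 2) ^+ k)))).
    by rewrite !mulrA.
  rewrite /A; apply: ler_wpM2l; first exact: ltW.
  apply: ler_wpM2l => //; rewrite -!expRD ler_expR -cz -exprM.
  have rq : r q < 0 by rewrite -KN_domainE.
  have [_ b2] := hB (z1 q); have Y0 : 0 <= cabs (z1 q) ^+ (2 * k) by rewrite exprn_ge0 ?cabs_ge0.
  have h1 : T * r q <= sg * r q by have := ler_wnM2r (ltW rq) sgT.
  have h2 : sg * r q <= - (sg * `|q.2.1|) + sg * (CP * cabs (z1 q) ^+ (2 * k)).
    rewrite -mulrN -mulrDr ler_pM2l //; have := hP (z1 q); rewrite ler_norml => /andP[l1 l2].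
    exact: lin8 l2 l1 rq.
  exact: lin3 h1 h2 (ler_wpM2r Y0 sgE) b2.
have := fA q Wq; have := fA2 q Wq; have c0 := cabs_ge0 (f q); have c1 := cabs_ge0 (ww q).
move=> u1 u2; rewrite -sqr_cabs.
have v1 : (cabs (ww q) * cabs (f q)) ^+ 2 <= A q ^+ 2 by apply: lerXn2r => //; rewrite nnegrE // mulr_ge0.
have v2 : cabs (f q) ^+ 2 <= A q ^+ 2 by apply: lerXn2r => //; rewrite nnegrE.
have v3 : (s ^+ 2 * (q.2.2 - b) ^+ 2) * cabs (f q) ^+ 2 <= (cabs (ww q) * cabs (f q)) ^+ 2.
  rewrite exprMn; apply: ler_wpM2r; first exact: sqr_ge0.
  by rewrite sqr_cabs /sqmod ImW exprMn; have := sqr_ge0 (complex.Re (ww q)); rewrite lerDr.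
exact: lin4 v2 v3 v1.
Qed.
End KohnNirenbergFamily.

(** * Integrability of products of functions of separate variables *)

Section ProductIntegrable.
Context d1 d2 (T1 : measurableType d1) (T2 : measurableType d2) (R : realType).
Variables (m1 : {sigma_finite_measure set T1 -> \bar R}) (m2 : {sigma_finite_measure set T2 -> \bar R}).
Variables (f : T1 -> R) (g : T2 -> R).
Hypotheses (mf : measurable_fun setT f) (mg : measurable_fun setT g) (f0 : forall x, 0 <= f x) (g0 : forall x, 0 <= g x).

Lemma measurable_prod_fun : measurable_fun setT (fun x : T1 * T2 => f x.1 * g x.2).
Proof. by apply: measurable_funM; [apply: (measurableT_comp mf) | apply: (measurableT_comp mg)]. Qed.

Lemma integral_prod_lty : (\int[m1]_x (f x)%:E < +oo)%E -> (\int[m2]_x (g x)%:E < +oo)%E ->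
  (\int[product_measure1 m1 m2]_x (f x.1 * g x.2)%:E < +oo)%E.
Proof.
move=> If Ig.
have mF : measurable_fun setT (fun x : T1 * T2 => (f x.1 * g x.2)%:E).
  by apply/measurable_EFinP; exact: measurable_prod_fun.
have F0 (x : T1 * T2) : (0 <= (f x.1 * g x.2)%:E)%E by rewrite lee_fin mulr_ge0.
rewrite (@fubini_tonelli1 _ _ T1 T2 R m1 m2 _ mF F0).
have [I IE] : exists I : R, (\int[m2]_x (g x)%:E = I%:E)%E.
  exists (fine (\int[m2]_x (g x)%:E)); rewrite fineK // ge0_fin_numE //.
  by apply: integral_ge0 => x _; rewrite lee_fin.
have I0 : 0 <= I by rewrite -lee_fin -IE; apply: integral_ge0 => x _; rewrite lee_fin.
rewrite (eq_integral (fun x => (I%:E * (f x)%:E)%E)); last first.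
  move=> x _; rewrite /fubini_F /=; under eq_integral do rewrite EFinM.
  rewrite ge0_integralZl //; [by rewrite IE muleC | exact/measurable_EFinP | by move=> y _; rewrite lee_fin | by rewrite lee_fin].
by rewrite ge0_integralZl //; [exact: lte_mul_pinfty | exact/measurable_EFinP | move=> y _; rewrite lee_fin].
Qed.
End ProductIntegrable.

(** * Square integrability and positivity of the Caratheodory metric *)

Section KohnNirenbergA2.
Variable R : realType.
Variables (N : nat) (c : nat -> nat -> R[i]) (k : nat).
Hypothesis P_real : forall z : R[i], complex.Im (zzpoly N c z) = 0.
Hypothesis k_gt1 : (1 < k)%N.
Hypothesis P_hom : forall (r : R) (z : R[i]), zzpoly N c (Complex r 0 * z) = Complex (r ^+ (2 * k)) 0 * zzpoly N c z.
Hypothesis P_subh : forall x : R * R, x != 0 -> 0 < ddbar (ex R) (ey R) (ex R) (ey R) (KN_P N c) x.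
Implicit Types (z w : R[i]) (p q v : C2 R).
Local Notation RC x := (Complex x 0).
Local Notation W := (KN_domain N c).
Local Notation T1 := (measurableTypeR R).
Local Notation T2 := (T1 * T1)%type.
Let V (x : T1) : R := (oneDsqr x)^-1.

Let mV : measurable_fun setT V.
Proof. by apply: continuous_measurable_fun; exact: continuous_oneDsqrV. Qed.

Let V0 x : 0 <= V x. Proof. by rewrite invr_ge0 addr_ge0 // sqr_ge0. Qed.

Let IV : (\int[@lebesgue_measure R]_x (V x)%:E < +oo)%E.
Proof.
rewrite ge0_symfun_integralT //; first last.
- by move=> x; rewrite /V /= /oneDsqr sqrrN.
- exact: continuous_oneDsqrV.
by rewrite -set_itvcy integral0y_oneDsqr -EFinM ltry.
Qed.

Lemma weight4_integrable : measurable_fun setT (fun p : T2 * T2 => (weight4 p)^-1) /\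
  (\int[mu4 R]_p ((weight4 p)^-1)%:E < +oo)%E.
Proof.
have E (p : T2 * T2) : (weight4 p)^-1 = (V p.1.1 * V p.1.2) * (V p.2.1 * V p.2.2).
  by rewrite /weight4 !invfM /V /oneDsqr !mulrA.
have m2 := measurable_prod_fun mV mV.
have I2 := @integral_prod_lty _ _ T1 T1 R (@lebesgue_measure R) (@lebesgue_measure R) V V mV mV V0 V0 IV IV.
have p0 (x : T2) : 0 <= V x.1 * V x.2 by rewrite mulr_ge0.
rewrite (_ : (fun p => _) = fun p : T2 * T2 => (V p.1.1 * V p.1.2) * (V p.2.1 * V p.2.2)); last exact/funext.
split; first exact: (measurable_prod_fun m2 m2).
under eq_integral do rewrite E.
exact: (@integral_prod_lty _ _ T2 T2 R (sf2 R) (sf2 R) _ _ m2 m2 p0 p0 I2 I2).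
Qed.

Lemma weight4_ge1 p : 1 <= weight4 p.
Proof.
have h (x : R) : 1 <= 1 + x ^+ 2 by rewrite lerDl sqr_ge0.
by rewrite /weight4; do 3 (rewrite mulr_ege1 //).
Qed.

Lemma decay_A2 f C : CDon W f -> (forall q, W q -> sqmod (f q) * weight4 q <= C) -> A2 W f.
Proof.
move=> fD fC; apply/A2P; split => //; have oW := KN_opn P_real P_hom.
have mW := opn_measurable oW; have [mw Iw] := weight4_integrable.
have wp p : 0 < weight4 p by apply: lt_le_trans (weight4_ge1 p).
have C0' : 0 <= `|C| by [].
rewrite /Nm; apply: (@le_lt_trans _ _ (\int[mu4 R]_(p in W) (`|C|%:E * ((weight4 p)^-1)%:E))%E).
  apply: ge0_le_integral => //.
  - by move=> p _; rewrite lee_fin sqmod_ge0.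
  - by apply/measurable_EFinP; exact: sqmod_measurable.
  - apply/measurable_EFinP; apply: measurable_funM => //; exact: measurable_funTS.
  move=> p Wp; rewrite -EFinM lee_fin ler_pdivlMr //.
  by apply: le_trans (fC p Wp) _; exact: ler_norm.
rewrite ge0_integralZl //; [|by apply/measurable_EFinP; exact: measurable_funTS|by move=> p _; rewrite lee_fin invr_ge0 ltW].
apply: lte_mul_pinfty => //.
apply: le_lt_trans Iw; apply: ge0_subset_integral => //; first by apply/measurable_EFinP.
by move=> p _; rewrite lee_fin invr_ge0 ltW.
Qed.

Lemma KN_decaying p : W p -> exists f C, [/\ forall q, exists L1 L2, CD f q L1 L2,
  forall q, W q -> sqmod (f q) * weight4 q <= C & f p != 0].
Proof.
move=> Wp; have [m [K [m0 K0 F]]] := KN_family P_real k_gt1 P_hom P_subh.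
have [f [C [f1 f2 f3 f4]]] := F p 1 ltr01 Wp; exists f, C; split => //.
by rewrite -cabs_gt0; apply: lt_le_trans f3; rewrite mulr_gt0 // expR_gt0.
Qed.

Lemma KN_A2_nonvanishing p : W p -> exists2 h, A2 W h & h p != 0.
Proof.
move=> /KN_decaying[f [C [f1 f2 f3]]]; exists f => //; apply: decay_A2 f2 => q _; exact: f1.
Qed.

Lemma coord_weight4 (x : R) q : x = sqmod (z1 q) \/ x = sqmod (z2 q) \/ x = 1 -> x <= weight4 q.
Proof.
case: q => [[a b] [s t]] h.
have := sqr_ge0 a; have := sqr_ge0 b; have := sqr_ge0 s; have := sqr_ge0 t.
have {h} : x = a ^+ 2 + b ^+ 2 \/ x = s ^+ 2 + t ^+ 2 \/ x = 1 by [].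
rewrite /weight4 /=; move: (a ^+ 2) (b ^+ 2) (s ^+ 2) (t ^+ 2) => A B S T h T0 S0 B0 A0; move: h.
have AB : 1 + A + B <= (1 + A) * (1 + B) by have := mulr_ge0 A0 B0; lra.
have ST : 1 + S + T <= (1 + S) * (1 + T) by have := mulr_ge0 S0 T0; lra.
have : (1 + A + B) * (1 + S + T) <= (1 + A) * (1 + B) * (1 + S) * (1 + T).
  by rewrite -[leRHS]mulrA; apply: ler_pM => //; lra.
have := mulr_ge0 A0 S0; have := mulr_ge0 A0 T0; have := mulr_ge0 B0 S0; have := mulr_ge0 B0 T0.
by move=> u1 u2 u3 u4 u [|[|]] ->; apply: le_trans u; lra.
Qed.

Lemma caratheodory_ge (U : set (C2 R)) h p v : CDon U h -> (forall q, U q -> cabs (h q) < 1) -> h p = 0 ->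
  ((cabs (dC h p v))%:E <= caratheodory U p v)%E.
Proof. by move=> hD h1 h0; apply: ereal_sup_ubound; exists h => //; split => //; apply/holo_CDon. Qed.

(** The competitor is [(z_j - z_j(p)) f / B], where [z_j] is a coordinate in which [v] does not
    vanish. It is bounded because [weight4] dominates [|z_j|^2], and its derivative at [p] along [v]
    is [f(p) v_j / B]. *)
Lemma caratheodory_positive : positive_metric W (caratheodory W).
Proof.
move=> p v Wp v0; have [f [C [f1 f2 f3]]] := KN_decaying Wp.
have [zz [L1 [L2 [zD zw zv]]]] : exists (zz : C2 R -> R[i]) L1 L2, [/\ forall q, CD zz q L1 L2,
    forall q, sqmod (zz q) <= weight4 q & L1 * z1 v + L2 * z2 v != 0].
  have [h1|h1] := eqVneq (z1 v) 0; last first.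
    exists (@z1 R), 1, 0; split => [q|q|]; [exact: CD_z1 | by apply: coord_weight4; left | by rewrite mul1r mul0r addr0].
  exists (@z2 R), 0, 1; split => [q|q|]; [exact: CD_z2 | by apply: coord_weight4; right; left | ].
  rewrite mul1r mul0r add0r; apply: contra v0 => /eqP h2; move: h1 h2; rewrite /z1 /z2 /cplx.
  by case: v => [[a b] [s t]] /= [-> ->] [-> ->].
pose B : R := Num.sqrt `|C| * (1 + cabs (zz p)) + 1.
have sC (z : R[i]) : sqmod z <= `|C| -> cabs z <= Num.sqrt `|C| by move=> h; rewrite /cabs ler_wsqrtr.
have B0 : 0 < B by rewrite ltr_wpDl // mulr_ge0 ?sqrtr_ge0 // addr_ge0 // cabs_ge0.
pose F q := RC B^-1 * ((zz q - zz p) * f q).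
have FD q : exists M1 M2, CD f q M1 M2 /\ CD F q (RC B^-1 * ((L1 + 0) * f q + (zz q + - zz p) * M1)) (RC B^-1 * ((L2 + 0) * f q + (zz q + - zz p) * M2)).
  have [M1 [M2 D]] := f1 q; exists M1, M2; split => //.
  exact: (CD_scale (RC B^-1) (CD_mul (CD_add (zD q) (CD_cst (- zz p) q)) D)).
have FDW : CDon W F by move=> q _; have [M1 [M2 [_ D]]] := FD q; do 2 eexists; exact: D.
have FB q : W q -> cabs (F q) < 1.
  move=> /f2 fC; have w1 := weight4_ge1 q; have s0 := sqmod_ge0 (f q).
  have fb : cabs (f q) <= Num.sqrt `|C|.
    by apply: sC; apply: le_trans (ler_norm C); apply: le_trans fC; rewrite ler_peMr.
  have zb : cabs (zz q) * cabs (f q) <= Num.sqrt `|C|.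
    rewrite -cabsM; apply: sC; apply: le_trans (ler_norm C); apply: le_trans fC.
    by rewrite -sqr_cabs cabsM exprMn !sqr_cabs mulrC ler_wpM2l.
  rewrite /F cabsM cabs_real ger0_norm ?invr_ge0 ?(ltW B0) // mulrC ltr_pdivrMr // mul1r cabsM.
  have t := ler_wpM2r (cabs_ge0 (f q)) (cabsBD (zz q) (zz p)).
  apply: le_lt_trans t _; rewrite mulrDl /B ltr_pwDr // mulrDr mulr1 lerD //.
  by rewrite mulrC ler_wpM2r // cabs_ge0.
apply: lt_le_trans (caratheodory_ge v FDW FB _); last by rewrite /F subrr mul0r mulr0.
have [M1 [M2 [_ D]]] := FD p; rewrite lte_fin cabs_gt0 (CD_dC v D).
have -> : RC B^-1 * ((L1 + 0) * f p + (zz p + - zz p) * M1) * z1 v + RC B^-1 * ((L2 + 0) * f p + (zz p + - zz p) * M2) * z2 v =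
  RC B^-1 * f p * (L1 * z1 v + L2 * z2 v) by ring.
have bn : RC B^-1 != 0 by rewrite -cabs_gt0 cabs_real normr_gt0 invr_eq0 gt_eqF.
exact: mulf_neq0 (mulf_neq0 bn f3) zv.
Qed.
End KohnNirenbergA2.

(** * Holomorphic functions along curves of class [C^1] *)

Section Curves.
Variable R : realType.
Implicit Types (p q v : C2 R) (f : C2 R -> R[i]) (W : set (C2 R)) (g : R -> C2 R) (F : C2 R -> C2 R -> \bar R).
Local Notation RC x := (Complex x 0).
Local Notation mu := (@lebesgue_measure R).

(* No measurability is available for a Finsler integrand, so monotonicity is read off the definition of the integral. *)
Lemma ge0_le_integral_nonmeasurable d (T : measurableType d) (m : {measure set T -> \bar R}) (D : set T) (f1 f2 : T -> \bar R) :
  (forall x, D x -> (0 <= f1 x)%E) -> (forall x, D x -> (f1 x <= f2 x)%E) ->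
  (\int[m]_(x in D) f1 x <= \int[m]_(x in D) f2 x)%E.
Proof.
move=> f0 f12; rewrite !ge0_integralE => [|x Dx|//]; last exact: le_trans (f0 x Dx) (f12 x Dx).
apply: ereal_sup_le => _ [h hf <-]; exists h => // x; apply: le_trans (hf x) _.
by rewrite !patchE; case: ifPn => // /set_mem; exact: f12.
Qed.

Lemma C1_eps g t e : C1_curve g -> 0 < e -> exists2 d, 0 < d & forall h, `|h| < d -> pn (g (t + h) - g t - h *: derive1 g t) <= e * `|h|.
Proof.
move=> [/(_ t) dg _] e0; have e4 : 0 < e / 4 by rewrite divr_gt0.
have : (h^-1 *: (g (h + t) - g t)) @[h --> (0 : R)^'] --> derive1 g t.
  have -> : (fun h : R => h^-1 *: (g (h + t) - g t)) = (fun h : R => h^-1 *: ((g \o shift t) (h *: 1) - g t)).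
    by apply/funext => h /=; rewrite /GRing.scale /= mulr1.
  by rewrite derive1E; exact: dg.
move=> /cvgrPdist_le /(_ _ e4); rewrite /= /dnbhs /within /= => -[d /= d0 hd].
exists d => // h hh; have [->|h0] := eqVneq h 0.
  by rewrite addr0 subrr scale0r subr0 pn0 normr0 mulr0.
have := hd h; rewrite /ball /= sub0r normrN => /(_ hh h0) k1.
have -> : g (t + h) - g t - h *: derive1 g t = h *: (h^-1 *: (g (h + t) - g t) - derive1 g t).
  by rewrite scalerBr scalerA divff // scale1r (addrC t).
rewrite pnZ mulrC; apply: ler_wpM2r => //; apply: le_trans (pn_norm _) _.
by rewrite distrC in k1; have := k1; lra.
Qed.

Lemma C1_cont g t e : C1_curve g -> 0 < e -> exists2 d, 0 < d & forall h, `|h| < d -> pn (derive1 g (t + h) - derive1 g t) <= e.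
Proof.
move=> [_ cg] e0; have e4 : 0 < e / 4 by rewrite divr_gt0.
have /cvgrPdist_le /(_ _ e4) := cg t; rewrite /= => -[d /= d0 hd].
exists d => // h hh; have := hd (t + h); rewrite /ball /= opprD addNKr normrN => /(_ hh) k1.
by apply: le_trans (pn_norm _) _; rewrite distrC in k1; have := k1; lra.
Qed.

Definition curve_cont (u : R -> R[i]) t := forall e, 0 < e -> exists2 d, 0 < d & forall h, `|h| < d -> cabs (u (t + h) - u t) <= e.

Lemma curve_cont_add (u v : R -> R[i]) t : curve_cont u t -> curve_cont v t -> curve_cont (fun s => u s + v s) t.
Proof.
move=> cu cv e e0; have e2 : 0 < e / 2 by rewrite divr_gt0.
have [d d0 hd] := cu _ e2; have [d' d'0 hd'] := cv _ e2.
exists (Num.min d d') => [|h]; first by rewrite lt_min d0.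
rewrite lt_min => /andP[/hd a /hd' b].
have -> : u (t + h) + v (t + h) - (u t + v t) = (u (t + h) - u t) + (v (t + h) - v t) by ring.
by apply: le_trans (cabsD _ _) _; rewrite [leRHS]splitr lerD.
Qed.

Lemma curve_cont_mul (u v : R -> R[i]) t : curve_cont u t -> curve_cont v t -> curve_cont (fun s => u s * v s) t.
Proof.
move=> cu cv e e0; pose M := cabs (u t) + cabs (v t) + 1.
have [a0 b0] := (cabs_ge0 (u t), cabs_ge0 (v t)).
have M0 : 0 < M by rewrite /M; lra.
pose e' := Num.min 1 (e / (2 * M)).
have e'0 : 0 < e' by rewrite lt_min ltr01 divr_gt0 // mulr_gt0.
have [e'1 e'2] : e' <= 1 /\ e' * (2 * M) <= e by rewrite -ler_pdivlMr ?mulr_gt0 // /e' !ge_min !lexx orbT.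
have [d d0 hd] := cu _ e'0; have [d' d'0 hd'] := cv _ e'0.
exists (Num.min d d') => [|h]; first by rewrite lt_min d0.
rewrite lt_min => /andP[/hd a /hd' b].
have -> : u (t + h) * v (t + h) - u t * v t =
  (u (t + h) - u t) * (v (t + h) - v t) + ((u (t + h) - u t) * v t + u t * (v (t + h) - v t)) by ring.
apply: le_trans (cabsD _ _) _; apply: le_trans (lerD (lexx _) (cabsD _ _)) _; rewrite !cabsM.
have c1 := cabs_ge0 (u (t + h) - u t); have c2 := cabs_ge0 (v (t + h) - v t).
have h1 : cabs (u (t + h) - u t) * cabs (v (t + h) - v t) <= e' * 1 by apply: ler_pM => //; exact: le_trans b e'1.
have h2 := ler_wpM2r b0 a; have h3 := ler_wpM2l a0 b; move: h1 h2 h3 e'2 e'0; rewrite /M; lra.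
Qed.

Lemma curve_cont_real (u : R -> R[i]) t (w : R[i]) : curve_cont u t -> {for t, continuous (fun s => complex.Re (w * u s))}.
Proof.
move=> cu; have cw : curve_cont (fun=> w) t by move=> e e0; exists 1 => // h _; rewrite subrr cabs0 ltW.
apply/cvgrPdist_le => e e0; have [d d0 hd] := curve_cont_mul cw cu e0.
exists d => //= s; rewrite /ball /= => ts; rewrite distrC -reN -reD.
have E : t + (s - t) = s by rewrite addrC subrK.
by apply: le_trans (Re_cabs _) _; have := hd (s - t); rewrite E distrC; exact.
Qed.

Let dot_le (a b x y : R) : 0 <= a -> 0 <= b -> 0 <= x -> 0 <= y -> a * x + b * y <= (a + b + 1) * (x + y).
Proof. by move=> a0 b0 x0 y0; have := mulr_ge0 a0 y0; have := mulr_ge0 b0 x0; lra. Qed.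

Lemma chain_eps W f g t : CDon W f -> W (g t) -> C1_curve g -> forall e, 0 < e -> exists2 d, 0 < d &
  forall h, `|h| < d -> cabs (f (g (t + h)) - f (g t) - RC h * dC f (g t) (derive1 g t)) <= e * `|h|.
Proof.
move=> fD Wt C1 e e0; have [L1 [L2 D]] := fD _ Wt; rewrite (CD_dC _ D).
pose L := cabs L1 + cabs L2 + 1; pose M := pn (derive1 g t) + 1.
have L0 : 0 < L by rewrite /L; have := cabs_ge0 L1; have := cabs_ge0 L2; lra.
have M0 : 0 < M by rewrite /M; have := pn_ge0 (derive1 g t); lra.
have e10 : 0 < e / (2 * M) by rewrite divr_gt0 // mulr_gt0.
have [d1 d10 hd1] := D _ e10.
pose e2 := Num.min 1 (e / (2 * L)).
have e20 : 0 < e2 by rewrite lt_min ltr01 divr_gt0 // mulr_gt0.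
have [e21 e22] : e2 <= 1 /\ e2 * (2 * L) <= e by rewrite -ler_pdivlMr ?mulr_gt0 // /e2 !ge_min !lexx orbT.
have [d2 d20 hd2] := C1_eps t C1 e20.
exists (Num.min d2 (d1 / M)) => [|h]; first by rewrite lt_min d20 divr_gt0.
rewrite lt_min ltr_pdivlMr // => /andP[/hd2 h2 hM].
pose Y := g (t + h) - g t; pose Z := Y - h *: derive1 g t.
have Zle : pn Z <= e2 * `|h| by [].
have Yle : pn Y <= M * `|h|.
  have -> : Y = Z + h *: derive1 g t by rewrite /Z subrK.
  apply: le_trans (pnD _ _) _; rewrite pnZ /M; have := ler_wpM2r (normr_ge0 h) e21.
  by move: Zle; lra.
have := hd1 Y.
have -> : g t + Y = g (t + h) by rewrite /Y addrC subrK.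
have Yd : pn Y < d1 by apply: le_lt_trans Yle _; rewrite mulrC.
move=> /(_ Yd) k1.
have -> : f (g (t + h)) - f (g t) - RC h * (L1 * z1 (derive1 g t) + L2 * z2 (derive1 g t)) =
   (f (g (t + h)) - f (g t) - (L1 * z1 Y + L2 * z2 Y)) + (L1 * z1 Z + L2 * z2 Z).
  by rewrite /Z !z1D !z2D !z1N !z2N !z1Z !z2Z; ring.
apply: le_trans (cabsD _ _) _.
have k2 : cabs (L1 * z1 Z + L2 * z2 Z) <= L * pn Z.
  apply: le_trans (cabsD (L1 * z1 Z) (L2 * z2 Z)) _; rewrite (cabsM L1) (cabsM L2) /L /pn.
  by apply: dot_le; exact: cabs_ge0.
have k3 := ler_wpM2l (ltW e10) Yle.
have k4 : e / (2 * M) * (M * `|h|) = e / 2 * `|h| by field; rewrite gt_eqF.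
have k5 := ler_wpM2l (ltW L0) Zle; have k6 := ler_wpM2r (normr_ge0 h) e22.
move: k1 k2 k3 k5 k6; rewrite k4; clear; lra.
Qed.

Lemma curve_cont_comp W f g t : CDon W f -> W (g t) -> C1_curve g -> curve_cont (fun s => f (g s)) t.
Proof.
move=> fD Wt C1 e e0; have [d d0 hd] := chain_eps fD Wt C1 ltr01.
pose M := cabs (dC f (g t) (derive1 g t)) + 1; have M0 : 0 < M by rewrite /M; have := cabs_ge0 (dC f (g t) (derive1 g t)); lra.
exists (Num.min d (e / M)) => [|h]; first by rewrite lt_min d0 divr_gt0.
rewrite lt_min ltr_pdivlMr // => /andP[/hd h1 h2]; apply: le_trans (ltW h2).
have := cabsD (f (g (t + h)) - f (g t) - RC h * dC f (g t) (derive1 g t)) (RC h * dC f (g t) (derive1 g t)).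
rewrite subrK => /le_trans; apply; rewrite cabsM cabs_real /M; move: h1; lra.
Qed.

Lemma curve_cont_deriv W f g t : opn W -> CDon W f -> W (g t) -> C1_curve g ->
  curve_cont (fun s => dC f (g s) (ex1 R) * z1 (derive1 g s) + dC f (g s) (ex2 R) * z2 (derive1 g s)) t.
Proof.
move=> oW fD Wt C1.
have c1 : curve_cont (fun s => z1 (derive1 g s)) t.
  move=> e e0; have [d d0 hd] := C1_cont t C1 e0; exists d => // h /hd; apply: le_trans.
  by rewrite /pn z1D z1N lerDl cabs_ge0.
have c2 : curve_cont (fun s => z2 (derive1 g s)) t.
  move=> e e0; have [d d0 hd] := C1_cont t C1 e0; exists d => // h /hd; apply: le_trans.
  by rewrite /pn z2D z2N lerDr cabs_ge0.
by apply: curve_cont_add; apply: curve_cont_mul => //; exact: (curve_cont_comp (dC_CDon _ oW fD) Wt C1).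
Qed.
End Curves.

(** * Lower and upper bounds for integrated distances *)

Section IntegratedDistance.
Variable R : realType.
Implicit Types (p q v : C2 R) (f : C2 R -> R[i]) (g : R -> C2 R).
Local Notation RC x := (Complex x 0).
Local Notation mu := (@lebesgue_measure R).
Variables (W : set (C2 R)) (F : C2 R -> C2 R -> \bar R).
Hypothesis oW : opn W.
Hypothesis HF : forall x v, W x -> (caratheodory W x v <= F x v)%E.

(** [(f - f p) / (2 B + 1)] is a competitor: the difference is at most [2 B], and the extra 1 makes
    the bound strict and covers [B = 0]. *)
Lemma caratheodory_bounded_ge f (B : R) p v : CDon W f -> (forall q, W q -> cabs (f q) <= B) -> W p ->
  (((2 * B + 1)^-1 * cabs (dC f p v))%:E <= caratheodory W p v)%E.
Proof.
move=> fD fB Wp; have B0 : 0 <= B := le_trans (cabs_ge0 _) (fB p Wp).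
have A0 : 0 < 2 * B + 1 by lra.
pose h q := RC (2 * B + 1)^-1 * (f q + - f p).
have hD q L1 L2 : CD f q L1 L2 -> CD h q (RC (2 * B + 1)^-1 * (L1 + 0)) (RC (2 * B + 1)^-1 * (L2 + 0)).
  by move=> D; exact: (CD_scale _ (CD_add D (CD_cst (- f p) q))).
have hW : CDon W h by move=> q /fD[L1 [L2 /hD D]]; do 2 eexists; exact: D.
have hB q : W q -> cabs (h q) < 1.
  move=> Wq; rewrite /h cabsM cabs_real ger0_norm ?invr_ge0 ?(ltW A0) // mulrC ltr_pdivrMr // mul1r.
  by apply: le_lt_trans (cabsBD _ _) _; have := fB q Wq; have := fB p Wp; lra.
have h0 : h p = 0 by rewrite /h subrr mulr0.
apply: le_trans (caratheodory_ge v hW hB h0); rewrite lee_fin.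
have [L1 [L2 D]] := fD p Wp; rewrite (CD_dC v D) (CD_dC v (hD _ _ _ D)) !addr0.
have -> : RC (2 * B + 1)^-1 * L1 * z1 v + RC (2 * B + 1)^-1 * L2 * z2 v = RC (2 * B + 1)^-1 * (L1 * z1 v + L2 * z2 v) by ring.
by rewrite [leRHS]cabsM cabs_real ger0_norm // invr_ge0 ltW.
Qed.

Lemma caratheodory_ge0 p v : W p -> (0 <= caratheodory W p v)%E.
Proof.
move=> Wp; have cD : CDon W (fun=> 0) by move=> q _; exists 0, 0; exact: CD_cst.
apply: le_trans (caratheodory_ge v cD _ erefl); first by rewrite lee_fin cabs_ge0.
by move=> q _; rewrite cabs0 ltr01.
Qed.

Lemma exists_phase (x : R[i]) (A : R) : 0 <= A -> exists2 w, cabs w <= A & complex.Re (w * x) = A * cabs x.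
Proof.
move=> A0; exists (RC (A * (cabs x)^-1) * x^*).
  rewrite cabsM cabs_conj cabs_real ger0_norm ?mulr_ge0 ?invr_ge0 ?cabs_ge0 // -mulrA.
  apply: ler_piMr => //; have [->|x0] := eqVneq (cabs x) 0; first by rewrite mulr0.
  by rewrite mulVf.
rewrite -mulrA RC_re [_^* * _]mulrC mulJ /=.
have [->|x0] := eqVneq (cabs x) 0; first by rewrite expr0n /= !mulr0.
by rewrite expr2 -mulrA mulKf.
Qed.

(** A factor [w] aligned with [f (g b) - f (g a)] turns the increment into that of the real function
    [Re (w f(g t))]. The fundamental theorem of calculus applies to it, and its derivative is
    bounded by [F] through [caratheodory_bounded_ge]. *)
Lemma segment_length_ge f (B : R) g a b : CDon W f -> (forall q, W q -> cabs (f q) <= B) -> a < b -> C1_curve g ->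
  (forall t, a <= t <= b -> W (g t)) ->
  (((2 * B + 1)^-1 * cabs (f (g b) - f (g a)))%:E <= \int[mu]_(t in `[a, b]) F (g t) (derive1 g t))%E.
Proof.
move=> fD fB ab C1 gW; have B0 : 0 <= B by apply: le_trans (cabs_ge0 _) (fB (g a) _); apply: gW; rewrite lexx ltW.
have A0 : 0 <= (2 * B + 1)^-1 by rewrite invr_ge0; lra.
have [w wA wE] := exists_phase (f (g b) - f (g a)) A0.
pose h t := complex.Re (w * f (g t)).
pose dl t := dC f (g t) (ex1 R) * z1 (derive1 g t) + dC f (g t) (ex2 R) * z2 (derive1 g t).
pose ph t := complex.Re (w * dl t).
have dlE t : W (g t) -> dC f (g t) (derive1 g t) = dl t by move=> Wt; exact: CD_dC (CDon_dC fD Wt).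
have cph t : a <= t <= b -> {for t, continuous ph}.
  by move=> /gW Wt; apply: curve_cont_real; exact: curve_cont_deriv oW fD Wt C1.
have ch t : a <= t <= b -> {for t, continuous h}.
  by move=> /gW Wt; apply: curve_cont_real; exact: curve_cont_comp fD Wt C1.
have dh t : a <= t <= b -> is_derive t 1 h (ph t).
  move=> /gW Wt.
  have C : (fun s : R => s^-1 *: ((h \o shift t) (s *: 1) - h t)) @ 0^' --> ph t.
    apply/cvgrPdist_le => e e0; have w1 : 0 < cabs w + 1 by have := cabs_ge0 w; lra.
    have e10 : 0 < e / (cabs w + 1) by rewrite divr_gt0.
    have [d d0 hd] := chain_eps fD Wt C1 e10.
    exists d => //= s; rewrite /ball /= sub0r normrN => /hd {}hd s0; rewrite dlE // in hd.
    rewrite distrC /h /= [s *: 1]mulr1 (addrC s).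
    have -> : s^-1 *: (complex.Re (w * f (g (t + s))) - complex.Re (w * f (g t))) - ph t =
       s^-1 * complex.Re (w * (f (g (t + s)) - f (g t) - RC s * dl t)).
      have -> : w * (f (g (t + s)) - f (g t) - RC s * dl t) = w * f (g (t + s)) - w * f (g t) - RC s * (w * dl t) by ring.
      by rewrite !reD !reN RC_re -/(ph t) [RHS]mulrBr [s^-1 * (s * _)]mulKf.
    rewrite normrM normfV mulrC ler_pdivrMr ?normr_gt0 //; apply: le_trans (Re_cabs _) _; rewrite cabsM.
    apply: le_trans (ler_wpM2l (cabs_ge0 w) hd) _; rewrite mulrA; apply: ler_wpM2r => //.
    rewrite mulrCA; apply: ler_piMr; first exact: ltW.
    by rewrite ler_pdivrMr // mul1r lerDl.
  by split; [apply/cvg_ex; exists (ph t) | apply: cvg_lim].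
have abm : measurable (`[a, b]%classic : set (measurableTypeR R)) by exact: measurable_itv.
have cpw : {within `[a, b], continuous ph}.
  by apply: continuous_in_subspaceT => t; rewrite inE /= in_itv /= => /cph.
have mph : measurable_fun `[a, b] ph.
  by apply: subspace_continuous_measurable_fun.
have FTC : (\int[mu]_(t in `[a, b]) (ph t)%:E = (h b)%:E - (h a)%:E)%E.
  apply: continuous_FTC2 => //.
  - split.
    + move=> t; rewrite in_itv /= => /andP[t1 t2]; have [] := dh t _ => //; by rewrite !ltW.
    + by apply: cvg_at_right_filter; apply: ch; rewrite lexx ltW.
    + by apply: cvg_at_left_filter; apply: ch; rewrite lexx ltW.
  - move=> t; rewrite in_itv /= => /andP[t1 t2]; rewrite derive1E; have [] := dh t _ => //; by rewrite !ltW.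
have -> : (2 * B + 1)^-1 * cabs (f (g b) - f (g a)) = h b - h a by rewrite -wE mulrBr reD reN.
rewrite EFinB -FTC; apply: le_trans (lee_abs _) _; apply: le_trans (le_abse_integral _ abm _) _; first exact/measurable_EFinP.
apply: ge0_le_integral_nonmeasurable => t; rewrite /= in_itv /= => /gW Wt; first by rewrite lee_fin.
apply: le_trans (HF _ Wt); apply: le_trans (caratheodory_bounded_ge (derive1 g t) fD fB Wt); rewrite lee_fin.
by apply: le_trans (Re_cabs _) _; rewrite cabsM -dlE // ler_wpM2r // cabs_ge0.
Qed.

Lemma path_length_ge f (B : R) p q gam n s (g : nat -> R -> C2 R) : CDon W f -> (forall q, W q -> cabs (f q) <= B) ->
  pw_C1_path W p q gam n s g -> (((2 * B + 1)^-1 * cabs (f q - f p))%:E <= curve_length F n s g)%E.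
Proof.
move=> fD fB [s0 s1 sg [g0 g1] gW].
have B0 : 0 <= B by apply: le_trans (cabs_ge0 _) (fB (gam 0) _); apply: gW; rewrite lexx ler01.
have A0 : 0 <= (2 * B + 1)^-1 by rewrite invr_ge0; lra.
have smono i j : (i <= j)%N -> (j <= n)%N -> s i <= s j.
  move=> ij; have -> : j = (i + (j - i))%N by rewrite subnKC.
  elim: (j - i)%N => [|m IH]; first by rewrite addn0.
  by rewrite addnS => lt; have [/ltW + _] := sg _ lt; apply: le_trans; apply: IH; exact: ltnW.
have H j : (j <= n)%N -> (((2 * B + 1)^-1 * cabs (f (gam (s j)) - f p))%:E <=
    \sum_(i < j) \int[mu]_(t in `[s i, s i.+1]) F (g i t) (derive1 (g i) t))%E.
  elim: j => [_|j IH jn]; first by rewrite big_ord0 s0 g0 subrr cabs0 mulr0.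
  have [sj [C1 gE]] := sg _ jn; rewrite big_ord_recr /=.
  have gjW t : s j <= t <= s j.+1 -> W (g j t).
    move=> tj; rewrite -gE //; apply: gW; move: tj => /andP[t1 t2].
    by rewrite -s0 -s1 (le_trans (smono 0%N j _ _) t1) ?(ltnW jn) //= (le_trans t2) // smono.
  apply: le_trans (leeD (IH (ltnW jn)) (segment_length_ge fD fB sj C1 gjW)).
  rewrite -EFinD lee_fin -mulrDr; apply: ler_wpM2l => //.
  by rewrite -!gE ?lexx ?(ltW sj) // [leRHS]addrC; exact: cabs_tri.
by have := H n (leqnn n); rewrite s1 g1.
Qed.

(** Bounded holomorphic functions are Lipschitz for every distance that dominates the Caratheodory
    one. Completeness uses the distance only through this and [int_dist_near]. *)
Lemma int_dist_bound f (B e : R) p q : CDon W f -> (forall q, W q -> cabs (f q) <= B) -> 0 <= B ->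
  (int_dist W F p q < e%:E)%E -> cabs (f q - f p) <= (2 * B + 1) * e.
Proof.
move=> fD fB B0 /ereal_inf_lt[l [gam [n [s [g [pw ->]]]]] le].
have A0 : 0 < 2 * B + 1 by lra.
have := le_trans (path_length_ge fD fB pw) (ltW le).
by rewrite lee_fin mulrC ler_pdivrMr // mulrC.
Qed.

Hypothesis UF : forall p, W p -> exists r C, [/\ 0 < r, 0 <= C, pball p r `<=` W &
  forall q v, pball p r q -> (F q v <= (C * pn v)%:E)%E].

Lemma line_C1 p v : C1_curve (fun t : R => p + t *: v) /\ forall t, derive1 (fun t : R => p + t *: v) t = v.
Proof.
have D t : (fun h : R => h^-1 *: (((fun t : R => p + t *: v) \o shift t) (h *: 1) - (p + t *: v))) @ 0^' --> (v : C2o R).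
  apply: cvg_near_cst; exists 1 => //= h _ h0.
  by rewrite [h *: 1]mulr1 opprD addrACA subrr add0r scalerDl addrK scalerA mulVf // scale1r.
have d1 t : derive1 (fun t : R => p + t *: v) t = v by rewrite derive1E; exact: cvg_lim (D t).
split=> //; split=> [t|]; first by apply/cvg_ex; exists v; exact: D.
have -> : derive1 (fun t : R => p + t *: v) = fun=> v by apply/funext.
by move=> t; exact: cvg_cst.
Qed.

(** The straight segment stays in the ball, where [F] is at most a multiple of the norm. *)
Lemma int_dist_near p : W p -> exists r C, [/\ 0 < r, 0 <= C & forall q, pball p r q -> (int_dist W F q p <= (C * pn (p - q))%:E)%E].
Proof.
move=> Wp; have [r [C [r0 C0 rW hF]]] := UF Wp; exists r, C; split => // q hq.
pose gam (t : R) := q + t *: (p - q).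
have [C1 d1] := line_C1 q (p - q).
have gB t : 0 <= t <= 1 -> pball p r (gam t).
  move=> /andP[t0 t1]; rewrite /pball /= /gam.
  have -> : q + t *: (p - q) - p = (1 - t) *: (q - p).
    by rewrite scalerBl scale1r -(opprB q p) scalerN addrAC.
  rewrite pnZ ger0_norm ?subr_ge0 //; apply: le_lt_trans hq; apply: ler_piMl; first exact: pn_ge0.
  by rewrite gerBl.
apply: le_trans (ereal_inf_lbound _) _.
  (* A path with a single piece: the breakpoints are [0] and [1]. *)
  exists gam, 1%N, (fun i => i%:R), (fun=> gam); split; last reflexivity.
  split=> //.
  - by move=> [|//] _; rewrite ltr01.
  - by rewrite /gam scale0r addr0 scale1r addrC subrK.
  - by move=> t /gB /rW.
rewrite /curve_length big_ord1 /=.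
have itvE : mu `[0%R, 1%R]%classic = 1%:E by rewrite lebesgue_measure_itv /= lte_fin ltr01 oppr0 adde0.
apply: (@le_trans _ _ (\int[mu]_(t in `[0%R, 1%R]) (cst (C * pn (p - q))%:E) t)%E); last first.
  by rewrite integral_cst // [X in (_ * X)%E]itvE mule1.
apply: ge0_le_integral_nonmeasurable => t; rewrite /= in_itv /= => /gB gt.
  have Wt := rW _ gt; apply: le_trans (HF _ Wt); exact: caratheodory_ge0.
by rewrite d1; exact: hF.
Qed.
End IntegratedDistance.

(** * Completeness of the domain for both metrics *)

Section Completeness.
Variable R : realType.
Variables (N : nat) (c : nat -> nat -> R[i]) (k : nat).
Hypothesis P_real : forall z : R[i], complex.Im (zzpoly N c z) = 0.
Hypothesis k_gt1 : (1 < k)%N.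
Hypothesis P_hom : forall (r : R) (z : R[i]), zzpoly N c (Complex r 0 * z) = Complex (r ^+ (2 * k)) 0 * zzpoly N c z.
Hypothesis P_subh : forall x : R * R, x != 0 -> 0 < ddbar (ex R) (ey R) (ex R) (ey R) (KN_P N c) x.
Implicit Types (z w : R[i]) (p q v : C2 R).
Local Notation W := (KN_domain N c).
Local Notation r := (KN_r N c).
(** One argument serves both metrics: [F] is any metric above the Caratheodory metric and locally
    bounded by the norm. *)
Variable F : C2 R -> C2 R -> \bar R.
Hypothesis HF : forall x v, W x -> (caratheodory W x v <= F x v)%E.
Hypothesis UF : forall p, W p -> exists r C, [/\ 0 < r, 0 <= C, pball p r `<=` W &
  forall q v, pball p r q -> (F q v <= (C * pn v)%:E)%E].
Let oW : opn W := KN_opn P_real P_hom.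

Let half_loss (a x y d : R) : a + a <= x -> x - y <= d -> d <= a -> a <= y.
Proof. lra. Qed.
Let limit_neg (X Y Z V d : R) : X + Z <= - d -> - (d / 2) < X - Y -> - (d / 2) < Z - V -> Y + V < 0.
Proof. lra. Qed.

(** The coordinates are unbounded, so they are recovered as quotients of the bounded functions
    [zz f] and [f]; the lower bound [m] on [|f|] at both points makes the quotient stable. *)
Lemma coordinate_separated f (zz : C2 R -> R[i]) (B m e : R) p q : CDon W f -> CDon W (fun x => zz x * f x) ->
  (forall x, W x -> cabs (f x) <= B) -> (forall x, W x -> cabs (zz x * f x) <= B) -> 0 < m -> 0 <= B -> 0 <= e -> W p ->
  m <= cabs (f p) -> m <= cabs (f q) -> (int_dist W F p q < e%:E)%E ->
  cabs (zz q - zz p) <= (2 * B + 1) * (1 + B / m) / m * e.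
Proof.
move=> fD zD fB zB m0 B0 e0 Wp mp mq d.
have h1 := int_dist_bound oW HF fD fB B0 d; have h2 := int_dist_bound oW HF zD zB B0 d.
have zp : cabs (zz p) <= B / m.
  rewrite ler_pdivlMr //; apply: le_trans (zB p Wp); rewrite cabsM.
  by apply: ler_wpM2l => //; exact: cabs_ge0.
have E : (zz q - zz p) * f q = (zz q * f q - zz p * f p) - zz p * (f q - f p) by ring.
have h3 : cabs (zz q - zz p) * m <= (2 * B + 1) * e + B / m * ((2 * B + 1) * e).
  apply: (@le_trans _ _ (cabs ((zz q - zz p) * f q))).
    by rewrite cabsM; apply: ler_wpM2l => //; exact: cabs_ge0.
  rewrite E; apply: le_trans (cabsBD _ _) _; apply: lerD => //; rewrite cabsM.
  by apply: ler_pM; rewrite ?cabs_ge0.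
have -> : (2 * B + 1) * (1 + B / m) / m * e = ((2 * B + 1) * e + B / m * ((2 * B + 1) * e)) / m by ring.
by rewrite ler_pdivlMr.
Qed.

(** Uniformity of [m] and [K] in [T] is decisive. All functions [f_j] attached to [u j] with
    [T j = 1 / |r(u j)|] are bounded by [K], so on one common tail of the sequence each varies by at
    most [m'], although the [T j] might be unbounded. *)
Lemma KN_boundary_bound u : (forall n, W (u n)) ->
  (forall e : R, 0 < e -> exists M, forall i j, (M <= i)%N -> (M <= j)%N -> (int_dist W F (u i) (u j) < e%:E)%E) ->
  exists M f (C m de : R), [/\ forall q, exists L1 L2, CD f q L1 L2, forall q, W q -> sqmod (f q) * weight4 q <= C, 0 < m, 0 < de &
    forall j, (M <= j)%N -> m <= cabs (f (u j)) /\ r (u j) <= - de].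
Proof.
move=> Wu Cau; have [m [K [m0 K0 FAM]]] := KN_family P_real k_gt1 P_hom P_subh.
have rj j : 0 < - r (u j) by rewrite oppr_gt0 -KN_domainE.
(* [f_j] is at least [m e^(-1) = 2 m'] in modulus at [u j], since [T j r(u j) = -1]; losing [m']
   along the tail leaves [m']. *)
pose m' : R := m * expR (-1) / 2; have m'0 : 0 < m' by rewrite divr_gt0 // mulr_gt0 // expR_gt0.
have K20 : 0 < 2 * K + 1 by rewrite addr_gt0 // mulr_gt0.
have [M hM] := Cau (m' / (2 * K + 1)) (divr_gt0 m'0 K20).
pose T j := (- r (u j))^-1; have T0 j : 0 < T j by rewrite invr_gt0.
have fam j : (M <= j)%N -> exists f C, [/\ forall q, exists L1 L2, CD f q L1 L2, forall q, W q -> sqmod (f q) * weight4 q <= C,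
    forall q, W q -> cabs (f q) <= K * expR (T j * r q) & forall i, (M <= i)%N -> m' <= cabs (f (u i))].
  move=> Mj; have rn : r (u j) < 0 by rewrite -oppr_gt0.
  have [f [C [f1 f2 f3 f4]]] := FAM (u j) (T j) (T0 j) rn; exists f, C; split => // i Mi.
  have fD : CDon W f by move=> q _; exact: f1.
  have fB q : W q -> cabs (f q) <= K.
    move=> Wq; apply: le_trans (f2 q Wq) _; apply: ler_piMr; first exact: ltW.
    have rq : r q < 0 := Wq.
    have Tq : T j * r q <= 0 := mulr_ge0_le0 (ltW (T0 j)) (ltW rq).
    by rewrite -ler_expR expR0 in Tq.
  have h := int_dist_bound oW HF fD fB (ltW K0) (hM j i Mj Mi).
  have E : (2 * K + 1) * (m' / (2 * K + 1)) = m' by rewrite mulrC divfK // gt_eqF.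
  have Tr : T j * r (u j) = -1 by rewrite /T invrN mulNr mulVf // lt_eqF.
  have m2 : m * expR (-1) = m' + m' by rewrite /m' -splitr.
  rewrite E in h; rewrite Tr m2 in f3; have := cabs_subr (f (u j)) (f (u i)); rewrite cabsB => tri.
  exact: half_loss f3 tri h.
have [f [C [f1 f2 f3 f4]]] := fam M (leqnn M).
(* [m' <= |f_j(u M)| <= K exp(T j r(u M))] reads [L <= r(u M) / |r(u j)|]. Both sides are negative,
   so [|r(u j)|] is at least [|r(u M)| / (- L)]. *)
pose L := ln (m' / K); have LE : expR L = m' / K by rewrite lnK // posrE divr_gt0.
have key j : (M <= j)%N -> L <= T j * r (u M).
  move=> Mj; have [g [C' [_ _ g3 g4]]] := fam j Mj.
  rewrite -ler_expR LE ler_pdivrMr // mulrC; exact: le_trans (g4 M (leqnn M)) (g3 _ (Wu M)).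
have rM : r (u M) < 0 by rewrite -oppr_gt0.
have L0 : 0 < - L.
  by rewrite oppr_gt0; apply: le_lt_trans (key M (leqnn M)) _; rewrite pmulr_rlt0.
exists M, f, C, m', (- r (u M) / - L); split => //; first by rewrite divr_gt0.
move=> j Mj; split; first exact: f4.
by rewrite lerNr ler_pdivrMr // mulrN lerN2; have := key j Mj; rewrite /T ler_pdivlMl.
Qed.

Lemma KN_complete : complete_dist W (int_dist W F).
Proof.
move=> u Wu Cau; have [M [f [C [m [de [f1 f2 m0 de0 fu]]]]]] := KN_boundary_bound Wu Cau.
pose B := Num.sqrt `|C|; have B0 : 0 <= B := sqrtr_ge0 _.
have sC (z : R[i]) : sqmod z <= `|C| -> cabs z <= B by move=> h; rewrite /cabs ler_wsqrtr.
have fD : CDon W f by move=> q _; exact: f1.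
have mB (zz : C2 R -> R[i]) q : sqmod (zz q) <= weight4 q -> W q -> cabs (zz q * f q) <= B.
  move=> zw Wq; apply: sC; apply: le_trans (ler_norm C); apply: le_trans (f2 q Wq).
  rewrite sqmodM [leRHS]mulrC; apply: ler_wpM2r => //; exact: sqmod_ge0.
have fB q : W q -> cabs (f q) <= B.
  move=> Wq; have := mB (fun=> 1) q; rewrite mul1r; apply => //.
  by rewrite /sqmod /= expr1n expr0n /= addr0 weight4_ge1.
pose Q := (2 * B + 1) * (1 + B / m) / m.
have Q0 : 0 <= Q.
  by apply: divr_ge0; [apply: mulr_ge0; rewrite addr_ge0 // ?mulr_ge0 // invr_ge0 | ]; rewrite ltW.
have cauchy_coord (zz : C2 R -> R[i]) : (forall q, exists L1 L2, CD zz q L1 L2) -> (forall q, sqmod (zz q) <= weight4 q) ->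
    exists x, forall e, 0 < e -> exists n0, forall n, (n0 <= n)%N -> cabs (zz (u n) - x) <= e.
  move=> zD zw; apply: complex_cauchy => e e0; have Q1 : 0 < Q + 1 by apply: ltr_wpDl.
  have e1 : 0 < e / (Q + 1) by rewrite divr_gt0.
  have [M' hM'] := Cau _ e1; exists (maxn M M') => i j; rewrite !geq_max => /andP[i1 i2] /andP[j1 j2].
  have zfD : CDon W (fun x => zz x * f x).
    move=> q _; have [L1 [L2 D1]] := zD q; have [M1 [M2 D2]] := f1 q.
    by have := CD_mul D1 D2; do 2 eexists; eauto.
  have := coordinate_separated fD zfD fB (fun x => mB zz x (zw x)) m0 B0 (ltW e1) (Wu j) (fu j j1).1 (fu i i1).1 (hM' j i j2 i2).
  move=> /le_trans; apply; rewrite mulrCA; apply: ler_piMr; first exact: ltW.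
  by rewrite ler_pdivrMr // mul1r lerDl.
have [x1 hx1] := cauchy_coord (@z1 R) (fun q => ex_intro _ _ (ex_intro _ _ (CD_z1 q))) (fun q => coord_weight4 (or_introl erefl)).
have [x2 hx2] := cauchy_coord (@z2 R) (fun q => ex_intro _ _ (ex_intro _ _ (CD_z2 q))) (fun q => coord_weight4 (or_intror (or_introl erefl))).
pose p : C2 R := ((complex.Re x1, complex.Im x1), (complex.Re x2, complex.Im x2)).
have [p1 p2] : z1 p = x1 /\ z2 p = x2 by rewrite /z1 /z2 /= !cplxK.
have up e : 0 < e -> exists n0, forall n, (n0 <= n)%N -> pn (u n - p) <= e.
  move=> e0; have e2 : 0 < e / 2 by rewrite divr_gt0.
  have [a ha] := hx1 _ e2; have [b hb] := hx2 _ e2; exists (maxn a b) => n; rewrite geq_max => /andP[na nb].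
  by rewrite /pn z1D z2D z1N z2N p1 p2 [leRHS]splitr lerD ?ha ?hb.
(* The margin [r <= - de] passes to the limit by continuity of [P], so the limit point is not on the
   boundary. *)
have Wp : W p.
  rewrite KN_domainE; have d2 : 0 < de / 2 by rewrite divr_gt0.
  have [d d0 hd] := P_cont P_real P_hom x1 d2.
  have d4 : 0 < Num.min d (de / 2) / 2 by rewrite divr_gt0 // lt_min d0.
  have [n0 hn0] := up _ d4; pose n := maxn n0 M.
  have nn : (n0 <= n)%N by rewrite leq_maxl.
  have nM : (M <= n)%N by rewrite leq_maxr.
  have un : pn (u n - p) < Num.min d (de / 2).
    by apply: le_lt_trans (hn0 n nn) _; rewrite ltr_pdivrMr // ltr_pMr ?lt_min ?d0 // ltr1n.
  move: un; rewrite lt_min => /andP[u1 u2].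
  have [_ ru] := fu n nM.
  have h1 : cabs (z1 (u n) - x1) < d.
    by apply: le_lt_trans u1; rewrite /pn z1D z1N p1 lerDl cabs_ge0.
  have h2 : `|complex.Re (z2 (u n)) - complex.Re x2| < de / 2.
    apply: le_lt_trans u2; rewrite -reN -reD; apply: le_trans (Re_cabs _) _.
    by rewrite /pn z2D z2N p2 lerDr cabs_ge0.
  have h3 : `|complex.Re (zzpoly N c (z1 (u n))) - complex.Re (zzpoly N c x1)| < de / 2.
    by apply: le_lt_trans (hd _ h1); rewrite -reN -reD; exact: Re_cabs.
  by move: h2 h3; rewrite !ltr_norml => /andP[a1 _] /andP[a2 _]; rewrite /KN_r p1 p2; exact: limit_neg ru a1 a2.
exists p => // e e0; have [s [D [s0 D0 near]]] := int_dist_near HF UF Wp.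
have D1 : 0 < D + 1 by apply: ltr_wpDl.
have sm : 0 < Num.min s (e / (D + 1)) / 2 by rewrite divr_gt0 // lt_min s0 divr_gt0.
have [n0 hn0] := up _ sm; exists n0 => n /hn0 un.
have : pn (u n - p) < Num.min s (e / (D + 1)).
  by apply: le_lt_trans un _; rewrite ltr_pdivrMr // ltr_pMr ?lt_min ?s0 ?divr_gt0 // ltr1n.
rewrite lt_min => /andP[u1 u2]; apply: le_lt_trans (near _ u1) _.
rewrite lte_fin -opprB pnN; apply: (@le_lt_trans _ _ ((D + 1) * pn (u n - p))).
  by apply: ler_wpM2r; [exact: pn_ge0 | rewrite lerDl].
by rewrite mulrC -ltr_pdivlMr.
Qed.
End Completeness.

Theorem theorem1p2 (R : realType) (N : nat) (c : nat -> nat -> R[i]) (k : nat)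
  (P_real : forall z : R[i], complex.Im (zzpoly N c z) = 0)
  (k_gt1 : (1 < k)%N)
  (P_hom : forall (r : R) (z : R[i]),
      zzpoly N c (Complex r 0 * z) = Complex (r ^+ (2 * k)) 0 * zzpoly N c z)
  (P_subh : forall x : R * R, x != 0 ->
      0 < ddbar (ex R) (ey R) (ex R) (ey R) (KN_P N c) x)
  (phi : nat -> C2 R -> R[i])
  (phi_ONB : complete_orthonormal (KN_domain N c) phi) :
  ((forall z, KN_domain N c z -> 0 < bergman_diag phi z) /\
   positive_metric (KN_domain N c) (bergman_length phi) /\
   complete_dist (KN_domain N c) (int_dist (KN_domain N c) (bergman_length phi))) /\
  (positive_metric (KN_domain N c) (caratheodory (KN_domain N c)) /\
   complete_dist (KN_domain N c) (int_dist (KN_domain N c) (caratheodory (KN_domain N c)))).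
Proof.
have oW := KN_opn P_real P_hom.
have nv := KN_A2_nonvanishing P_real k_gt1 P_hom P_subh.
have cp := caratheodory_positive P_real k_gt1 P_hom P_subh.
have bc := bergman_ge oW phi_ONB nv.
have complete := KN_complete P_real k_gt1 P_hom P_subh.
split; split.
- by move=> z Wz; rewrite bergman_diagE; exact: (diag_gt0 oW phi_ONB nv Wz).
- split; first by move=> p v Wp v0; apply: lt_le_trans (cp p v Wp v0) (bc p v Wp).
  (* Domination of the Caratheodory metric and the local upper bound are the two properties required
     of [F]. *)
  by apply: complete => [x v|p]; [exact: bc | exact: (bergman_upper oW phi_ONB nv)].
- exact: cp.
- apply: complete => [x v _|p]; [exact: lexx | exact: (caratheodory_upper oW)].
Qed.
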